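(* Let $(Z_n)_{n\ge 0}$ be a Markov-additive process on $\mathbb{Z}^d\times\{1,\dots,p\}$ which is irreducible, aperiodic, has finite exponential moments, and is non-centered (its global drift $m$ is non-zero). Then there exist a continuous function $c:\mathbb{S}^{d-1}\to\mathbb{R}^d$, for each $i,j\in\{1,\dots,p\}$ a continuous function $\chi_{i,j}:\mathbb{S}^{d-1}\to\mathbb{R}$, and positive constants $C_1,C_2$ such that $C_1\le \chi_{i,j}\le C_2$ and $$G\big((0,i),(x,j)\big)\sim \chi_{i,j}\!\left(\frac{x}{\|x\|}\right)\|x\|^{-\frac{d-1}{2}}\, e^{-c\left(\frac{x}{\|x\|}\right)\cdot x}\qquad\text{as } \|x\|\to+\infty,\ x\in\mathbb{Z}^d.$$
   Context: Fix integers $d,p\ge 1$. A Markov-additive process on $\mathbb{Z}^d\times\{1,\dots,p\}$ is a Markov chain $(Z_n)_{n\ge0}=(A_n,M_n)_{n\ge0}$ such that $\mathbb{P}_{(x,i)}((A_1,M_1)=(x',i'))=\mathbb{P}_{(0,i)}((A_1,M_1)=(x'-x,i'))$ for all $x,x'\in\mathbb{Z}^d$, $i,i'\in\{1,\dots,p\}$. Its jump matrix is the $p\times p$ matrix of sub-probability measures $\mu_{i,j}(x)=\mathbb{P}_{(0,i)}((A_1,M_1)=(x,j))$ on $\mathbb{Z}^d$. Aperiodic means: for every state $(x,i)$, $\gcd\{n\ge1:\mathbb{P}_{(x,i)}(Z_n=(x,i))>0\}=1$. Finite exponential moments means $\sum_{x\in\mathbb{Z}^d}e^{\alpha\|x\|}\mu_{i,j}(x)<\infty$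 for all $i,j$ and all $\alpha>0$. The matrix $\big(\sum_x\mu_{i,j}(x)\big)_{i,j}$ is the transition matrix of the chain $(M_n)$, which under these assumptions has a unique stationary distribution $\pi=(\pi_1,\dots,\pi_p)$. The local drifts are $m_{i,j}=\sum_x x\,\mu_{i,j}(x)\in\mathbb{R}^d$ and the global drift is $m=\sum_{i,j}\pi_i m_{i,j}$. The Green function is $G((z,i),(x,j))=\sum_{n\ge0}\mathbb{P}_{(z,i)}(Z_n=(x,j))$. *)

(* Defs.v *)
From HB Require Import structures.
From mathcomp Require Import all_boot all_order all_algebra.
From mathcomp Require Import all_classical all_reals all_analysis.
Set Implicit Arguments. Unset Strict Implicit. Unset Printing Implicit Defensive.
Import Order.TTheory GRing.Theory Num.Theory.
Import numFieldNormedType.Exports.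
Local Open Scope classical_set_scope.
Local Open Scope ring_scope.

Section MAP.
Variables (R : realType) (d p : nat).

Definition state := ('rV[int]_d * 'I_p)%type.

(* A jump matrix: mu i j x = P_(0,i)((A_1,M_1) = (x,j)). *)
Definition jump := 'I_p -> 'I_p -> 'rV[int]_d -> R.

Definition toR (x : 'rV[int]_d) : 'rV[R]_d := map_mx (fun z : int => z%:~R) x.
Definition enorm (v : 'rV[R]_d) : R := Num.sqrt (\sum_(k < d) v 0 k ^+ 2).
Definition dotp (u v : 'rV[R]_d) : R := \sum_(k < d) u 0 k * v 0 k.
Definition sphere : set 'rV[R]_d := [set u | enorm u = 1].

(* Nonnegative countable sums are taken with esum in \bar R;
   a signed absolutely summable sum is (sum of positive part) - (sum of negative part). *)
Definition sumR (T : choiceType) (f : T -> R) : R :=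
  fine (\esum_(t in setT) ((Num.max (f t) 0)%:E)) -
  fine (\esum_(t in setT) ((Num.max (- f t) 0)%:E)).

Definition is_jump_matrix (mu : jump) : Prop :=
  (forall i j x, 0 <= mu i j x) /\
  (forall i, \sum_(j < p) \esum_(x in setT) (mu i j x)%:E = 1%E).

Definition P1 (mu : jump) (s t : state) : R := mu s.2 t.2 (t.1 - s.1).

Fixpoint Pn (mu : jump) (n : nat) (s t : state) : \bar R :=
  match n with
  | 0 => (if s == t then 1 else 0)%:E
  | n'.+1 => \esum_(u in setT) (Pn mu n' s u * (P1 mu u t)%:E)%E
  end.

Definition green (mu : jump) (s t : state) : \bar R :=
  \esum_(n in [set: nat]) Pn mu n s t.

Definition irreducible (mu : jump) : Prop :=
  forall s t : state, exists n, (0 < Pn mu n s t)%E.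

(* gcd {n >= 1 : P_s(Z_n = s) > 0} = 1, i.e. 1 is the only common divisor. *)
Definition aperiodic (mu : jump) : Prop :=
  forall (s : state) (k : nat),
    (forall n, (0 < n)%N -> (0 < Pn mu n s s)%E -> (k %| n)%N) -> k = 1%N.

Definition finite_exp_moments (mu : jump) : Prop :=
  forall i j (a : R), 0 < a ->
    (\esum_(x in setT) (expR (a * enorm (toR x)) * mu i j x)%:E < +oo)%E.

Definition Mtrans (mu : jump) (i j : 'I_p) : R := fine (\esum_(x in setT) (mu i j x)%:E).

Definition local_drift (mu : jump) (i j : 'I_p) : 'rV[R]_d :=
  \row_(k < d) sumR (fun x : 'rV[int]_d => (x 0 k)%:~R * mu i j x).

Definition stationary (mu : jump) (pi : 'I_p -> R) : Prop :=
  (forall i, 0 <= pi i) /\ \sum_(i < p) pi i = 1 /\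
  (forall j, \sum_(i < p) pi i * Mtrans mu i j = pi j).

Definition global_drift (mu : jump) (pi : 'I_p -> R) : 'rV[R]_d :=
  \sum_(i < p) \sum_(j < p) pi i *: local_drift mu i j.

(* Non-centered: the global drift (w.r.t. the (unique) stationary distribution) is nonzero. *)
Definition non_centered (mu : jump) : Prop :=
  forall pi, stationary mu pi -> global_drift mu pi != 0.

End MAP.

(* Main.v *)
Require Import Defs.
From HB Require Import structures.
From mathcomp Require Import all_boot all_order all_algebra.
From mathcomp Require Import all_classical all_reals all_analysis.
From mathcomp Require Import ring lra zify.
Set Implicit Arguments. Unset Strict Implicit. Unset Printing Implicit Defensive.
Import Order.TTheory GRing.Theory Num.Theory.
Import numFieldNormedType.Exports.
Local Open Scope classical_set_scope.
Local Open Scope ring_scope.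
From mathcomp Require Import complex.

(** Mark every step landing in a fixed type [i0] with probability 1/2 and decompose
    paths at the marks: the Green function becomes a negligible term plus the sum of
    the convolution powers [kap * nu^n] of a positive measure [nu] on Z^d, where
    [nu], [kap] have exponential moments near the convex body
    [D = {alpha : phi(alpha) <= 1}], [phi] being the Laplace transform of [nu].
    A nonzero drift gives, through the Poisson equation of the modulating chain, a
    point with [phi < 1], so for each direction [u] the linear form [u] is maximal
    on [D] at a unique [c u], where [phi = 1] and [grad phi = lam u] with [lam > 0];
    tilting by [c u] turns [nu] into a probability measure with drift along [u].
    The sum over [n] of the tilted powers at [x = r u] concentrates on
    [|n - r / lam| = O(sqrt r)] and is compared with binomial averages over blocks of
    [L] consecutive powers; their local limit theorem needs no aperiodicity, has
    a covariance of the form [S + (L/2) m^T m], and [L] is sent to infinity last. *)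

(** * Unordered sums *)

(** A local limit theorem for each single power would have to be followed by a Riemann sum over the
    window of powers. The block average avoids this: it is one measure, with transform [ft kap *
    (sum of psi^r) * ((1 + psi^L) / 2)^K], so one local limit estimate gives the whole weighted sum.
    Division by the central binomial weight makes the relevant weights 1 up to O(1 / L), and the
    powers of [L] cancel against the determinant of the covariance, which leaves a bordered
    determinant as the limit constant.

    A second obstacle is the boundary of the domain of phi: nu need not have all exponential
    moments, although the jumps do. Wherever phi is finite, the slack 1 in [G = 1 + Qa G] leaves
    room for a slightly larger weight, so D lies inside the domain, with a uniform margin by
    compactness.

    Marking only half of the visits makes nu positive at every site. This bounds D, and the atoms at
    0 and at the unit vectors keep the covariance nondegenerate and the transform away from its
    maximal modulus off the origin. All constants depend only on moments and atoms, hence not on the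
    direction. *)

Section EsumTheory.
Variable R : realType.
Implicit Types T : choiceType.

Lemma esum_term_le T (f : T -> \bar R) x :
  (forall y, (0 <= f y)%E) -> (f x <= \esum_(y in setT) f y)%E.
Proof.
move=> f0; rewrite (esumID [set x])//=.
by rewrite setTI esum_set1// leeDl// esum_ge0.
Qed.

Lemma esumZl_le T (c : \bar R) (f : T -> \bar R) :
  (forall y, (0 <= f y)%E) -> (0 <= c)%E ->
  (\esum_(y in setT) (c * f y) <= c * \esum_(y in setT) f y)%E.
Proof.
move=> f0 c0; apply: ge_ereal_sup => /= _ [A [finA _] <-].
rewrite -ge0_mule_fsumr//.
by apply: lee_wpmul2l => //; apply: esum_ge; exists A.
Qed.

Lemma esumZl T (c : \bar R) (f : T -> \bar R) :
  (forall y, (0 <= f y)%E) -> (0 <= c)%E ->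
  (\esum_(y in setT) (c * f y) = c * \esum_(y in setT) f y)%E.
Proof.
move=> f0 c0; apply/eqP; rewrite eq_le esumZl_le//=.
case: c c0 => [r| |//] r0.
- rewrite lee_fin in r0.
  have [->|rn0] := eqVneq r 0.
    by rewrite mul0e esum_ge0// => x _; rewrite mul0e.
  have rp : 0 < r by rewrite lt_neqAle eq_sym rn0.
  (* The inequality already proved is applied to [r * f] with the factor [r^-1]; multiplying back by
     [r] gives the converse. *)
  have -> : (\esum_(y in [set: T]) f y =
             \esum_(y in [set: T]) ((r^-1)%:E * (r%:E * f y)))%E.
    by apply: eq_esum => y _; rewrite muleA -EFinM mulVf// mul1e.
  have h : (r%:E * (\esum_(y in setT) ((r^-1)%:E * (r%:E * f y))) <=
     r%:E * ((r^-1)%:E * (\esum_(y in setT) (r%:E * f y))))%E.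
    apply: lee_wpmul2l => //; apply: esumZl_le.
      by move=> y; rewrite mule_ge0.
    by rewrite lee_fin invr_ge0.
  apply: (le_trans h); rewrite muleA -EFinM divff// mul1e//.
- have [[x fx]|nx] := pselect (exists x, (0 < f x)%E).
    have : ((+oo * f x) <= \esum_(y in setT) (+oo * f y))%E.
      by apply: (@esum_term_le _ (fun y => +oo * f y)%E) => y; rewrite mule_ge0.
    by rewrite gt0_mulye// leye_eq => /eqP ->; rewrite leey.
  have f00 y : f y = 0%E.
    apply/eqP; rewrite eq_le f0 andbT leNgt; apply/negP => fy.
    by apply: nx; exists y.
  rewrite [X in (_ * X)%E]esum1 ?mule0//.
  by apply: esum_ge0 => y _; rewrite f00 mule0.
Qed.

Lemma esumZr T (c : \bar R) (f : T -> \bar R) :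
  (forall y, (0 <= f y)%E) -> (0 <= c)%E ->
  (\esum_(y in setT) (f y * c) = (\esum_(y in setT) f y) * c)%E.
Proof.
move=> f0 c0; rewrite muleC -esumZl//.
by apply: eq_esum => y _; rewrite muleC.
Qed.

Lemma esum_exchange (T T' : choiceType) (a : T -> T' -> \bar R) :
  (forall x y, (0 <= a x y)%E) ->
  \esum_(x in setT) \esum_(y in setT) a x y =
  \esum_(y in setT) \esum_(x in setT) a x y.
Proof.
move=> a0; rewrite !esum_esum//.
rewrite (reindex_esum (setT `*`` (fun _ : T' => setT)) _ (fun z => (z.2, z.1)))//.
split => //=.
- by move=> [a1 a2] [b1 b2] _ _ [] -> ->.
- by move=> [a1 a2] _; exists (a2, a1).
Qed.

Lemma esum_bij (T T' : choiceType) (e : T -> T') (a : T' -> \bar R) :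
  bijective e -> \esum_(y in setT) a y = \esum_(x in setT) a (e x).
Proof.
move=> be; apply: reindex_esum; split => //.
- by move=> x y _ _; apply: (bij_inj be).
- by move=> y _; case: be => g eg ge; exists (g y).
Qed.

Lemma esum_opp_shift (T : zmodType) (x : T) (a : T -> \bar R) :
  \esum_(y in setT) a y = \esum_(y in setT) a (x - y).
Proof.
by apply: esum_bij; exists (fun y => x - y) => y; rewrite opprB addrC subrK.
Qed.

Lemma esum_shift (T : zmodType) (x : T) (a : T -> \bar R) :
  \esum_(y in setT) a y = \esum_(y in setT) a (y + x).
Proof. by apply: esum_bij; exists (fun y => y - x) => y; rewrite ?addrK ?subrK. Qed.

Lemma maxr_sub (a : R) : a = Num.max a 0 - Num.max (- a) 0.
Proof.
case: (leP a 0) => h; first by rewrite max_l; lra.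
by rewrite max_r; lra.
Qed.

(** The positive and negative parts [p], [n] of [f] satisfy [p + b = a + n] pointwise, and all four
    sums are finite, so the value does not depend on the chosen decomposition. *)
Lemma sumR_diff T (f a b : T -> R) :
  (forall x, 0 <= a x) -> (forall x, 0 <= b x) -> (forall x, f x = a x - b x) ->
  (\esum_(x in setT) (a x)%:E < +oo)%E -> (\esum_(x in setT) (b x)%:E < +oo)%E ->
  sumR f = fine (\esum_(x in setT) (a x)%:E) - fine (\esum_(x in setT) (b x)%:E).
Proof.
move=> a0 b0 fab sa sb; rewrite /sumR.
set p := fun x => Num.max (f x) 0; set n := fun x => Num.max (- f x) 0.
have p0 x : 0 <= p x by rewrite le_max lexx orbT.
have n0 x : 0 <= n x by rewrite le_max lexx orbT.
have pa x : p x <= a x by rewrite ge_max a0 fab gerBl b0.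
have nb x : n x <= b x by rewrite ge_max b0 fab opprB gerBl a0.
have sp : (\esum_(x in setT) (p x)%:E < +oo)%E.
  by apply: le_lt_trans sa; apply: le_esum => x _; rewrite lee_fin.
have sn : (\esum_(x in setT) (n x)%:E < +oo)%E.
  by apply: le_lt_trans sb; apply: le_esum => x _; rewrite lee_fin.
have g0 (g : T -> R) : (forall x, 0 <= g x) -> (0 <= \esum_(x in [set: T]) (g x)%:E)%E.
  by move=> gg; apply: esum_ge0 => x _; rewrite lee_fin.
have eqs : (\esum_(x in [set: T]) (p x)%:E + \esum_(x in [set: T]) (b x)%:E =
            \esum_(x in [set: T]) (a x)%:E + \esum_(x in [set: T]) (n x)%:E)%E.
  rewrite -!esumD; try by move=> *; rewrite lee_fin.
  apply: eq_esum => x _; rewrite -!EFinD; congr EFin.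
  rewrite /p /n fab; case: (leP (a x - b x) 0) => h.
    by rewrite max_l; lra.
  by rewrite max_r; lra.
have fin (g : T -> R) : (forall x, 0 <= g x) -> (\esum_(x in [set: T]) (g x)%:E < +oo)%E ->
   \esum_(x in [set: T]) (g x)%:E \is a fin_num.
  by move=> gg h; rewrite ge0_fin_numE// g0.
move/(congr1 fine): eqs; rewrite !fineD ?fin//; lra.
Qed.

Definition summ T (f : T -> R) := (\esum_(x in setT) (`|f x|)%:E < +oo)%E.

Lemma summ_le T (f g : T -> R) : (forall x, `|f x| <= g x) -> summ g -> summ f.
Proof.
move=> fg; apply: le_lt_trans; apply: le_esum => x _.
by rewrite lee_fin (le_trans (fg x))// ler_norm.
Qed.

Lemma summ_norm T (f : T -> R) : summ f -> summ (fun x => `|f x|).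
Proof. by apply: le_lt_trans; apply: le_esum => x _; rewrite normr_id. Qed.

Lemma summ_esum T (f : T -> R) : (forall x, 0 <= f x) ->
  summ f = (\esum_(x in setT) (f x)%:E < +oo)%E :> Prop.
Proof.
by move=> f0; rewrite /summ; under eq_esum do rewrite ger0_norm//.
Qed.

Lemma summ_parts T (f : T -> R) : summ f ->
  (\esum_(x in setT) (Num.max (f x) 0)%:E < +oo)%E /\
  (\esum_(x in setT) (Num.max (- f x) 0)%:E < +oo)%E.
Proof.
move=> sf; split; apply: le_lt_trans sf; apply: le_esum => x _;
  by rewrite lee_fin ge_max normr_ge0 andbT ?ler_norm// -normrN ler_norm.
Qed.

Lemma ge0_sumR T (f : T -> R) : (forall x, 0 <= f x) ->
  sumR f = fine (\esum_(x in setT) (f x)%:E).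
Proof.
move=> f0; rewrite /sumR.
have -> : \esum_(t in [set: T]) (Num.max (- f t) 0)%:E = 0%E.
  by apply: esum1 => t _; rewrite max_r// oppr_le0.
rewrite subr0; congr fine; apply: eq_esum => t _.
by rewrite max_l.
Qed.

Lemma ge0_sumRE T (f : T -> R) : (forall x, 0 <= f x) -> summ f ->
  (sumR f)%:E = \esum_(x in setT) (f x)%:E.
Proof.
move=> f0 sf; rewrite ge0_sumR// fineK// ge0_fin_numE; last first.
  by apply: esum_ge0 => *; rewrite lee_fin.
by rewrite -summ_esum.
Qed.

Lemma eq_sumR T (f g : T -> R) : (forall x, f x = g x) -> sumR f = sumR g.
Proof. by move=> fg; congr sumR; apply/funext. Qed.

Lemma sumR_ge0 T (f : T -> R) : (forall x, 0 <= f x) -> 0 <= sumR f.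
Proof.
move=> f0; rewrite ge0_sumR// fine_ge0// esum_ge0// => x _; by rewrite lee_fin.
Qed.

Lemma summD T (f g : T -> R) : summ f -> summ g -> summ (fun x => f x + g x).
Proof.
move=> sf sg; apply: (@le_lt_trans _ _
  (\esum_(x in setT) (`|f x|)%:E + \esum_(x in setT) (`|g x|)%:E)%E).
  rewrite -esumD; try by move=> *; rewrite lee_fin.
  by apply: le_esum => x _; rewrite lee_fin ler_normD.
exact: lte_add_pinfty.
Qed.

Lemma summZ T (c : R) (f : T -> R) : summ f -> summ (fun x => c * f x).
Proof.
move=> sf; rewrite /summ.
under eq_esum do rewrite normrM EFinM.
rewrite esumZl//.
by rewrite lte_mul_pinfty ?lee_fin.
Qed.

Lemma summN T (f : T -> R) : summ f -> summ (fun x => - f x).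
Proof. by rewrite /summ; under eq_esum do rewrite -normrN. Qed.

Lemma summB T (f g : T -> R) : summ f -> summ g -> summ (fun x => f x - g x).
Proof. by move=> sf sg; apply: summD => //; exact: summN. Qed.

Lemma summ0 T : summ (fun _ : T => 0).
Proof. by rewrite /summ esum1// => x _; rewrite normr0. Qed.

Lemma sumRD T (f g : T -> R) : summ f -> summ g ->
  sumR (fun x => f x + g x) = sumR f + sumR g.
Proof.
move=> sf sg.
have [fp fn] := summ_parts sf; have [gp gn] := summ_parts sg.
have m0 (h : T -> R) (x : T) : 0 <= Num.max (h x) 0 by rewrite le_max lexx orbT.
have E0 (h : T -> R) : (0 <= \esum_(x in setT) (Num.max (h x) 0)%:E)%E.
  by apply: esum_ge0 => *; rewrite lee_fin.
rewrite (@sumR_diff _ _ (fun x => Num.max (f x) 0 + Num.max (g x) 0)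
  (fun x => Num.max (- f x) 0 + Num.max (- g x) 0)).
- under eq_esum do rewrite EFinD.
  under [X in _ - fine X]eq_esum do rewrite EFinD.
  rewrite !esumD; try by move=> *; rewrite lee_fin ?m0// (m0 (fun y => - _ y)).
  rewrite !fineD; try by rewrite ge0_fin_numE ?E0 ?(E0 (fun y => - _ y)).
  by rewrite /sumR; lra.
- by move=> x; rewrite addr_ge0.
- by move=> x; rewrite addr_ge0// le_max lexx orbT.
- by move=> x; rewrite {1}(maxr_sub (f x)) {1}(maxr_sub (g x)); lra.
- under eq_esum do rewrite EFinD.
  rewrite esumD; try by move=> *; rewrite lee_fin.
  exact: lte_add_pinfty.
- under eq_esum do rewrite EFinD.
  rewrite esumD; try by move=> *; rewrite lee_fin (m0 (fun y => - _ y)).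
  exact: lte_add_pinfty.
Qed.

Lemma sumRN T (f : T -> R) : sumR (fun x => - f x) = - sumR f.
Proof.
rewrite /sumR opprB; congr (_ - fine _).
by apply: eq_esum => x _; rewrite opprK.
Qed.

Lemma sumRB T (f g : T -> R) : summ f -> summ g ->
  sumR (fun x => f x - g x) = sumR f - sumR g.
Proof.
by move=> sf sg; rewrite sumRD//; [rewrite sumRN | exact: summN].
Qed.

Lemma sumRZ T (c : R) (f : T -> R) : sumR (fun x => c * f x) = c * sumR f.
Proof.
wlog c0 : c / 0 <= c => [hw|].
  have [c0|c0] := leP 0 c; first exact: hw.
  have := hw (- c); rewrite oppr_ge0 (ltW c0) => /(_ isT).
  rewrite mulNr => /(congr1 -%R); rewrite opprK => <-; rewrite -sumRN.
  by apply: eq_sumR => x; rewrite mulNr opprK.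
have E (h : T -> R) : (\esum_(x in setT) (Num.max (c * h x) 0)%:E =
   c%:E * \esum_(x in setT) (Num.max (h x) 0)%:E)%E.
  rewrite -esumZl//; last by move=> y; rewrite lee_fin le_max lexx orbT.
  by apply: eq_esum => x _; rewrite -EFinM maxr_pMr// mulr0.
(* [fine] sends [+oo] to 0, which is why homogeneity holds for divergent parts too. *)
have F (u : \bar R) : (0 <= u)%E -> fine (c%:E * u) = c * fine u.
  case: u => [r||]//= _; have [->|cn] := eqVneq c 0; first by rewrite mul0e mul0r.
  by rewrite gt0_muley ?mulr0// lte_fin lt_neqAle eq_sym cn.
rewrite /sumR E; under [X in _ - fine X]eq_esum do rewrite -mulrN.
rewrite (E (fun x => - f x)) !F ?mulrBr//; apply: esum_ge0 => x _;
  by rewrite lee_fin le_max lexx orbT.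
Qed.

Lemma le_sumR T (f g : T -> R) : summ f -> summ g ->
  (forall x, f x <= g x) -> sumR f <= sumR g.
Proof.
move=> sf sg fg; rewrite -subr_ge0 -sumRB//; apply: sumR_ge0 => x.
by rewrite subr_ge0.
Qed.

Lemma ler_norm_sumR T (f : T -> R) : summ f -> `|sumR f| <= sumR (fun x => `|f x|).
Proof.
move=> sf; rewrite ler_norml -sumRN; apply/andP; split; apply: le_sumR => //.
- exact/summN/summ_norm.
- by move=> x; rewrite lerNl -normrN ler_norm.
- exact: summ_norm.
- by move=> x; exact: ler_norm.
Qed.

Lemma ler_sumR_bound T (f g : T -> R) : summ g -> (forall x, `|f x| <= g x) ->
  `|sumR f| <= sumR g.
Proof.
move=> sg fg; have sf := summ_le fg sg.
apply: (le_trans (ler_norm_sumR sf)); apply: le_sumR => //; exact: summ_norm.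
Qed.

Lemma summ_big T (I : Type) (r : seq I) (P : pred I) (f : I -> T -> R) :
  (forall i, P i -> summ (f i)) -> summ (fun x => \sum_(i <- r | P i) f i x).
Proof.
move=> sf; elim: r => [|i r IH].
  by under eq_fun do rewrite big_nil; exact: summ0.
under eq_fun do rewrite big_cons.
have [Pi|Pi] := boolP (P i) => //.
by apply: summD => //; apply: sf.
Qed.

Lemma sumR0 T : sumR (fun _ : T => 0 : R) = 0.
Proof. by rewrite ge0_sumR// esum1. Qed.

Lemma sumR_big T (I : Type) (r : seq I) (P : pred I) (f : I -> T -> R) :
  (forall i, P i -> summ (f i)) ->
  sumR (fun x => \sum_(i <- r | P i) f i x) = \sum_(i <- r | P i) sumR (f i).
Proof.
move=> sf; elim: r => [|i r IH].
  by rewrite big_nil; under eq_fun do rewrite big_nil; exact: sumR0.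
rewrite big_cons; under eq_fun do rewrite big_cons.
have [Pi|Pi] := boolP (P i) => //.
by rewrite sumRD ?IH//; [exact: sf | exact: summ_big].
Qed.

Lemma sumR_term_le T (f : T -> R) x : (forall y, 0 <= f y) -> summ f -> f x <= sumR f.
Proof.
move=> f0 sf; rewrite -lee_fin ge0_sumRE//.
by apply: (@esum_term_le _ (fun y => (f y)%:E)) => y; rewrite lee_fin.
Qed.

Lemma summ_mulb T (f c : T -> R) (B : R) : summ f -> (forall x, `|c x| <= B) ->
  summ (fun x => f x * c x).
Proof.
move=> sf cB; apply: (@summ_le _ _ (fun x => B * `|f x|)).
  by move=> x; rewrite normrM mulrC ler_wpM2r.
exact/summZ/summ_norm.
Qed.

Definition rconv (T : zmodType) (f h : T -> R) (x : T) : R :=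
  sumR (fun y => f y * h (x - y)).

Section Conv.
Variables (T : zmodType) (f h : T -> R).
Hypotheses (f0 : forall x, 0 <= f x) (h0 : forall x, 0 <= h x).
Hypotheses (sf : summ f) (sh : summ h).

Lemma rconv_ge0 x : 0 <= rconv f h x.
Proof. by apply: sumR_ge0 => y; rewrite mulr_ge0. Qed.

Lemma summ_rconv_term x : summ (fun y => f y * h (x - y)).
Proof.
apply: (@summ_mulb _ _ _ (sumR h)) => // y.
by rewrite ger0_norm//; exact: sumR_term_le.
Qed.

Lemma rconv_esum x : (rconv f h x)%:E = \esum_(y in setT) (f y * h (x - y))%:E.
Proof.
rewrite /rconv ge0_sumRE//; first by move=> y; rewrite mulr_ge0.
exact: summ_rconv_term.
Qed.

(** Tonelli in the extended reals; summability of the left side is then read off from the right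
    side, which the bound [B] controls. *)
Lemma rconv_ge0_fubini (c : T -> R) (B : R) :
  (forall x, 0 <= c x) -> (forall x, `|c x| <= B) ->
  summ (fun x => rconv f h x * c x) /\
  sumR (fun x => rconv f h x * c x) =
  sumR (fun y => f y * sumR (fun z => h z * c (y + z))).
Proof.
move=> c0 cB.
have shc y : summ (fun z => h z * c (y + z)) by apply: summ_mulb => // z; exact: cB.
have E : \esum_(x in setT) (rconv f h x * c x)%:E =
   \esum_(y in setT) (f y * sumR (fun z => h z * c (y + z)))%:E.
  have -> : \esum_(x in setT) (rconv f h x * c x)%:E =
      \esum_(x in setT) \esum_(y in setT) (f y * h (x - y) * c x)%:E.
    apply: eq_esum => x _; rewrite EFinM rconv_esum -esumZr ?lee_fin//.
    by move=> y; rewrite lee_fin mulr_ge0.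
  rewrite esum_exchange; last first.
    by move=> x y; rewrite lee_fin !mulr_ge0.
  apply: eq_esum => y _; rewrite EFinM ge0_sumRE//; last first.
    by move=> z; rewrite mulr_ge0.
  rewrite -esumZl ?lee_fin//; last by move=> z; rewrite lee_fin mulr_ge0.
  rewrite (esum_shift (- y)); apply: eq_esum => z _.
  by rewrite -!EFinM [y + _]addrC subrK mulrA.
have s2 : summ (fun y => f y * sumR (fun z => h z * c (y + z))).
  apply: (@summ_mulb _ _ _ (sumR (fun z => B * `|h z|))) => // y.
  apply: ler_sumR_bound; first exact/summZ/summ_norm.
  by move=> z; rewrite normrM mulrC ler_wpM2r.
have n1 x : 0 <= rconv f h x * c x by rewrite mulr_ge0 ?rconv_ge0.
have n2 y : 0 <= f y * sumR (fun z => h z * c (y + z)).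
  by rewrite mulr_ge0// sumR_ge0// => z; rewrite mulr_ge0.
split; first by rewrite summ_esum// E -summ_esum.
by rewrite ge0_sumR// E -ge0_sumR.
Qed.

(** The intended test functions are cosines and sines: bounded but signed, hence split into positive
    and negative parts. *)
Lemma rconv_fubini (c : T -> R) (B : R) : (forall x, `|c x| <= B) ->
  sumR (fun x => rconv f h x * c x) =
  sumR (fun y => f y * sumR (fun z => h z * c (y + z))).
Proof.
move=> cB.
pose cp x := Num.max (c x) 0; pose cn x := Num.max (- c x) 0.
have cpn x : c x = cp x - cn x by exact: maxr_sub.
have cp0 x : 0 <= cp x by rewrite le_max lexx orbT.
have cn0 x : 0 <= cn x by rewrite le_max lexx orbT.
have cpB x : `|cp x| <= B.
  by rewrite ger0_norm// (le_trans _ (cB x))// ge_max normr_ge0 ler_norm.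
have cnB x : `|cn x| <= B.
  by rewrite ger0_norm// (le_trans _ (cB x))// ge_max normr_ge0 -normrN ler_norm.
have [sp ep] := rconv_ge0_fubini cp0 cpB.
have [sn en] := rconv_ge0_fubini cn0 cnB.
have shb (b : T -> R) y : (forall x, `|b x| <= B) -> summ (fun z => h z * b (y + z)).
  by move=> bB; apply: summ_mulb => // z; exact: bB.
have sfb (b : T -> R) : (forall x, `|b x| <= B) ->
    summ (fun y => f y * sumR (fun z => h z * b (y + z))).
  move=> bB; apply: (@summ_mulb _ _ _ (sumR (fun z => B * `|h z|))) => // y.
  apply: ler_sumR_bound; first exact/summZ/summ_norm.
  by move=> z; rewrite normrM mulrC ler_wpM2r.
under eq_sumR do rewrite cpn mulrBr.
rewrite sumRB// ep en -sumRB; [|exact: sfb..].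
apply: eq_sumR => y; rewrite -mulrBr; congr (_ * _).
rewrite -sumRB; [|exact: shb..].
by apply: eq_sumR => z; rewrite -mulrBr cpn.
Qed.

Lemma summ_rconv : summ (rconv f h).
Proof.
have [|s _] := @rconv_ge0_fubini (fun=> 1) 1 (fun=> ler01).
  by move=> x; rewrite normr1.
by move: s; under eq_fun do rewrite mulr1.
Qed.

End Conv.

End EsumTheory.

(** * Elementary inequalities *)

Section Inequalities.
Variable R : realType.
Implicit Types s t x y : R.

Lemma expR_le_quad s : expR s <= 1 + s + s ^+ 2 * expR `|s|.
Proof.
have e1 : expR s - 1 <= s * expR s.
  have h := expR_ge1Dx (- s); have e := expR_gt0 s.
  have : (1 - s) * expR s <= expR (- s) * expR s by rewrite ler_pM2r.
  by rewrite -expRD addNr expR0; lra.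
have e2 : 1 + `|s| <= expR `|s| := expR_ge1Dx _.
have e3 : 0 <= `|s| := normr_ge0 _.
have [s0|s0] := leP 0 s.
  rewrite (ger0_norm s0) in e2 *.
  have : s * (expR s - 1) <= s * (s * expR s) by rewrite ler_wpM2l.
  nra.
rewrite (ltr0_norm s0) in e2 e3 *.
have h := expR_ge1Dx s.
have : - s * (1 - expR s) <= - s * (- s) by rewrite ler_wpM2l//; lra.
have : s ^+ 2 * 1 <= s ^+ 2 * expR (- s) by rewrite ler_wpM2l ?sqr_ge0//; lra.
nra.
Qed.

(** Source of the strict convexity of the Laplace transform. For [s >= -2] it follows from squaring
    [1 + s / 2 <= expR (s / 2)]; below [-2] the left side is negative because [|s| <= B]. *)
Lemma expR_ge_quad (B s : R) : 1 <= B -> `|s| <= B -> 1 + s + s ^+ 2 / (4 * B) <= expR s.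
Proof.
move=> B1; rewrite ler_norml => /andP[sB1 sB2].
have Bp : 0 < 4 * B by lra.
have [s2|s2] := leP (-2) s.
  have h := expR_ge1Dx (s / 2).
  have h2 : (1 + s / 2) ^+ 2 <= expR s.
    have -> : expR s = expR (s / 2) ^+ 2 by rewrite expr2 -expRD; congr expR; lra.
    by rewrite ler_sqr ?nnegrE ?expR_ge0//; lra.
  apply: le_trans h2.
  have : s ^+ 2 / (4 * B) <= s ^+ 2 / 4.
    by rewrite ler_wpM2l ?sqr_ge0// lef_pV2 ?posrE; lra.
  nra.
apply: le_trans (expR_ge0 s).
have : s ^+ 2 / (4 * B) <= - s / 4.
  rewrite ler_pdivrMr//.
  have -> : - s / 4 * (4 * B) = - s * B by lra.
  by nra.
lra.
Qed.

Lemma expR_sub1_le s : `|expR s - 1| <= `|s| * expR `|s|.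
Proof.
have e1 : expR s - 1 <= s * expR s.
  have h := expR_ge1Dx (- s); have e := expR_gt0 s.
  have : (1 - s) * expR s <= expR (- s) * expR s by rewrite ler_pM2r.
  by rewrite -expRD addNr expR0; lra.
have h := expR_ge1Dx s.
have [s0|s0] := leP 0 s.
  by rewrite (ger0_norm s0) ger0_norm //; lra.
have e2 : 1 <= expR (- s) by have := expR_ge1Dx (- s); lra.
have e3 : expR s <= 1 by rewrite -(expR0 R) ler_expR ltW.
rewrite (ltr0_norm s0) ler0_norm; last lra.
nra.
Qed.

(** The inequality [z <= expR z] at [z = a t / k], raised to the power [k]. Every absorption of a
    polynomial by an exponential below goes through this bound. *)
Lemma pow_le_expR (k : nat) (a t : R) : 0 < a -> 0 <= t ->
  t ^+ k <= (k%:R / a) ^+ k * expR (a * t).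
Proof.
move=> a0 t0; case: k => [|k].
  by rewrite !expr0 mul1r -(expR0 R) ler_expR mulr_ge0// ltW.
have k0 : 0 < (k.+1)%:R :> R by rewrite ltr0n.
have -> : expR (a * t) = expR (a * t / k.+1%:R) ^+ k.+1.
  by rewrite -expRM_natl; congr expR; field.
rewrite -exprMn lerXn2r ?nnegrE//.
  by rewrite mulr_ge0 ?expR_ge0// divr_ge0// ltW.
set z := a * t / k.+1%:R.
have E (m : R) : 0 < m -> t = m / a * (a * t / m).
  by move=> m0; field; rewrite !gt_eqF.
rewrite {1}(E _ k0).
rewrite ler_wpM2l//; first by rewrite divr_ge0// ltW.
by apply: le_trans (expR_ge1Dx z); rewrite lerDr.
Qed.

Lemma MVT_bound (f df : R -> R) (M y : R) :
  (forall x, is_derive x 1 f (df x)) -> (forall x, `|x| <= `|y| -> `|df x| <= M) ->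
  `|f y - f 0| <= M * `|y|.
Proof.
move=> fd fM.
have fc : continuous f.
  by move=> x; apply/differentiable_continuous/derivable1_diffP; have [] := fd x.
have [y0|y0] := leP 0 y.
  have [c] := MVT_segment y0 (fun x _ => fd x) (continuous_subspaceT fc).
  rewrite in_itv /= => /andP[c0 cy] ->; rewrite subr0 normrM ler_wpM2r//.
  by apply: fM; rewrite !ger0_norm.
have [c] := MVT_segment (ltW y0) (fun x _ => fd x) (continuous_subspaceT fc).
rewrite in_itv /= => /andP[cy c0] E; rewrite distrC E sub0r normrM normrN ler_wpM2r//.
by apply: fM; rewrite ler0_norm// ltr0_norm// lerN2.
Qed.

Lemma norm_sin_le y : `|sin y| <= `|y|.
Proof.
have := @MVT_bound sin cos 1 y (fun x => is_derive_sin x).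
rewrite sin0 subr0 mul1r; apply => x _.
by rewrite ler_norml cos_geN1 cos_le1.
Qed.

Lemma one_sub_cos y : 1 - cos y = 2 * sin (y / 2) ^+ 2.
Proof.
have -> : cos y = cos (y / 2 + y / 2) by congr cos; lra.
by rewrite cosD; have := cos2Dsin2 (y / 2); lra.
Qed.

Lemma one_sub_cos_ge0 y : 0 <= 1 - cos y.
Proof. by rewrite subr_ge0 cos_le1. Qed.

Lemma one_sub_cos_le y : 1 - cos y <= y ^+ 2 / 2.
Proof.
rewrite one_sub_cos; have h := norm_sin_le (y / 2).
have : `|sin (y / 2)| ^+ 2 <= `|y / 2| ^+ 2 by rewrite lerXn2r ?nnegrE.
rewrite !real_normK ?num_real//; lra.
Qed.

(** The mean value theorem gives the bounds [2 |y|] and [|y|^3 / 2], and [y^2] dominates their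
    minimum. The quadratic bound is the one that integrates to the cubic bound for the cosine. *)
Lemma sin_taylor y : `|sin y - y| <= y ^+ 2 /\ `|sin y - y| <= `|y| ^+ 3.
Proof.
pose f := fun x : R => sin x - x.
have fd x : is_derive x 1 f (cos x - 1) by rewrite /f; apply: is_deriveB.
have f0 : f 0 = 0 by rewrite /f sin0 subr0.
have y0 := normr_ge0 y.
have h1 : `|f y| <= 2 * `|y|.
  have := @MVT_bound f (fun x => cos x - 1) 2 y fd; rewrite f0 subr0; apply => x _.
  by have := cos_geN1 x; have := cos_le1 x; rewrite ler_norml; lra.
have h2 : `|f y| <= (`|y| ^+ 2 / 2) * `|y|.
  have := @MVT_bound f (fun x => cos x - 1) (`|y| ^+ 2 / 2) y fd.
  rewrite f0 subr0; apply => x xy.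
  rewrite distrC ger0_norm ?one_sub_cos_ge0//.
  apply: (le_trans (one_sub_cos_le x)).
  rewrite -[x ^+ 2]real_normK ?num_real// ler_wpM2r// lerXn2r ?nnegrE//.
rewrite -[y ^+ 2]real_normK ?num_real//.
move: h1 h2 y0; rewrite /f; set a := `|sin y - y|; set b := `|y| => h1 h2 b0.
have b2 : 0 <= b ^+ 2 by rewrite sqr_ge0.
split; last by rewrite exprS; nra.
have [bb|bb] := leP b 2; nra.
Qed.

Lemma cos_taylor y : `|cos y - 1 + y ^+ 2 / 2| <= `|y| ^+ 3.
Proof.
pose f := fun x : R => cos x + x ^+ 2 / 2.
have fd x : is_derive x 1 f (x - sin x).
  have -> : f = (fun x : R => cos x + 2^-1 * (x * x)).
    by apply/funext => z; rewrite /f expr2 mulrC.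
  have -> : x - sin x = - sin x + 2^-1 * (x * 1 + x * 1) by lra.
  apply: is_deriveD; apply: is_deriveZ; exact: is_deriveM.
have := @MVT_bound f (fun x => x - sin x) (`|y| ^+ 2) y fd.
have -> : f y - f 0 = cos y - 1 + y ^+ 2 / 2.
  by rewrite /f cos0 expr0n /= ; lra.
rewrite -exprSr; apply => x xy.
rewrite distrC; apply: (le_trans (sin_taylor x).1).
by rewrite -[x ^+ 2]real_normK ?num_real// lerXn2r ?nnegrE.
Qed.

Lemma sin_ge_lin s : 0 <= s <= pi / 2 -> s / 4 <= sin s.
Proof.
move=> /andP[s0 spi].
have pi2 : (pi : R) / 2 < 2 := @pihalf_lt2 R.
have [->|sn] := eqVneq s 0; first by rewrite sin0; lra.
have sp : 0 < s by rewrite lt_neqAle eq_sym sn.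
have ss : 0 <= sin s by apply: sin_ge0_pi; rewrite s0 /=; lra.
have cs : 0 <= cos s by apply: cos_ge0_pihalf; rewrite spi andbT; lra.
have cs2 := cos2Dsin2 s.
have h : s * cos s <= sin s.
  have [c] := MVT_segment s0 (fun x _ => is_derive_sin x)
    (continuous_subspaceT (@continuous_sin R)).
  rewrite in_itv /= => /andP[c0 cs']; rewrite sin0 !subr0 => ->.
  rewrite mulrC ler_wpM2r//.
  have [->//|ne] := eqVneq c s.
  rewrite ltW// ltr_cos ?in_itv /= ?c0 ?s0 /=; lra.
(* If [cos s >= 1/2], then [s cos s <= sin s] suffices; otherwise [sin s] exceeds [1/2], while
   [s / 4 < 1/2]. *)
have [c2|c2] := leP (1/2) (cos s); first by nra.
nra.
Qed.

Lemma one_sub_cos_ge t : `|t| <= pi -> t ^+ 2 / 32 <= 1 - cos t.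
Proof.
move=> tpi; rewrite one_sub_cos.
have h (s : R) : 0 <= s <= pi -> s ^+ 2 / 32 <= 2 * sin (s / 2) ^+ 2.
  move=> /andP[s0 spi].
  have := @sin_ge_lin (s / 2); have -> : 0 <= s / 2 <= pi / 2 by lra.
  move=> /(_ isT); nra.
have [t0|t0] := leP 0 t.
  by apply: h; rewrite t0 /= -(ger0_norm t0).
have := h (- t); rewrite mulNr sinN sqrrN sqrrN; apply.
by rewrite -(ltr0_norm t0) normr_ge0.
Qed.

End Inequalities.

(** * Gaussian lattice sums *)

Section GaussOne.
Import gauss_integral_proof.
Variable R : realType.
Implicit Types h s x y : R.
Local Notation g := (@gauss_fun R).
Local Notation Phi := (@integral0_gauss R).
Local Notation mu := (@lebesgue_measure R).

Lemma gauss_fun_nincr x y : 0 <= x -> x <= y -> g y <= g x.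
Proof.
move=> x0 xy; rewrite ler_expR lerN2 lerXn2r ?nnegrE//.
exact: le_trans xy.
Qed.

Lemma integrable_gauss_itv (a b : R) : mu.-integrable `[a, b] (EFin \o g).
Proof. exact: (@integrableS _ _ _ mu setT) (integrableT_gauss). Qed.

Lemma integral0_gauss_MVT x y : 0 <= x -> x <= y ->
  g y * (y - x) <= Phi y - Phi x <= g x * (y - x).
Proof.
move=> x0 xy.
have y0 : 0 <= y by exact: le_trans xy.
have dP z : z \in `]x, y[%R -> is_derive z 1 Phi (g z).
  rewrite in_itv /= => /andP[xz zy].
  have [||||] := @continuous_FTC1_closed R g 0 z (z + 1).
  - by rewrite ltrDl.
  - exact: integrable_gauss_itv.
  - exact: le_lt_trans xz.
  - exact: continuous_gauss_fun.
  move=> d1 d2; apply: (DeriveDef d1).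
  by rewrite -derive1E d2.
have cP : {within `[x, y], continuous Phi}.
  apply: (@continuous_subspaceW _ _ _ `[0, y]).
    by move=> z /=; rewrite !in_itv /= => /andP[xz ->]; rewrite (le_trans x0).
  apply: parameterized_integral_continuous => //.
  exact: integrable_gauss_itv.
have [c] := MVT_segment xy dP cP.
rewrite in_itv /= => /andP[xc cy] ->.
by rewrite !ler_wpM2r ?subr_ge0// gauss_fun_nincr// (le_trans x0).
Qed.

Lemma cvg_integral0_gauss : Phi x @[x --> +oo] --> Num.sqrt pi / 2.
Proof.
have : Num.sqrt (Phi x ^+ 2) @[x --> +oo] --> Num.sqrt (pi / 4 : R).
  by apply: continuous_cvg; [exact: sqrt_continuous|exact: cvg_integral0_gauss_sqr].
rewrite sqrtrM ?pi_ge0// sqrtrV// (_ : 4 = 2 ^+ 2); last by rewrite expr2 -natrM.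
rewrite sqrtr_sqr ger0_norm//.
rewrite (_ : (fun _ => Num.sqrt _) = integral0_gauss)//.
by apply/funext => r; rewrite sqrtr_sqr// ger0_norm// integral0_gauss_ge0.
Qed.

Lemma integral0_gauss_nd x y : 0 <= x -> x <= y -> Phi x <= Phi y.
Proof.
move=> x0 xy; have /andP[h _] := integral0_gauss_MVT x0 xy.
by rewrite -subr_ge0; apply: le_trans h; rewrite mulr_ge0 ?gauss_fun_ge0// subr_ge0.
Qed.

Lemma integral0_gauss_le x : 0 <= x -> Phi x <= Num.sqrt pi / 2.
Proof.
move=> x0; rewrite -(cvg_lim (@Rhausdorff R) cvg_integral0_gauss).
apply: limr_ge; first by apply/cvg_ex; eexists; exact: cvg_integral0_gauss.
near=> z; apply: integral0_gauss_nd => //; near: z; exact: nbhs_pinfty_ge.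
Unshelve. all: by end_near. Qed.

Lemma integral0_gauss0 : Phi 0 = 0.
Proof. by rewrite /integral0_gauss set_itv1 Rintegral_set1. Qed.

(** Telescoped comparison of a decreasing function with its integral. The offset [y <= h] and the
    first term each cost at most [h], since the integrand is at most 1. *)
Lemma gauss_half_sum_finite h y n : 0 < h -> 0 <= y -> y <= h ->
  Phi (h *+ n) - h <= h * \sum_(k < n) g (y + h *+ k) <= Num.sqrt pi / 2 + h.
Proof.
move=> h0 y0 yh.
have hn k : 0 <= y + h *+ k by rewrite addr_ge0// mulrn_wge0// ltW.
have st k : h * g (y + h *+ k.+1) <= Phi (y + h *+ k.+1) - Phi (y + h *+ k) <=
    h * g (y + h *+ k).
  have := @integral0_gauss_MVT (y + h *+ k) (y + h *+ k.+1) (hn k).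
  rewrite lerD2l ler_pMn2l// leqnSn => /(_ isT).
  have -> : y + h *+ k.+1 - (y + h *+ k) = h by rewrite mulrS; ring.
  by rewrite !(mulrC h).
have lo m : Phi (y + h *+ m) - Phi y <= h * \sum_(k < m) g (y + h *+ k).
  elim: m => [|m IH]; first by rewrite mulr0n addr0 big_ord0 mulr0 subrr.
  by rewrite big_ord_recr /= mulrDr; have /andP[_] := st m; lra.
have up m : h * \sum_(k < m.+1) g (y + h *+ k) <= h + (Phi (y + h *+ m) - Phi y).
  elim: m => [|m IH].
    rewrite mulr0n addr0 big_ord_recr big_ord0 /= add0r mulr0n addr0 subrr addr0.
    by rewrite ger_pMr// gauss_fun_le1.
  by rewrite big_ord_recr /= mulrDr; have /andP[+ _] := st m; lra.
have Py : Phi y <= h.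
  have /andP[_ ] := integral0_gauss_MVT (lexx 0) y0.
  rewrite integral0_gauss0 !subr0 => /le_trans; apply.
  by apply: le_trans yh; rewrite ler_piMl// gauss_fun_le1.
have Py0 : 0 <= Phi y := integral0_gauss_ge0 y.
apply/andP; split.
  have := lo n; have : Phi (h *+ n) <= Phi (y + h *+ n); last lra.
  by apply: integral0_gauss_nd; rewrite ?mulrn_wge0 ?lerDr// ltW.
case: n => [|n].
  by rewrite big_ord0 mulr0 addr_ge0 ?divr_ge0 ?sqrtr_ge0// ltW.
have := up n; have := integral0_gauss_le (hn n); lra.
Qed.

Lemma esum_nat_le (a : nat -> R) (M : R) : (forall k, 0 <= a k) ->
  (forall n, \sum_(k < n) a k <= M) -> (\esum_(k in setT) (a k)%:E <= M%:E)%E.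
Proof.
move=> a0 aM; rewrite -nneseries_esumT; last by move=> *; rewrite lee_fin.
apply: lime_le; first by apply: is_cvg_nneseries => k _ _; rewrite lee_fin.
by apply: nearW => n; rewrite sumEFin lee_fin big_mkord.
Qed.

Lemma esum_nat_ge (a : nat -> R) n : (forall k, 0 <= a k) ->
  ((\sum_(k < n) a k)%:E <= \esum_(k in setT) (a k)%:E)%E.
Proof.
move=> a0; rewrite -nneseries_esumT; last by move=> *; rewrite lee_fin.
rewrite -(big_mkord xpredT) -sumEFin.
by apply: nneseries_lim_ge => k _; rewrite lee_fin.
Qed.

Lemma gauss_half_sum h y : 0 < h -> 0 <= y -> y <= h ->
  ((Num.sqrt pi / 2 - h)%:E <= (\esum_(k in [set: nat]) (h * g (y + h *+ k))%:E)
     <= (Num.sqrt pi / 2 + h)%:E)%E.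
Proof.
move=> h0 y0 yh.
have g0 k : 0 <= h * g (y + h *+ k) by rewrite mulr_ge0 ?gauss_fun_ge0 ?ltW.
have up : ((\esum_(k in [set: nat]) (h * g (y + h *+ k))%:E)
     <= (Num.sqrt pi / 2 + h)%:E)%E.
  apply: esum_nat_le => // n; rewrite -mulr_sumr.
  by have /andP[] := gauss_half_sum_finite n h0 y0 yh.
rewrite up andbT.
have fin : \esum_(k in [set: nat]) (h * g (y + h *+ k))%:E \is a fin_num.
  rewrite ge0_fin_numE; first by apply: le_lt_trans up _; exact: ltry.
  by apply: esum_ge0 => k _; rewrite lee_fin.
rewrite -(fineK fin) lee_fin lerBlDr; set v := fine _.
have le_v z : 0 <= z -> Phi z <= v + h.
  move=> z0; pose n := (Num.truncn (z / h)).+1.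
  have zn : z <= h *+ n.
    rewrite -mulr_natl -ler_pdivrMr//; apply/ltW; exact: truncnS_gt.
  apply: (le_trans (integral0_gauss_nd z0 zn)).
  have /andP[+ _] := gauss_half_sum_finite n h0 y0 yh.
  rewrite lerBlDr => /le_trans; apply; rewrite lerD2r mulr_sumr.
  by rewrite -lee_fin /v fineK// esum_nat_ge.
rewrite -(cvg_lim (@Rhausdorff R) cvg_integral0_gauss).
apply: limr_le; first by apply/cvg_ex; eexists; exact: cvg_integral0_gauss.
near=> z; apply: le_v; near: z; exact: nbhs_pinfty_ge.
Unshelve. all: by end_near. Qed.

Lemma esum_int (a : int -> \bar R) : (forall k, (0 <= a k)%E) ->
  (\esum_(k in setT) a k =
   \esum_(n in [set: nat]) a (Posz n) + \esum_(n in [set: nat]) a (Negz n))%E.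
Proof.
move=> a0; rewrite (esumID [set k : int | 0 <= k])// !setTI; congr (_ + _)%E.
- rewrite (reindex_esum setT _ Posz)//; split => //.
  + by move=> m n _ _ [].
  + by case=> [n|n] //= _; exists n.
- rewrite (reindex_esum setT _ Negz)//; split => //.
  + by move=> m n _ _ [].
  + by case=> [n|n] //= _; exists n.
Qed.

(** The error is uniform in the shift [s]; this is what lets the multidimensional sum be handled one
    coordinate at a time, the shift depending on the other coordinates. *)
Lemma gauss_int_sum h s : 0 < h ->
  ((Num.sqrt pi - 2 * h)%:E <= (\esum_(k in [set: int]) (h * g (h * k%:~R + s))%:E)
     <= (Num.sqrt pi + 2 * h)%:E)%E.
Proof.
move=> h0.
(* Translation by [j] reduces the shift to [0 <= s0 <= h]. The negative integers then form, by
   evenness, another half sum with offset [h - s0]. *)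
pose j := Num.floor (s / h); pose s0 := s - h * j%:~R.
have fl : j%:~R <= s / h < (j + 1)%:~R.
  by rewrite floor_le_tmp floorD1_gt.
have s00 : 0 <= s0.
  by move/andP: fl => [+ _]; rewrite ler_pdivlMr// /s0 subr_ge0 mulrC.
have s0h : s0 <= h.
  move/andP: fl => [_]; rewrite ltr_pdivrMr// intrD mulrDl mul1r => /ltW.
  by rewrite /s0 lerBlDl [h * _]mulrC.
rewrite (esum_shift (- j)) esum_int; last first.
  by move=> k; rewrite lee_fin mulr_ge0 ?gauss_fun_ge0 ?ltW.
have -> : \esum_(n in [set: nat]) (h * g (h * (Posz n - j)%:~R + s))%:E =
    \esum_(n in [set: nat]) (h * g (s0 + h *+ n))%:E.
  apply: eq_esum => n _; congr (_ * g _)%:E.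
  by rewrite /s0 intrB -mulr_natr pmulrn; ring.
have -> : \esum_(n in [set: nat]) (h * g (h * (Negz n - j)%:~R + s))%:E =
    \esum_(n in [set: nat]) (h * g (h - s0 + h *+ n))%:E.
  apply: eq_esum => n _; congr (_ * _)%:E.
  rewrite /gauss_fun -[in RHS]sqrrN; congr (expR (- _ ^+ 2)).
  by rewrite /s0 intrB NegzE -mulr_natr mulrNz -pmulrn -natr1; ring.
have /andP[l1 u1] := gauss_half_sum h0 s00 s0h.
have /andP[l2 u2] : ((Num.sqrt pi / 2 - h)%:E <=
    (\esum_(k in [set: nat]) (h * g (h - s0 + h *+ k))%:E)
     <= (Num.sqrt pi / 2 + h)%:E)%E by apply: gauss_half_sum => //; lra.
have -> : Num.sqrt pi - 2 * h = (Num.sqrt pi / 2 - h) + (Num.sqrt pi / 2 - h) by lra.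
have -> : Num.sqrt pi + 2 * h = (Num.sqrt pi / 2 + h) + (Num.sqrt pi / 2 + h) by lra.
by rewrite !EFinD; apply/andP; split; apply: leeD.
Qed.

Lemma gauss_int_sum_var (a h s : R) : 0 < a -> 0 < h ->
  ((Num.sqrt (2 * pi) / Num.sqrt a - 2 * h)%:E <=
   (\esum_(k in [set: int]) (h * expR (- (a * (h * k%:~R + s) ^+ 2) / 2))%:E)
     <= (Num.sqrt (2 * pi) / Num.sqrt a + 2 * h)%:E)%E.
Proof.
move=> a0 h0; pose b : R := Num.sqrt (a / 2).
have a2 : 0 < a / 2 by rewrite divr_gt0.
have b0 : 0 < b by rewrite sqrtr_gt0.
have b2 : b ^+ 2 = a / 2 by rewrite sqr_sqrtr// ltW.
have e : Num.sqrt (2 * pi) / Num.sqrt a = Num.sqrt pi / b.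
  rewrite /b !sqrtrM ?sqrtrV// ?ltW// invfM invrK; ring.
have -> : (\esum_(k in [set: int]) (h * expR (- (a * (h * k%:~R + s) ^+ 2) / 2))%:E =
   (b^-1)%:E * \esum_(k in [set: int]) ((h * b) * g ((h * b) * k%:~R + s * b))%:E)%E.
  rewrite -esumZl ?lee_fin ?invr_ge0 ?ltW//; last first.
    by move=> k; rewrite lee_fin !mulr_ge0 ?gauss_fun_ge0 ?ltW.
  apply: eq_esum => k _; rewrite -EFinM; congr EFin.
  rewrite [RHS]mulrA [X in _ = X * _]mulrC mulfK ?gt_eqF//; congr (_ * expR _).
  have -> : h * b * k%:~R + s * b = b * (h * k%:~R + s) by ring.
  by rewrite exprMn b2; lra.
have hb0 : 0 < h * b by rewrite mulr_gt0.
have /andP[l u] := gauss_int_sum (s * b) hb0.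
have bi : (0 <= (b^-1)%:E)%E by rewrite lee_fin invr_ge0 ltW.
have := lee_wpmul2l bi l; have := lee_wpmul2l bi u.
rewrite -!EFinM e mulrBr mulrDr.
have -> : b^-1 * (2 * (h * b)) = 2 * h by field; rewrite gt_eqF.
by rewrite [b^-1 * Num.sqrt pi]mulrC => -> ->.
Qed.

End GaussOne.

(** * Gaussian sums over the lattice in dimension d, through Schur complements *)

Section GaussLattice.
Variable R : realType.

Lemma esum_pair (T1 T2 : choiceType) (a : T1 * T2 -> \bar R) :
  (forall z, (0 <= a z)%E) ->
  \esum_(z in setT) a z = \esum_(x in setT) \esum_(y in setT) a (x, y).
Proof.
move=> a0; rewrite esum_esum//.
have -> : [set: T1] `*`` (fun=> [set: T2]) = setT by apply/seteqP; split.
by apply: eq_esum => -[].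
Qed.

Lemma esum_row_mx d (a : 'rV[int]_(1 + d) -> \bar R) : (forall x, (0 <= a x)%E) ->
  \esum_(x in setT) a x =
  \esum_(w in [set: 'rV[int]_d]) \esum_(t in [set: int]) a (row_mx t%:M w).
Proof.
move=> a0; rewrite (@esum_bij R _ _ (fun z : 'rV[int]_d * int => row_mx z.2%:M z.1)).
  by rewrite esum_pair.
exists (fun x => (rsubmx x, lsubmx x 0 0)) => [[w t] | x] /=.
  by rewrite row_mxKr row_mxKl mxE.
rewrite -[RHS]hsubmxK; congr row_mx.
by apply/matrixP => i j; rewrite !ord1 mxE.
Qed.

Definition qf d (A : 'M[R]_d) (v : 'rV[R]_d) : R := (v *m A *m v^T) 0 0.

Lemma dotpE d (u v : 'rV[R]_d) : dotp u v = (u *m v^T) 0 0.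
Proof. by rewrite !mxE; apply: eq_bigr => k _; rewrite mxE. Qed.

Lemma dotpC d (u v : 'rV[R]_d) : dotp u v = dotp v u.
Proof. by apply: eq_bigr => k _; rewrite mulrC. Qed.

Lemma mulmx_trC d (u v : 'rV[R]_d) : u *m v^T = v *m u^T.
Proof. by apply/matrixP => i j; rewrite !ord1 -!dotpE dotpC. Qed.

Lemma dotp_sqr_ge0 d (v : 'rV[R]_d) : 0 <= dotp v v.
Proof. by apply: sumr_ge0 => k _; rewrite -expr2 sqr_ge0. Qed.

Lemma dotp_row_mx d (s t : R) (u v : 'rV[R]_d) :
  dotp (row_mx s%:M u : 'rV_(1 + d)) (row_mx t%:M v) = s * t + dotp u v.
Proof.
rewrite !dotpE tr_row_mx mul_row_col mxE tr_scalar_mx mul_scalar_mx.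
by rewrite !mxE.
Qed.

Lemma qfZ d (A : 'M[R]_d) (h : R) v : qf A (h *: v) = h ^+ 2 * qf A v.
Proof. by rewrite /qf linearZ /= -!scalemxAl -scalemxAr scalerA mxE expr2. Qed.

Definition schur d (A : 'M[R]_(1 + d)) : 'M[R]_d :=
  drsubmx A - (A 0 0)^-1 *: ((ursubmx A)^T *m ursubmx A).

Section SchurStep.
Variables (d : nat) (A : 'M[R]_(1 + d)).
Hypothesis A_sym : A^T = A.
Hypothesis A_neq0 : A 0 0 != 0.
Let a := A 0 0.
Let b := ursubmx A.

Lemma sym_blockE : A = block_mx a%:M b b^T (drsubmx A).
Proof.
rewrite -[LHS]submxK; congr block_mx.
  by apply/matrixP => i j; rewrite !ord1 !mxE /=; congr (A _ _); apply/val_inj.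
by rewrite /b trmx_ursub A_sym.
Qed.

Lemma schur_sym : (schur A)^T = schur A.
Proof.
rewrite /schur linearB linearZ /= trmx_mul trmxK; congr (_ - _).
by rewrite trmx_drsub A_sym.
Qed.

(** Completing the square in the first coordinate: for fixed [w] the Gaussian becomes a shifted
    one-dimensional one. *)
Lemma qf_schur t (w : 'rV[R]_d) :
  qf A (row_mx t%:M w) = a * (t + dotp b w / a) ^+ 2 + qf (schur A) w.
Proof.
have e1 : qf A (row_mx t%:M w) =
    a * t ^+ 2 + 2 * t * dotp b w + qf (drsubmx A) w.
  rewrite /qf {1}sym_blockE mul_row_block tr_row_mx mul_row_col tr_scalar_mx.
  rewrite !mul_mx_scalar mul_scalar_mx mulmxDl mulmx_trC -scalemxAl dotpE.
  set X := b *m w^T; set Y := w *m _ *m _.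
  by rewrite !mxE /=; ring.
have e2 : qf (schur A) w = qf (drsubmx A) w - a^-1 * dotp b w ^+ 2.
  rewrite /qf /schur -/a -/b mulmxBr mulmxBl -scalemxAr -scalemxAl.
  rewrite (mulmxA w b^T b) -(mulmxA _ b w^T) (mulmx_trC w b) dotpE.
  move: (b *m w^T) (w *m drsubmx A *m w^T) => X Y.
  by rewrite !mxE big_ord1; ring.
rewrite e1 e2; field.
exact: A_neq0.
Qed.

Lemma det_schur : \det A = a * \det (schur A).
Proof.
have -> : \det A = \det (block_mx 1%:M 0 (- a^-1 *: b^T) 1%:M *m A).
  by rewrite det_mulmx det_lblock !det1 !mul1r.
rewrite {1}sym_blockE mulmx_block !mul1mx !mul0mx !addr0.
rewrite mul_mx_scalar scalerA mulrN divff// scaleN1r addNr.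
rewrite det_ublock det_scalar1; congr (_ * \det _).
by rewrite /schur addrC scaleNr mulNmx scalemxAl.
Qed.

End SchurStep.

Definition gauss_term d (A : 'M[R]_d) (h : R) (k : 'rV[int]_d) : R :=
  h ^+ d * expR (- qf A (h *: toR R k) / 2).

Lemma gauss_term_ge0 d (A : 'M[R]_d) h k : 0 <= h -> 0 <= gauss_term A h k.
Proof. by move=> h0; rewrite mulr_ge0 ?expR_ge0// exprn_ge0. Qed.

Lemma toR_row_mx d (t : int) (w : 'rV[int]_d) :
  toR R (row_mx t%:M w : 'rV_(1 + d)) = row_mx (t%:~R)%:M (toR R w).
Proof.
rewrite /toR map_row_mx; congr row_mx.
by apply/matrixP => i j; rewrite !ord1 !mxE.
Qed.

Lemma gauss_term_schur d (A : 'M[R]_(1 + d)) h t w : A^T = A -> A 0 0 != 0 ->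
  gauss_term A h (row_mx t%:M w) = gauss_term (schur A) h w *
    (h * expR (- (A 0 0 * (h * t%:~R + h * (dotp (ursubmx A) (toR R w) / A 0 0)) ^+ 2) / 2)).
Proof.
move=> As A0; rewrite /gauss_term toR_row_mx !qfZ qf_schur//.
have -> : h ^+ (1 + d) = h ^+ d * h by rewrite addnC exprD expr1.
rewrite mulrACA -expRD; congr (_ * expR _).
by rewrite -mulrDr exprMn; lra.
Qed.

(* The factor (2 pi)^(d/2) / sqrt (det A) is the Gaussian integral of exp(- qf A / 2). *)
Definition gauss_const d (A : 'M[R]_d) : R := Num.sqrt (2 * pi) ^+ d / Num.sqrt (\det A).

Definition form_bounded d (kap B : R) (A : 'M[R]_d) :=
  A^T = A /\ forall v, kap * dotp v v <= qf A v <= B * dotp v v.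

Lemma schur_bounded d kap B (A : 'M[R]_(1 + d)) : 0 < kap -> form_bounded kap B A ->
  kap <= A 0 0 /\ form_bounded kap B (schur A).
Proof.
move=> kap0 [As Ab].
have e1 : dotp (row_mx 1%:M 0 : 'rV[R]_(1 + d)) (row_mx 1%:M 0) = 1.
  by rewrite dotp_row_mx mulr1 /dotp big1 ?addr0// => k _; rewrite mxE mul0r.
have e2 : qf A (row_mx 1%:M 0) = A 0 0.
  rewrite /qf {1}(sym_blockE As) mul_row_block tr_row_mx mul_row_col trmx0 mulmx0.
  rewrite !mul0mx !addr0 tr_scalar_mx !mul_scalar_mx !scale1r !mulmx1.
  by rewrite mxE.
have ka : kap <= A 0 0 by have := Ab (row_mx 1%:M 0); rewrite e1 e2 mulr1 => /andP[].
have a0 : 0 < A 0 0 by exact: lt_le_trans ka.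
split => //; split; first exact: schur_sym.
move=> w; set bw := dotp (ursubmx A) w.
(* For the lower bound the first coordinate is the one that annihilates the square; for the upper
   bound it is 0 and the square is discarded. *)
have /andP[l _] := Ab (row_mx (- (bw / A 0 0))%:M w).
have /andP[_ u] := Ab (row_mx 0%:M w).
move: l u; rewrite !qf_schur ?gt_eqF// !dotp_row_mx -/bw addNr expr0n mulr0 !add0r mulr0.
rewrite add0r => l u; apply/andP; split.
  by apply: le_trans l; rewrite ler_pM2l// lerDr -expr2 sqr_ge0.
by apply: le_trans u; rewrite lerDr mulr_ge0 ?sqr_ge0// ltW.
Qed.

(** Induction on the dimension: the first coordinate is summed out with an error uniform in its
    shift, and the Schur complement keeps the bounds [kap] and [B]. Hence [C] depends on these
    bounds only. Positivity of the determinant comes from the same recursion and is reused later for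
    its own sake. *)
Lemma gauss_lattice_sum d (kap B : R) : 0 < kap -> exists2 C : R, 0 <= C &
  forall A : 'M[R]_d, form_bounded kap B A ->
  [/\ 0 < \det A, gauss_const A <= C &
   forall h, 0 < h <= 1 -> exists2 S : R,
     (\esum_(k in setT) (gauss_term A h k)%:E = S%:E)%E & `|S - gauss_const A| <= C * h].
Proof.
move=> kap0; elim: d => [|d [C C0 IH]].
  exists 1 => // A _; rewrite /gauss_const det_mx00 expr0 sqrtr1 divr1; split => //.
  move=> h /andP[h0 h1]; exists 1; last by rewrite subrr normr0 mul1r ltW.
  have -> : [set: 'rV[int]_0] = [set 0].
    by apply/seteqP; split => // x _ /=; apply/matrixP => i [].
  rewrite esum_set1 ?lee_fin ?gauss_term_ge0 ?ltW//.
  rewrite /gauss_term expr0 mul1r /qf.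
  by rewrite mxE big_ord0 oppr0 mul0r expR0.
pose r0 := Num.sqrt (2 * pi) / Num.sqrt kap.
have r00 : 0 <= r0 by rewrite divr_ge0 ?sqrtr_ge0.
have rr00 : 0 <= r0 * C by rewrite mulr_ge0.
exists (r0 * C + 4 * C + r0 * C).
  by rewrite !addr_ge0// mulr_ge0.
rewrite -[d.+1]/(1 + d)%N => A Ab; have As := Ab.1.
have [ka Sb] := schur_bounded kap0 Ab.
have a0 : 0 < A 0 0 by exact: lt_le_trans ka.
have [det0 JC sumS] := IH _ Sb.
pose r := Num.sqrt (2 * pi) / Num.sqrt (A 0 0).
have r0' : 0 <= r by rewrite divr_ge0 ?sqrtr_ge0.
have rle : r <= r0.
  by rewrite ler_wpM2l ?sqrtr_ge0// lef_pV2 ?posrE ?sqrtr_gt0// ler_wsqrtr.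
have JE : gauss_const A = gauss_const (schur A) * r.
  rewrite /gauss_const det_schur ?gt_eqF//.
  rewrite [Num.sqrt (A 0 0 * _)]sqrtrM ?(ltW a0)// invfM.
  by rewrite [_ ^+ (1 + d)]exprS /r; ring.
have J0 : 0 <= gauss_const (schur A).
  by rewrite divr_ge0 ?exprn_ge0 ?sqrtr_ge0.
split.
- by rewrite det_schur ?gt_eqF// mulr_gt0.
- rewrite JE; have : gauss_const (schur A) * r <= C * r0 by apply: ler_pM.
  lra.
move=> h h01; have /andP[h0 h1] := h01.
have [S ES Sd] := sumS h h01.
have E : \esum_(k in setT) (gauss_term A h k)%:E =
   \esum_(w in setT) ((gauss_term (schur A) h w)%:E * \esum_(t in [set: int])
     (h * expR (- (A 0 0 * (h * t%:~R + h * (dotp (ursubmx A) (toR R w) / A 0 0)) ^+ 2) / 2))%:E)%E.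
  rewrite esum_row_mx; last by move=> x; rewrite lee_fin gauss_term_ge0// ltW.
  apply: eq_esum => w _; rewrite -esumZl ?lee_fin ?gauss_term_ge0 ?ltW//; last first.
    by move=> t; rewrite lee_fin mulr_ge0 ?expR_ge0// ltW.
  by apply: eq_esum => t _; rewrite gauss_term_schur ?gt_eqF.
have t0 w : (0 <= (gauss_term (schur A) h w)%:E)%E.
  by rewrite lee_fin gauss_term_ge0// ltW.
have S0 : 0 <= S by rewrite -lee_fin -ES esum_ge0.
have up : (\esum_(k in setT) (gauss_term A h k)%:E <= (S * (r + 2 * h))%:E)%E.
  rewrite E EFinM -ES -esumZr//; last by rewrite lee_fin addr_ge0// mulr_ge0// ltW.
  apply: le_esum => w _; apply: lee_wpmul2l => //.
  by have /andP[_] := gauss_int_sum_var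
    (h * (dotp (ursubmx A) (toR R w) / A 0 0)) a0 h0.
have lo : ((S * (r - 2 * h))%:E <= \esum_(k in setT) (gauss_term A h k)%:E)%E.
  have [rh|rh] := leP 0 (r - 2 * h); last first.
    apply: (@le_trans _ _ 0%E); first by rewrite lee_fin mulr_ge0_le0// ltW.
    by apply: esum_ge0 => k _; rewrite lee_fin gauss_term_ge0// ltW.
  rewrite E EFinM -ES -esumZr//.
  apply: le_esum => w _; apply: lee_wpmul2l => //.
  by have /andP[] := gauss_int_sum_var
    (h * (dotp (ursubmx A) (toR R w) / A 0 0)) a0 h0.
have fin : \esum_(k in setT) (gauss_term A h k)%:E \is a fin_num.
  rewrite ge0_fin_numE; first by apply: le_lt_trans up _; exact: ltry.
  by apply: esum_ge0 => k _; rewrite lee_fin gauss_term_ge0// ltW.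
exists (fine (\esum_(k in setT) (gauss_term A h k)%:E)); first by rewrite fineK.
move: up lo; rewrite -(fineK fin) !lee_fin; set V := fine _ => up lo.
rewrite JE; move: Sd; rewrite !ler_norml => /andP[Sl Su].
have Sle : S <= 2 * C.
  have : C * h <= C by rewrite ler_piMr. by lra.
have S2 : S * (2 * h) <= 4 * C * h.
  have : S * h <= 2 * C * h by rewrite ler_pM2r. by lra.
have Sr1 : (S - gauss_const (schur A)) * r <= C * h * r0.
  apply: (@le_trans _ _ (C * h * r)); first by rewrite ler_wpM2r.
  by rewrite ler_wpM2l// mulr_ge0// ltW.
have Sr2 : - (C * h * r0) <= (S - gauss_const (schur A)) * r.
  apply: (@le_trans _ _ (- (C * h * r))).
    by rewrite lerN2 ler_wpM2l// mulr_ge0// ltW.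
  by rewrite -mulNr ler_wpM2r.
have hC : 0 <= r0 * C * h by rewrite mulr_ge0// ltW.
by rewrite /=; apply/andP; split; lra.
Qed.

End GaussLattice.

(** * Fourier analysis on the integer lattice *)

Section ComplexModulus.
Variable R : realType.
Local Open Scope complex_scope.
Implicit Types (z w : R[i]) (t : R).

Definition cabs z : R := Re `|z|.

Lemma cabsE z : (cabs z)%:C = `|z|.
Proof. by rewrite /cabs normc_def. Qed.

Lemma cabs_ge0 z : 0 <= cabs z.
Proof. by rewrite /cabs normc_def /= sqrtr_ge0. Qed.

Lemma cabsM z w : cabs (z * w) = cabs z * cabs w.
Proof. by apply: (fmorph_inj (real_complex R)); rewrite rmorphM /= !cabsE normrM. Qed.

Lemma cabsX z n : cabs (z ^+ n) = cabs z ^+ n.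
Proof. by apply: (fmorph_inj (real_complex R)); rewrite rmorphXn /= !cabsE normrX. Qed.

Lemma cabsD z w : cabs (z + w) <= cabs z + cabs w.
Proof. by rewrite -lecR rmorphD /= !cabsE ler_normD. Qed.

Lemma cabsN z : cabs (- z) = cabs z.
Proof. by rewrite /cabs normrN. Qed.

Lemma cabsB z w : cabs (z - w) = cabs (w - z).
Proof. by rewrite -cabsN opprB. Qed.

Lemma cabs_real t : cabs t%:C = `|t|.
Proof. by rewrite /cabs normc_def /= expr0n addr0 sqrtr_sqr. Qed.

Lemma cabs0 : cabs 0 = 0.
Proof. by rewrite (_ : 0 = 0%:C)// cabs_real normr0. Qed.

Lemma cabs1 : cabs 1 = 1.
Proof. by rewrite (_ : 1 = 1%:C)// cabs_real normr1. Qed.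

Lemma cabs_sum (I : Type) (r : seq I) (P : pred I) (F : I -> R[i]) :
  cabs (\sum_(i <- r | P i) F i) <= \sum_(i <- r | P i) cabs (F i).
Proof.
elim/big_rec2: _ => [|i y1 y2 _ h]; first by rewrite cabs0.
by apply: (le_trans (cabsD _ _)); rewrite lerD2l.
Qed.

Lemma cabs_Re z : `|Re z| <= cabs z.
Proof. by rewrite -lecR cabsE normc_ge_Re. Qed.

Lemma cabs_le_ReIm z : cabs z <= `|Re z| + `|Im z|.
Proof.
rewrite {1}(complexE z); apply: (le_trans (cabsD _ _)).
by rewrite cabsM !cabs_real /cabs normc_def /= expr0n add0r expr1n sqrtr1 mul1r.
Qed.

Lemma cabs_sqr z : cabs z ^+ 2 = Re z ^+ 2 + Im z ^+ 2.
Proof. by rewrite /cabs normc_def /= sqr_sqrtr// addr_ge0 ?sqr_ge0. Qed.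

Definition cis t : R[i] := cos t +i* sin t.

Lemma cisD t u : cis (t + u) = cis t * cis u.
Proof. by rewrite /cis cosD sinD [X in _ +i* X]addrC. Qed.

Lemma cis0 : cis 0 = 1.
Proof. by rewrite /cis cos0 sin0. Qed.

Lemma cis_sum (I : Type) (r : seq I) (P : pred I) (F : I -> R) :
  cis (\sum_(i <- r | P i) F i) = \prod_(i <- r | P i) cis (F i).
Proof. by elim/big_rec2: _ => [|i y1 y2 _ <-]; rewrite ?cis0// cisD. Qed.

Lemma cisMn t n : cis (t *+ n) = cis t ^+ n.
Proof.
by elim: n => [|n IH]; rewrite ?mulr0n ?cis0// mulrS cisD IH exprS.
Qed.

Lemma cabs_cis t : cabs (cis t) = 1.
Proof. by rewrite /cabs normc_def /= cos2Dsin2 sqrtr1. Qed.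

Lemma cis_sub1 t : cabs (cis t - 1) <= 2 * `|t|.
Proof.
apply: (le_trans (cabs_le_ReIm _)); rewrite /cis /= subr0.
have h1 := norm_sin_le t.
have : `|cos t - 1| <= `|t|; last lra.
rewrite distrC ger0_norm ?one_sub_cos_ge0// one_sub_cos.
have s1 : `|sin (t / 2)| <= `|t| / 2.
  by apply: (le_trans (norm_sin_le _)); rewrite normrM [`|2^-1|]ger0_norm.
have s2 : `|sin (t / 2)| <= 1 by rewrite ler_norml sin_geN1 sin_le1.
rewrite -[sin _ ^+ 2]real_normK ?num_real//.
have := normr_ge0 (sin (t / 2)); nra.
Qed.

Lemma cabs_exprB z w (n : nat) (m : R) : cabs z <= m -> cabs w <= m ->
  cabs (z ^+ n - w ^+ n) <= n%:R * m ^+ n.-1 * cabs (z - w).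
Proof.
move=> zm wm; rewrite subrXX cabsM mulrC ler_wpM2r ?cabs_ge0//.
apply: (le_trans (cabs_sum _ _ _)).
rewrite -[n in n%:R]card_ord -sum1_card natr_sum mulr_suml; apply: ler_sum => i _.
rewrite mul1r cabsM !cabsX.
have -> : n.-1 = (n.-1 - i + i)%N by rewrite subnK// -ltnS (ltn_predK (ltn_ord i)).
rewrite exprD; apply: ler_pM; rewrite ?exprn_ge0 ?cabs_ge0//;
  rewrite ?lerXn2r ?nnegrE ?cabs_ge0 ?(le_trans (cabs_ge0 z))//.
by rewrite subnK// ?lerXn2r ?nnegrE ?cabs_ge0 ?(le_trans (cabs_ge0 z))//
   -ltnS (ltn_predK (ltn_ord i)).
Qed.

End ComplexModulus.

(** * Fourier transform on the lattice and inversion on finite grids *)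

Section Fourier.
Variables (R : realType) (d : nat).
Local Open Scope complex_scope.
Local Notation X := 'rV[int]_d.
Implicit Types (F h : X -> R) (th : 'rV[R]_d) (x y : X).

Local Notation ang th x := (dotp th (toR R x)).

Lemma dotpDr (u v w : 'rV[R]_d) : dotp u (v + w) = dotp u v + dotp u w.
Proof. by rewrite /dotp -big_split; apply: eq_bigr => k _; rewrite mxE mulrDr. Qed.

Lemma dotpNr (u v : 'rV[R]_d) : dotp u (- v) = - dotp u v.
Proof. by rewrite /dotp -sumrN; apply: eq_bigr => k _; rewrite mxE mulrN. Qed.

Lemma dotpZr c (u v : 'rV[R]_d) : dotp u (c *: v) = c * dotp u v.
Proof. by rewrite /dotp mulr_sumr; apply: eq_bigr => k _; rewrite mxE mulrCA. Qed.

Lemma dotpDl (u v w : 'rV[R]_d) : dotp (u + v) w = dotp u w + dotp v w.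
Proof. by rewrite dotpC dotpDr !(dotpC w). Qed.

Lemma dotpNl (u v : 'rV[R]_d) : dotp (- u) v = - dotp u v.
Proof. by rewrite dotpC dotpNr dotpC. Qed.

Lemma dotpZl c (u v : 'rV[R]_d) : dotp (c *: u) v = c * dotp u v.
Proof. by rewrite dotpC dotpZr dotpC. Qed.

Lemma dotp0r (u : 'rV[R]_d) : dotp u 0 = 0.
Proof. by rewrite /dotp big1// => k _; rewrite mxE mulr0. Qed.

Lemma toRD x y : toR R (x + y) = toR R x + toR R y.
Proof. by apply/rowP => k; rewrite !mxE intrD. Qed.

Lemma toRN x : toR R (- x) = - toR R x.
Proof. by apply/rowP => k; rewrite !mxE mulrNz. Qed.

Lemma toR0 : toR R (0 : X) = 0.
Proof. by apply/rowP => k; rewrite !mxE. Qed.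

Definition ft F th : R[i] :=
  sumR (fun x => F x * cos (ang th x)) +i* sumR (fun x => F x * sin (ang th x)).

Lemma norm_cos_le1 (t : R) : `|cos t| <= 1.
Proof. by rewrite ler_norml cos_geN1 cos_le1. Qed.

Lemma norm_sin_le1 (t : R) : `|sin t| <= 1.
Proof. by rewrite ler_norml sin_geN1 sin_le1. Qed.

Lemma summ_cos F th : summ F -> summ (fun x => F x * cos (ang th x)).
Proof. by move=> sF; apply: summ_mulb => // x; exact: norm_cos_le1. Qed.

Lemma summ_sin F th : summ F -> summ (fun x => F x * sin (ang th x)).
Proof. by move=> sF; apply: summ_mulb => // x; exact: norm_sin_le1. Qed.

Lemma ft_rconv F h th : (forall x, 0 <= F x) -> (forall x, 0 <= h x) ->
  summ F -> summ h -> ft (rconv F h) th = ft F th * ft h th.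
Proof.
move=> F0 h0 sF sh.
have sFc := summ_cos th sF; have sFs := summ_sin th sF.
have shc := summ_cos th sh; have shs := summ_sin th sh.
rewrite /ft.
rewrite (@rconv_fubini R X F h F0 h0 sF sh (fun x => cos (ang th x)) 1); last first.
  by move=> x; exact: norm_cos_le1.
rewrite (@rconv_fubini R X F h F0 h0 sF sh (fun x => sin (ang th x)) 1); last first.
  by move=> x; exact: norm_sin_le1.
set c := sumR (fun x => h x * cos _); set s := sumR (fun x => h x * sin _).
have ec y : sumR (fun z => h z * cos (ang th (y + z))) =
    c * cos (ang th y) - s * sin (ang th y).
  rewrite mulrC [s * _]mulrC -!sumRZ -sumRB; [|exact: summZ..].
  by apply: eq_sumR => z; rewrite toRD dotpDr cosD; ring.
have es y : sumR (fun z => h z * sin (ang th (y + z))) =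
    c * sin (ang th y) + s * cos (ang th y).
  rewrite mulrC [s * _]mulrC -!sumRZ -sumRD; [|exact: summZ..].
  by apply: eq_sumR => z; rewrite toRD dotpDr sinD; ring.
rewrite (eq_sumR (f := fun y => F y * sumR (fun z => h z * cos (ang th (y + z))))
  (g := fun y => c * (F y * cos (ang th y)) - s * (F y * sin (ang th y)))).
  rewrite (eq_sumR (f := fun y => F y * sumR (fun z => h z * sin (ang th (y + z))))
    (g := fun y => c * (F y * sin (ang th y)) + s * (F y * cos (ang th y)))).
    rewrite sumRB; [|exact: summZ..].
    rewrite sumRD; [|exact: summZ..].
    by rewrite !sumRZ; apply/eqP; rewrite eq_complex /=; apply/andP; split;
      apply/eqP; ring.
  by move=> y; rewrite es; ring.
by move=> y; rewrite ec; ring.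
Qed.

Lemma ft_bigsum (I : Type) (r : seq I) (P : pred I) (c : I -> R) (F : I -> X -> R) th :
  (forall i, P i -> summ (F i)) ->
  ft (fun x => \sum_(i <- r | P i) c i * F i x) th =
  \sum_(i <- r | P i) (c i)%:C * ft (F i) th.
Proof.
move=> sF.
have ReS : Re (\sum_(i <- r | P i) (c i)%:C * ft (F i) th) =
    \sum_(i <- r | P i) c i * sumR (fun x => F i x * cos (ang th x)).
  elim/big_rec2: _ => //= i y1 y2 _ <-.
  by case: y2 => a b /=; rewrite mul0r subr0.
have ImS : Im (\sum_(i <- r | P i) (c i)%:C * ft (F i) th) =
    \sum_(i <- r | P i) c i * sumR (fun x => F i x * sin (ang th x)).
  elim/big_rec2: _ => //= i y1 y2 _ <-.
  by case: y2 => a b /=; rewrite mul0r addr0.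
rewrite /ft.
have -> : sumR (fun x => (\sum_(i <- r | P i) c i * F i x) * cos (ang th x)) =
    \sum_(i <- r | P i) c i * sumR (fun x => F i x * cos (ang th x)).
  rewrite (eq_sumR (g := fun x => \sum_(i <- r | P i) c i * (F i x * cos (ang th x)))).
    by rewrite sumR_big => [|i Pi]; [apply: eq_bigr => i _; rewrite sumRZ
      |apply/summZ/summ_cos/sF].
  by move=> x; rewrite mulr_suml; apply: eq_bigr => i _; rewrite mulrA.
have -> : sumR (fun x => (\sum_(i <- r | P i) c i * F i x) * sin (ang th x)) =
    \sum_(i <- r | P i) c i * sumR (fun x => F i x * sin (ang th x)).
  rewrite (eq_sumR (g := fun x => \sum_(i <- r | P i) c i * (F i x * sin (ang th x)))).
    by rewrite sumR_big => [|i Pi]; [apply: eq_bigr => i _; rewrite sumRZ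
      |apply/summZ/summ_sin/sF].
  by move=> x; rewrite mulr_suml; apply: eq_bigr => i _; rewrite mulrA.
by rewrite -ReS -ImS; case: (\sum_(i <- r | P i) _).
Qed.

Lemma cabs_ft F th : (forall x, 0 <= F x) -> summ F -> cabs (ft F th) <= 2 * sumR F.
Proof.
move=> F0 sF; apply: (le_trans (cabs_le_ReIm _)); rewrite /ft /=.
have : `|sumR (fun x => F x * cos (ang th x))| <= sumR F.
  by apply: ler_sumR_bound => // x; rewrite normrM ger0_norm// ler_piMr// norm_cos_le1.
have : `|sumR (fun x => F x * sin (ang th x))| <= sumR F.
  by apply: ler_sumR_bound => // x; rewrite normrM ger0_norm// ler_piMr// norm_sin_le1.
lra.
Qed.

(** Each coordinate runs over [-n .. n - 1]; scaled by [pi / n] these points sample the box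
    [[-pi, pi]^d]. Finite trigonometric sums replace the integral over the torus. *)
Definition gridz n (k : {ffun 'I_d -> 'I_(n.*2)}) : X := \row_j ((k j)%:Z - n%:Z).

Definition grid n k : 'rV[R]_d := (pi / n%:R) *: toR R (@gridz n k).

Lemma grid_box n (k : {ffun 'I_d -> 'I_(n.*2)}) j : `|grid k 0 j| <= pi.
Proof.
have n0 : (0 < n)%N by rewrite -double_gt0; exact: leq_ltn_trans (ltn_ord (k j)).
have np : 0 < n%:R :> R by rewrite ltr0n.
rewrite /grid !mxE normrM ger0_norm ?divr_ge0 ?pi_ge0//.
rewrite -[leRHS]mulr1 -mulrA ler_pM2l ?pi_gt0// ler_pdivrMl// mulr1.
rewrite intrB -!pmulrn ler_norml.
have : ((k j)%:R <= (n.*2)%:R :> R) by rewrite ler_nat ltnW.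
have : (0 <= (k j)%:R :> R) by [].
by have -> : (n.*2)%:R = n%:R + n%:R :> R; [rewrite -natrD addnn | lra].
Qed.

(** A normalized sum of characters of the group of residues modulo [2 n]: it is 1 when [2 n] divides
    every coordinate of [y], and 0 otherwise. *)
Definition dker n (y : X) : R :=
  (\sum_(k : {ffun 'I_d -> 'I_(n.*2)}) cos (ang (grid k) y)) / (n.*2)%:R ^+ d.

Lemma cis_geom n (a : int) : (0 < n)%N ->
  \sum_(k < n.*2) cis (pi / n%:R * (k%:Z - n%:Z)%:~R * a%:~R : R) =
  if cis (pi / n%:R * a%:~R : R) == 1 then (n.*2)%:R else 0.
Proof.
move=> n0; set s := \sum_(_ < _) _; have np : 0 < n%:R :> R by rewrite ltr0n.
pose z := cis (pi / n%:R * a%:~R : R).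
have zn : z ^+ n = cis (pi * a%:~R).
  by rewrite /z -cisMn; congr cis; rewrite -mulr_natr; field; rewrite gt_eqF.
have z2n : z ^+ n.*2 = 1.
  rewrite -addnn exprD zn -cisD.
  have -> : pi * a%:~R + pi * a%:~R = pi *+ 2 *~ a :> R by rewrite -mulrzr; lra.
  case: a {s z zn} => m.
    by rewrite -pmulrn cisMn /cis cos2pi sin2pi expr1n.
  rewrite NegzE mulrNz -pmulrn /cis cosN sinN.
  have := cisMn (pi *+ 2 : R) m.+1; rewrite /cis cos2pi sin2pi.
  by rewrite (_ : 1 +i* 0 = 1)// expr1n => -[-> ->]; rewrite oppr0.
have sE : s = cis (- (pi * a%:~R)) * \sum_(k < n.*2) z ^+ k.
  rewrite mulr_sumr; apply: eq_bigr => k _; rewrite /z -cisMn -cisD; congr cis.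
  by rewrite intrB -!pmulrn -mulr_natr; field; rewrite gt_eqF.
have [z1|z1] := eqVneq z 1.
  rewrite sE z1.
  have -> : cis (- (pi * a%:~R)) = 1 :> R[i].
    have : cis (- (pi * a%:~R)) * z ^+ n = 1 by rewrite zn -cisD addNr cis0.
    by rewrite z1 expr1n mulr1.
  rewrite mul1r; under eq_bigr do rewrite expr1n.
  by rewrite sumr_const card_ord.
rewrite sE.
have : (z - 1) * \sum_(k < n.*2) z ^+ k = 0 by rewrite -subrX1 z2n subrr.
by move/eqP; rewrite mulf_eq0 subr_eq0 (negPf z1) /= => /eqP ->; rewrite mulr0.
Qed.

Lemma cis_neq1 (t : R) : 0 < `|t| -> `|t| < 2 * pi -> cis t != 1.
Proof.
move=> t0 tpi; apply/eqP => -[c1 _].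
have : 1 - cos `|t| = 0.
  by case: (leP 0 t) => h; rewrite ?(ger0_norm h) ?(ltr0_norm h) ?cosN c1 subrr.
rewrite one_sub_cos => /eqP; rewrite mulf_eq0 pnatr_eq0 /= sqrf_eq0 => /eqP s0.
have := @sin_gt0_pi R (`|t| / 2); rewrite s0 ltxx => h.
by have : false by apply: h; apply/andP; split; lra.
Qed.

Lemma dker_prod n y : (0 < n)%N -> dker n y =
  Re (\prod_(j < d) \sum_(k < n.*2) cis (pi / n%:R * (k%:Z - n%:Z)%:~R * (y 0 j)%:~R : R))
   / (n.*2)%:R ^+ d.
Proof.
move=> n0; rewrite /dker; congr (_ / _).
rewrite bigA_distr_bigA /=.
have ReS (I : finType) (G : I -> R[i]) : Re (\sum_i G i) = \sum_i Re (G i).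
  by elim/big_rec2: _ => //= i y1 y2 _ <-; case: (G i); case: y2.
rewrite ReS; apply: eq_bigr => k _; rewrite -cis_sum /cis /=; congr cos.
by rewrite /dotp; apply: eq_bigr => j _; rewrite !mxE.
Qed.

Lemma dker01 n y : (0 < n)%N -> dker n y = 0 \/ dker n y = 1.
Proof.
move=> n0; rewrite dker_prod//.
have N0 : (n.*2)%:R ^+ d != 0 :> R by rewrite expf_neq0// pnatr_eq0 double_eq0 -lt0n.
have [all1|] := boolP [forall j : 'I_d, cis (pi / n%:R * (y 0 j)%:~R : R) == 1].
  right; rewrite (eq_bigr (fun=> (n.*2)%:R)); last first.
    by move=> j _; rewrite cis_geom// (forallP all1 j).
  rewrite prodr_const card_ord.
  have -> : (n.*2)%:R ^+ d = ((n.*2)%:R ^+ d)%:C :> R[i] by rewrite rmorphXn rmorph_nat.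
  by rewrite /= divff.
rewrite negb_forall => /existsP[j yj]; left.
rewrite (bigD1 j)//= cis_geom// (negPf yj) mul0r /=.
by rewrite mul0r.
Qed.

Lemma dker_0 n : (0 < n)%N -> dker n 0 = 1.
Proof.
move=> n0; rewrite /dker (eq_bigr (fun=> 1)); last first.
  by move=> k _; rewrite toR0 dotp0r cos0.
rewrite sumr_const card_ffun !card_ord natrX divff//.
by rewrite expf_neq0// pnatr_eq0 double_eq0 -lt0n.
Qed.

Lemma dker_eq0 n y : (0 < n)%N -> y != 0 -> (forall j, `|y 0 j| < (n.*2)%:Z) ->
  dker n y = 0.
Proof.
move=> n0 yn0 yn; rewrite dker_prod//.
have np : 0 < n%:R :> R by rewrite ltr0n.
have /rV0Pn[j yj] := yn0.
rewrite (bigD1 j)//= cis_geom// ifN; first by rewrite mul0r /= mul0r.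
have E : `|pi / n%:R * (y 0 j)%:~R| = pi / n%:R * `|y 0 j|%:~R :> R.
  by rewrite normrM ger0_norm ?divr_ge0 ?pi_ge0// intr_norm.
have pn : 0 < pi / n%:R :> R by rewrite divr_gt0 ?pi_gt0.
apply: cis_neq1; rewrite E.
  by rewrite mulr_gt0// ltr0z normr_gt0.
apply: (@lt_le_trans _ _ (pi / n%:R * (n.*2)%:R)).
  by rewrite ltr_pM2l// -[(n.*2)%:R]/((n.*2)%:Z%:~R) ltr_int.
rewrite -addnn natrD le_eqVlt; apply/orP; left; apply/eqP.
by field; rewrite gt_eqF.
Qed.

(** Discrete inversion of [ft F]. It yields the sum of [F] over [x] plus all multiples of [2 n], so
    for nonnegative [F] it dominates [F x], and it tends to [F x] as the period grows. *)
Definition dft n F x : R := (\sum_(k : {ffun 'I_d -> 'I_(n.*2)})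
  Re (ft F (grid k) * cis (- ang (grid k) x))) / (n.*2)%:R ^+ d.

Lemma dft_dker n F x : summ F -> dft n F x = sumR (fun y => F y * dker n (y - x)).
Proof.
move=> sF; rewrite /dft.
rewrite (eq_sumR (g := fun y => ((n.*2)%:R ^+ d)^-1 *
   \sum_(k : {ffun 'I_d -> 'I_(n.*2)}) F y * cos (ang (grid k) (y - x)))); last first.
  by move=> y; rewrite /dker -mulr_sumr; ring.
rewrite sumRZ mulrC; congr (_ * _); rewrite sumR_big; last first.
  by move=> k _; apply: summ_mulb => // y; exact: norm_cos_le1.
apply: eq_bigr => k _; rewrite /ft /cis /= cosN sinN mulrN opprK.
rewrite mulrC [X in _ + X]mulrC -!sumRZ -sumRD; [|exact/summZ/summ_cos|exact/summZ/summ_sin].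
by apply: eq_sumR => y; rewrite toRD toRN dotpDr dotpNr cosB; ring.
Qed.

Lemma summ_tail_eps F (x : X) (eps : R) : (forall y, 0 <= F y) -> summ F -> 0 < eps ->
  exists n0 : nat, forall n, (n0 <= n)%N ->
   sumR (fun y => F y * (~~ [forall j, `|(y - x) 0 j| < (n.*2)%:Z])%:R) <= eps.
Proof.
move=> F0 sF e0.
have E := ge0_sumRE F0 sF.
have : ((sumR F - eps)%:E < \esum_(y in setT) (F y)%:E)%E.
  by rewrite -E lte_fin ltrBlDr ltrDl.
move=> /ereal_sup_gt[_ [A [finA _] <-]] /ltW lA.
pose s : seq X := finmap.enum_fset (fset_set A).
(* A crude common bound: the total of all coordinates, seen from [x], of the finite set [A] that
   carries [F] up to [eps]. *)
pose n0 := (\sum_(y <- s) \sum_(j < d) absz ((y - x)%R 0%R j))%N.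
exists n0.+1 => n nn.
pose b (y : X) : R := (~~ [forall j, `|(y - x) 0 j| < (n.*2)%:Z])%:R.
have sb : summ (fun y => F y * b y).
  by apply: (summ_mulb (B := 1)) => // y; rewrite /b; case: (~~ _); rewrite ?normr1 ?normr0.
have sb' : summ (fun y => F y * (1 - b y)).
  apply: (summ_mulb (B := 1)) => // y; rewrite /b; case: (~~ _);
  by rewrite ?subrr ?subr0 ?normr1 ?normr0.
have split : sumR F = sumR (fun y => F y * b y) + sumR (fun y => F y * (1 - b y)).
  by rewrite -sumRD//; apply: eq_sumR => y; ring.
suff : sumR F - eps <= sumR (fun y => F y * (1 - b y)) by rewrite split; lra.
rewrite -lee_fin ge0_sumRE//; last first.
  by move=> y; rewrite mulr_ge0// /b; case: (~~ _); rewrite ?subrr ?subr0.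
apply: (le_trans lA).
apply: (@le_trans _ _ (\sum_(y \in A) (F y * (1 - b y))%:E)%E); last first.
  by apply: esum_ge; exists A.
apply: lee_fsum => // y Ay; rewrite lee_fin.
have -> : b y = 0; last by rewrite subr0 mulr1.
rewrite /b (_ : [forall j, _] = true)//; apply/forallP => j.
rewrite -abszE ltz_nat; apply: (@leq_ltn_trans n0); last first.
  by apply: leq_trans nn _; rewrite -addnn leq_addr.
have e : (y \in s) = (y \in A) := in_fset_set finA y.
have ys : y \in s by rewrite e inE.
rewrite /n0 (big_rem y)//= (bigD1 j)//= -addnA leq_addr//.
Qed.

Lemma dft_ge n F x : (0 < n)%N -> (forall y, 0 <= F y) -> summ F -> F x <= dft n F x.
Proof.
move=> n0 F0 sF; rewrite dft_dker//.
have k01 y : 0 <= dker n y <= 1.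
  by have [->|->] := dker01 y n0; rewrite ?lexx ?ler01.
have := @sumR_term_le R _ (fun y => F y * dker n (y - x)) x.
rewrite subrr dker_0// mulr1; apply.
  by move=> y; rewrite mulr_ge0//; have /andP[] := k01 (y - x).
apply: (summ_mulb (B := 1)) => // y.
by have /andP[h1 h2] := k01 (y - x); rewrite ger0_norm.
Qed.

Lemma dft_cvg F x (eps : R) : (forall y, 0 <= F y) -> summ F -> 0 < eps ->
  exists n0 : nat, forall n, (n0 <= n)%N -> (0 < n)%N -> `|F x - dft n F x| <= eps.
Proof.
move=> F0 sF e0; have [n0 h] := summ_tail_eps x F0 sF e0.
exists n0 => n nn np; have l := dft_ge x np F0 sF.
rewrite distrC ger0_norm ?subr_ge0// lerBlDl.
apply: le_trans (lerD (lexx _) (h n nn)).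
rewrite dft_dker//.
pose b (y : X) : R := (~~ [forall j, `|(y - x) 0 j| < (n.*2)%:Z])%:R.
rewrite -[X in _ <= _ + X]/(sumR (fun y => F y * b y)).
pose dx (y : X) : R := (y == x)%:R * F x.
have edx : \esum_(y in setT) (dx y)%:E = (F x)%:E.
  rewrite (esumID [set x])//=; last by move=> y _; rewrite lee_fin mulr_ge0.
  rewrite !setTI esum_set1 ?lee_fin ?mulr_ge0// /dx eqxx mul1r.
  rewrite esum1 ?adde0// => y /= /eqP/negPf ->; by rewrite mul0r.
have dx0 y : 0 <= dx y by rewrite mulr_ge0.
have sdx : summ dx by rewrite summ_esum// edx ltry.
have <- : sumR dx = F x by rewrite ge0_sumR// edx.
have sb : summ (fun y => F y * b y).
  by apply: (summ_mulb (B := 1)) => // y; rewrite /b; case: (~~ _); rewrite ?normr1 ?normr0.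
rewrite -sumRD//; apply: le_sumR.
- apply: (summ_mulb (B := 1)) => // y.
  by have [->|->] := dker01 (y - x) np; rewrite ?normr1 ?normr0.
- exact: summD.
move=> y; rewrite /dx /b; have [->|yx] := eqVneq y x.
  by rewrite subrr dker_0// mul1r mulr1 lerDl mulr_ge0.
rewrite mul0r add0r ler_wpM2l//.
have [all|] := boolP [forall j, `|(y - x) 0 j| < (n.*2)%:Z] => /=.
  by rewrite dker_eq0 ?subr_eq0// => j; exact: (forallP all j).
by have [->|->] := dker01 (y - x) np; rewrite ?lexx ?ler01.
Qed.

End Fourier.

(** * Local upper bounds and local limits from estimates of the transform *)

Section LocalLimit.
Variables (R : realType) (d : nat).
Local Open Scope complex_scope.
Local Notation X := 'rV[int]_d.
Local Notation ang th x := (dotp th (toR R x)).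

Lemma esum_point (T : choiceType) (f : T -> \bar R) y :
  (forall x, x != y -> f x = 0%E) -> (0 <= f y)%E -> \esum_(x in setT) f x = f y.
Proof.
move=> fz f0; rewrite (esumID [set y])/=.
  rewrite !setTI esum_set1// esum1 ?adde0// => x /= /eqP; exact: fz.
by move=> x _; have [->//|/fz ->] := eqVneq x y.
Qed.

Lemma esum_finType (T : finType) (f : T -> \bar R) : (forall x, (0 <= f x)%E) ->
  \esum_(x in setT) f x = (\sum_x f x)%E.
Proof.
move=> f0.
have -> : \esum_(x in setT) f x =
    \esum_(x in [set: T]) (\sum_y (if x == y then f y else 0))%E.
  apply: eq_esum => x _; rewrite -big_mkcond (eq_bigl (pred1 x)) ?big_pred1_eq//.
rewrite esum_sum; last by move=> x y _ _; case: ifP.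
apply: eq_bigr => y _; rewrite (@esum_point _ _ y) ?eqxx// => x /negPf ->//.
Qed.

Lemma gridz_inj n : injective (@gridz d n).
Proof.
move=> k1 k2 /rowP e; apply/ffunP => j; apply/val_inj.
by have := e j; rewrite !mxE => /addIr [].
Qed.

Lemma qf_scalar (c : R) (v : 'rV[R]_d) : qf c%:M v = c * dotp v v.
Proof. by rewrite /qf mul_mx_scalar -scalemxAl mxE dotpE. Qed.

Lemma form_bounded_scalar (c : R) : form_bounded c c (c%:M : 'M[R]_d).
Proof. by split; [rewrite tr_scalar_mx | move=> v; rewrite qf_scalar lexx]. Qed.

Lemma qf_grid n (Q : 'M[R]_d) (k : {ffun 'I_d -> 'I_(n.*2)}) :
  qf Q (grid R k) = (pi / n%:R) ^+ 2 * qf Q (toR R (gridz k)).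
Proof. by rewrite /grid qfZ. Qed.

Lemma esum_gridE n (G : X -> R) : (forall x, 0 <= G x) ->
  (\esum_(x in setT) (G x)%:E =
   (\sum_(k : {ffun 'I_d -> 'I_(n.*2)}) G (gridz k))%:E +
   \esum_(x in ~` range (@gridz d n)) (G x)%:E)%E.
Proof.
move=> G0; rewrite (esumID (range (@gridz d n))) ?setTI; last first.
  by move=> *; rewrite lee_fin.
congr (_ + _)%E; rewrite -sumEFin -esum_finType; last by move=> *; rewrite lee_fin.
by rewrite esum_image// => k1 k2 _ _; exact: gridz_inj.
Qed.

Lemma gauss_term_grid n (Q : 'M[R]_d) (K : R) (k : {ffun 'I_d -> 'I_(n.*2)}) :
  0 <= K ->
  gauss_term Q (pi / n%:R * Num.sqrt K) (gridz k) =
  (pi / n%:R * Num.sqrt K) ^+ d * expR (- (K * qf Q (grid R k)) / 2).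
Proof.
move=> K0; rewrite /gauss_term; congr (_ * expR _).
by rewrite qfZ qf_grid exprMn sqr_sqrtr//; ring.
Qed.

Lemma grid_gauss_le : exists2 C : R, 0 <= C & forall (q : R) n, 0 < q -> (0 < n)%N ->
  pi / n%:R * Num.sqrt q <= 1 ->
  (\sum_(k : {ffun 'I_d -> 'I_(n.*2)}) expR (- (q * dotp (grid R k) (grid R k))))
    / (n.*2)%:R ^+ d <= C / Num.sqrt q ^+ d.
Proof.
(* With the form twice the identity, the exponent [- qf / 2] is minus the squared norm. *)
have [C C0 HC] := @gauss_lattice_sum R d 2 2 (ltr0n _ 2).
have [_ JC HS] := HC _ (form_bounded_scalar 2).
exists (C + C) => [|q n q0 n0 h1]; first by rewrite addr_ge0.
have np : 0 < n%:R :> R by rewrite ltr0n.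
have sq : 0 < Num.sqrt q by rewrite sqrtr_gt0.
set h := pi / n%:R * Num.sqrt q in h1 *.
have h0 : 0 < h by rewrite mulr_gt0// divr_gt0 ?pi_gt0.
have h01 : 0 < h <= 1 by rewrite h0.
have [S ES Sd] := HS h h01.
have SC : S <= C + C.
  move: Sd; rewrite ler_norml => /andP[_]; have : C * h <= C by rewrite ler_piMr.
  lra.
have t0 (x : X) : 0 <= gauss_term (2%:M : 'M[R]_d) h x by rewrite gauss_term_ge0// ltW.
have : \sum_(k : {ffun 'I_d -> 'I_(n.*2)}) gauss_term (2%:M : 'M[R]_d) h (gridz k) <= S.
  rewrite -lee_fin -ES (esum_gridE n)// leeDl// esum_ge0// => x _.
  by rewrite lee_fin.
under eq_bigr do rewrite gauss_term_grid ?(ltW q0)// qf_scalar -/h.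
rewrite -mulr_sumr => hS.
rewrite ler_pdivrMr ?exprn_gt0 ?ltr0n ?double_gt0//.
have e : C + C <= (C + C) / Num.sqrt q ^+ d * (n.*2)%:R ^+ d * h ^+ d.
  rewrite -!mulrA -exprVn -!exprMn.
  rewrite ler_peMr ?addr_ge0// exprn_ege1//.
  have -> : (Num.sqrt q)^-1 * ((n.*2)%:R * h) = 2 * pi.
    rewrite /h -addnn natrD; field.
    by rewrite !gt_eqF.
  by have := @pi_ge2 R; lra.
have := le_trans (le_trans hS SC) e.
rewrite mulrC ler_pM2r ?exprn_gt0//.
by apply: le_trans; apply: ler_sum => k _; rewrite ler_expR; lra.
Qed.

Definition in_box (th : 'rV[R]_d) := forall j, `|th 0 j| <= pi.

Lemma grid_in_box n (k : {ffun 'I_d -> 'I_(n.*2)}) : in_box (grid R k).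
Proof. by move=> j; exact: grid_box. Qed.

Lemma mesh_small (q eps : R) : 0 < eps -> exists2 n0 : nat, (0 < n0)%N &
  forall n, (n0 <= n)%N -> pi / n%:R * Num.sqrt q <= eps.
Proof.
move=> e0; pose n0 := (Num.truncn (pi * Num.sqrt q / eps)).+1.
exists n0 => // n nn.
have np : 0 < n%:R :> R by rewrite ltr0n (leq_trans _ nn).
rewrite mulrAC ler_pdivrMr// [leRHS]mulrC -ler_pdivrMr//.
apply: (@le_trans _ _ n0%:R); last by rewrite ler_nat.
by apply/ltW; exact: truncnS_gt.
Qed.

(** Since [F] is nonnegative, its periodization already dominates [F x], so a single grid of mesh at
    most 1 in the Gaussian scale suffices and no limit is taken. *)
Lemma local_upper : exists2 C : R, 0 <= C &
  forall (F : X -> R) (M q : R), (forall x, 0 <= F x) -> summ F -> 0 <= M -> 0 < q ->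
  (forall th, in_box th -> cabs (ft F th) <= M * expR (- (q * dotp th th))) ->
  forall x, F x <= C * M / Num.sqrt q ^+ d.
Proof.
have [C C0 HC] := grid_gauss_le; exists C => // F M q F0 sF M0 q0 HF x.
have [n n0 Hn] := mesh_small q (ltr01 : 0 < 1 :> R).
apply: (le_trans (dft_ge x n0 F0 sF)); rewrite /dft.
apply: (@le_trans _ _ (M * ((\sum_(k : {ffun 'I_d -> 'I_(n.*2)})
   expR (- (q * dotp (grid R k) (grid R k)))) / (n.*2)%:R ^+ d))).
  rewrite mulrA ler_wpM2r ?invr_ge0 ?exprn_ge0// mulr_sumr; apply: ler_sum => k _.
  apply: (le_trans (ler_norm _)); apply: (le_trans (cabs_Re _)).
  rewrite cabsM cabs_cis mulr1; apply: HF; exact: grid_in_box.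
rewrite mulrAC mulrC; apply: ler_wpM2r => //.
by apply: HC => //; exact: Hn.
Qed.

(** Off the grid some coordinate is at least [n] in absolute value, so the scaled squared norm is at
    least [K]. Half of the Gaussian exponent pays for the small factor, the other half stays
    summable. *)
Lemma off_grid n (K kap : R) (x : X) : (0 < n)%N -> 0 < K -> 0 < kap ->
  x \notin range (@gridz d n) ->
  gauss_term (kap%:M : 'M[R]_d) (pi / n%:R * Num.sqrt K) x <=
  expR (- (K * kap / 4)) *
    gauss_term ((kap / 2)%:M : 'M[R]_d) (pi / n%:R * Num.sqrt K) x.
Proof.
move=> n0 K0 kap0 xn.
have np : 0 < n%:R :> R by rewrite ltr0n.
have [j xj] : exists j, n%:R <= `|(x 0 j)%:~R| :> R.
  apply: contrapT => nj; move/negP: xn; apply; rewrite inE.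
  have lt j : `|(x 0 j)%:~R| < n%:R :> R.
    by rewrite ltNge; apply/negP => h; apply: nj; exists j.
  have lt2 j : (absz (x 0%R j + n%:Z)%R < n.*2)%N.
    have := lt j; rewrite -intr_norm -[n%:R]/(n%:Z%:~R) ltr_int.
    rewrite -addnn; case: (x 0 j) => m; lia.
  exists [ffun j => Ordinal (lt2 j)] => //.
  apply/rowP => j; rewrite !mxE ffunE /= abszE ger0_norm ?addrK//.
  have := lt j; rewrite -intr_norm -[n%:R]/(n%:Z%:~R) ltr_int.
  by case: (x 0 j) => m; lia.
set h := _ * Num.sqrt K.
have h0 : 0 < h by rewrite mulr_gt0 ?divr_gt0 ?pi_gt0 ?sqrtr_gt0.
rewrite /gauss_term mulrCA ler_pM2l ?exprn_gt0// -expRD ler_expR !qfZ !qf_scalar.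
have hK : K <= h ^+ 2 * dotp (toR R x) (toR R x).
  rewrite /h exprMn sqr_sqrtr ?(ltW K0)//.
  have : 1 <= (pi / n%:R) ^+ 2 * dotp (toR R x) (toR R x).
    have pn : 2 <= pi / n%:R * `|(x 0 j)%:~R| :> R.
      rewrite mulrAC ler_pdivlMr//; apply: ler_pM => //; exact: pi_ge2.
    apply: (@le_trans _ _ ((pi / n%:R * `|(x 0 j)%:~R|) ^+ 2)).
      by rewrite -[leLHS](expr1n _ 2) lerXn2r ?nnegrE//; lra.
    rewrite exprMn ler_wpM2l ?sqr_ge0//.
    rewrite real_normK ?num_real// /dotp (bigD1 j)//= !mxE -expr2 lerDl.
    by apply: sumr_ge0 => i _; rewrite -expr2 sqr_ge0.
  by move=> h1; rewrite mulrAC ler_peMl// ltW.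
move: hK; set y := h ^+ 2 * dotp _ _.
have -> : h ^+ 2 * (kap * dotp (toR R x) (toR R x)) = kap * y by rewrite /y; ring.
have -> : h ^+ 2 * (kap / 2 * dotp (toR R x) (toR R x)) = kap / 2 * y by rewrite /y; ring.
move=> yK; have : kap * K <= kap * y by rewrite ler_pM2l.
lra.
Qed.

Lemma two_pi_ge1 : 1 <= 2 * pi :> R.
Proof. by have := @pi_ge2 R; lra. Qed.

(** The grid is refined with [F], [K], [x] fixed, so the inversion and Riemann sum errors are
    arbitrarily small: they form the [eta]. There remain the error of the transform, integrated
    against a Gaussian, and the Gaussian mass outside the box, exponentially small in [K]. The
    constant is chosen before [F], [Q], [K] and [x]. *)
Lemma local_limit (kap B kap' M : R) : 0 < kap -> 0 < kap' -> 0 <= M ->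
  exists2 C : R, 0 <= C &
  forall (F : X -> R) (Q : 'M[R]_d) (K a : R) (x : X),
  (forall y, 0 <= F y) -> summ F -> form_bounded kap B Q -> 1 <= K -> `|a| <= M ->
  (forall th, in_box th ->
     cabs (ft F th * cis (- ang th x) - (a * expR (- (K * qf Q th) / 2))%:C) <=
     M / Num.sqrt K * expR (- (K * kap' * dotp th th))) ->
  `|Num.sqrt K ^+ d * F x - a * (gauss_const Q / (2 * pi) ^+ d)| <= C / Num.sqrt K.
Proof.
move=> kap0 kap'0 M0.
have [C1 C10 H1] := grid_gauss_le.
have [C2 C20 H2] := @gauss_lattice_sum R d kap B kap0.
have kap2 : 0 < kap / 2 by rewrite divr_gt0.
have [C3 C30 H3] := @gauss_lattice_sum R d (kap / 2) (kap / 2) kap2.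
have [_ J3 S3] := H3 _ (form_bounded_scalar (kap / 2)).
(* [Ca] comes from the error of the transform, [Cb] from the part of the Gaussian outside the
   box. *)
pose Ca := M * C1 / Num.sqrt kap' ^+ d.
pose Cb := M * (2 * C3 * (4 / kap)).
have Ca0 : 0 <= Ca by rewrite divr_ge0 ?mulr_ge0 ?exprn_ge0 ?sqrtr_ge0.
have Cb0 : 0 <= Cb by rewrite !mulr_ge0 ?invr_ge0 ?(ltW kap0).
exists (Ca + Cb) => [|F Q K a x F0 sF Qb K1 aM HF]; first by rewrite addr_ge0.
have K0 : 0 < K by exact: lt_le_trans K1.
have sK1 : 1 <= Num.sqrt K by rewrite -sqrtr1 ler_wsqrtr.
have sK0 : 0 < Num.sqrt K by exact: lt_le_trans sK1.
have [detQ JQ SQ] := H2 _ Qb.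
apply/ler_addgt0Pr => eta eta0.
pose eps := eta / 2 / Num.sqrt K ^+ d.
have eps0 : 0 < eps by rewrite !divr_gt0// exprn_gt0.
have [na Ha] := dft_cvg x F0 sF eps0.
(* A mesh for which the Riemann sum error [M * C2 * h] is at most [eta / 2]; the other half of [eta]
   is the inversion error. *)
pose hm := Num.min (eta / 2 / (M * C2 + 1)) 1.
have MC : 0 < M * C2 + 1 by rewrite ltr_wpDl// mulr_ge0.
have hm0 : 0 < hm by rewrite lt_min ltr01 andbT !divr_gt0.
have [nb nb0 Hb] := mesh_small K hm0.
have [nc nc0 Hc] := mesh_small (K * kap') (ltr01 : 0 < 1 :> R).
pose n := (na + nb + nc)%N.
have nan : (na <= n)%N by rewrite /n -addnA leq_addr.
have nbn : (nb <= n)%N by rewrite /n addnAC leq_addl.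
have ncn : (nc <= n)%N by rewrite /n leq_addl.
have n0 : (0 < n)%N by exact: leq_trans ncn.
have np : 0 < n%:R :> R by rewrite ltr0n.
have {}Ha := Ha n nan n0; have {}Hb := Hb n nbn; have {}Hc := Hc n ncn.
pose En := (\sum_(k : {ffun 'I_d -> 'I_(n.*2)}) expR (- (K * qf Q (grid R k)) / 2))
   / (n.*2)%:R ^+ d.
have st2 : `|dft n F x - a * En| <= M / Num.sqrt K * (C1 / Num.sqrt (K * kap') ^+ d).
  rewrite /dft /En mulrA -mulrBl mulr_sumr -sumrB normrM.
  rewrite [`|_^-1|]ger0_norm ?invr_ge0 ?exprn_ge0//.
  apply: (@le_trans _ _ (M / Num.sqrt K * ((\sum_(k : {ffun 'I_d -> 'I_(n.*2)})
   expR (- (K * kap' * dotp (grid R k) (grid R k)))) / (n.*2)%:R ^+ d))).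
    rewrite [leRHS]mulrA ler_wpM2r ?invr_ge0 ?exprn_ge0//.
    apply: (le_trans (ler_norm_sum _ _ _)).
    rewrite mulr_sumr; apply: ler_sum => k _.
    apply: le_trans (HF _ (grid_in_box k)).
    apply: le_trans (cabs_Re _); rewrite le_eqVlt; apply/orP; left; apply/eqP.
    by congr `|_|; case: (_ * cis _).
  rewrite ler_wpM2l ?divr_ge0 ?sqrtr_ge0//; apply: H1 => //.
  by rewrite mulr_gt0.
pose h := pi / n%:R * Num.sqrt K.
have h0 : 0 < h by rewrite mulr_gt0 ?divr_gt0 ?pi_gt0.
have h1 : h <= 1 by apply: (le_trans Hb); rewrite ge_min lexx orbT.
have h01 : 0 < h <= 1 by rewrite h0.
have [S ES Sd] := SQ h h01.
have [S' ES' Sd'] := S3 h h01.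
have gE : \sum_(k : {ffun 'I_d -> 'I_(n.*2)}) gauss_term Q h (gridz k) =
    (2 * pi * Num.sqrt K) ^+ d * En.
  under eq_bigr do rewrite gauss_term_grid ?(ltW K0)// -/h.
  rewrite -mulr_sumr /En; set sm := \sum_(_ : _) _.
  rewrite mulrCA mulrC; congr (_ * _); rewrite -exprVn -exprMn; congr (_ ^+ _).
  by rewrite /h -mul2n natrM; field; rewrite gt_eqF.
have gt0 (A : 'M[R]_d) (z : X) : 0 <= gauss_term A h z by rewrite gauss_term_ge0// ltW.
have eKk : expR (- (K * kap / 4)) <= 4 / kap / Num.sqrt K.
  have y0 : 0 < K * kap / 4 by rewrite divr_gt0 ?mulr_gt0.
  apply: (@le_trans _ _ (K * kap / 4)^-1).
    rewrite expRN lef_pV2 ?posrE ?expR_gt0//.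
    by apply: le_trans (expR_ge1Dx _); rewrite lerDr.
  rewrite invf_div [K * kap]mulrC invfM mulrA ler_wpM2l ?divr_ge0 ?(ltW kap0)//.
  rewrite lef_pV2 ?posrE// -{2}(sqr_sqrtr (ltW K0)) expr2 ler_peMl//.
have off : S - \sum_(k : {ffun 'I_d -> 'I_(n.*2)}) gauss_term Q h (gridz k) <=
    expR (- (K * kap / 4)) * S'.
  rewrite lerBlDl -lee_fin -ES (esum_gridE n)// EFinD leeD2l// EFinM -ES'.
  rewrite -esumZl ?lee_fin ?expR_ge0//; last by move=> z; rewrite lee_fin.
  rewrite esum_mkcond; apply: le_esum => z _; rewrite in_setC.
  case: ifPn => [zn|_]; last by rewrite -EFinM lee_fin mulr_ge0 ?expR_ge0.
  rewrite -EFinM lee_fin; apply: le_trans (off_grid n0 K0 kap0 zn).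
  rewrite /gauss_term ler_pM2l ?exprn_gt0// ler_expR qf_scalar.
  by rewrite -/h; have /andP[hz _] := Qb.2 (h *: toR R z); lra.
have offge : 0 <= S - \sum_(k : {ffun 'I_d -> 'I_(n.*2)}) gauss_term Q h (gridz k).
  by rewrite subr_ge0 -lee_fin -ES (esum_gridE n)// leeDl// esum_ge0// => z _; rewrite lee_fin.
have S'le : S' <= 2 * C3.
  move: Sd'; rewrite ler_norml => /andP[_]; have : C3 * h <= C3 by rewrite ler_piMr.
  lra.
have st3 : `|(2 * pi * Num.sqrt K) ^+ d * En - gauss_const Q| <=
    C2 * h + 2 * C3 * (4 / kap) / Num.sqrt K.
  have -> : (2 * pi * Num.sqrt K) ^+ d * En - gauss_const Q =
     (S - gauss_const Q) - (S - (2 * pi * Num.sqrt K) ^+ d * En) by ring.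
  apply: (le_trans (ler_normB _ _)); rewrite -gE (ger0_norm offge).
  apply: lerD => //; apply: (le_trans off).
  rewrite mulrC -[leRHS]mulrA; apply: ler_pM => //; try exact: expR_ge0.
  by rewrite -lee_fin -ES' esum_ge0// => z _; rewrite lee_fin.
have p2 : 1 <= (2 * pi) ^+ d :> R.
  by rewrite exprn_ege1// two_pi_ge1.
have p20 : 0 < (2 * pi) ^+ d :> R by exact: lt_le_trans p2.
have st4 : `|Num.sqrt K ^+ d * (a * En) - a * (gauss_const Q / (2 * pi) ^+ d)| <=
    M * (C2 * h + 2 * C3 * (4 / kap) / Num.sqrt K).
  have -> : Num.sqrt K ^+ d * (a * En) - a * (gauss_const Q / (2 * pi) ^+ d) =
     a * (((2 * pi * Num.sqrt K) ^+ d * En - gauss_const Q) / (2 * pi) ^+ d).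
    have G (e s P J : R) : P != 0 -> s * (a * e) - a * (J / P) = a * ((P * s * e - J) / P).
      by move=> P0; field.
    by rewrite [(2 * pi * _) ^+ d]exprMn G// gt_eqF.
  rewrite normrM; apply: ler_pM => //.
  rewrite normrM [`|_^-1|]ger0_norm ?invr_ge0 ?(ltW p20)//.
  apply: le_trans st3; rewrite ler_piMr// invf_le1//.
have st1 : `|Num.sqrt K ^+ d * F x - Num.sqrt K ^+ d * dft n F x| <= eta / 2.
  rewrite -mulrBr normrM ger0_norm ?exprn_ge0 ?sqrtr_ge0//.
  by rewrite mulrC -ler_pdivlMr ?exprn_gt0.
have st2' : `|Num.sqrt K ^+ d * dft n F x - Num.sqrt K ^+ d * (a * En)| <= Ca / Num.sqrt K.
  rewrite -mulrBr normrM ger0_norm ?exprn_ge0 ?sqrtr_ge0//.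
  apply: (le_trans (ler_wpM2l _ st2)); first by rewrite exprn_ge0 ?sqrtr_ge0.
  rewrite le_eqVlt; apply/orP; left; apply/eqP; rewrite /Ca sqrtrM ?(ltW K0)// exprMn.
  by field; rewrite !gt_eqF// ?exprn_gt0 ?sqrtr_gt0.
have MCh : M * (C2 * h) <= eta / 2.
  have : h <= eta / 2 / (M * C2 + 1) by apply: (le_trans Hb); rewrite ge_min lexx.
  rewrite ler_pdivlMr// => hh; have : 0 <= M * C2 by rewrite mulr_ge0.
  have := ltW h0; nra.
have -> : Num.sqrt K ^+ d * F x - a * (gauss_const Q / (2 * pi) ^+ d) =
  (Num.sqrt K ^+ d * F x - Num.sqrt K ^+ d * dft n F x) +
  ((Num.sqrt K ^+ d * dft n F x - Num.sqrt K ^+ d * (a * En)) +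
   (Num.sqrt K ^+ d * (a * En) - a * (gauss_const Q / (2 * pi) ^+ d))) by ring.
apply: (le_trans (ler_normD _ _)).
have := ler_normD (Num.sqrt K ^+ d * dft n F x - Num.sqrt K ^+ d * (a * En))
   (Num.sqrt K ^+ d * (a * En) - a * (gauss_const Q / (2 * pi) ^+ d)).
have : M * (2 * C3 * (4 / kap) / Num.sqrt K) = Cb / Num.sqrt K by rewrite /Cb; ring.
move: st4; rewrite mulrDr mulrDl; lra.
Qed.

End LocalLimit.

(** * Lattice measures with exponential moments *)

Section LatticeMeasure.
Variables (R : realType) (d : nat).
Local Open Scope complex_scope.
Local Notation X := 'rV[int]_d.
Local Notation ang th x := (dotp th (toR R x)).
Implicit Types (xi : X -> R) (th v : 'rV[R]_d) (x y : X).

(** The l1 norm is dual to the sup norm, in which the distance between two tilts is measured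
    throughout. *)
Definition n1 x : R := \sum_k `|(x 0 k)%:~R|.

Lemma n1_ge0 x : 0 <= n1 x.
Proof. exact: sumr_ge0. Qed.

Lemma n1D x y : n1 (x + y) <= n1 x + n1 y.
Proof.
rewrite /n1 -big_split /=; apply: ler_sum => k _; rewrite mxE intrD; exact: ler_normD.
Qed.

Lemma coord_le_n1 x k : `|(x 0 k)%:~R| <= n1 x.
Proof. by rewrite /n1 (bigD1 k)//= lerDl sumr_ge0. Qed.

Lemma enorm_ge0 v : 0 <= enorm v.
Proof. exact: sqrtr_ge0. Qed.

Lemma enorm_sqr v : enorm v ^+ 2 = dotp v v.
Proof.
rewrite sqr_sqrtr; first by apply: eq_bigr => k _; rewrite expr2.
by apply: sumr_ge0 => k _; rewrite sqr_ge0.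
Qed.

Lemma coord_le_enorm v k : `|v 0 k| <= enorm v.
Proof.
rewrite -sqrtr_sqr ler_wsqrtr// (bigD1 k)//= lerDl.
by apply: sumr_ge0 => i _; rewrite sqr_ge0.
Qed.

Lemma dotp_le_coord (r : R) v x : (forall k, `|v 0 k| <= r) -> `|ang v x| <= r * n1 x.
Proof.
move=> vr; rewrite /dotp /n1 mulr_sumr; apply: (le_trans (ler_norm_sum _ _ _)).
by apply: ler_sum => k _; rewrite normrM mxE ler_wpM2r.
Qed.

Lemma dotp_le_enorm v x : `|ang v x| <= enorm v * n1 x.
Proof. by apply: dotp_le_coord => k; exact: coord_le_enorm. Qed.

Lemma box_enorm th : in_box th -> enorm th <= pi * d%:R.
Proof.
move=> box; rewrite -[leRHS]ger0_norm ?mulr_ge0 ?pi_ge0// -sqrtr_sqr ler_wsqrtr//.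
apply: (@le_trans _ _ (\sum_(k < d) pi ^+ 2)).
  apply: ler_sum => k _; rewrite -[_ 0 k ^+ 2]real_normK ?num_real//.
  by rewrite lerXn2r ?nnegrE ?pi_ge0// box.
rewrite sumr_const card_ord -[leLHS]mulr_natr [(pi * _) ^+ 2]exprMn.
rewrite ler_wpM2l ?sqr_ge0//.
by rewrite -natrX ler_nat; case: d => // n; rewrite expnS expn1 leq_pmulr.
Qed.

(** Rate and bound are explicit so that estimates proved for one measure are automatically uniform
    over a family of tilted measures. *)
Definition expmom (del M : R) xi := [/\ forall x, 0 <= xi x,
  summ (fun x => expR (del * n1 x) * xi x) &
  sumR (fun x => expR (del * n1 x) * xi x) <= M].

Section ExpMom.
Variables (del M : R) (xi : X -> R).
Hypotheses (del0 : 0 < del) (H : expmom del M xi).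

Lemma expmom_summ_bound (f : X -> R) (c : R) : 0 <= c ->
  (forall x, `|f x| <= c * expR (del * n1 x)) ->
  summ (fun x => f x * xi x) /\ `|sumR (fun x => f x * xi x)| <= c * M.
Proof.
move: H => [xi0 s sM] c0 fc.
have le x : `|f x * xi x| <= c * (expR (del * n1 x) * xi x).
  by rewrite normrM (ger0_norm (xi0 x)) mulrA ler_wpM2r.
have sc : summ (fun x => c * (expR (del * n1 x) * xi x)) by exact: summZ.
split; first exact: summ_le le sc.
apply: (le_trans (ler_sumR_bound sc le)).
by rewrite sumRZ ler_wpM2l.
Qed.

Lemma expmom_ge0 x : 0 <= xi x.
Proof. by case: H. Qed.

Lemma expmom_M_ge0 : 0 <= M.
Proof.
case: H => xi0 s sM; apply: le_trans sM; apply: sumR_ge0 => x.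
by rewrite mulr_ge0 ?expR_ge0.
Qed.

Lemma expmom_summ : summ xi /\ sumR xi <= M.
Proof.
have [||s b] := @expmom_summ_bound (fun=> 1) 1 => //.
  by move=> x; rewrite normr1 mul1r -(expR0 R) ler_expR mulr_ge0 ?n1_ge0 ?ltW.
have e : (fun x => 1 * xi x) = xi by apply/funext => x; rewrite mul1r.
by move: s b; rewrite e mul1r => s /(le_trans (ler_norm _)).
Qed.

Lemma expmom_pow (j : nat) (f : X -> R) (c : R) : 0 <= c ->
  (forall x, `|f x| <= c * n1 x ^+ j) ->
  summ (fun x => f x * xi x) /\
  `|sumR (fun x => f x * xi x)| <= c * (j%:R / del) ^+ j * M.
Proof.
move=> c0 fc; apply: expmom_summ_bound.
  by rewrite mulr_ge0// exprn_ge0// divr_ge0// ltW.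
move=> x; apply: (le_trans (fc x)); rewrite -mulrA ler_wpM2l//.
by apply: pow_le_expR => //; exact: n1_ge0.
Qed.

Definition mean : 'rV[R]_d := \row_k sumR (fun x => (x 0 k)%:~R * xi x).

Definition mom2 : 'M[R]_d := \matrix_(i, j) sumR (fun x => (x 0 i)%:~R * (x 0 j)%:~R * xi x).

Lemma dotp_mean v : dotp v mean = sumR (fun x => ang v x * xi x).
Proof.
rewrite (eq_sumR (g := fun x => \sum_k v 0 k * ((x 0 k)%:~R * xi x))); last first.
  by move=> x; rewrite /dotp mulr_suml; apply: eq_bigr => k _; rewrite mxE mulrA.
rewrite sumR_big; last first.
  move=> k _; apply: summZ; apply: (expmom_pow (j := 1) (c := 1) _ _).1 => // x.
  by rewrite mul1r expr1 coord_le_n1.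
by apply: eq_bigr => k _; rewrite sumRZ mxE.
Qed.

Lemma summ_ang v : summ (fun x => ang v x * xi x).
Proof.
apply: (expmom_pow (j := 1) (c := enorm v) (enorm_ge0 v) _).1 => x.
by rewrite expr1 dotp_le_enorm.
Qed.

Lemma summ_ang2 v : summ (fun x => ang v x ^+ 2 * xi x).
Proof.
apply: (expmom_pow (j := 2) (c := enorm v ^+ 2) (sqr_ge0 _) _).1 => x.
by rewrite normrX -exprMn lerXn2r ?nnegrE ?mulr_ge0 ?enorm_ge0 ?n1_ge0 ?dotp_le_enorm.
Qed.

Lemma qf_mom2 v : qf mom2 v = sumR (fun x => ang v x ^+ 2 * xi x).
Proof.
have s2 i j : summ (fun x => (x 0 i)%:~R * (x 0 j)%:~R * xi x).
  apply: (expmom_pow (j := 2) (c := 1) _ _).1 => // x.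
  by rewrite mul1r normrM expr2 ler_pM ?coord_le_n1.
rewrite (eq_sumR (g := fun x => \sum_j \sum_i v 0 i * v 0 j *
    ((x 0 i)%:~R * (x 0 j)%:~R * xi x))); last first.
  move=> x; rewrite expr2 {2}/dotp mulr_sumr mulr_suml; apply: eq_bigr => j _.
  rewrite /dotp !mulr_suml; apply: eq_bigr => i _; rewrite !mxE; ring.
rewrite sumR_big; last by move=> j _; apply: summ_big => i _; apply: summZ.
rewrite /qf mxE; apply: eq_bigr => j _; rewrite sumR_big; last by move=> i _; apply: summZ.
rewrite !mxE mulr_suml; apply: eq_bigr => i _; rewrite sumRZ !mxE; ring.
Qed.

Lemma mom2_sym : mom2^T = mom2.
Proof.
by apply/matrixP => i j; rewrite !mxE; apply: eq_sumR => x; rewrite [_ * (x 0 i)%:~R]mulrC.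
Qed.

Lemma mean_bound v : `|dotp v mean| <= enorm v / del * M.
Proof.
rewrite dotp_mean.
have b x : `|ang v x| <= enorm v * n1 x ^+ 1 by rewrite expr1 dotp_le_enorm.
by have [_] := expmom_pow (enorm_ge0 v) b; rewrite expr1 mul1r.
Qed.

Lemma mom2_bound v : 0 <= qf mom2 v <= enorm v ^+ 2 * (2 / del) ^+ 2 * M.
Proof.
rewrite qf_mom2; apply/andP; split.
  by apply: sumR_ge0 => x; rewrite mulr_ge0 ?sqr_ge0 ?expmom_ge0.
apply: (le_trans (ler_norm _)).
apply: (expmom_pow (j := 2) (c := enorm v ^+ 2) (sqr_ge0 _) _).2 => x.
by rewrite normrX -exprMn lerXn2r ?nnegrE ?mulr_ge0 ?enorm_ge0 ?n1_ge0 ?dotp_le_enorm.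
Qed.

Lemma ft_taylor th :
  cabs (ft xi th - ((sumR xi - qf mom2 th / 2) +i* dotp th mean)) <=
  2 * (3 / del) ^+ 3 * M * enorm th ^+ 3.
Proof.
have [s _] := expmom_summ.
have t3 : 0 <= enorm th ^+ 3 by rewrite exprn_ge0 ?enorm_ge0.
have b3 x : `|ang th x| ^+ 3 <= enorm th ^+ 3 * n1 x ^+ 3.
  by rewrite -exprMn lerXn2r ?nnegrE ?mulr_ge0 ?enorm_ge0 ?n1_ge0 ?dotp_le_enorm.
apply: (le_trans (cabs_le_ReIm _)); rewrite /ft /=.
have sc := summ_cos th s; have ss := summ_sin th s.
have s2 : summ (fun x => ang th x ^+ 2 / 2 * xi x).
  apply: (summ_le (g := fun x => 2^-1 * (ang th x ^+ 2 * xi x))).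
    move=> x; rewrite mulrAC mulrC ger0_norm//.
    by do 2?[apply: mulr_ge0 => //]; [exact: sqr_ge0|exact: expmom_ge0].
  exact/summZ/summ_ang2.
have -> : sumR (fun x => xi x * cos (ang th x)) - (sumR xi - qf mom2 th / 2) =
    sumR (fun x => (cos (ang th x) - 1 + ang th x ^+ 2 / 2) * xi x).
  have -> : qf mom2 th / 2 = sumR (fun x => ang th x ^+ 2 / 2 * xi x).
    by rewrite qf_mom2 mulrC -sumRZ; apply: eq_sumR => x; ring.
  rewrite opprB addrCA -sumRB// addrC -sumRD//; last exact: summB.
  by apply: eq_sumR => x; ring.
have -> : sumR (fun x => xi x * sin (ang th x)) - dotp th mean =
    sumR (fun x => (sin (ang th x) - ang th x) * xi x).
  rewrite dotp_mean -sumRB//; last exact: summ_ang.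
  by apply: eq_sumR => x; ring.
have [_ h1] := expmom_pow t3 (fun x => le_trans (cos_taylor (ang th x)) (b3 x)).
have [_ h2] := expmom_pow t3 (fun x => le_trans (sin_taylor (ang th x)).2 (b3 x)).
lra.
Qed.

Lemma ft_lip th : cabs (ft xi th - (sumR xi)%:C) <= 3 / del * M * enorm th.
Proof.
have [s _] := expmom_summ.
have t1 : 0 <= enorm th by exact: enorm_ge0.
apply: (le_trans (cabs_le_ReIm _)); rewrite /ft /= subr0.
have sc := summ_cos th s; have ss := summ_sin th s.
have -> : sumR (fun x => xi x * cos (ang th x)) - sumR xi =
    sumR (fun x => (cos (ang th x) - 1) * xi x).
  by rewrite -sumRB//; apply: eq_sumR => x; ring.
have c1 x : `|cos (ang th x) - 1| <= 2 * enorm th * n1 x ^+ 1.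
  have := cis_sub1 (ang th x); have := cabs_Re (cis (ang th x) - 1); rewrite /=.
  have := dotp_le_enorm th x; rewrite expr1; lra.
have s1 x : `|sin (ang th x)| <= enorm th * n1 x ^+ 1.
  by apply: (le_trans (norm_sin_le _)); rewrite expr1 dotp_le_enorm.
have [|_ h1] := expmom_pow (j := 1) _ c1; first by rewrite mulr_ge0.
have [_ h2] := expmom_pow (j := 1) t1 s1.
have -> : sumR (fun x => xi x * sin (ang th x)) = sumR (fun x => sin (ang th x) * xi x).
  by apply: eq_sumR => x; ring.
move: h1 h2; rewrite !expr1; lra.
Qed.

End ExpMom.

Lemma sumR_two_le (f : X -> R) x y : (forall z, 0 <= f z) -> summ f -> x != y ->
  f x + f y <= sumR f.
Proof.
move=> f0 sf xy; rewrite -lee_fin ge0_sumRE// (esumID [set x])/=; last first.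
  by move=> z _; rewrite lee_fin.
rewrite !setTI esum_set1 ?lee_fin// EFinD leeD2l//.
rewrite (esumID [set y])/=; last by move=> z _; rewrite lee_fin.
rewrite (_ : ~` [set x] `&` [set y] = [set y]); last first.
  by apply/seteqP; split => z /= [] // -> //; split => //; apply/eqP; rewrite eq_sym.
rewrite esum_set1 ?lee_fin// leeDl// esum_ge0// => z _; by rewrite lee_fin.
Qed.

Definition ebase (k : 'I_d) : X := delta_mx 0 k.

Lemma ang_ebase th k : ang th (ebase k) = th 0 k.
Proof.
rewrite /dotp (bigD1 k)//= !mxE !eqxx mulr1 big1 ?addr0// => j jk.
by rewrite !mxE (negPf jk) mulr0.
Qed.

(** Quantitative nondegeneracy: the differences of these atoms generate the lattice. It bounds the
    covariance from below and separates the modulus of the transform from its value at 0 on the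
    whole box. *)
Definition spread (eps : R) xi := eps <= xi 0 /\ forall k, eps <= xi (ebase k).

(* Maximizing over the phase a + ib turns the modulus of the transform into a
   nonnegative sum, in which the atoms 0 and e_k already give the bound. *)
Lemma cabs_ft_deficit eps xi th : (forall x, 0 <= xi x) -> summ xi -> 0 <= eps ->
  spread eps xi -> in_box th ->
  d%:R * cabs (ft xi th) + eps / 64 * dotp th th <= d%:R * sumR xi.
Proof.
move=> xi0 s eps0 [e0 ek] box.
set r := cabs (ft xi th).
have one k : r + eps / 64 * th 0 k ^+ 2 <= sumR xi.
  have [a [b [ab rE]]] : exists a b : R, a ^+ 2 + b ^+ 2 = 1 /\
      r = a * Re (ft xi th) + b * Im (ft xi th).
    have [r0|r0] := eqVneq r 0.
      have := cabs_sqr (ft xi th); rewrite -/r r0 expr2 mul0r.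
      move: (Re (ft xi th)) (Im (ft xi th)) => A B e.
      have /eqP : A ^+ 2 = 0 by have := sqr_ge0 A; have := sqr_ge0 B; lra.
      rewrite sqrf_eq0 => /eqP E1.
      by exists 1, 0; rewrite expr1n expr0n /= E1 addr0 mul1r mul0r addr0.
    exists (Re (ft xi th) / r), (Im (ft xi th) / r).
    have e := cabs_sqr (ft xi th); rewrite -/r in e.
    split; first by rewrite !exprMn -mulrDl -e exprVn divff// expf_neq0.
    apply: (mulIf r0); rewrite -expr2 e; field => //.
  pose f x := xi x * (1 - (a * cos (ang th x) + b * sin (ang th x))).
  have cs t : a * cos t + b * sin t <= 1.
    have := cos2Dsin2 t; have := sqr_ge0 (a - cos t); have := sqr_ge0 (b - sin t).
    nra.
  have f0 x : 0 <= f x by rewrite mulr_ge0// subr_ge0.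
  have sc := summ_cos th s; have ss := summ_sin th s.
  have sf : summ f.
    have -> : f = fun x => xi x - (a * (xi x * cos (ang th x)) + b * (xi x * sin (ang th x))).
      by apply/funext => x; rewrite /f; ring.
    by apply: summB => //; apply: summD; apply: summZ.
  have rf : sumR xi - r = sumR f.
    rewrite rE /ft /= -!sumRZ -sumRD; [|exact: summZ..].
    rewrite -sumRB//; last by apply: summD; apply: summZ.
    by apply: eq_sumR => x; rewrite /f; ring.
  have := @sumR_two_le f 0 (ebase k) f0 sf.
  have -> : 0 != ebase k.
    apply/eqP => /rowP /(_ k); rewrite !mxE !eqxx //.
  move=> /(_ isT); rewrite -rf /f toR0 dotp0r cos0 sin0 ang_ebase mulr1 mulr0 addr0.
  have c2 := one_sub_cos_ge (box k).
  have := cos2Dsin2 (th 0 k); have := cs (th 0 k); move: c2 (e0) (ek k).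
  set c := cos _; set sn := sin _; set x0 := xi 0; set xk := xi _; set t2 := th 0 k ^+ 2.
  move=> c2 x0e xke cse csb.
  have a1 : a <= 1 by have := cs 0; rewrite cos0 sin0 mulr1 mulr0 addr0.
  (* The squared distance of two unit vectors is [2 - 2] times their scalar product, so this is the
     triangle inequality between [(1, 0)], [(a, b)] and [(c, sn)], squared. *)
  have key : 1 - c <= 2 * (1 - a) + 2 * (1 - (a * c + b * sn)).
    have := sqr_ge0 (1 - 2 * a + c); have := sqr_ge0 (2 * b - sn); nra.
  have h1 : eps * (1 - a) <= x0 * (1 - a) by rewrite ler_wpM2r// subr_ge0.
  have h2 : eps * (1 - (a * c + b * sn)) <= xk * (1 - (a * c + b * sn)).
    by rewrite ler_wpM2r// subr_ge0.
  have h3 : eps * (t2 / 32) <= eps * (1 - c) by rewrite ler_wpM2l.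
  have h4 : eps * (1 - c) <= eps * (2 * (1 - a) + 2 * (1 - (a * c + b * sn))).
    by rewrite ler_wpM2l.
  lra.
have -> : d%:R * r + eps / 64 * dotp th th = \sum_(k < d) (r + eps / 64 * th 0 k ^+ 2).
  rewrite big_split /= sumr_const card_ord mulr_natl; congr (_ + _).
  by rewrite /dotp mulr_sumr; apply: eq_bigr => k _; rewrite expr2.
apply: (le_trans (ler_sum _ (fun k _ => one k))).
by rewrite sumr_const card_ord mulr_natl.
Qed.

Lemma cabs_ft_le eps M xi th : (0 < d)%N -> (forall x, 0 <= xi x) -> summ xi ->
  0 < M -> sumR xi <= M -> 0 <= eps -> spread eps xi -> in_box th ->
  cabs (ft xi th) <= sumR xi * expR (- (eps / (64 * d%:R * M) * dotp th th)).
Proof.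
move=> d0 xi0 s M0 xM eps0 sp box.
have dp : 0 < d%:R :> R by rewrite ltr0n.
have h := cabs_ft_deficit xi0 s eps0 sp box.
have s0 : 0 <= sumR xi by exact: sumR_ge0.
set q := eps / (64 * d%:R * M) * dotp th th.
have q0 : 0 <= q.
  by rewrite mulr_ge0 ?dotp_sqr_ge0// divr_ge0// !mulr_ge0// ltW.
have e : eps / 64 * dotp th th = d%:R * M * q.
  by rewrite /q; field; rewrite !gt_eqF.
apply: (@le_trans _ _ (sumR xi * (1 - q))).
  rewrite -(ler_pM2l dp) mulrBr mulr1 mulrBr.
  have : d%:R * (sumR xi * q) <= d%:R * M * q.
    by rewrite -mulrA ler_pM2l// ler_wpM2r.
  lra.
by rewrite ler_wpM2l// (le_trans _ (expR_ge1Dx _)).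
Qed.

End LatticeMeasure.

(** * Second order expansions of characteristic functions *)

Section Jets.
Variables (R : realType) (tau : R).
Local Open Scope complex_scope.
Hypothesis tau0 : 0 <= tau.
Implicit Types (t c a b : R) (f g : R[i]).

(* f = 1 + i a - b / 2 up to third order in the small parameter t. *)
Definition jet t c f a b :=
  [/\ cabs (f - ((1 - b / 2) +i* a)) <= c * t ^+ 3, `|a| <= c * t & `|b| <= c * t ^+ 2].

(** The product of the first order terms [i a1] and [i a2] is [- a1 a2], which enters [b] as
    [2 a1 a2]. All other cross terms are of third order, higher powers of [t] being absorbed through
    [t <= tau]. *)
Lemma jet_mul c1 c2 : 0 <= c1 -> 0 <= c2 -> exists2 c, 0 <= c &
  forall t f g a1 b1 a2 b2, 0 <= t <= tau -> jet t c1 f a1 b1 -> jet t c2 g a2 b2 ->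
  jet t c (f * g) (a1 + a2) (b1 + b2 + 2 * a1 * a2).
Proof.
move=> c10 c20.
pose P c := 1 + c * tau + c * tau ^+ 2.
have P0 c : 0 <= c -> 0 <= P c.
  by move=> c0; rewrite !addr_ge0// ?mulr_ge0 ?sqr_ge0.
have t30 : 0 <= tau ^+ 3 by rewrite exprn_ge0.
(* The first three terms bound the cubic error, the last bracket the new [a] and [b]. *)
exists (c1 * (P c2 + c2 * tau ^+ 3) + P c1 * c2 + c1 * c2 * (tau + 2) + (c1 + c2 + 2 * c1 * c2)).
  have A1 : 0 <= c1 * (P c2 + c2 * tau ^+ 3) by rewrite mulr_ge0// addr_ge0 ?P0 ?mulr_ge0.
  have A2 : 0 <= P c1 * c2 by rewrite mulr_ge0 ?P0.
  have A3 : 0 <= c1 * c2 * (tau + 2) by rewrite !mulr_ge0// addr_ge0.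
  have A4 : 0 <= 2 * c1 * c2 by rewrite !mulr_ge0.
  by rewrite !addr_ge0.
move=> t f g a1 b1 a2 b2 /andP[t0 tt] [f1 f2 f3] [g1 g2 g3].
have t2 : t ^+ 2 <= tau ^+ 2 by rewrite lerXn2r ?nnegrE.
have t3 : t ^+ 3 <= tau ^+ 3 by rewrite lerXn2r ?nnegrE.
have t2p : 0 <= t ^+ 2 by rewrite sqr_ge0.
have t3p : 0 <= t ^+ 3 by rewrite exprn_ge0.
pose p1 := (1 - b1 / 2) +i* a1 : R[i]; pose p2 := (1 - b2 / 2) +i* a2 : R[i].
have pP c (b a : R) : 0 <= c -> `|a| <= c * t -> `|b| <= c * t ^+ 2 ->
    cabs ((1 - b / 2) +i* a) <= P c.
  move=> c0 ha hb; apply: (le_trans (cabs_le_ReIm _)) => /=.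
  have : `|1 - b / 2| <= 1 + `|b|.
    apply: (le_trans (ler_normB _ _)); rewrite normr1 normrM [`|2^-1|]ger0_norm//.
    have := normr_ge0 b; lra.
  have : c * t <= c * tau by rewrite ler_wpM2l.
  have : c * t ^+ 2 <= c * tau ^+ 2 by rewrite ler_wpM2l.
  rewrite /P; lra.
have p1P := pP _ _ _ c10 f2 f3; have p2P := pP _ _ _ c20 g2 g3.
have gP : cabs g <= P c2 + c2 * tau ^+ 3.
  have -> : g = p2 + (g - p2) by rewrite addrC subrK.
  apply: (le_trans (cabsD _ _)); apply: lerD => //.
  by apply: (le_trans g1); rewrite ler_wpM2l.
have a12 : `|a1 * a2| <= c1 * c2 * t ^+ 2.
  rewrite normrM; have -> : c1 * c2 * t ^+ 2 = (c1 * t) * (c2 * t) by ring.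
  exact: ler_pM.
have b12 : `|b1 * b2| <= c1 * c2 * (tau * t ^+ 3).
  rewrite normrM; apply: (@le_trans _ _ ((c1 * t ^+ 2) * (c2 * t ^+ 2))).
    exact: ler_pM.
  have -> : c1 * t ^+ 2 * (c2 * t ^+ 2) = c1 * c2 * (t * t ^+ 3) by ring.
  by rewrite ler_wpM2l ?mulr_ge0// ler_wpM2r.
have ab1 : `|b1 * a2| <= c1 * c2 * t ^+ 3.
  rewrite normrM; have -> : c1 * c2 * t ^+ 3 = (c1 * t ^+ 2) * (c2 * t) by ring.
  exact: ler_pM.
have ab2 : `|b2 * a1| <= c1 * c2 * t ^+ 3.
  rewrite normrM; have -> : c1 * c2 * t ^+ 3 = (c2 * t ^+ 2) * (c1 * t) by ring.
  exact: ler_pM.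
have e1 : 0 <= c1 * (P c2 + c2 * tau ^+ 3) + P c1 * c2 + c1 * c2 * (tau + 2).
  by rewrite !addr_ge0// !mulr_ge0// ?addr_ge0 ?P0 ?mulr_ge0.
have e2 : 0 <= c1 + c2 + 2 * c1 * c2 by rewrite !addr_ge0// !mulr_ge0.
have c12 : 0 <= c1 * c2 by rewrite mulr_ge0.
split.
- have -> : f * g - ((1 - (b1 + b2 + 2 * a1 * a2) / 2) +i* (a1 + a2)) =
    (f - p1) * g + p1 * (g - p2) +
    ((b1 * b2 / 4) +i* (- (b1 * a2 + b2 * a1) / 2)).
    have -> : (f - p1) * g + p1 * (g - p2) = f * g - p1 * p2 by ring.
    rewrite -[RHS]addrA; congr (_ + _); apply/eqP; rewrite eq_complex /=.
    by apply/andP; split; apply/eqP; lra.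
  apply: (le_trans (cabsD _ _)); apply: (@le_trans _ _
    (c1 * (P c2 + c2 * tau ^+ 3) * t ^+ 3 + P c1 * c2 * t ^+ 3 +
     c1 * c2 * (tau + 2) * t ^+ 3)); last first.
    have : 0 <= (c1 + c2 + 2 * c1 * c2) * t ^+ 3 by rewrite mulr_ge0.
    lra.
  apply: lerD.
    apply: (le_trans (cabsD _ _)); rewrite !cabsM; apply: lerD.
      by rewrite mulrAC; apply: ler_pM; rewrite ?cabs_ge0.
    by rewrite -mulrA; apply: ler_pM; rewrite ?cabs_ge0.
  apply: (le_trans (cabs_le_ReIm _)) => /=.
  have h1 : `|b1 * b2 / 4| <= `|b1 * b2|.
    by rewrite normrM [`|4^-1|]ger0_norm// ler_piMr// invf_le1//; lra.
  have h2 : `|- (b1 * a2 + b2 * a1) / 2| <= `|b1 * a2| + `|b2 * a1|.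
    rewrite mulNr normrN normrM [`|2^-1|]ger0_norm//.
    have := ler_normD (b1 * a2) (b2 * a1); have := normr_ge0 (b1 * a2 + b2 * a1); lra.
  lra.
- apply: (le_trans (ler_normD _ _)).
  have : 0 <= (c1 * (P c2 + c2 * tau ^+ 3) + P c1 * c2 + c1 * c2 * (tau + 2)) * t.
    by rewrite mulr_ge0.
  have : 0 <= (2 * c1 * c2) * t by rewrite !mulr_ge0.
  lra.
- apply: (le_trans (ler_normD _ _)).
  have := ler_normD b1 b2.
  have : `|2 * a1 * a2| <= 2 * c1 * c2 * t ^+ 2.
    by rewrite -!mulrA normrM [`|2|]ger0_norm// ler_pM2l// mulrA.
  have : 0 <= (c1 * (P c2 + c2 * tau ^+ 3) + P c1 * c2 + c1 * c2 * (tau + 2)) * t ^+ 2.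
    by rewrite mulr_ge0.
  lra.
Qed.

Lemma jet_pow c0 L : 0 <= c0 -> exists2 c, 0 <= c &
  forall t f a b, 0 <= t <= tau -> jet t c0 f a b ->
  jet t c (f ^+ L) (L%:R * a) (L%:R * b + L%:R * (L%:R - 1) * a ^+ 2).
Proof.
move=> c00; elim: L => [|L [c c0' IH]].
  exists 0 => // t f a b _ _; rewrite !mul0r add0r expr0; split.
  - have -> : (1 - 0 / 2) +i* 0 = 1 :> R[i] by rewrite mul0r subr0.
    by rewrite subrr cabs0 mul0r.
  - by rewrite normr0 mul0r.
  - by rewrite normr0 mul0r.
have [c' c'0 H] := jet_mul c0' c00.
exists c' => // t f a b tt j.
have := H _ _ _ _ _ _ _ tt (IH _ _ _ _ tt j) j.
rewrite -exprSr; congr jet; rewrite -natr1; ring.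
Qed.

Lemma jet_avg1 c t f a b : 0 <= c -> 0 <= t -> jet t c f a b ->
  jet t c ((1 + f) / 2) (a / 2) (b / 2).
Proof.
move=> c0 t0 [h1 h2 h3].
have half (x y : R) : `|x| <= y -> `|x / 2| <= y.
  by rewrite normrM [`|2^-1|]ger0_norm//; have := normr_ge0 x; lra.
split; [|exact: half..].
have -> : (1 + f) / 2 - ((1 - b / 2 / 2) +i* (a / 2)) =
    (f - ((1 - b / 2) +i* a)) / 2.
  apply: (@mulIf _ 2); first by rewrite pnatr_eq0.
  rewrite mulrBl !divfK ?pnatr_eq0//.
  rewrite [1 + f]addrC -addrA; congr (_ + _).
  apply/eqP; rewrite eq_complex /=; apply/andP; split; apply/eqP; lra.
rewrite cabsM; have -> : cabs (2^-1 : R[i]) = 2^-1.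
  have -> : (2^-1 : R[i]) = (2^-1)%:C by rewrite fmorphV rmorph_nat.
  by rewrite cabs_real ger0_norm.
have := cabs_ge0 (f - ((1 - b / 2) +i* a)); lra.
Qed.

Lemma jet_cis c t y : 0 <= c -> 0 <= t -> `|y| <= c * t ->
  jet t (c + c ^+ 2 + 2 * c ^+ 3) (cis y) y (y ^+ 2).
Proof.
move=> c0 t0 yc.
have c2 : 0 <= c ^+ 2 by rewrite sqr_ge0.
have c3 : 0 <= c ^+ 3 by rewrite exprn_ge0.
have t2p : 0 <= t ^+ 2 by rewrite sqr_ge0.
have t3p : 0 <= t ^+ 3 by rewrite exprn_ge0.
have y2 : `|y| ^+ 2 <= c ^+ 2 * t ^+ 2 by rewrite -exprMn lerXn2r ?nnegrE// mulr_ge0.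
have y3 : `|y| ^+ 3 <= c ^+ 3 * t ^+ 3 by rewrite -exprMn lerXn2r ?nnegrE// mulr_ge0.
split.
- apply: (le_trans (cabs_le_ReIm _)); rewrite /cis /=.
  have := cos_taylor y; have := (sin_taylor y).2.
  have -> : cos y - (1 - y ^+ 2 / 2) = cos y - 1 + y ^+ 2 / 2 by lra.
  have : 0 <= c * t ^+ 3 by rewrite mulr_ge0.
  have : 0 <= c ^+ 2 * t ^+ 3 by rewrite mulr_ge0.
  lra.
- have : 0 <= c ^+ 2 * t by rewrite mulr_ge0.
  have : 0 <= c ^+ 3 * t by rewrite mulr_ge0.
  lra.
- rewrite normrX.
  have : 0 <= c * t ^+ 2 by rewrite mulr_ge0.
  have : 0 <= c ^+ 3 * t ^+ 2 by rewrite mulr_ge0.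
  lra.
Qed.

Lemma expRN_taylor (y : R) : 0 <= y -> `|expR (- y) - (1 - y)| <= y ^+ 2.
Proof.
move=> y0; have h1 := expR_ge1Dx (- y).
have h2 : expR (- y) <= (1 + y)^-1.
  by rewrite expRN lef_pV2 ?posrE ?expR_gt0// ?expR_ge1Dx//; lra.
have h3 : (1 + y)^-1 <= 1 - y + y ^+ 2.
  rewrite -div1r ler_pdivrMr; last lra.
  have : 0 <= y ^+ 3 by rewrite exprn_ge0.
  rewrite exprS; lra.
rewrite ger0_norm; lra.
Qed.

(* For psi = 1 + i a - b / 2 + O(t^3), the lazy L-step average ((1 + psi^L) / 2),
   recentred by its mean L a / 2, has second order part [Q] below. *)
Lemma lazy_jet c0 L : 0 <= c0 -> exists2 c, 0 <= c &
  forall t f a b, 0 <= t <= tau -> jet t c0 f a b ->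
  let Q := L%:R / 2 * (b - a ^+ 2) + L%:R ^+ 2 / 4 * a ^+ 2 in 0 <= Q ->
  cabs ((1 + f ^+ L) / 2 * cis (- (L%:R * a / 2)) - (expR (- (Q / 2)))%:C) <= c * t ^+ 3.
Proof.
move=> c00; have [c1 c10 H1] := jet_pow L c00.
pose cy := L%:R * c0; have cy0 : 0 <= cy by rewrite mulr_ge0.
pose c2 := cy + cy ^+ 2 + 2 * cy ^+ 3.
have c20 : 0 <= c2 by rewrite !addr_ge0 ?mulr_ge0 ?exprn_ge0 ?mulr_ge0.
have [c3 c30 H3] := jet_mul c10 c20.
exists (c3 + c3 ^+ 2 * tau) => [|t f a b tt j Q Q0].
  by rewrite addr_ge0// mulr_ge0 ?sqr_ge0.
have /andP[t0 ttau] := tt.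
have j1 := jet_avg1 c10 t0 (H1 _ _ _ _ tt j).
have yb : `|- (L%:R * a / 2)| <= cy * t.
  rewrite normrN normrM [`|2^-1|]ger0_norm// normrM [`|L%:R|]ger0_norm//.
  case: j => _ ha _; have : L%:R * `|a| <= L%:R * (c0 * t) by rewrite ler_wpM2l.
  have : 0 <= L%:R * `|a| by rewrite mulr_ge0.
  rewrite /cy; lra.
have [J1 _ J3] := H3 _ _ _ _ _ _ _ tt j1 (jet_cis cy0 t0 yb).
move: J1 J3.
have -> : L%:R * a / 2 + - (L%:R * a / 2) = 0 by rewrite subrr.
(* After recentring, the second order term is the variance of a lazy block: [L / 2] times the
   variance [b - a^2] of one step, plus [L^2 a^2 / 4] from the coin that decides whether the block
   is run. *)
have -> : (L%:R * b + L%:R * (L%:R - 1) * a ^+ 2) / 2 + (- (L%:R * a / 2)) ^+ 2 +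
   2 * (L%:R * a / 2) * (- (L%:R * a / 2)) = Q by rewrite /Q; field.
rewrite (ger0_norm Q0) => J1 J3.
have q2 : `|expR (- (Q / 2)) - (1 - Q / 2)| <= c3 ^+ 2 * tau * t ^+ 3.
  apply: (le_trans (expRN_taylor _)); first by rewrite divr_ge0.
  have : Q ^+ 2 <= (c3 * t ^+ 2) ^+ 2 by rewrite lerXn2r ?nnegrE ?mulr_ge0 ?sqr_ge0.
  have -> : (c3 * t ^+ 2) ^+ 2 = c3 ^+ 2 * t * t ^+ 3 by ring.
  have : c3 ^+ 2 * t * t ^+ 3 <= c3 ^+ 2 * tau * t ^+ 3.
    by rewrite ler_wpM2r ?exprn_ge0// ler_wpM2l ?sqr_ge0.
  have := sqr_ge0 Q; rewrite exprMn; lra.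
set z := _ * cis _ in J1 *.
have -> : z - (expR (- (Q / 2)))%:C = (z - ((1 - Q / 2) +i* 0)) +
   (((1 - Q / 2) +i* 0) - (expR (- (Q / 2)))%:C) by rewrite addrA subrK.
apply: (le_trans (cabsD _ _)); rewrite [leRHS]mulrDl; apply: lerD => //.
by rewrite cabsB -[_ +i* 0]/((1 - Q / 2)%:C) -rmorphB cabs_real.
Qed.

End Jets.

(** * Local limit theorem for binomially averaged convolution powers *)

Section Walk.
Variables (R : realType) (d : nat).
Local Open Scope complex_scope.
Local Notation X := 'rV[int]_d.
Local Notation ang th x := (dotp th (toR R x)).
Implicit Types (kap nu : X -> R) (th v : 'rV[R]_d) (x y : X).

Definition wpow kap nu n : X -> R := iter n (fun f => rconv f nu) kap.

Section Basic.
Variables kap nu : X -> R.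
Hypotheses (k0 : forall x, 0 <= kap x) (n0 : forall x, 0 <= nu x).
Hypotheses (sk : summ kap) (sn : summ nu).

Lemma wpow_ge0_summ n : (forall x, 0 <= wpow kap nu n x) /\ summ (wpow kap nu n).
Proof.
elim: n => //= n [IH1 IH2]; split; last exact: summ_rconv.
by move=> x; exact: rconv_ge0.
Qed.

Lemma ft_wpow n th : ft (wpow kap nu n) th = ft kap th * ft nu th ^+ n.
Proof.
elim: n => [|n IH]; first by rewrite expr0 mulr1.
have [p s] := wpow_ge0_summ n.
by rewrite /= ft_rconv// IH exprSr mulrA.
Qed.

Definition binw (K k : nat) : R := 'C(K, k)%:R / 2 ^+ K.

Lemma binw_ge0 K k : 0 <= binw K k.
Proof. by rewrite divr_ge0// exprn_ge0. Qed.

(** The number of blocks [z.1] is binomial and [z.2] runs over the positions in a block, so the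
    power [n] appears once, with weight [binw K (n %/ L)]. The weights sum to [L]. *)
Definition Wsum L K x : R :=
  \sum_(z : 'I_K.+1 * 'I_L) binw K z.1 * wpow kap nu (L * z.1 + z.2) x.

Lemma Wsum_ge0 L K x : 0 <= Wsum L K x.
Proof.
apply: sumr_ge0 => z _; rewrite mulr_ge0 ?binw_ge0//.
by have [p _] := wpow_ge0_summ (L * z.1 + z.2).
Qed.

Lemma summ_Wsum L K : summ (Wsum L K).
Proof.
by apply: summ_big => z _; apply: summZ; have [_ s] := wpow_ge0_summ (L * z.1 + z.2).
Qed.

Lemma ft_Wsum L K th : ft (Wsum L K) th =
  ft kap th * (\sum_(r < L) ft nu th ^+ r) * ((1 + ft nu th ^+ L) / 2) ^+ K.
Proof.
rewrite /Wsum ft_bigsum; last by move=> z _; have [_ s] := wpow_ge0_summ (L * z.1 + z.2).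
set psi := ft nu th.
transitivity (ft kap th * ((\sum_(k < K.+1) (binw K k)%:C * psi ^+ (L * k)) *
   (\sum_(r < L) psi ^+ r))).
  rewrite big_distrlr /= pair_big /= mulr_sumr; apply: eq_bigr => z _.
  by rewrite ft_wpow exprD; ring.
rewrite [X in _ * X]mulrC mulrA; congr (_ * _).
rewrite exprMn exprDn mulr_suml; apply: eq_bigr => k _.
rewrite expr1n mul1r -exprM /binw rmorphM rmorph_nat fmorphV rmorphXn rmorph_nat.
by rewrite exprVn -mulr_natr; ring.
Qed.

End Basic.

(** The lazy average is always at least 1/2, so Gaussian decay can survive only for bounded [y]; on
    the box [y] is bounded and only the rate is lowered. *)
Lemma lazy_bound (y Y : R) : 0 <= y <= Y ->
  (1 + expR (- y)) / 2 <= expR (- (y / (2 * (1 + Y)))).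
Proof.
move=> /andP[y0 yY].
apply: le_trans (expR_ge1Dx _).
have Y1 : 0 < 1 + Y by lra.
have e : expR (- y) <= (1 + y)^-1.
  by rewrite expRN lef_pV2 ?posrE ?expR_gt0// ?expR_ge1Dx//; lra.
have e2 : (1 + y)^-1 <= 1 - y / (1 + Y).
  apply: (@le_trans _ _ (1 - y / (1 + y))).
    rewrite le_eqVlt; apply/orP; left; apply/eqP; field; apply/eqP; lra.
  by rewrite lerD2l lerN2 ler_wpM2l// lef_pV2 ?posrE; lra.
have -> : y / (2 * (1 + Y)) = y / (1 + Y) / 2 by field; rewrite gt_eqF.
lra.
Qed.

(** In the variable [s = sqrt K * t] both prefactors are powers of [s] divided by [sqrt K]; half of
    the Gaussian absorbs the powers of [s]. *)
Lemma poly_gauss (k3 : R) : 0 < k3 -> exists2 C, 0 <= C &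
  forall K t : R, 1 <= K -> 0 <= t ->
  t * expR (- (K * k3 * t ^+ 2)) <= C / Num.sqrt K * expR (- (K * (k3 / 2) * t ^+ 2)) /\
  K * t ^+ 3 * expR (- (K * k3 * t ^+ 2)) <=
    C / Num.sqrt K * expR (- (K * (k3 / 2) * t ^+ 2)).
Proof.
move=> k30; have k2 : 0 < k3 / 2 by rewrite divr_gt0.
pose C1 := 1%:R / (k3 / 2); pose C2 := (2%:R / (k3 / 2)) ^+ 2.
have C10 : 0 <= C1 by rewrite divr_ge0// ltW.
have C20 : 0 <= C2 by rewrite sqr_ge0.
exists (1 + C1 + C2) => [|K t K1 t0]; first by rewrite !addr_ge0.
have K0 : 0 < K by exact: lt_le_trans K1.
have sK : 0 < Num.sqrt K by rewrite sqrtr_gt0.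
set s := Num.sqrt K * t.
have s0 : 0 <= s by rewrite mulr_ge0// ltW.
have s2 : s ^+ 2 = K * t ^+ 2 by rewrite exprMn sqr_sqrtr// ltW.
set e := expR ((k3 / 2) * s ^+ 2).
have h0 : 1 <= e by rewrite -(expR0 R) ler_expR mulr_ge0 ?sqr_ge0 ?ltW.
have h1 : s ^+ 2 <= C1 * e.
  by have := @pow_le_expR R 1 _ _ k2 (sqr_ge0 s); rewrite !expr1.
have h2 : (s ^+ 2) ^+ 2 <= C2 * e := @pow_le_expR R 2 _ _ k2 (sqr_ge0 s).
have e0 : 0 < e := expR_gt0 _.
have C1e : 0 <= C1 * e by rewrite mulr_ge0// ltW.
have C2e : 0 <= C2 * e by rewrite mulr_ge0// ltW.
have E : expR (- (K * k3 * t ^+ 2)) = (e * e)^-1.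
  by rewrite -expRD -expRN s2; congr expR; lra.
have E2 : expR (- (K * (k3 / 2) * t ^+ 2)) = e^-1.
  by rewrite -expRN s2; congr expR; lra.
have b1 : s <= (1 + C1 + C2) * e.
  have : s <= 1 + s ^+ 2 by have := sqr_ge0 (s - 1); have := sqr_ge0 s; lra.
  lra.
have b3 : s ^+ 3 <= (1 + C1 + C2) * e.
  have : s ^+ 3 <= 1 + (s ^+ 2) ^+ 2.
    have [s1|s1] := leP s 1.
      have : s ^+ 3 <= 1 by rewrite exprn_ile1.
      have := sqr_ge0 (s ^+ 2); lra.
    have : s ^+ 3 <= s ^+ 4 by rewrite ler_weXn2l ?ltW.
    rewrite -exprM; lra.
  lra.
rewrite E E2 invfM; split.
  have -> : t = s / Num.sqrt K by rewrite /s; field; rewrite gt_eqF.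
  have -> : s / Num.sqrt K * (e^-1 / e) = s / e / (Num.sqrt K * e) by field; rewrite !gt_eqF.
  have -> : (1 + C1 + C2) / Num.sqrt K / e = (1 + C1 + C2) / (Num.sqrt K * e).
    by field; rewrite !gt_eqF.
  rewrite ler_wpM2r//; first by rewrite invr_ge0 mulr_ge0// ltW.
  by rewrite ler_pdivrMr.
have -> : K * t ^+ 3 = s ^+ 3 / Num.sqrt K.
  have -> : s ^+ 3 = s ^+ 2 * s by rewrite exprSr.
  by rewrite s2 /s; field; rewrite gt_eqF.
have -> : s ^+ 3 / Num.sqrt K * (e^-1 / e) = s ^+ 3 / e / (Num.sqrt K * e).
  by field; rewrite !gt_eqF.
have -> : (1 + C1 + C2) / Num.sqrt K / e = (1 + C1 + C2) / (Num.sqrt K * e).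
  by field; rewrite !gt_eqF.
rewrite ler_wpM2r//; first by rewrite invr_ge0 mulr_ge0// ltW.
by rewrite ler_pdivrMr.
Qed.

Definition cov nu : 'M[R]_d := mom2 nu - (mean nu)^T *m mean nu.

(** Law of total covariance for a step that with probability 1/2 performs [L] steps of the walk and
    otherwise stays. *)
Definition covQ L nu : 'M[R]_d :=
  (L%:R / 2) *: cov nu + (L%:R ^+ 2 / 4) *: ((mean nu)^T *m mean nu).

Lemma qf_outer (m v : 'rV[R]_d) : qf (m^T *m m) v = dotp v m ^+ 2.
Proof.
by rewrite /qf mulmxA -mulmxA (mulmx_trC m v) mxE big_ord1 -dotpE expr2.
Qed.

Lemma qfD (A B : 'M[R]_d) v : qf (A + B) v = qf A v + qf B v.
Proof. by rewrite /qf mulmxDr mulmxDl mxE. Qed.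

Lemma qfN (A : 'M[R]_d) v : qf (- A) v = - qf A v.
Proof. by rewrite /qf mulmxN mulNmx mxE. Qed.

Lemma qfZm (c : R) (A : 'M[R]_d) v : qf (c *: A) v = c * qf A v.
Proof. by rewrite /qf -scalemxAr -scalemxAl mxE. Qed.

Lemma qf_cov nu v : qf (cov nu) v = qf (mom2 nu) v - dotp v (mean nu) ^+ 2.
Proof. by rewrite /cov qfD qfN qf_outer. Qed.

Lemma qf_covQ L nu v : qf (covQ L nu) v =
  L%:R / 2 * (qf (mom2 nu) v - dotp v (mean nu) ^+ 2) +
  L%:R ^+ 2 / 4 * dotp v (mean nu) ^+ 2.
Proof. by rewrite /covQ qfD !qfZm qf_cov qf_outer. Qed.

Lemma cov_sym nu : (cov nu)^T = cov nu.
Proof. by rewrite /cov linearB /= trmx_mul trmxK mom2_sym. Qed.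

Lemma covQ_sym L nu : (covQ L nu)^T = covQ L nu.
Proof. by rewrite /covQ linearD /= !linearZ /= cov_sym trmx_mul trmxK. Qed.

Section Prob.
Variables (del M eps : R) (nu : X -> R).
Hypotheses (d0 : (0 < d)%N) (del0 : 0 < del) (eps0 : 0 < eps).
Hypotheses (Hnu : expmom del M nu) (sp : spread eps nu) (nu1 : sumR nu = 1).

(** The atoms 0 and [e_k] take the values 0 and [v_k], and around any centre [a] one has
    [a^2 + (v_k - a)^2 >= v_k^2 / 2]. Averaging over [k] gives the factor [1 / d]. *)
Lemma cov_lower v : eps / (2 * d%:R) * dotp v v <= qf (cov nu) v.
Proof.
have dp : 0 < d%:R :> R by rewrite ltr0n.
have [s _] := expmom_summ del0 Hnu.
pose a := dotp v (mean nu).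
pose f x := (ang v x - a) ^+ 2 * nu x.
have sa := summ_ang del0 Hnu v; have sa2 := summ_ang2 del0 Hnu v.
have fE : f = fun x => ang v x ^+ 2 * nu x - 2 * a * (ang v x * nu x) + a ^+ 2 * nu x.
  by apply/funext => x; rewrite /f; ring.
have sf : summ f.
  by rewrite fE; apply: summD; [apply: summB => //; exact: summZ | exact: summZ].
have cE : qf (cov nu) v = sumR f.
  rewrite fE sumRD; [|apply: summB => //; exact: summZ|exact: summZ].
  rewrite sumRB//; last exact: summZ.
  rewrite !sumRZ nu1 qf_cov (qf_mom2 del0 Hnu) (dotp_mean del0 Hnu) -/a.
  by rewrite /a (dotp_mean del0 Hnu); ring.
have f0 x : 0 <= f x by rewrite mulr_ge0 ?sqr_ge0// (expmom_ge0 Hnu).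
have one k : eps / 2 * v 0 k ^+ 2 <= sumR f.
  have := @sumR_two_le R d f 0 (ebase k) f0 sf.
  have -> : 0 != ebase k by apply/eqP => /rowP /(_ k); rewrite !mxE !eqxx.
  move=> /(_ isT); rewrite /f toR0 dotp0r ang_ebase sub0r sqrrN => /(le_trans _); apply.
  case: sp => h0 /(_ k) hk.
  have : a ^+ 2 * eps <= a ^+ 2 * nu 0 by rewrite ler_wpM2l ?sqr_ge0.
  have : (v 0 k - a) ^+ 2 * eps <= (v 0 k - a) ^+ 2 * nu (ebase k).
    by rewrite ler_wpM2l ?sqr_ge0.
  have : 0 <= eps * (v 0 k - 2 * a) ^+ 2 by rewrite mulr_ge0 ?sqr_ge0// ltW.
  lra.
rewrite cE.
have -> : eps / (2 * d%:R) * dotp v v = (\sum_(k < d) eps / 2 * v 0 k ^+ 2) / d%:R.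
  rewrite -mulr_sumr; have -> : \sum_(k < d) v 0 k ^+ 2 = dotp v v.
    by apply: eq_bigr => k _; rewrite expr2.
  by field; rewrite gt_eqF.
rewrite ler_pdivrMr// -[d%:R in leRHS]/((d)%:R).
apply: (le_trans (ler_sum _ (fun k _ => one k))).
by rewrite sumr_const card_ord mulr_natr.
Qed.

Lemma covQ_bounded L : (0 < L)%N -> form_bounded (eps / (4 * d%:R))
  (L%:R / 2 * ((2 / del) ^+ 2 * M) + L%:R ^+ 2 / 4 * (M / del) ^+ 2) (covQ L nu).
Proof.
move=> L0; split; first exact: covQ_sym.
move=> v; have dp : 0 < d%:R :> R by rewrite ltr0n.
have L1 : 1 <= L%:R :> R by rewrite ler1n.
have cl := cov_lower v; rewrite qf_cov in cl.
rewrite qf_covQ; set a := dotp v (mean nu); set b := qf (mom2 nu) v.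
have a2 : 0 <= L%:R ^+ 2 / 4 * a ^+ 2 by rewrite mulr_ge0 ?sqr_ge0// divr_ge0 ?sqr_ge0.
have vv := dotp_sqr_ge0 v.
apply/andP; split.
  have -> : eps / (4 * d%:R) * dotp v v = 1 / 2 * (eps / (2 * d%:R) * dotp v v).
    by field; rewrite gt_eqF.
  have : 0 <= eps / (2 * d%:R) * dotp v v.
    by rewrite mulr_ge0// divr_ge0 ?mulr_ge0// ltW.
  move: cl; rewrite -/a -/b; set u := _ * dotp v v; set w := b - a ^+ 2 => uw u0.
  have : L%:R / 2 * u <= L%:R / 2 * w by rewrite ler_wpM2l// divr_ge0.
  have : 1 / 2 * u <= L%:R / 2 * u by rewrite ler_wpM2r//; lra.
  lra.
have hb : b <= dotp v v * (2 / del) ^+ 2 * M.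
  by rewrite -enorm_sqr; have /andP[] := mom2_bound del0 Hnu v.
have ha : a ^+ 2 <= dotp v v * (M / del) ^+ 2.
  have h := mean_bound del0 Hnu v.
  rewrite -[a ^+ 2]real_normK ?num_real// -enorm_sqr -exprMn.
  rewrite lerXn2r ?nnegrE//; last by rewrite mulrA mulrAC.
  by rewrite mulr_ge0 ?enorm_ge0// divr_ge0 ?(expmom_M_ge0 Hnu)// ltW.
rewrite [leRHS]mulrDl; apply: lerD.
  rewrite -[leRHS]mulrA ler_wpM2l ?divr_ge0//.
  have := sqr_ge0 a; lra.
by rewrite -[leRHS]mulrA ler_wpM2l ?divr_ge0 ?sqr_ge0// mulrC.
Qed.

End Prob.

(** The point [x] only has to be within a bounded distance of the mean [K L / 2 * mean nu], since a
    bounded displacement changes the phase by O(t). The constant may depend on [L] but not on the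
    measures, the number of blocks or the point. *)
Lemma llt_Wsum (L : nat) (del M eps M' : R) :
  (0 < d)%N -> (0 < L)%N -> 0 < del -> 0 < eps -> 0 <= M' -> 0 <= M ->
  exists2 C : R, 0 <= C &
  forall nu kap (K : nat) x, expmom del M nu -> spread eps nu -> sumR nu = 1 ->
    expmom del M kap -> (0 < K)%N ->
    (forall k, `|toR R x 0 k - K%:R * L%:R / 2 * mean nu 0 k| <= M') ->
  `|Num.sqrt K%:R ^+ d * Wsum kap nu L K x -
     sumR kap * L%:R * (gauss_const (covQ L nu) / (2 * pi) ^+ d)| <= C / Num.sqrt K%:R.
Proof.
move=> d0 L0 del0 eps0 M'0 M0.
have dp : 0 < d%:R :> R by rewrite ltr0n.
have L1 : 1 <= L%:R :> R by rewrite ler1n.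
pose tau : R := pi * d%:R.
have tau0 : 0 <= tau by rewrite mulr_ge0 ?pi_ge0.
pose M1 := M + 1; have M10 : 0 < M1 by rewrite ltr_wpDl.
pose c0 := 2 * (3 / del) ^+ 3 * M + M / del + (2 / del) ^+ 2 * M.
have c01 : 0 <= 2 * (3 / del) ^+ 3 * M.
  by do 2!apply: mulr_ge0 => //; rewrite exprn_ge0// divr_ge0// ltW.
have c02 : 0 <= M / del by rewrite divr_ge0// ltW.
have c03 : 0 <= (2 / del) ^+ 2 * M by rewrite mulr_ge0 ?sqr_ge0.
have c00 : 0 <= c0 by rewrite !addr_ge0.
have [cz cz0 Hz] := lazy_jet tau0 L c00.
pose k1 := eps / (64 * d%:R * M1).
have k10 : 0 < k1 by rewrite divr_gt0 ?mulr_gt0.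
pose Y := k1 * tau ^+ 2.
have Y0 : 0 <= Y by rewrite mulr_ge0 ?sqr_ge0// ltW.
pose k2 := k1 / (2 * (1 + Y)).
have k20 : 0 < k2 by rewrite divr_gt0// mulr_gt0// ltr_pwDl.
pose kQ := eps / (4 * d%:R).
have kQ0 : 0 < kQ by rewrite divr_gt0 ?mulr_gt0.
(* A common decay rate for the lazy transform and for its Gaussian model, so that the telescoped
   difference of their powers keeps a Gaussian factor. *)
pose k3 := Num.min k2 (kQ / 2).
have k30 : 0 < k3 by rewrite lt_min k20 divr_gt0.
pose B := L%:R / 2 * ((2 / del) ^+ 2 * M) + L%:R ^+ 2 / 4 * (M / del) ^+ 2.
have [cp cp0 Hp] := poly_gauss k30.
pose A0 := 2 * M * L%:R; have A00 : 0 <= A0 by rewrite !mulr_ge0.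
pose cl := 3 / del * M; have cl0 : 0 <= cl by rewrite mulr_ge0// divr_ge0// ltW.
pose A1 := cl * L%:R + M * (L%:R * (L%:R * cl)).
have A10 : 0 <= A1.
  by apply: addr_ge0; [exact: mulr_ge0 | do 3!apply: mulr_ge0 => //].
(* [A0] bounds the prefactor. The bracket collects three errors: displacement of [x] from the mean,
   variation of the prefactor, and replacement of the [K]-th power by the Gaussian. *)
pose MM := A0 + (A0 * (2 * (d%:R * M')) + A1 + M * L%:R * cz * expR (k3 * tau ^+ 2)) * cp.
have e30 : 0 <= expR (k3 * tau ^+ 2) := expR_ge0 _.
have g1 : 0 <= A0 * (2 * (d%:R * M')) by rewrite !mulr_ge0.
have g2 : 0 <= M * L%:R * cz * expR (k3 * tau ^+ 2) by rewrite !mulr_ge0.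
have MM1 : A0 <= MM.
  by rewrite lerDl; apply: mulr_ge0 => //; apply: addr_ge0 => //; exact: addr_ge0.
have MM0 : 0 <= MM by exact: le_trans MM1.
have k32 : 0 < k3 / 2 by rewrite divr_gt0.
have [C C0 HC] := @local_limit R d kQ B (k3 / 2) MM kQ0 k32 MM0.
exists C => // nu kap K x Hnu sp nu1 Hk K0 Hx.
have [sn _] := expmom_summ del0 Hnu; have [sk kM] := expmom_summ del0 Hk.
have n0 := expmom_ge0 Hnu; have k0 := expmom_ge0 Hk.
have sk0 : 0 <= sumR kap by exact: sumR_ge0.
have K1 : 1 <= K%:R :> R by rewrite ler1n.
have Kp : 0 < K%:R :> R by rewrite ltr0n.
apply: HC => //.
- by move=> y; exact: Wsum_ge0.
- exact: summ_Wsum.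
- exact: (covQ_bounded d0 del0 eps0 Hnu sp nu1 L0).
- rewrite ger0_norm ?mulr_ge0//; apply: (@le_trans _ _ A0) => //.
  by rewrite ler_wpM2r// (le_trans kM)// ler_peMl// ler1n.
move=> th box; set t := enorm th.
have t0 : 0 <= t by exact: enorm_ge0.
have tt : 0 <= t <= tau by rewrite t0 box_enorm.
have t2 : dotp th th = t ^+ 2 by rewrite enorm_sqr.
set psi := ft nu th; set a := dotp th (mean nu); set b := qf (mom2 nu) th.
have psi1 : cabs psi <= expR (- (k1 * t ^+ 2)).
  rewrite -t2; have := @cabs_ft_le R d eps M1 nu th d0 n0 sn M10.
  by rewrite nu1 mul1r; apply => //; [rewrite lerDr|exact: ltW].
have psile1 : cabs psi <= 1.
  apply: (le_trans psi1); rewrite -(expR0 R) ler_expR oppr_le0 mulr_ge0 ?sqr_ge0//.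
  exact: ltW.
have jpsi : jet t c0 psi a b.
  split.
  - have := ft_taylor del0 Hnu th; rewrite nu1 => /le_trans; apply.
    by rewrite ler_wpM2r ?exprn_ge0// /c0 -addrA lerDl addr_ge0.
  - have := mean_bound del0 Hnu th; rewrite -/a -/t => /le_trans; apply.
    rewrite mulrAC -mulrA mulrC [M * _]mulrC [del^-1 * _]mulrC; apply: ler_wpM2r => //.
    by rewrite /c0 addrAC lerDr addr_ge0.
  - have /andP[b0 bB] := mom2_bound del0 Hnu th; rewrite ger0_norm//.
    apply: (le_trans bB); rewrite -mulrA mulrC; apply: ler_wpM2r; first exact: sqr_ge0.
    by rewrite /c0 lerDr addr_ge0.
set Qt := qf (covQ L nu) th.
have QE : Qt = L%:R / 2 * (b - a ^+ 2) + L%:R ^+ 2 / 4 * a ^+ 2 by exact: qf_covQ.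
have Ql : kQ * t ^+ 2 <= Qt.
  by rewrite -t2; have [_ /(_ th)/andP[]] := covQ_bounded d0 del0 eps0 Hnu sp nu1 L0.
have Q0 : 0 <= Qt by apply: le_trans Ql; rewrite mulr_ge0 ?sqr_ge0// ltW.
set Psi := (1 + psi ^+ L) / 2; set z := Psi * cis (- (L%:R * a / 2)).
set w := expR (- (Qt / 2)).
have zw : cabs (z - w%:C) <= cz * t ^+ 3.
  have := Hz _ _ _ _ tt jpsi; rewrite -QE; exact.
set rho := expR (- (k3 * t ^+ 2)).
have t2tau : t ^+ 2 <= tau ^+ 2 by case/andP: tt => _ ttau; rewrite lerXn2r ?nnegrE.
have Psib : cabs Psi <= rho.
  apply: (@le_trans _ _ ((1 + expR (- (k1 * t ^+ 2))) / 2)).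
    rewrite /Psi cabsM; have -> : cabs (2^-1 : R[i]) = 2^-1.
      have -> : (2^-1 : R[i]) = (2^-1)%:C by rewrite fmorphV rmorph_nat.
      by rewrite cabs_real ger0_norm.
    rewrite ler_pM2r//; apply: (le_trans (cabsD _ _)); rewrite cabs1 lerD2l cabsX.
    apply: le_trans psi1; rewrite -{2}[cabs psi]expr1; apply: ler_wiXn2l => //.
    exact: cabs_ge0.
  have := @lazy_bound (k1 * t ^+ 2) Y; rewrite mulr_ge0 ?sqr_ge0 ?(ltW k10)//.
  rewrite /Y ler_pM2l// t2tau => /(_ isT) /le_trans; apply.
  rewrite ler_expR lerN2 -/Y.
  have -> : k1 * t ^+ 2 / (2 * (1 + Y)) = k2 * t ^+ 2 by rewrite /k2 mulrAC.
  by rewrite ler_wpM2r ?sqr_ge0// ge_min lexx.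
have zb : cabs z <= rho by rewrite cabsM cabs_cis mulr1.
have w0 : 0 <= w := expR_ge0 _.
have wb : cabs w%:C <= rho.
  rewrite cabs_real ger0_norm// ler_expR lerN2.
  apply: (@le_trans _ _ (kQ / 2 * t ^+ 2)); last by lra.
  by rewrite ler_wpM2r ?sqr_ge0// ge_min lexx orbT.
have rho0 : 0 <= rho := expR_ge0 _.
have rhoK : rho ^+ K = expR (- (K%:R * k3 * t ^+ 2)).
  by rewrite -expRM_natl; congr expR; ring.
(* The telescoped difference of [K]-th powers loses one factor [rho]; on the box [rho] is bounded
   below, so it is restored at a constant price. *)
have rhoK1 : rho ^+ K.-1 <= expR (k3 * tau ^+ 2) * rho ^+ K.
  have -> : rho ^+ K = rho * rho ^+ K.-1 by rewrite -exprS prednK.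
  rewrite mulrA -[leLHS]mul1r.
  rewrite ler_wpM2r ?exprn_ge0//.
  have -> : 1 = expR (k3 * t ^+ 2) * rho by rewrite -expRD subrr expR0.
  by rewrite ler_wpM2r// ler_expR ler_pM2l.
set r := (fun k => toR R x 0 k - K%:R * L%:R / 2 * mean nu 0 k).
pose rv : 'rV[R]_d := toR R x - (K%:R * L%:R / 2) *: mean nu.
have angx : ang th x = dotp th rv + (L%:R * a / 2) *+ K.
  rewrite /rv dotpDr dotpNr dotpZr -/a -mulr_natr; ring.
have rvb : `|dotp th rv| <= d%:R * M' * t.
  rewrite /dotp; apply: (le_trans (ler_norm_sum _ _ _)).
  apply: (@le_trans _ _ (\sum_(k < d) M' * t)).
    apply: ler_sum => k _; rewrite normrM mulrC; apply: ler_pM => //.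
      by have := Hx k; rewrite /rv !mxE.
    exact: coord_le_enorm.
  by rewrite sumr_const card_ord -[leLHS]mulr_natl mulrA.
set S := \sum_(r < L) psi ^+ r; set A := ft kap th * S.
set a0 := sumR kap * L%:R.
have ftE : ft (Wsum kap nu L K) th * cis (- ang th x) = A * z ^+ K * cis (- dotp th rv).
  have zK : z ^+ K = Psi ^+ K * cis (- ((L%:R * a / 2) *+ K)).
    by rewrite /z exprMn -cisMn mulNrn.
  by rewrite ft_Wsum// -/psi -/S -/Psi zK angx opprD cisD /A; ring.
have wK : a0 * expR (- (K%:R * Qt) / 2) = a0 * w ^+ K.
  by rewrite -expRM_natl; congr (_ * expR _); ring.
have Sb : cabs S <= L%:R.
  apply: (le_trans (cabs_sum _ _ _)); rewrite -[L in leRHS]card_ord -sum1_card natr_sum.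
  by apply: ler_sum => i _; rewrite cabsX exprn_ile1 ?cabs_ge0.
have Ab : cabs A <= A0.
  rewrite /A cabsM; apply: ler_pM; rewrite ?cabs_ge0//.
  by apply: (le_trans (cabs_ft _ k0 sk)); rewrite ler_pM2l.
have S1 : cabs (S - L%:R) <= L%:R * (L%:R * cl) * t.
  have -> : (L%:R : R[i]) = \sum_(r < L) 1 by rewrite sumr_const card_ord.
  rewrite -sumrB; apply: (le_trans (cabs_sum _ _ _)).
  have -> : L%:R * (L%:R * cl) * t = \sum_(r < L) (L%:R * (cl * t)).
    by rewrite sumr_const card_ord -mulr_natl; ring.
  apply: ler_sum => i _; rewrite -[1](expr1n _ i).
  have := @cabs_exprB R psi 1 i 1 psile1; rewrite cabs1 lexx => /(_ isT) /le_trans; apply.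
  rewrite expr1n mulr1; apply: ler_pM; rewrite ?cabs_ge0//.
    by rewrite ler_nat ltnW.
  by have := ft_lip del0 Hnu th; rewrite nu1.
have Aa : cabs (A - a0%:C) <= A1 * t.
  have -> : A - a0%:C = (ft kap th - (sumR kap)%:C) * S + (sumR kap)%:C * (S - L%:R).
    by rewrite /a0 rmorphM rmorph_nat /A; ring.
  apply: (le_trans (cabsD _ _)); rewrite [leRHS]mulrDl; apply: lerD; rewrite cabsM.
    rewrite mulrAC; apply: ler_pM; rewrite ?cabs_ge0//.
    exact: ft_lip.
  rewrite -[leRHS]mulrA; apply: ler_pM; rewrite ?cabs_ge0//.
  by rewrite cabs_real ger0_norm.
have zKb : cabs (z ^+ K) <= rho ^+ K by rewrite cabsX lerXn2r ?nnegrE ?cabs_ge0.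
have zwK : cabs (z ^+ K - (w ^+ K)%:C) <=
    K%:R * t ^+ 3 * rho ^+ K * (cz * expR (k3 * tau ^+ 2)).
  rewrite rmorphXn; apply: (le_trans (cabs_exprB K zb wb)).
  apply: (@le_trans _ _ (K%:R * (expR (k3 * tau ^+ 2) * rho ^+ K) * (cz * t ^+ 3))).
    apply: ler_pM => //; rewrite ?cabs_ge0// ?mulr_ge0 ?exprn_ge0//.
    by rewrite ler_wpM2l.
  by rewrite le_eqVlt; apply/orP; left; apply/eqP; ring.
rewrite ftE wK; set c := cis (- dotp th rv).
have -> : A * z ^+ K * c - (a0 * w ^+ K)%:C =
   A * z ^+ K * (c - 1) + (A - a0%:C) * z ^+ K + a0%:C * (z ^+ K - (w ^+ K)%:C).
  by rewrite rmorphM /=; ring.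
have c1 : cabs (c - 1) <= 2 * (d%:R * M') * t.
  by apply: (le_trans (cis_sub1 _)); rewrite normrN -mulrA ler_pM2l.
have rK0 : 0 <= rho ^+ K by rewrite exprn_ge0.
have T1 : cabs (A * z ^+ K * (c - 1)) <= A0 * (2 * (d%:R * M')) * (t * rho ^+ K).
  rewrite cabsM; apply: (@le_trans _ _ (A0 * rho ^+ K * (2 * (d%:R * M') * t))).
    apply: ler_pM; rewrite ?cabs_ge0// cabsM; apply: ler_pM; rewrite ?cabs_ge0//.
  by rewrite le_eqVlt; apply/orP; left; apply/eqP; ring.
have T2 : cabs ((A - a0%:C) * z ^+ K) <= A1 * (t * rho ^+ K).
  rewrite cabsM; apply: (@le_trans _ _ (A1 * t * rho ^+ K)).
    by apply: ler_pM; rewrite ?cabs_ge0.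
  by rewrite mulrA.
have a0M : `|a0| <= M * L%:R by rewrite ger0_norm ?mulr_ge0// ler_wpM2r.
have T3 : cabs (a0%:C * (z ^+ K - (w ^+ K)%:C)) <=
   M * L%:R * cz * expR (k3 * tau ^+ 2) * (K%:R * t ^+ 3 * rho ^+ K).
  rewrite cabsM cabs_real; apply: (@le_trans _ _ (M * L%:R *
     (K%:R * t ^+ 3 * rho ^+ K * (cz * expR (k3 * tau ^+ 2))))).
    by apply: ler_pM; rewrite ?cabs_ge0.
  by rewrite le_eqVlt; apply/orP; left; apply/eqP; ring.
have [P1 P2] := Hp _ _ K1 t0; rewrite -rhoK in P1 P2.
set V := expR (- (K%:R * (k3 / 2) * t ^+ 2)) in P1 P2.
rewrite t2 -/V.
have V0 : 0 <= V := expR_ge0 _.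
have sKp : 0 < Num.sqrt K%:R :> R by rewrite sqrtr_gt0.
set U := cp / Num.sqrt K%:R * V in P1 P2.
apply: (le_trans (cabsD _ _)).
apply: (@le_trans _ _ ((A0 * (2 * (d%:R * M')) + A1 +
   M * L%:R * cz * expR (k3 * tau ^+ 2)) * U)).
  rewrite [leRHS]mulrDl [X in _ <= X + _]mulrDl; apply: lerD; last first.
    by apply: (le_trans T3); rewrite ler_wpM2l.
  apply: (le_trans (cabsD _ _)); apply: lerD.
    by apply: (le_trans T1); rewrite ler_wpM2l.
  by apply: (le_trans T2); rewrite ler_wpM2l.
have -> : forall q, q * U = q * cp / Num.sqrt K%:R * V by move=> q; rewrite /U; ring.
rewrite ler_wpM2r// ler_wpM2r ?invr_ge0 ?(ltW sKp)// /MM lerDr//.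
Qed.

End Walk.

(** * Exponential tilting and the convex set [phi <= 1] *)

Section Tilt.
Variables (R : realType) (d : nat).
Local Notation X := 'rV[int]_d.
Local Notation ang th x := (dotp th (toR R x)).
Implicit Types (f nu : X -> R) (al be w : 'rV[R]_d) (x : X).

Definition tilt al f x : R := expR (ang al x) * f x.

Lemma tilt_ge0 al f : (forall x, 0 <= f x) -> forall x, 0 <= tilt al f x.
Proof. by move=> f0 x; rewrite mulr_ge0 ?expR_ge0. Qed.

Lemma tiltE al be f x : tilt be f x = expR (ang (be - al) x) * tilt al f x.
Proof. by rewrite /tilt mulrA -expRD -dotpDl subrK. Qed.

Lemma expmom_weaken (del del' M M' : R) f : 0 <= del' <= del -> M <= M' ->
  expmom del M f -> expmom del' M' f.
Proof.
move=> /andP[d'0 dd] MM [f0 s sM].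
have le x : expR (del' * n1 R x) * f x <= expR (del * n1 R x) * f x.
  by rewrite ler_wpM2r// ler_expR ler_wpM2r// n1_ge0.
have s' : summ (fun x => expR (del' * n1 R x) * f x).
  by apply: summ_le s => x; rewrite ger0_norm// mulr_ge0 ?expR_ge0.
by split => //; apply: le_trans MM; apply: le_trans sM; exact: le_sumR.
Qed.

Section Perturb.
Variables (del M : R) (f : X -> R) (al be : 'rV[R]_d) (r : R).
Hypotheses (del0 : 0 < del) (Hf : expmom del M (tilt al f)).
Hypotheses (r0 : 0 <= r) (rdel : r <= del / 4).
Hypothesis (close : forall k, `|(be - al) 0 k| <= r).

Lemma expmom_perturb : expmom (del / 2) M (tilt be f).
Proof.
case: Hf => f0 s sM.
have f0' x : 0 <= tilt be f x by rewrite (tiltE al) mulr_ge0 ?expR_ge0.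
have le x : expR (del / 2 * n1 R x) * tilt be f x <= expR (del * n1 R x) * tilt al f x.
  rewrite (tiltE al be) mulrA -expRD ler_wpM2r// ler_expR.
  have := dotp_le_coord x close; have n0 := n1_ge0 R x.
  have : r * n1 R x <= del / 4 * n1 R x by rewrite ler_wpM2r.
  have := ler_norm (ang (be - al) x); have : 0 <= del * n1 R x by rewrite mulr_ge0// ltW.
  lra.
have s' : summ (fun x => expR (del / 2 * n1 R x) * tilt be f x).
  by apply: summ_le s => x; rewrite ger0_norm// mulr_ge0 ?expR_ge0.
by split => //; apply: le_trans sM; exact: le_sumR.
Qed.

(** The rate [del] is spent as follows: half on [q], a quarter on the change of tilt, and a quarter
    on the factor [n1] that the change brings down. *)
Lemma perturb_lip (q : X -> R) (cq : R) : 0 <= cq ->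
  (forall x, `|q x| <= cq * expR (del / 2 * n1 R x)) ->
  `|sumR (fun x => q x * tilt be f x) - sumR (fun x => q x * tilt al f x)| <=
  r * (cq * (4 / del) * M).
Proof.
move=> cq0 hq.
have d4 : 0 < del / 4 by rewrite divr_gt0.
have d2 : 0 < del / 2 by rewrite divr_gt0.
have sq g : expmom (del / 2) M g -> summ (fun x => q x * g x).
  by move=> Hg; have [] := expmom_summ_bound Hg cq0 hq.
have Ha : expmom (del / 2) M (tilt al f).
  apply: expmom_weaken (lexx M) Hf; lra.
rewrite -sumRB; [|exact: sq expmom_perturb|exact: sq Ha].
pose g x := q x * (expR (ang (be - al) x) - 1).
rewrite (eq_sumR (g := fun x => g x * tilt al f x)); last first.
  by move=> x; rewrite (tiltE al be) /g; ring.
rewrite mulrA; apply: (expmom_summ_bound Hf _ _).2.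
  by rewrite !mulr_ge0// invr_ge0 ltW.
move=> x; rewrite /g normrM.
have n0 := n1_ge0 R x.
have e1 : `|expR (ang (be - al) x) - 1| <= r * (4 / del) * expR (del / 2 * n1 R x).
  apply: (le_trans (expR_sub1_le _)).
  have a1 : `|ang (be - al) x| <= r * n1 R x by exact: dotp_le_coord.
  apply: (@le_trans _ _ (r * n1 R x * expR (del / 4 * n1 R x))).
    apply: ler_pM => //.
    by rewrite ler_expR (le_trans a1)// ler_wpM2r.
  have := @pow_le_expR R 1 _ _ d4 n0; rewrite !expr1 => h1.
  have -> : expR (del / 2 * n1 R x) = expR (del / 4 * n1 R x) * expR (del / 4 * n1 R x).
    by rewrite -expRD; congr expR; lra.
  rewrite mulrA ler_wpM2r ?expR_ge0// -mulrA ler_wpM2l//.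
  apply: (le_trans h1); rewrite ler_wpM2r ?expR_ge0//.
  by rewrite le_eqVlt; apply/orP; left; apply/eqP; field; rewrite gt_eqF.
have -> : r * (cq * (4 / del)) * expR (del * n1 R x) =
   (cq * expR (del / 2 * n1 R x)) * (r * (4 / del) * expR (del / 2 * n1 R x)).
  have -> : expR (del * n1 R x) = expR (del / 2 * n1 R x) * expR (del / 2 * n1 R x).
    by rewrite -expRD; congr expR; lra.
  ring.
exact: ler_pM.
Qed.

End Perturb.

(** [expR_le_quad] is summed pointwise. The factor [(8 / del)^2] is the price of absorbing [n1^2]
    into [expR (del / 4 * n1)]. *)
Lemma mgf_upper (del M : R) f al w (t : R) : 0 < del -> expmom del M (tilt al f) ->
  (forall k, `|w 0 k| <= 1) -> `|t| <= del / 4 ->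
  sumR (tilt (al + t *: w) f) <=
  sumR (tilt al f) + t * dotp w (mean (tilt al f)) + t ^+ 2 * ((8 / del) ^+ 2 * M).
Proof.
move=> del0 Hf w1 td.
have d4 : 0 < del / 4 by rewrite divr_gt0.
have close k : `|(al + t *: w - al) 0 k| <= `|t|.
  by rewrite addrC addrA addNr add0r mxE normrM ler_piMr.
have H2 := expmom_perturb del0 Hf td close.
have d2 : 0 < del / 2 by rewrite divr_gt0.
have [s2 _] := expmom_summ d2 H2; have [s1 _] := expmom_summ del0 Hf.
have f0 := expmom_ge0 Hf.
pose q x := (t * ang w x) ^+ 2 * expR `|t * ang w x|.
have qb x : `|q x| <= t ^+ 2 * (8 / del) ^+ 2 * expR (del * n1 R x).
  have n0 := n1_ge0 R x.
  have a1 : `|ang w x| <= n1 R x by rewrite -[leRHS]mul1r dotp_le_coord.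
  have a2 : `|t * ang w x| <= del / 4 * n1 R x by rewrite normrM; exact: ler_pM.
  rewrite ger0_norm; last by rewrite mulr_ge0 ?sqr_ge0 ?expR_ge0.
  apply: (@le_trans _ _ (t ^+ 2 * n1 R x ^+ 2 * expR (del / 4 * n1 R x))).
    apply: ler_pM; rewrite ?sqr_ge0 ?expR_ge0// ?ler_expR//.
    rewrite exprMn ler_wpM2l ?sqr_ge0// -[_ ^+ 2]real_normK ?num_real//.
    by rewrite lerXn2r ?nnegrE.
  rewrite -[leLHS]mulrA -[leRHS]mulrA ler_wpM2l ?sqr_ge0//.
  have h := @pow_le_expR R 2 _ _ d4 n0.
  apply: (@le_trans _ _ ((2%:R / (del / 4)) ^+ 2 * expR (del / 4 * n1 R x) *
     expR (del / 4 * n1 R x))).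
    by rewrite ler_wpM2r ?expR_ge0.
  have -> : 2%:R / (del / 4) = 8 / del by field; rewrite gt_eqF.
  rewrite -mulrA ler_wpM2l ?sqr_ge0// -expRD ler_expR.
  have : 0 <= del * n1 R x by rewrite mulr_ge0// ltW.
  lra.
have c0 : 0 <= t ^+ 2 * (8 / del) ^+ 2 by rewrite mulr_ge0 ?sqr_ge0.
have [sq qM] := expmom_summ_bound Hf c0 qb.
have sa := summ_ang del0 Hf w.
rewrite (dotp_mean del0 Hf) -sumRZ -sumRD//; last exact: summZ.
rewrite mulrA; apply: le_trans (lerD (lexx _) (le_trans (ler_norm _) qM)).
rewrite -sumRD//; last by apply: summD => //; exact: summZ.
apply: le_sumR => //; first by apply: summD => //; apply: summD => //; exact: summZ.
move=> x; rewrite (tiltE al) addrAC subrr add0r dotpZl /q.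
have := expR_le_quad (t * ang w x).
set e := expR (t * _) => h.
have := ler_wpM2r (f0 x) h; lra.
Qed.

(** Summability is part of membership: [sumR] of a divergent nonnegative family is 0, so the
    inequality alone would admit tilts with infinite Laplace transform. *)
Definition Dset nu : set 'rV[R]_d :=
  [set al | summ (tilt al nu) /\ sumR (tilt al nu) <= 1].

(** The margin [del] may depend on the point, boundary points included; compactness makes it
    uniform. *)
Definition local_mom nu f := forall al, Dset nu al ->
  exists2 del : R, 0 < del & summ (fun x => expR (del * n1 R x) * tilt al f x).

Section ConvexSet.
Variable nu : X -> R.
Hypothesis nu_pos : forall x, 0 < nu x.

Let nu0 x : 0 <= nu x := ltW (nu_pos x).

(** Each atom alone gives [expR (ang al x) * nu x <= 1]; the atoms at plus and minus [e_k] bound the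
    coordinate from both sides. *)
Lemma Dset_coord : exists2 B0 : R, 0 <= B0 & forall al, Dset nu al -> forall k, `|al 0 k| <= B0.
Proof.
pose L x : R := `|ln (nu x)|.
have L0 x : 0 <= L x by exact: normr_ge0.
exists (\sum_k (L (ebase k) + L (- ebase k))).
  by apply: sumr_ge0 => k _; rewrite addr_ge0 ?L0.
move=> al [s le1] k.
have key x : ang al x <= L x.
  have h : tilt al nu x <= 1.
    by apply: le_trans le1; apply: sumR_term_le => //; exact: tilt_ge0.
  have : ang al x + ln (nu x) <= 0.
    by rewrite -ler_expR expR0 expRD lnK ?posrE.
  have := ler_norm (- ln (nu x)); rewrite normrN -/(L x); lra.
have kb : L (ebase k) + L (- ebase k) <= \sum_j (L (ebase j) + L (- ebase j)).
  by rewrite (bigD1 k)//= lerDl sumr_ge0// => j _; rewrite addr_ge0 ?L0.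
have := key (ebase k); have := key (- ebase k).
rewrite toRN dotpNr ang_ebase => h1 h2.
have := normr_ge0 (ln (nu (ebase k))); have := normr_ge0 (ln (nu (- ebase k))).
rewrite -/(L _) -/(L _) ler_norml; lra.
Qed.

(** A Fatou argument: it suffices to bound each finite partial sum by 1, and a finite sum changes by
    a factor at most [expR (e * N)] between tilts at distance [e]. *)
Lemma Dset_closed : closed (Dset nu).
Proof.
move=> al cl.
have le1 : (\esum_(x in setT) (tilt al nu x)%:E <= 1%:E)%E.
  apply: ge_ereal_sup => /= _ [A [finA _] <-].
  rewrite fsbig_finite//= sumEFin lee_fin.
  set s : seq X := finmap.enum_fset (fset_set A).
  rewrite -[X in X <= 1]/(\sum_(x <- s) tilt al nu x).
  pose N : R := \sum_(x <- s) n1 R x.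
  have N0 : 0 <= N by apply: sumr_ge0 => x _; exact: n1_ge0.
  apply/ler_addgt0Pr => eta eta0.
  pose e := Num.min 1 (eta / (N * expR N + 1)).
  have Np : 0 < N * expR N + 1 by rewrite ltr_wpDl// mulr_ge0 ?expR_ge0.
  have e0 : 0 < e by rewrite lt_min ltr01 divr_gt0.
  have [be [[sb ble] bb]] := cl _ (nbhsx_ballx al e e0).
  have close k : `|(al - be) 0 k| <= e.
    by have [_ /(_ 0 k)/ltW] := bb; rewrite !mxE.
  have eN : expR (e * N) <= 1 + eta.
    have := expR_sub1_le (e * N).
    have eN0 : 0 <= e * N by rewrite mulr_ge0// ltW.
    rewrite (ger0_norm eN0) => /(le_trans (ler_norm _)) h.
    have h2 : e * N * expR (e * N) <= e * (N * expR N).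
      rewrite -mulrA; apply: ler_wpM2l; first exact: ltW.
      by rewrite ler_wpM2l// ler_expR ler_piMl// ge_min lexx.
    have h3 : e * (N * expR N + 1) <= eta by rewrite -ler_pdivlMr// ge_min lexx orbT.
    have := ltW e0; lra.
  apply: le_trans eN.
  apply: (@le_trans _ _ (\sum_(x <- s) expR (e * N) * tilt be nu x)).
    rewrite !big_seq; apply: ler_sum => x xs.
    rewrite (tiltE be al) ler_wpM2r ?tilt_ge0// ler_expR.
    apply: (le_trans (ler_norm _)); apply: (le_trans (dotp_le_coord x close)).
    rewrite ler_wpM2l ?(ltW e0)// /N (big_rem x)//= lerDl.
    by apply: sumr_ge0 => y _; exact: n1_ge0.
  rewrite -mulr_sumr -[leRHS]mulr1 ler_pM2l ?expR_gt0//.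
  apply: le_trans ble; rewrite -lee_fin ge0_sumRE//; last exact: tilt_ge0.
  rewrite -sumEFin; apply: esum_ge; exists A => //.
  by rewrite fsbig_finite.
have t0 := tilt_ge0 al nu0.
have s : summ (tilt al nu) by rewrite summ_esum//; exact: le_lt_trans le1 (ltry _).
by split => //; rewrite -lee_fin ge0_sumRE.
Qed.

Lemma Dset_compact : compact (Dset nu).
Proof.
have [B0 B00 HB] := Dset_coord.
apply: (subclosed_compact Dset_closed (B := [set v : 'rV[R]_d |
    forall i, `[(- B0), B0]%classic (v ord0 i)])).
  by apply: (@rV_compact _ _ (fun=> `[(- B0), B0]%classic)) => i; exact: segment_compact.
move=> al Da i /=; rewrite in_itv /=.
by have := HB _ Da i; rewrite ler_norml.
Qed.

(** A moment of rate [del] at [al] gives rate [del / 2], with the same bound, on the ball of radius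
    [del / 2] around [al]. Compactness then selects one rate and one bound. *)
Lemma unif_expmom f : (forall x, 0 <= f x) -> local_mom nu f ->
  exists del M : R, [/\ 0 < del, 0 < M & forall al, Dset nu al -> expmom del M (tilt al f)].
Proof.
move=> f0 Hf.
have /compact_near_coveringP cov := Dset_compact.
(* One integer encodes both parameters: as [n] grows, the rate [1 / (n + 1)] and the bound [n + 1]
   become jointly less demanding. *)
have := cov nat \oo (fun n al => expmom (n.+1%:R^-1) n.+1%:R (tilt al f)) _.
case=> [al Da|N _ HN].
  have [del del0 s] := Hf _ Da.
  pose S := sumR (fun x => expR (del * n1 R x) * tilt al f x).
  pose n0 := (Num.truncn (Num.max (2 / del) S)).+1.
  have n0b : Num.max (2 / del) S <= n0%:R by apply/ltW; exact: truncnS_gt.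
  move: n0b; rewrite ge_max => /andP[n1b n2b].
  have d2 : 0 < del / 2 by rewrite divr_gt0.
  exists (ball al (del / 2), [set n | (n0 <= n)%N]).
    by split; [exact: nbhsx_ballx | exists n0].
  move=> [be n] /= [bb n0n].
  have nn : n0%:R <= n.+1%:R :> R by rewrite ler_nat leqW.
  have close k : `|(be - al) 0 k| <= del / 2.
    by rewrite !mxE distrC; have [_] := bb; move=> /(_ 0 k)/ltW.
  have t0 := tilt_ge0 be f0.
  have le x : expR (n.+1%:R^-1 * n1 R x) * tilt be f x <= expR (del * n1 R x) * tilt al f x.
    rewrite (tiltE al be) mulrA -expRD ler_wpM2r ?tilt_ge0// ler_expR.
    have h := le_trans (ler_norm _) (dotp_le_coord x close).
    have n0' := n1_ge0 R x.
    have : n.+1%:R^-1 * n1 R x <= del / 2 * n1 R x.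
      rewrite ler_wpM2r//; have -> : del / 2 = (2 / del)^-1 by rewrite invf_div.
      rewrite lef_pV2 ?posrE ?divr_gt0// ?ltr0n//; lra.
    move: (_^-1 * n1 R x) => a; lra.
  have s' : summ (fun x => expR (n.+1%:R^-1 * n1 R x) * tilt be f x).
    by apply: summ_le s => x; rewrite ger0_norm// mulr_ge0 ?expR_ge0.
  by split => //; apply: (@le_trans _ _ S); [exact: le_sumR | lra].
exists N.+1%:R^-1, N.+1%:R; split => // al Da.
by have := HN N (leqnn N); apply.
Qed.

End ConvexSet.

End Tilt.

(** * Support points of the convex set *)

Section Support.
Variables (R : realType) (d : nat).
Local Notation X := 'rV[int]_d.
Local Notation ang th x := (dotp th (toR R x)).

Lemma continuous_sum (T : topologicalType) (I : Type) (s : seq I) (F : I -> T -> R) :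
  (forall i, continuous (F i)) -> continuous (fun t => \sum_(i <- s) F i t).
Proof.
move=> cF; elim: s => [|i s IH].
  have -> : (fun t => \sum_(i <- [::]) F i t) = cst 0.
    by apply/funext => t; rewrite big_nil.
  exact: cst_continuous.
have -> : (fun t => \sum_(j <- i :: s) F j t) = (fun t => F i t + \sum_(j <- s) F j t).
  by apply/funext => t; rewrite big_cons.
by move=> t; apply: cvgD; [exact: cF|exact: IH].
Qed.

Lemma continuous_prod (T : topologicalType) (I : Type) (s : seq I) (F : I -> T -> R) :
  (forall i, continuous (F i)) -> continuous (fun t => \prod_(i <- s) F i t).
Proof.
move=> cF; elim: s => [|i s IH].
  have -> : (fun t => \prod_(i <- [::]) F i t) = cst 1.
    by apply/funext => t; rewrite big_nil.
  exact: cst_continuous.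
have -> : (fun t => \prod_(j <- i :: s) F j t) = (fun t => F i t * \prod_(j <- s) F j t).
  by apply/funext => t; rewrite big_cons.
by move=> t; apply: cvgM; [exact: cF|exact: IH].
Qed.

Lemma continuous_det (T : topologicalType) n (F : T -> 'M[R]_n) :
  (forall i j, continuous (fun t => F t i j)) -> continuous (fun t => \det (F t)).
Proof.
move=> cF; rewrite /determinant; apply: continuous_sum => s t.
apply: cvgM; first exact: cvg_cst.
by apply: continuous_prod => i; exact: cF.
Qed.

Lemma dotp_continuous (u : 'rV[R]_d) : continuous (dotp u).
Proof.
apply: continuous_sum => k v.
have h : continuous (fun v : 'rV[R]_d => v 0 k) by exact: coord_continuous.
exact: (continuous_comp (h v) (@mulrl_continuous R (u 0 k) _)).
Qed.

Lemma dotp_le_sum (u v : 'rV[R]_d) (r : R) : (forall k, `|u 0 k| <= r) ->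
  `|dotp u v| <= d%:R * r * enorm v.
Proof.
move=> ur; apply: (le_trans (ler_norm_sum _ _ _)).
apply: (@le_trans _ _ (\sum_(k < d) r * enorm v)).
  by apply: ler_sum => k _; rewrite normrM; apply: ler_pM => //; exact: coord_le_enorm.
by rewrite sumr_const card_ord -[leLHS]mulr_natl mulrA.
Qed.

Lemma enorm_eq0 (v : 'rV[R]_d) : dotp v v <= 0 -> v = 0.
Proof.
move=> h; apply/rowP => k; rewrite mxE; apply/eqP; rewrite -normr_le0.
apply: (le_trans (coord_le_enorm v k)).
have : enorm v ^+ 2 <= 0 by rewrite enorm_sqr.
by move=> h2; rewrite leNgt; apply/negP => h3; have := exprn_gt0 2 h3; lra.
Qed.

Lemma sphere_coord (u : 'rV[R]_d) k : sphere u -> `|u 0 k| <= 1.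
Proof. by move=> su; rewrite -[leRHS]su; exact: coord_le_enorm. Qed.

Lemma sphere_dotp (u : 'rV[R]_d) : sphere u -> dotp u u = 1.
Proof. by move=> su; rewrite -enorm_sqr su expr1n. Qed.

Variable nu : X -> R.
Hypothesis nu_pos : forall x, 0 < nu x.
Hypothesis nu_mom : local_mom nu nu.
Variable al0 : 'rV[R]_d.
Hypothesis al0_D : Dset nu al0.
Hypothesis al0_lt1 : sumR (tilt al0 nu) < 1.

Let nu0 x : 0 <= nu x := ltW (nu_pos x).

Lemma spread_tilt (B : R) : exists2 eps : R, 0 < eps &
  forall al : 'rV[R]_d, (forall k, `|al 0 k| <= B) -> spread eps (tilt al nu).
Proof.
pose S := (nu 0)^-1 + \sum_k (nu (ebase k))^-1.
have i0 x : 0 < (nu x)^-1 by rewrite invr_gt0.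
have sk : 0 <= \sum_(k < d) (nu (ebase k))^-1 by apply: sumr_ge0 => k _; exact: ltW.
have S0 : 0 < S by rewrite ltr_pwDl.
have h0 : S^-1 <= nu 0 by rewrite -[leRHS]invrK lef_pV2 ?posrE// lerDl.
have hk k : S^-1 <= nu (ebase k).
  rewrite -[leRHS]invrK lef_pV2 ?posrE// /S (bigD1 k)//=.
  have : 0 <= \sum_(i < d | i != k) (nu (ebase i))^-1 by apply: sumr_ge0 => i _; exact: ltW.
  have := i0 0; lra.
exists (expR (- `|B|) * S^-1); first by rewrite mulr_gt0 ?expR_gt0 ?invr_gt0.
move=> al alB; have eB : expR (- `|B|) <= 1 by rewrite -(expR0 R) ler_expR oppr_le0.
have S1 : 0 <= S^-1 by rewrite invr_ge0 ltW.
split=> [|k]; rewrite /tilt.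
  by rewrite toR0 dotp0r expR0 mul1r; apply: le_trans h0; rewrite ler_piMl.
apply: ler_pM => //.
rewrite ler_expR ang_ebase; have := alB k; rewrite ler_norml; have := ler_norm B.
lra.
Qed.

Lemma support_exists : exists c : 'rV[R]_d -> 'rV[R]_d, forall u,
  Dset nu (c u) /\ forall be, Dset nu be -> dotp u be <= dotp u (c u).
Proof.
suff h u : exists a, Dset nu a /\ forall be, Dset nu be -> dotp u be <= dotp u a.
  by have [c Hc] := boolp.choice h; exists c.
have [c cD cmax] := @compact_EVT_max _ R (dotp u) (Dset nu) (ex_intro _ al0 al0_D)
  (Dset_compact nu_pos) (continuous_subspaceT (@dotp_continuous u)).
exists c; rewrite inE in cD; split => // be Db.
by apply: cmax; rewrite inE.
Qed.

Section AtPoint.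
Variables (del M : R) (u al : 'rV[R]_d).
Hypotheses (del0 : 0 < del) (HM : expmom del M (tilt al nu)).
Hypotheses (su : sphere u) (alD : Dset nu al).
Hypothesis (almax : forall be, Dset nu be -> dotp u be <= dotp u al).

Let C := (8 / del) ^+ 2 * M.
Let C0 : 0 <= C.
Proof. by rewrite mulr_ge0 ?sqr_ge0 ?(expmom_M_ge0 HM). Qed.

Local Notation m := (mean (tilt al nu)).
Local Notation phi al := (sumR (tilt al nu)).

(** A move with positive component along [u] leaves the set, by maximality of [al]; as the moved
    tilt is still summable, phi must exceed 1 there, and [mgf_upper] bounds phi from above. *)
Lemma leaves_D (w : 'rV[R]_d) (t : R) : (forall k, `|w 0 k| <= 1) -> 0 < dotp u w ->
  0 < t <= del / 4 -> 1 < phi al + t * dotp w m + t ^+ 2 * C.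
Proof.
move=> w1 uw /andP[t0 td].
have td' : `|t| <= del / 4 by rewrite gtr0_norm.
have close k : `|(al + t *: w - al) 0 k| <= `|t|.
  by rewrite addrC addrA addNr add0r mxE normrM ler_piMr.
have H2 := expmom_perturb del0 HM td' close.
have d2 : 0 < del / 2 by rewrite divr_gt0.
have [s2 _] := expmom_summ d2 H2.
apply: lt_le_trans (mgf_upper del0 HM w1 td').
rewrite ltNge; apply/negP => le1.
have := almax (conj s2 le1); rewrite dotpDr dotpZr.
have : 0 < t * dotp u w by rewrite mulr_gt0.
lra.
Qed.

(** A gap [g] below 1 would leave room for a short move along [u] inside the set. *)
Lemma phi_support : phi al = 1.
Proof.
apply/eqP; rewrite eq_le; case: (alD) => _ -> /=; rewrite leNgt; apply/negP => lt1.
have u1 k := sphere_coord k su.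
have uu := sphere_dotp su.
pose g := 1 - phi al; have g0 : 0 < g by rewrite subr_gt0.
pose K := `|dotp u m| + C + 1.
have K0 : 0 < K by rewrite ltr_wpDl// addr_ge0.
pose t := Num.min (Num.min (del / 4) 1) (g / K).
have t0 : 0 < t by rewrite !lt_min !divr_gt0// ltr01.
have t1 : t <= 1 by rewrite !ge_min lexx orbT.
have td : t <= del / 4 by rewrite !ge_min lexx.
have tg : t * K <= g by rewrite -ler_pdivlMr// !ge_min lexx orbT.
have := @leaves_D u t u1; rewrite uu ltr01 t0 td => /(_ isT isT).
have : t * dotp u m <= t * `|dotp u m| by rewrite ler_pM2l// ler_norm.
have : t ^+ 2 * C <= t * C by rewrite ler_wpM2r// expr2 ler_piMl// ltW.
move: tg; rewrite /K /g; lra.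
Qed.

(** First order optimality: a direction in the open half-space of [u] along which phi decreases
    would stay in the set. The division by [enorm w + 1] brings [w] into the range of [leaves_D]. *)
Lemma grad_half (w : 'rV[R]_d) : 0 < dotp u w -> 0 <= dotp w m.
Proof.
move=> uw.
pose r := enorm w + 1; have r0 : 0 < r by rewrite ltr_wpDl// enorm_ge0.
pose w' := r^-1 *: w.
have w1 k : `|w' 0 k| <= 1.
  rewrite mxE normrM gtr0_norm ?invr_gt0// mulrC ler_pdivrMr// mul1r.
  by rewrite (le_trans (coord_le_enorm w k))// lerDl.
have uw' : 0 < dotp u w' by rewrite dotpZr mulr_gt0// invr_gt0.
suff : 0 <= dotp w' m by rewrite dotpZl pmulr_rge0// invr_gt0.
rewrite leNgt; apply/negP => neg.
pose g := - dotp w' m; have g0 : 0 < g by rewrite oppr_gt0.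
pose t := Num.min (del / 4) (g / (C + 1)).
have C1 : 0 < C + 1 by rewrite ltr_wpDl.
have t0 : 0 < t by rewrite lt_min !divr_gt0.
have td : t <= del / 4 by rewrite ge_min lexx.
have tg : t * (C + 1) <= g by rewrite -ler_pdivlMr// ge_min lexx orbT.
have := leaves_D w1 uw'; move=> /(_ t); rewrite t0 td => /(_ isT).
rewrite phi_support -[dotp w' m]opprK -/g expr2.
have : t * (t * (C + 1)) <= t * g by rewrite ler_pM2l.
have : 0 <= t * t by rewrite mulr_ge0// ltW.
lra.
Qed.

(** The Lagrange multiplier rule. With [p] the part of [m] orthogonal to [u], the test direction
    [- p + e' u] lies in the open half-space for every [e' > 0], which forces [p = 0]. *)
Lemma mean_support : m = dotp u m *: u.
Proof.
have uu := sphere_dotp su.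
pose lam := dotp u m; pose p := m - lam *: u.
have up : dotp u p = 0 by rewrite dotpDr dotpNr dotpZr uu mulr1 subrr.
have mp : m = p + lam *: u by rewrite subrK.
suff p0 : p = 0 by rewrite -/lam {1}mp p0 add0r.
apply: enorm_eq0; apply/ler_addgt0Pr => e e0; rewrite add0r.
pose e' := e / (`|lam| + 1).
have l1 : 0 < `|lam| + 1 by rewrite ltr_wpDl.
have e'0 : 0 < e' by rewrite divr_gt0.
have := @grad_half (- p + e' *: u).
rewrite dotpDr dotpNr dotpZr up uu oppr0 add0r mulr1 e'0 => /(_ isT).
have -> : dotp (- p + e' *: u) m = - dotp p p + e' * lam.
  rewrite dotpDl dotpNl dotpZl -/lam mp dotpDr dotpZr (dotpC p u) up mulr0 addr0.
  by [].
have : e' * lam <= e.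
  have : e' * (`|lam| + 1) = e by rewrite divfK// gt_eqF.
  have := ler_norm lam; nra.
lra.
Qed.

Lemma phi_convex (be : 'rV[R]_d) : summ (tilt be nu) ->
  phi al + dotp (be - al) m <= phi be.
Proof.
move=> sb; have [s _] := expmom_summ del0 HM; have sa := summ_ang del0 HM (be - al).
rewrite (dotp_mean del0 HM) -sumRD//; apply: le_sumR => //; first exact: summD.
move=> x; rewrite (tiltE al be).
have := expR_ge1Dx (ang (be - al) x); have := tilt_ge0 al nu0 x; nra.
Qed.

(** All atoms lie above their tangents; the atom [e_k] alone supplies the quadratic gain in the
    [k]-th coordinate. *)
Lemma phi_convex_strict (be : 'rV[R]_d) (B eps : R) k : 1 <= B -> 0 <= eps ->
  summ (tilt be nu) -> (forall k, `|(be - al) 0 k| <= B) -> spread eps (tilt al nu) ->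
  phi al + dotp (be - al) m + eps / (4 * B) * (be - al) 0 k ^+ 2 <= phi be.
Proof.
move=> B1 eps0 sb clo [_ /(_ k) sp].
have [s _] := expmom_summ del0 HM; have sa := summ_ang del0 HM (be - al).
pose f x := tilt be nu x - (tilt al nu x + ang (be - al) x * tilt al nu x).
have f0 x : 0 <= f x.
  rewrite subr_ge0 (tiltE al be).
  have := expR_ge1Dx (ang (be - al) x); have := tilt_ge0 al nu0 x; nra.
have sf : summ f by apply: summB => //; exact: summD.
have fk : eps / (4 * B) * (be - al) 0 k ^+ 2 <= f (ebase k).
  rewrite /f (tiltE al be) ang_ebase.
  have := expR_ge_quad B1 (clo k).
  set e := expR _; set sk := (be - al) 0 k => h.
  have : 0 <= sk ^+ 2 / (4 * B) by rewrite divr_ge0 ?sqr_ge0//; lra.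
  move: h sp; set q := sk ^+ 2 / (4 * B); set v := tilt al nu _ => h sp q0.
  have -> : eps / (4 * B) * sk ^+ 2 = eps * q by rewrite /q; ring.
  have : eps * q <= v * q by rewrite ler_wpM2r.
  have : v * (1 + sk + q) <= v * e by rewrite ler_wpM2l// (le_trans eps0).
  lra.
have := le_trans fk (sumR_term_le (ebase k) f0 sf).
rewrite /f sumRB//; last exact: summD.
rewrite sumRD// -(dotp_mean del0 HM); lra.
Qed.

End AtPoint.

End Support.

(** * Determinants of rank one perturbations *)

Section RankOne.
Variables (R : realType) (d : nat).
Implicit Types (S : 'M[R]_d) (m : 'rV[R]_d).

(** Its determinant is [m adj(S) m^T], and the block form makes its continuity in [S] and [m]
    immediate. *)
Definition bordered S m : 'M[R]_(1 + d) := block_mx 0 (- m) m^T S.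

(** The left side is the determinant of a block matrix in which [s] occurs in the first row only, so
    it is affine in [s]. *)
Lemma det_rank1 S m (s : R) : \det (S + s *: (m^T *m m)) = \det S + s * \det (bordered S m).
Proof.
pose B : 'M[R]_(1 + d) := block_mx 1%:M (- s *: m) m^T S.
have -> : \det (S + s *: (m^T *m m)) = \det B.
  have -> : \det B = \det (block_mx 1%:M 0 (- m^T) 1%:M *m B).
    by rewrite det_mulmx det_lblock !det1 !mul1r.
  rewrite /B mulmx_block !mul1mx !mul0mx !addr0 mulmx1 addNr det_ublock det1 mul1r.
  by rewrite mulNmx -scalemxAr scaleNr opprK addrC.
have -> : \det S = \det (block_mx 1%:M 0 m^T S : 'M[R]_(1 + d)).
  by rewrite det_lblock det1 mul1r.
rewrite -[X in X + _]mul1r.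
have low (a1 a2 : 'M[R]_1) (b1 b2 : 'rV[R]_d) :
    row' 0 (block_mx a1 b1 m^T S : 'M[R]_(1 + d)) =
    row' 0 (block_mx a2 b2 m^T S : 'M[R]_(1 + d)).
  apply/matrixP => i j; rewrite !mxE; case: splitP => // k e.
  by move: e; case: k => [] [].
apply: (@determinant_multilinear _ _ _ _ _ 0); rewrite ?(low _ 1%:M _ 0)//.
have up (a : 'M[R]_1) (b : 'rV[R]_d) : row 0 (block_mx a b m^T S : 'M[R]_(1 + d)) = row_mx a b.
  apply/matrixP => i j; rewrite ord1 !mxE; case: splitP => // k e.
  by rewrite !mxE ord1.
rewrite /B /bordered (up 1%:M (- s *: m)) (up 1%:M 0) (up 0 (- m)) scale1r.
apply/rowP => j; rewrite !mxE; case: (@splitP 1 d j) => k _; rewrite !mxE.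
  by rewrite mulr0 addr0.
by rewrite add0r mulrN mulNr.
Qed.

(** The perturbed forms stay positive for all [s >= 0], so the slope in [s] cannot be negative; it
    cannot vanish because the bordered matrix has trivial kernel. *)
Lemma det_bordered_gt0 S m (kap B : R) : 0 < kap -> form_bounded kap B S -> m != 0 ->
  0 < \det (bordered S m).
Proof.
move=> kap0 Sb m0.
have pos s : 0 <= s -> 0 < \det S + s * \det (bordered S m).
  move=> s0; rewrite -det_rank1.
  pose B' := B + s * (d%:R * enorm m) ^+ 2.
  have fb : form_bounded kap B' (S + s *: (m^T *m m)).
    split; first by rewrite linearD linearZ /= trmx_mul trmxK Sb.1.
    move=> v; rewrite qfD qfZm qf_outer; have /andP[l u] := Sb.2 v.
    apply/andP; split; first by apply: (le_trans l); rewrite lerDl mulr_ge0 ?sqr_ge0.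
    rewrite mulrDl; apply: lerD => //; rewrite -[leRHS]mulrA ler_wpM2l//.
    rewrite -enorm_sqr -exprMn dotpC -[leLHS]real_normK ?num_real//.
    rewrite lerXn2r ?nnegrE ?mulr_ge0 ?enorm_ge0//.
    by apply: dotp_le_sum => k; exact: coord_le_enorm.
  have [C _ HC] := @gauss_lattice_sum R d kap B' kap0.
  by have [] := HC _ fb.
have S0 : 0 < \det S by have := pos 0 (lexx 0); rewrite mul0r addr0.
rewrite lt_neqAle; apply/andP; split; last first.
  rewrite leNgt; apply/negP => neg.
  have := pos (\det S / - \det (bordered S m)).
  rewrite divr_ge0 ?oppr_ge0 ?(ltW S0) ?(ltW neg)// => /(_ isT).
  rewrite invrN mulrN mulNr divfK ?lt_eqF// subrr ltxx //.
(* For a null vector [(t, w)], the first equation makes [w] orthogonal to [m], the second then gives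
   [qf S w = 0]; hence [w = 0] and [t m = 0]. *)
rewrite eq_sym; apply/negP => /det0P[z z0 ze].
pose t := lsubmx z; pose w := rsubmx z.
have zE : z = row_mx t w by rewrite hsubmxK.
move: ze; rewrite zE /bordered mul_row_block mulmx0 add0r -row_mx0 => /eq_row_mx[wm tw].
have w0 : w = 0.
  apply: enorm_eq0; have /andP[l _] := Sb.2 w.
  have : qf S w = 0.
    have -> : qf S w = ((t *m m) *m w^T) 0 0.
      rewrite /qf; congr (_ 0 0); congr (_ *m _); apply/eqP; rewrite -subr_eq0 addrC.
      by rewrite -mulmxN tw.
    by rewrite -mulmxA -(mulmx_trC w m) wm mulmx0 mxE.
  move=> q0; move: l; rewrite q0 pmulr_rle0//.
move: tw; rewrite w0 mul0mx addr0 mulmxN => /eqP; rewrite oppr_eq0 => /eqP tm.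
have t0 : t = 0.
  have tE : t = (t 0 0)%:M by apply/matrixP => i j; rewrite !ord1 [RHS]mxE.
  move: tm; rewrite tE mul_scalar_mx => /eqP; rewrite scaler_eq0 (negPf m0) orbF => /eqP ->.
  by apply/matrixP => i j; rewrite !mxE mul0rn.
by move: z0; rewrite zE w0 t0 row_mx0 eqxx.
Qed.

End RankOne.

(** * The support point as a function of the direction *)

Section Package.
Variables (R : realType) (d : nat).
Local Notation X := 'rV[int]_d.
Variable nu : X -> R.
Hypothesis d0 : (0 < d)%N.
Hypothesis nu_pos : forall x, 0 < nu x.
Hypothesis nu_mom : local_mom nu nu.
Variable al0 : 'rV[R]_d.
Hypothesis al0_D : Dset nu al0.
Hypothesis al0_lt1 : sumR (tilt al0 nu) < 1.

Definition lam_of (c : 'rV[R]_d -> 'rV[R]_d) u : R := dotp u (mean (tilt (c u) nu)).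

(** All constants are uniform over the sphere. [sp_spread] is required in a whole neighbourhood of
    [c u] because the tail estimate moves the tilt further along the ray. *)
Record support_spec (c : 'rV[R]_d -> 'rV[R]_d) (del M eps lam0 lam1 Lc : R) : Prop := SupportSpec {
  sp_pos : [/\ 0 < del <= 1, 0 < M, 0 < eps, 0 < lam0 & 0 < lam1 /\ 0 <= Lc];
  sp_D : forall u, sphere u -> Dset nu (c u);
  sp_one : forall u, sphere u -> sumR (tilt (c u) nu) = 1;
  sp_mean : forall u, sphere u -> mean (tilt (c u) nu) = lam_of c u *: u;
  sp_lam : forall u, sphere u -> lam0 <= lam_of c u <= lam1;
  sp_mom : forall u, sphere u -> expmom del M (tilt (c u) nu);
  sp_spread : forall u, sphere u -> forall be, (forall k, `|(be - c u) 0 k| <= 1) ->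
    spread eps (tilt be nu);
  sp_lip : forall u v (r : R), sphere u -> sphere v -> (forall k, `|(u - v) 0 k| <= r) ->
    forall k, `|(c u - c v) 0 k| <= Lc * r }.

Lemma support_package : exists c del M eps lam0 lam1 Lc,
  support_spec c del M eps lam0 lam1 Lc.
Proof.
have dp : 0 < d%:R :> R by rewrite ltr0n.
have nu0 x : 0 <= nu x := ltW (nu_pos x).
have [c Hc] := support_exists nu_pos al0_D.
have [del' [M [del'0 M0 HM']]] := unif_expmom nu_pos nu0 nu_mom.
pose del := Num.min del' 1.
have del0 : 0 < del by rewrite lt_min del'0 ltr01.
have del1 : del <= 1 by rewrite ge_min lexx orbT.
have HM al : Dset nu al -> expmom del M (tilt al nu).
  move=> Da; apply: expmom_weaken (lexx M) (HM' _ Da).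
  by rewrite (ltW del0) ge_min lexx.
have [B0 B00 HB] := Dset_coord nu_pos.
have [eps eps0 Heps] := spread_tilt nu_pos (B0 + 1).
pose g := 1 - sumR (tilt al0 nu); have g0 : 0 < g by rewrite subr_gt0.
pose B1 := 2 * B0 + 1.
have B11 : 1 <= B1 by rewrite /B1; lra.
pose lam1 := M / del; have lam10 : 0 < lam1 by rewrite divr_gt0.
pose kap := eps / (4 * B1).
have kap0 : 0 < kap by rewrite divr_gt0// mulr_gt0//; lra.
(* Convexity at [c u], tested at [al0], gives [g <= lam * dotp (c u - al0) u], and the scalar
   product is at most [d * (d * B1)] on the bounded set. *)
pose lam0 := g / (d%:R * (d%:R * B1)).
have ddB : 0 < d%:R * (d%:R * B1) by rewrite !mulr_gt0//; lra.
have lam00 : 0 < lam0 by rewrite divr_gt0.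
pose Lc := lam1 * (d%:R * d%:R) / kap.
have Lc0 : 0 <= Lc.
  by apply: divr_ge0; [apply: mulr_ge0 => //; exact: ltW | exact: ltW].
have diffB al be k : Dset nu al -> Dset nu be -> `|(be - al) 0 k| <= B1.
  move=> Da Db; rewrite !mxE; apply: (le_trans (ler_normB _ _)).
  have := HB _ Da k; have := HB _ Db k; rewrite /B1; lra.
have one u : sphere u -> sumR (tilt (c u) nu) = 1.
  by move=> su; have [Dc mx] := Hc u; exact: (phi_support del0 (HM _ Dc) su Dc mx).
have meanE u : sphere u -> mean (tilt (c u) nu) = lam_of c u *: u.
  by move=> su; have [Dc mx] := Hc u; exact: (mean_support del0 (HM _ Dc) su Dc mx).
have sp1 u be : sphere u -> (forall k, `|(be - c u) 0 k| <= 1) -> spread eps (tilt be nu).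
  move=> su clo; have [Dc _] := Hc u; apply: Heps => k.
  have -> : be 0 k = (be - c u) 0 k + c u 0 k by rewrite !mxE subrK.
  by apply: (le_trans (ler_normD _ _)); have := clo k; have := HB _ Dc k; lra.
have lamup u : sphere u -> lam_of c u <= lam1.
  move=> su; have [Dc _] := Hc u.
  apply: (le_trans (ler_norm _)); apply: (le_trans (mean_bound del0 (HM _ Dc) u)).
  by rewrite su mul1r mulrC.
have lamlo u : sphere u -> lam0 <= lam_of c u.
  move=> su; have [Dc mx] := Hc u.
  have := phi_convex nu_pos del0 (HM _ Dc) al0_D.1.
  rewrite one// (meanE u su) dotpZr => h.
  have uB : dotp (c u - al0) u <= d%:R * (d%:R * B1).
    apply: (le_trans (ler_norm _)); rewrite dotpC.
    apply: (le_trans (dotp_le_sum _ (fun k => sphere_coord k su))).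
    rewrite mulr1 ler_pM2l//.
    have e2 : enorm (c u - al0) ^+ 2 <= (d%:R * B1) ^+ 2.
      rewrite enorm_sqr /dotp; apply: (@le_trans _ _ (\sum_(k < d) B1 ^+ 2)).
        apply: ler_sum => k _; rewrite -expr2 -[leLHS]real_normK ?num_real//.
        rewrite lerXn2r ?nnegrE//; first by lra.
        exact: diffB.
      rewrite sumr_const card_ord -[leLHS]mulr_natl exprMn ler_wpM2r ?sqr_ge0//.
      by rewrite expr2 ler_peMr// ler1n.
    rewrite -(ler_pXn2r (n := 2))// nnegrE ?enorm_ge0// mulr_ge0//; lra.
  have h2 : g <= lam_of c u * dotp (c u - al0) u.
    move: h; rewrite -opprB dotpNl mulrN /g; lra.
  have pos : 0 < dotp (c u - al0) u.
    rewrite dotpC dotpDr dotpNr subr_gt0 lt_neqAle; have -> := mx _ al0_D; rewrite andbT.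
    apply/eqP => e; move: h2; rewrite dotpC dotpDr dotpNr e subrr mulr0; lra.
  rewrite /lam0 ler_pdivrMr//; apply: (le_trans h2).
  rewrite ler_wpM2l//; rewrite -(pmulr_lge0 _ pos); apply: le_trans h2; exact: ltW.
exists c, del, M, eps, lam0, lam1, Lc; split => //.
- by rewrite del0.
- by move=> u su; have [Dc _] := Hc u.
- by move=> u su; rewrite lamlo//= lamup.
- by move=> u su; have [Dc _] := Hc u; exact: HM.
- by move=> u su be; exact: sp1.
move=> u v r su sv uv k.
have r0 : 0 <= r by apply: le_trans (uv k).
have [Du mxu] := Hc u; have [Dv mxv] := Hc v.
set D := c v - c u.
have clo j : `|D 0 j| <= B1 by exact: diffB.
have spu : spread eps (tilt (c u) nu).
  by apply: (sp1 u) => // j; rewrite subrr mxE normr0.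
(* Strict convexity at [c u], tested at [c v] where phi is also 1, bounds the square by
   [lam * dotp u (c u - c v)]. Optimality of [c v] for [v] lets [u] be replaced by [u - v], which is
   small. *)
have key j : kap * D 0 j ^+ 2 <= lam1 * (d%:R * r * enorm D).
  have := phi_convex_strict nu_pos del0 (HM _ Du) j B11 (ltW eps0) Dv.1 clo spu.
  rewrite one// one// (meanE u su) dotpZr -/D -/kap => h.
  have du : dotp u (c u - c v) <= d%:R * r * enorm D.
    have : dotp u (c u - c v) <= dotp (u - v) (c u - c v).
      rewrite dotpDl dotpNl lerDl oppr_ge0 dotpDr dotpNr subr_le0; exact: mxv.
    move=> /le_trans; apply; apply: (le_trans (ler_norm _)).
    have -> : c u - c v = - D by rewrite opprB.
    by rewrite dotpNr normrN; exact: dotp_le_sum.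
  have du0 : 0 <= dotp u (c u - c v) by rewrite dotpDr dotpNr subr_ge0; exact: mxu.
  apply: (@le_trans _ _ (lam_of c u * dotp u (c u - c v))).
    move: h; have -> : dotp D u = - dotp u (c u - c v) by rewrite -dotpNr opprB dotpC.
    lra.
  apply: ler_pM => //; last exact: lamup.
  exact: le_trans (ltW lam00) (lamlo u su).
have tot : kap * enorm D ^+ 2 <= d%:R * (lam1 * (d%:R * r * enorm D)).
  rewrite enorm_sqr /dotp mulr_sumr.
  apply: (@le_trans _ _ (\sum_(j < d) lam1 * (d%:R * r * enorm D))).
    by apply: ler_sum => j _; rewrite -expr2; exact: key.
  by rewrite sumr_const card_ord -[leLHS]mulr_natl.
have -> : (c u - c v) 0 k = - D 0 k by rewrite !mxE opprB.
rewrite normrN; apply: (le_trans (coord_le_enorm D k)).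
have [e0|e0] := eqVneq (enorm D) 0; first by rewrite e0 mulr_ge0.
have ep : 0 < enorm D by rewrite lt_neqAle eq_sym e0 enorm_ge0.
have : kap * enorm D <= lam1 * (d%:R * d%:R) * r.
  rewrite -(ler_pM2r ep); apply: le_trans (le_trans _ tot) _; first by rewrite expr2 mulrA.
  by rewrite le_eqVlt; apply/orP; left; apply/eqP; ring.
have -> : Lc * r = lam1 * (d%:R * d%:R) * r / kap by rewrite /Lc; ring.
by rewrite ler_pdivlMr// mulrC.
Qed.

End Package.

(** * Binomial weights *)

Section Binomial.
Variable R : realType.

Lemma bin_central_le (k j : nat) : ('C(k.*2, k + j) <= 'C(k.*2, k))%N.
Proof.
elim: j => [|j IH]; first by rewrite addn0.
apply: leq_trans IH; rewrite addnS.
have := mul_bin_left k.*2 (k + j) => e.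
have : ((k + j).+1 * 'C(k.*2, (k + j).+1) <= (k + j).+1 * 'C(k.*2, k + j))%N.
  by rewrite e leq_mul2r; apply/orP; right; rewrite -addnn; lia.
by rewrite leq_mul2l.
Qed.

(** Consecutive coefficients have ratio [(k - j) / (k + j + 1)]. After multiplication by
    [k + j + 1], the margin of the induction step is exactly [(j^3 + (j + 1)^3) / k]; when
    [(j + 1)^2 >= k] the claim is trivial. *)
Lemma bin_central_lower (k j : nat) : (0 < k)%N ->
  (1 - j%:R ^+ 2 / k%:R) * 'C(k.*2, k)%:R <= 'C(k.*2, k + j)%:R :> R.
Proof.
move=> k0; have kp : 0 < k%:R :> R by rewrite ltr0n.
have B0 : 0 < 'C(k.*2, k)%:R :> R.
  by rewrite ltr0n bin_gt0 -addnn leq_addr.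
elim: j => [|j IH]; first by rewrite addn0 expr0n mul0r subr0 mul1r.
have [h|h] := leP k%:R (j.+1%:R ^+ 2 : R).
  apply: le_trans (ler0n _ _); rewrite pmulr_lle0// subr_le0.
  by rewrite ler_pdivlMr// mul1r.
have jk : (j < k)%N.
  by move: h; rewrite -natrX ltr_nat; apply: leq_trans; rewrite leqW// -[leqLHS]muln1 leq_mul.
have e : (k%:R + j%:R + 1) * 'C(k.*2, k + j.+1)%:R = (k%:R - j%:R) * 'C(k.*2, k + j)%:R :> R.
  have := mul_bin_left k.*2 (k + j).
  have -> : (k.*2 - (k + j) = k - j)%N by rewrite -addnn; lia.
  move=> /(congr1 (fun n : nat => n%:R : R)); rewrite !natrM natrB ?(ltnW jk)// addnS => <-.
  by rewrite -natr1 natrD.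
move: e IH; move: ('C(_, k + j.+1)%:R) ('C(_, k + j)%:R) => B' B e IH.
have jj : j%:R < k%:R :> R by rewrite ltr_nat.
have j0 : 0 <= j%:R :> R by [].
have kj : 0 < k%:R + j%:R + 1 :> R by lra.
rewrite -(ler_pM2l kj) e; apply: le_trans (ler_wpM2l _ IH); last by rewrite subr_ge0 ltW.
rewrite !mulrA ler_pM2r// -subr_ge0 -natr1.
rewrite (_ : _ - _ = (j%:R ^+ 3 + (j%:R + 1) ^+ 3) / k%:R); last by field; rewrite gt_eqF.
by rewrite divr_ge0// addr_ge0// exprn_ge0// addr_ge0.
Qed.

Lemma bin_central (k l : nat) : (0 < k)%N ->
  (1 - (l%:R - k%:R) ^+ 2 / k%:R) * binw R k.*2 k <= binw R k.*2 l <= binw R k.*2 k.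
Proof.
move=> k0; have i0 : 0 <= (2 ^+ k.*2)^-1 :> R by rewrite invr_ge0 exprn_ge0.
apply/andP; split; rewrite /binw ?mulrA ler_wpM2r//.
  have [kl|lk] := leqP k l.
    by have := bin_central_lower (l - k) k0; rewrite subnKC// natrB.
  have := bin_central_lower (k - l) k0.
  have -> : (k + (k - l) = k.*2 - l)%N by rewrite -addnn; lia.
  rewrite bin_sub; last by rewrite -addnn; lia.
  by rewrite natrB ?(ltnW lk)// -(sqrrN (k%:R - l%:R)) opprB.
rewrite ler_nat; have [kl|lk] := leqP k l.
  by rewrite -(subnKC kl); exact: bin_central_le.
rewrite -bin_sub; last by rewrite -addnn; lia.
have -> : (k.*2 - l = k + (k - l))%N by rewrite -addnn; lia.
exact: bin_central_le.
Qed.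

Lemma binw_central_gt0 k : 0 < binw R k.*2 k.
Proof. by rewrite divr_gt0 ?exprn_gt0// ltr0n bin_gt0 -addnn leq_addr. Qed.

(** The sequence increases and is bounded by 1, both through the ratio [(2 k + 1) / (2 k + 2)] of
    central weights. The limit enters the final constant as [w]. *)
Lemma wallis : exists2 w : R, 0 < w & forall eps, 0 < eps -> exists n0 : nat,
  forall k, (n0 <= k)%N -> `|w - Num.sqrt (k.*2)%:R * binw R k.*2 k| <= eps.
Proof.
pose p (k : nat) : R := binw R k.*2 k.
pose q (k : nat) : R := (k.*2)%:R * p k ^+ 2.
pose a (k : nat) : R := Num.sqrt (k.*2)%:R * p k.
have p0 k : 0 < p k by exact: binw_central_gt0.
have pS k : p k.+1 * (2 * k%:R + 2) = p k * (2 * k%:R + 1).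
  have e1 : (k.+1 * 'C(k.+1.*2, k.+1) = k.+1.*2 * 'C(k.*2.+1, k))%N.
    by rewrite -mul_bin_diag doubleS.
  have e2 : (k.*2.+1 * 'C(k.*2, k) = k.+1 * 'C(k.*2.+1, k))%N.
    by rewrite mul_bin_down; congr (_ * _)%N; rewrite -addnn; lia.
  have e3 : (k.+1 * 'C(k.+1.*2, k.+1) = 2 * k.*2.+1 * 'C(k.*2, k))%N.
    by rewrite e1 -mulnA e2 mulnA mul2n.
  move/(congr1 (fun n : nat => n%:R : R)): e3; rewrite !natrM.
  rewrite -[in k.+1%:R](natr1 k) -(natr1 k.*2) -[in k.*2%:R]mul2n natrM => e3.
  rewrite /p /binw doubleS; move: e3; move: ('C(_, _)%:R) ('C(_, _)%:R) => B B' e3.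
  have -> : 2 ^+ k.*2.+2 = 4 * 2 ^+ k.*2 :> R by rewrite !exprS; ring.
  have -> : B' / (4 * 2 ^+ k.*2) * (2 * k%:R + 2) = ((k%:R + 1) * B') / (2 * 2 ^+ k.*2).
    by field; rewrite expf_neq0.
  by rewrite e3; field; rewrite expf_neq0.
have aq k : a k ^+ 2 = q k by rewrite /a /q exprMn sqr_sqrtr.
have a0 k : 0 <= a k by rewrite mulr_ge0 ?sqrtr_ge0 ?ltW.
have kr (k : nat) : (k.*2)%:R = 2 * k%:R :> R by rewrite -mul2n natrM.
have anx k : a k <= a k.+1.
  rewrite -(ler_pXn2r (n := 2)) ?nnegrE// !aq /q !kr -natr1.
  have k0 : 0 <= k%:R :> R by [].
  have kk : 0 < (2 * k%:R + 2) ^+ 2 :> R by rewrite exprn_gt0//; lra.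
  rewrite -(ler_pM2r kk) -[leRHS]mulrA -[in leRHS]exprMn.
  rewrite pS (exprMn _ (p k)).
  have := sqr_ge0 (p k); move: (p k ^+ 2) => z z0.
  rewrite -subr_ge0 (_ : _ - _ = z * (2 * k%:R + 2)); last by ring.
  by rewrite mulr_ge0//; lra.
have r1 k : (2 * k%:R + 1) * p k ^+ 2 <= 1.
  elim: k => [|k IH]; first by rewrite /p /binw bin0 expr0 divr1 expr1n mulr0 add0r mulr1.
  have k0 : 0 <= k%:R :> R by [].
  apply: le_trans IH.
  have kk : 0 < (2 * k%:R + 2) ^+ 2 :> R by rewrite exprn_gt0//; lra.
  rewrite -(ler_pM2r kk) -[leLHS]mulrA -[in leLHS]exprMn pS (exprMn _ (p k)) -natr1.
  have := sqr_ge0 (p k); move: (p k ^+ 2) => z z0.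
  rewrite -subr_ge0 (_ : _ - _ = z * (2 * k%:R + 1)); last by ring.
  by rewrite mulr_ge0//; lra.
have a1 k : a k <= 1.
  rewrite -(ler_pXn2r (n := 2)) ?nnegrE// aq expr1n; apply: le_trans (r1 k).
  by rewrite /q kr ler_wpM2r ?sqr_ge0// lerDl.
have nd : nondecreasing_seq a by apply/nondecreasing_seqP.
have ub : has_ubound (range a) by exists 1 => _ [k _ <-].
have cv := nondecreasing_is_cvgn nd ub.
exists (limn a).
  apply: (@lt_le_trans _ _ (a 1%N)); last exact: nondecreasing_cvgn_le.
  by rewrite mulr_gt0 ?sqrtr_gt0.
move=> eps eps0; move/cvgrPdist_le: cv => /(_ eps eps0)[n0 _ H].
by exists n0 => k nk; exact: H.
Qed.

End Binomial.

(** * Tails of the convolution powers *)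

Section Tails.
Variable R : realType.

Lemma pow_absorb (d : nat) (a : R) : 0 < a -> exists2 C : R, 0 <= C &
  forall T, 0 <= T -> T ^+ d * expR (- (a * T)) <= C.
Proof.
move=> a0; exists ((d%:R / a) ^+ d); first by rewrite exprn_ge0// divr_ge0// ltW.
by move=> T T0; rewrite expRN ler_pdivrMr ?expR_gt0//; exact: pow_le_expR.
Qed.

(** The first factor is the relative error of the block weights, the exponential is the tail bound.
    For [n <= 2 T] the denominator is at most [3 T] and a Gaussian sum of mesh [1 / sqrt T] appears;
    for [n > 2 T] the exponent is linear in [n] and the sum is geometric. *)
Lemma sum_bound (a : R) : 0 < a -> exists2 C : R, 0 <= C &
  forall (T : R) (N : nat), 1 <= T ->
  \sum_(n < N) (1 + (n%:R - T) ^+ 2 / T) * expR (- (a * ((n%:R - T) ^+ 2 / (T + n%:R)))) <=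
  C * Num.sqrt T.
Proof.
move=> a0.
have a6 : 0 < a / 6 by rewrite divr_gt0.
have a12 : 0 < a / 12 by rewrite divr_gt0.
have [C1 C10 H1] := pow_absorb 1 a6.
have [C2 C20 H2] := pow_absorb 2 a6.
pose r := expR (- (a / 12)).
have r0 : 0 < r by exact: expR_gt0.
have r1 : r < 1 by rewrite -[ltRHS](expR0 R) ltr_expR; lra.
pose Cg := Num.sqrt (2 * pi) / Num.sqrt (2 * (a / 6)) + 2 : R.
exists ((1 + C1) * Cg + (1 + C2) / (1 - r)).
  have Cg0 : 0 <= Cg by rewrite addr_ge0// divr_ge0// sqrtr_ge0.
  by rewrite addr_ge0 ?mulr_ge0 ?addr_ge0 ?invr_ge0 ?subr_ge0// ltW.
move=> T N T1; have T0 : 0 < T by lra.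
have sT : 1 <= Num.sqrt T by rewrite -[leLHS]sqrtr1 ler_wsqrtr.
have term (n : nat) : (1 + (n%:R - T) ^+ 2 / T) * expR (- (a * ((n%:R - T) ^+ 2 / (T + n%:R)))) <=
    (1 + C1) * expR (- (a / 6 * ((n%:R - T) ^+ 2 / T))) + (1 + C2) * r ^+ n.
  have n0 : 0 <= n%:R :> R by [].
  have Tn : 0 < T + n%:R by lra.
  set z := (n%:R - T) ^+ 2.
  have z0 : 0 <= z by exact: sqr_ge0.
  have zT : 0 <= z / T by rewrite divr_ge0// ltW.
  have [le|gt] := leP n%:R (2 * T).
    apply: ler_wpDr; first by rewrite mulr_ge0 ?exprn_ge0 ?addr_ge0// ltW.
    have e1 : - (a * (z / (T + n%:R))) <= - (a / 6 * (z / T)) + - (a / 6 * (z / T)).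
      rewrite -opprD lerN2.
      have : z / T / 3 <= z / (T + n%:R).
        by rewrite -mulrA -invfM ler_wpM2l// lef_pV2 ?posrE ?mulr_gt0//; lra.
      have -> : a / 6 * (z / T) + a / 6 * (z / T) = a * (z / T / 3) by field; rewrite gt_eqF.
      by move=> h; rewrite ler_pM2l.
    apply: (@le_trans _ _ ((1 + z / T) * (expR (- (a / 6 * (z / T))) * expR (- (a / 6 * (z / T)))))).
      by rewrite ler_wpM2l ?addr_ge0// -expRD ler_expR.
    rewrite mulrA ler_wpM2r ?expR_ge0// mulrDl mul1r; apply: lerD; last exact: H1.
    by rewrite -[leRHS](expR0 R) ler_expR oppr_le0 mulr_ge0// ltW.
  apply: ler_wpDl; first by rewrite mulr_ge0 ?expR_ge0 ?addr_ge0.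
  pose s := n%:R - T.
  have s0 : 0 <= s by rewrite /s; lra.
  have zs : z = s ^+ 2 by [].
  have e1 : - (a * (z / (T + n%:R))) <= - (a / 6 * s) + - (a / 12 * n%:R).
    rewrite -opprD lerN2.
    have : s / 3 <= z / (T + n%:R).
      rewrite ler_pdivlMr// zs expr2 -mulrA ler_wpM2l// /s; lra.
    have : n%:R / 4 <= s / 2 by rewrite /s; lra.
    rewrite -(ler_pM2l a0) -(ler_pM2l a0 (s / 3)); lra.
  have zT2 : z / T <= s ^+ 2 by rewrite ler_pdivrMr// zs ler_peMr ?sqr_ge0.
  apply: (@le_trans _ _ ((1 + s ^+ 2) * (expR (- (a / 6 * s)) * r ^+ n))).
    apply: ler_pM; rewrite ?addr_ge0 ?expR_ge0 ?lerD2l//.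
    by rewrite /r -expRM_natr -expRD ler_expR; apply: (le_trans e1); rewrite mulNr.
  rewrite mulrA ler_wpM2r ?exprn_ge0 ?(ltW r0)// mulrDl mul1r; apply: lerD; last exact: H2.
  by rewrite -[leRHS](expR0 R) ler_expR oppr_le0 mulr_ge0// ltW.
apply: (le_trans (ler_sum _ (fun (n : 'I_N) _ => term n))).
rewrite big_split/= -!mulr_sumr [leRHS]mulrDl; apply: lerD.
  rewrite -[leRHS]mulrA ler_wpM2l ?addr_ge0//.
  pose h := (Num.sqrt T)^-1.
  have h0 : 0 < h by rewrite invr_gt0 sqrtr_gt0.
  have h1 : h <= 1 by rewrite invf_le1//; lra.
  have hT : h * Num.sqrt T = 1 by rewrite mulVf// sqrtr_eq0 -ltNge.
  pose f (k : int) := h * expR (- (2 * (a / 6) * (h * k%:~R + - Num.sqrt T) ^+ 2) / 2).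
  have /andP[_ up] := @gauss_int_sum_var R (2 * (a / 6)) h (- Num.sqrt T) ltac:(lra) h0.
  have f0 k : 0 <= f k by rewrite mulr_ge0 ?expR_ge0 ?ltW.
  have : ((\sum_(k < N) f (Posz k))%:E <= Cg%:E)%E.
    apply: (le_trans (esum_nat_ge N (a := fun k => f (Posz k)) (fun k => f0 _))).
    apply: le_trans (le_trans _ up) _; last by rewrite lee_fin /Cg lerD2l ler_piMr.
    rewrite esum_int; last by move=> k; rewrite lee_fin; exact: f0.
    by apply: leeDl; apply: esum_ge0 => k _; rewrite lee_fin; exact: f0.
  rewrite lee_fin => le.
  apply: (@le_trans _ _ ((\sum_(k < N) f (Posz k)) * Num.sqrt T)).
    rewrite mulr_suml; apply: ler_sum => k _; rewrite /f [leRHS]mulrAC hT mul1r.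
    rewrite le_eqVlt; apply/orP; left; apply/eqP; congr expR.
    have -> : h * k%:~R - Num.sqrt T = (k%:R - T) / Num.sqrt T.
      have TT : T / Num.sqrt T = Num.sqrt T.
        by rewrite -{1}[T]sqr_sqrtr ?(ltW T0)// expr2 mulfK// gt_eqF// sqrtr_gt0.
      by rewrite [RHS]mulrBl TT mulrC.
    by rewrite expr_div_n sqr_sqrtr ?ltW//; field; rewrite gt_eqF.
  by rewrite ler_wpM2r// sqrtr_ge0.
have : \sum_(k < N) r ^+ k <= (1 - r)^-1.
  have := subrX1 r N; rewrite -[1 - r]opprB -[r ^+ N - 1]opprK => /(congr1 -%R).
  rewrite opprK -mulNr => e; rewrite -[leRHS]mul1r ler_pdivlMr; last by rewrite opprB subr_gt0.
  by rewrite mulrC -e opprB gerBl exprn_ge0// ltW.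
move=> h; apply: (@le_trans _ _ ((1 + C2) / (1 - r))).
  by rewrite ler_wpM2l// addr_ge0.
by rewrite ler_peMr// divr_ge0// ?subr_ge0 ?(ltW r1)// addr_ge0.
Qed.

End Tails.

(** * Gaussian tails in the number of steps and comparison with block averages *)

Section Walk.
Variables (R : realType) (d : nat).
Local Notation X := 'rV[int]_d.
Local Notation ang th x := (dotp th (toR R x)).
Variables nu kap : X -> R.

Lemma tilt_rconv al (f h : X -> R) x : tilt al (rconv f h) x = rconv (tilt al f) (tilt al h) x.
Proof.
rewrite /tilt /rconv -sumRZ; apply: eq_sumR => y.
have -> : expR (ang al x) = expR (ang al y) * expR (ang al (x - y)).
  by rewrite -expRD -dotpDr -toRD addrC subrK.
by rewrite !mulrA; congr (_ * _); rewrite mulrAC.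
Qed.

Lemma wpowS (f g : X -> R) n : wpow f g n.+1 = rconv (wpow f g n) g.
Proof. by []. Qed.

Lemma tilt_wpow al n x : tilt al (wpow kap nu n) x = wpow (tilt al kap) (tilt al nu) n x.
Proof.
elim: n x => [//|n IH] x.
have e : tilt al (wpow kap nu n) = wpow (tilt al kap) (tilt al nu) n by apply/funext.
by rewrite (wpowS kap nu) tilt_rconv e.
Qed.

Lemma sum_blocks (L K N : nat) (w F : nat -> R) : (0 < L)%N ->
  (forall k, (K < k)%N -> w k = 0) -> (L * K.+1 <= N)%N ->
  \sum_(n < N) w (n %/ L)%N * F n = \sum_(z : 'I_K.+1 * 'I_L) w z.1 * F (L * z.1 + z.2)%N.
Proof.
move=> L0 w0 LN; rewrite -(pair_bigA _ (fun (i : 'I_K.+1) (j : 'I_L) => w i * F (L * i + j)%N))/=.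
rewrite -(big_mkord xpredT (fun n => w (n %/ L)%N * F n)).
have z : \sum_(L * K.+1 <= n < N) w (n %/ L)%N * F n = 0.
  rewrite big_nat; apply: big1 => n /andP[h _].
  by rewrite w0 ?mul0r// leq_divRL// mulnC.
rewrite (@big_cat_nat _ _ _ (L * K.+1)%N)//= z addr0.
rewrite mulnC big_nat_mul big_mkord; apply: eq_bigr => i _.
rewrite -{1}[(i * L)%N]add0n big_addn mulSn addnK big_mkord; apply: eq_bigr => j _.
by rewrite [(L * i)%N]mulnC [(j + _)%N]addnC divnMDl// (divn_small (ltn_ord j)) addn0.
Qed.

Variables (c : 'rV[R]_d -> 'rV[R]_d) (del M eps lam0 lam1 Lc : R).
Hypothesis d0 : (0 < d)%N.
Hypothesis nu_pos : forall x, 0 < nu x.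
Hypothesis kap_ge0 : forall x, 0 <= kap x.
Hypothesis spec : support_spec nu c del M eps lam0 lam1 Lc.
Hypothesis kap_mom : forall u, sphere u -> expmom del M (tilt (c u) kap).

(** The mass of [xi] is left free, since tilts off the boundary are used. The power 0 has a separate
    branch: there is no smoothing yet, and [(sqrt 0 ^+ d)^-1] would be 0. *)
Lemma wpow_upper : 0 < eps -> 0 < M -> exists2 B : R, 0 <= B &
  forall (ka xi : X -> R) n x, (forall y, 0 <= ka y) -> (forall y, 0 <= xi y) ->
  summ ka -> summ xi -> sumR ka <= M -> sumR xi <= M -> spread eps xi ->
  wpow ka xi n x <= B * sumR xi ^+ n * (if n is 0 then 1 else (Num.sqrt n%:R ^+ d)^-1).
Proof.
move=> eps0 M0; have dp : 0 < d%:R :> R by rewrite ltr0n.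
pose q := eps / (64 * d%:R * M).
have q0 : 0 < q by rewrite divr_gt0// !mulr_gt0.
have [CL CL0 HL] := local_upper R d.
have CB : 0 <= CL * (2 * M) / Num.sqrt q ^+ d.
  by rewrite divr_ge0 ?mulr_ge0 ?exprn_ge0 ?sqrtr_ge0// ltW.
exists (M + CL * (2 * M) / Num.sqrt q ^+ d); first by rewrite addr_ge0// ltW.
move=> ka xi n x k_0 n_0 k_s n_s k_M n_M sp.
have phi0 : 0 <= sumR xi by exact: sumR_ge0.
case: n => [|n].
  rewrite expr0 !mulr1; apply: ler_wpDr => //; apply: le_trans k_M.
  exact: sumR_term_le.
have [F0 sF] := wpow_ge0_summ k_0 n_0 k_s n_s n.+1.
have np : 0 < n.+1%:R :> R by [].
have key th : in_box th -> cabs (ft (wpow ka xi n.+1) th) <=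
    2 * M * sumR xi ^+ n.+1 * expR (- (q * n.+1%:R * dotp th th)).
  move=> box; rewrite ft_wpow// cabsM -mulrA; apply: ler_pM; rewrite ?cabs_ge0//.
    by apply: (le_trans (cabs_ft _ k_0 k_s)); rewrite ler_pM2l.
  rewrite cabsX; apply: (@le_trans _ _ ((sumR xi * expR (- (q * dotp th th))) ^+ n.+1)).
    rewrite lerXn2r ?nnegrE ?cabs_ge0 ?mulr_ge0 ?expR_ge0//.
    by apply: cabs_ft_le => //; exact: ltW.
  rewrite exprMn -expRM_natr ler_wpM2l ?exprn_ge0// ler_expR.
  by rewrite le_eqVlt; apply/orP; left; apply/eqP; ring.
have := HL _ _ _ F0 sF _ _ key x.
move=> /(_ _ _)/le_trans; apply.
- by rewrite !mulr_ge0 ?exprn_ge0// ltW.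
- by rewrite mulr_gt0.
rewrite sqrtrM ?(ltW q0)// exprMn invfM.
rewrite (_ : CL * _ * _ = CL * (2 * M) / Num.sqrt q ^+ d * sumR xi ^+ n.+1 / Num.sqrt n.+1%:R ^+ d); last by ring.
rewrite ler_wpM2r ?invr_ge0 ?exprn_ge0 ?sqrtr_ge0// ler_wpM2r ?exprn_ge0//.
by rewrite lerDr ltW.
Qed.

(* Tilting further along the ray by an amount proportional to [(T - n) / (T + n)]
   is what produces the Gaussian factor. *)
Lemma tail_upper : exists C a : R, [/\ 0 <= C, 0 < a &
  forall u x (T : R) n, sphere u -> toR R x = (lam_of nu c u * T) *: u -> 1 <= T ->
  tilt (c u) (wpow kap nu n) x <=
  C / Num.sqrt T ^+ d * expR (- (a * ((n%:R - T) ^+ 2 / (T + n%:R))))].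
Proof.
have [/andP[del0 del1] M0 eps0 lam00 [lam10 _]] := sp_pos spec.
have dp : 0 < d%:R :> R by rewrite ltr0n.
pose C2 := (8 / del) ^+ 2 * M.
have C20 : 0 <= C2 by rewrite mulr_ge0 ?sqr_ge0// ltW.
(* The first bound keeps the extra tilt within the moment margin; the second makes the second order
   term cost at most half of the first order gain [lam0]. *)
pose eta := Num.min (del / 4) (lam0 / (2 * (C2 + 1))).
have eta0 : 0 < eta by rewrite lt_min !divr_gt0//= mulr_gt0//; lra.
have etad : eta <= del / 4 by rewrite ge_min lexx.
have etaC : eta * C2 <= lam0 / 2.
  apply: (@le_trans _ _ (lam0 / (2 * (C2 + 1)) * (C2 + 1))).
    apply: ler_pM => //; rewrite ?(ltW eta0)//; last by lra.
    by rewrite ge_min lexx orbT.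
  by rewrite invfM mulrA divfK// gt_eqF//; lra.
pose a := eta * lam0 / 2.
have a0 : 0 < a by rewrite divr_gt0// mulr_gt0.
have a12 : 0 < a / 12 by rewrite divr_gt0.
have [C3 C30 H3] := pow_absorb d a12.
have [B B0 HB] := wpow_upper eps0 M0.
exists (B * (Num.sqrt 2 ^+ d + C3)), (a / 2); split; [| by rewrite divr_gt0|].
  by rewrite mulr_ge0// addr_ge0// exprn_ge0// sqrtr_ge0.
move=> u x T n su xu T1; have T0 : 0 < T by lra.
have n0 : 0 <= n%:R :> R by [].
have Tn : 0 < T + n%:R by lra.
have /andP[lamlo lamup] := sp_lam spec su; set lam := lam_of nu c u in xu lamlo lamup.
pose t := eta * (T - n%:R) / (T + n%:R).
have tE : `|t| <= eta.
  rewrite /t -mulrA normrM (gtr0_norm eta0) ler_piMr ?(ltW eta0)//.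
  rewrite normrM normfV (gtr0_norm Tn) ler_pdivrMr// mul1r ler_norml; lra.
pose be := c u + t *: u.
have u1 k : `|u 0 k| <= 1 by exact: sphere_coord.
have clo k : `|(be - c u) 0 k| <= eta.
  rewrite /be addrC addrA addNr add0r mxE normrM.
  by rewrite -[leRHS]mulr1; apply: ler_pM.
have mk := expmom_perturb del0 (kap_mom su) etad clo.
have mn := expmom_perturb del0 (sp_mom spec su) etad clo.
have del20 : 0 < del / 2 by rewrite divr_gt0.
have [k_s k_M] := expmom_summ del20 mk.
have [n_s n_M] := expmom_summ del20 mn.
have k_0 := expmom_ge0 mk; have n_0 := expmom_ge0 mn.
have sp : spread eps (tilt be nu).
  by apply: (sp_spread spec su) => k; apply: (le_trans (clo k)); lra.
set phi := sumR (tilt be nu) in n_M.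
have phi0 : 0 <= phi by exact: sumR_ge0.
have phiU : phi <= expR (t * lam + t ^+ 2 * C2).
  have := mgf_upper del0 (sp_mom spec su) u1 (le_trans tE etad).
  rewrite -/be -/phi (sp_one spec su) -/C2 -/(lam_of nu c u) -/lam => h.
  by apply: (le_trans h); rewrite -addrA; exact: expR_ge1Dx.
pose F := wpow (tilt be kap) (tilt be nu) n.
have [F0 sF] := wpow_ge0_summ k_0 n_0 k_s n_s n.
pose r := if n is 0 then 1 else (Num.sqrt n%:R ^+ d)^-1 : R.
have r0 : 0 <= r by rewrite /r; case: (n) => // n'; rewrite invr_ge0 exprn_ge0// sqrtr_ge0.
have Fx : F x <= B * phi ^+ n * r.
  by apply: HB.
have FE : tilt (c u) (wpow kap nu n) x = expR (- (t * (lam * T))) * F x.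
  have ux : ang u x = lam * T by rewrite xu dotpZr sphere_dotp// mulr1.
  rewrite (tiltE be) tilt_wpow; congr (expR _ * _).
  by rewrite /be opprD addrA subrr add0r dotpNl dotpZl ux.
set y := (n%:R - T) ^+ 2 / (T + n%:R).
have y0 : 0 <= y by rewrite divr_ge0 ?sqr_ge0// ltW.
have expo : - (t * (lam * T)) + (t * lam + t ^+ 2 * C2) * n%:R <= - (a * y).
  have -> : - (t * (lam * T)) + (t * lam + t ^+ 2 * C2) * n%:R =
      - (eta * y * (lam - eta * C2 * (n%:R / (T + n%:R)))).
    by rewrite /t /y; field; rewrite gt_eqF.
  have nT : n%:R / (T + n%:R) <= 1 by rewrite ler_pdivrMr// mul1r; lra.
  have nT0 : 0 <= n%:R / (T + n%:R) by rewrite divr_ge0// ltW.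
  have h : eta * C2 * (n%:R / (T + n%:R)) <= lam0 / 2.
    by apply: le_trans etaC; rewrite ler_piMr// mulr_ge0// ltW.
  rewrite lerN2 /a (_ : eta * lam0 / 2 * y = eta * y * (lam0 / 2)); last by ring.
  apply: ler_wpM2l; first by rewrite mulr_ge0// ltW.
  by move: h; move: (eta * C2 * _) => z h; lra.
have main : tilt (c u) (wpow kap nu n) x <= B * r * expR (- (a * y)).
  rewrite FE; apply: (@le_trans _ _ (expR (- (t * (lam * T))) * (B * phi ^+ n * r))).
    by rewrite ler_wpM2l ?expR_ge0.
  rewrite (_ : _ * (B * phi ^+ n * r) = B * r * (expR (- (t * (lam * T))) * phi ^+ n)); last by ring.
  rewrite ler_wpM2l ?mulr_ge0//; apply: le_trans (_ : _ <= expR (_ + _)) _; last first.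
    by rewrite ler_expR; exact: expo.
  rewrite expRD ler_wpM2l ?expR_ge0// expRM_natr.
  by rewrite lerXn2r ?nnegrE ?expR_ge0.
apply: (le_trans main); rewrite -(mulrA B r) -(mulrA B _ (_^-1)) -(mulrA B (_ / _)) ler_wpM2l//.
have sT0 : 0 < Num.sqrt T by rewrite sqrtr_gt0.
have -> : - (a * y) = - (a / 2 * y) + - (a / 2 * y) by lra.
rewrite expRD mulrA ler_wpM2r ?expR_ge0// ler_pdivlMr ?exprn_gt0//.
have e1 : expR (- (a / 2 * y)) <= 1.
  by rewrite -[leRHS](expR0 R) ler_expR oppr_le0 mulr_ge0// divr_ge0// ltW.
(* For [n >= T / 2] the local bound [n^(-d/2)] is of order [T^(-d/2)]. For smaller [n] half of the
   exponential is at most [expR (- a T / 12)], which beats [T^(d/2)]. *)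
have [big|small] := leP T (2 * n%:R).
  apply: ler_wpDr => //.
  have np : 0 < n%:R :> R by lra.
  have rE : r = (Num.sqrt n%:R ^+ d)^-1 by rewrite /r; case: (n) np => //; rewrite ltxx.
  apply: (@le_trans _ _ (r * 1 * Num.sqrt T ^+ d)).
    by rewrite ler_wpM2r ?exprn_ge0 ?sqrtr_ge0// ler_wpM2l.
  rewrite mulr1 rE mulrC ler_pdivrMr ?exprn_gt0 ?sqrtr_gt0// -exprMn lerXn2r ?nnegrE ?mulr_ge0 ?sqrtr_ge0//.
  by rewrite -sqrtrM// ler_wsqrtr.
apply: ler_wpDl; first by rewrite exprn_ge0// sqrtr_ge0.
have r1 : r <= 1.
  rewrite /r; case: (n) => // n'; rewrite invf_le1 ?exprn_gt0 ?sqrtr_gt0//.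
  by rewrite exprn_ege1// -[leLHS]sqrtr1 ler_wsqrtr// ler1n.
have yT : T / 6 <= y.
  rewrite /y ler_pdivlMr//; have : 0 <= (T - 2 * n%:R) * (5 * T - 6 * n%:R + n%:R) by rewrite mulr_ge0//; lra.
  have : 0 <= n%:R * T by rewrite mulr_ge0// ltW.
  nra.
apply: (@le_trans _ _ (expR (- (a / 12 * T)) * T ^+ d)).
  apply: ler_pM; rewrite ?mulr_ge0 ?expR_ge0 ?exprn_ge0 ?sqrtr_ge0//.
    rewrite -[leRHS]mul1r; apply: ler_pM => //; rewrite ?expR_ge0// ler_expR lerN2.
    have : a / 2 * (T / 6) <= a / 2 * y by rewrite ler_wpM2l// divr_ge0// ltW.
    lra.
  rewrite lerXn2r ?nnegrE ?sqrtr_ge0 ?(ltW T0)//.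
  rewrite -[leRHS]sqr_sqrtr ?(ltW T0)// expr2 ler_peMr ?sqrtr_ge0//.
  by rewrite -[leLHS]sqrtr1 ler_wsqrtr.
by rewrite mulrC; apply: H3; exact: ltW.
Qed.

(** Divided by the central one, the block weights are at most 1, which gives the sign. Their deficit
    is quadratically small around [T], because [k] is the index of the block containing [T], and the
    Gaussian tails sum it. *)
Lemma smooth_compare : exists2 C : R, 0 <= C &
  forall (L k N : nat) u x (T : R), (0 < L)%N -> sphere u ->
  toR R x = (lam_of nu c u * T) *: u -> 1 <= T -> L%:R <= T ->
  k%:R <= T / L%:R < k.+1%:R -> (L * k.*2.+1 <= N)%N ->
  0 <= \sum_(n < N) tilt (c u) (wpow kap nu n) x -
       Wsum (tilt (c u) kap) (tilt (c u) nu) L k.*2 x / binw R k.*2 k <=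
  C * (Num.sqrt T / Num.sqrt T ^+ d) * (L%:R^-1 + L%:R / T).
Proof.
have [C [a [C0 a0 HC]]] := tail_upper.
have [Cs Cs0 HCs] := sum_bound a0.
exists (4 * C * Cs); first by rewrite !mulr_ge0.
move=> L k N u x T L0 su xu T1 LT /andP[k1 k2] LN.
have T0 : 0 < T by lra.
have Lp : 0 < L%:R :> R by rewrite ltr0n.
have kp : (0 < k)%N.
  case: (k) k2 => // k2; have : 1 <= T / L%:R by rewrite ler_pdivlMr// mul1r.
  by rewrite leNgt k2.
have kr : 0 < k%:R :> R by rewrite ltr0n.
have b0 := binw_central_gt0 R k; set b := binw R k.*2 k in b0 *.
pose F n := tilt (c u) (wpow kap nu n) x.
have F0 n : 0 <= F n.
  have [ks _] := expmom_summ (proj1 (andP (let: And5 h _ _ _ _ := sp_pos spec in h))) (kap_mom su).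
  have [ns _] := expmom_summ (proj1 (andP (let: And5 h _ _ _ _ := sp_pos spec in h))) (sp_mom spec su).
  rewrite /F tilt_wpow; apply: (proj1 (wpow_ge0_summ _ _ ks ns n)).
    exact: tilt_ge0.
  by apply: tilt_ge0 => y; exact: ltW.
pose be n := binw R k.*2 (n %/ L) / b.
have -> : Wsum (tilt (c u) kap) (tilt (c u) nu) L k.*2 x / b = \sum_(n < N) be n * F n.
  have be0 l : (k.*2 < l)%N -> binw R k.*2 l / b = 0.
    by move=> h; rewrite /binw bin_small// mul0r mul0r.
  rewrite (sum_blocks (w := fun l => binw R k.*2 l / b) F L0 be0 LN) /Wsum mulr_suml.
  by apply: eq_bigr => z _; rewrite -tilt_wpow mulrAC.
rewrite -[X in X - _]/(\sum_(n < N) F n) -sumrB.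
(* The deficit is at most [(l - k)^2 / k] for the block [l] of [n]. Rounding [n] and [T] to blocks
   gives [|l - k| <= |n - T| / L + 1], and [1 / k <= 2 L / T]. *)
have be1 n : 0 <= 1 - be n <= 4 * (L%:R^-1 + L%:R / T) * (1 + (n%:R - T) ^+ 2 / T).
  have /andP[lo up] := bin_central R (n %/ L) kp.
  rewrite subr_ge0 ler_pdivrMr// mul1r up /=.
  set l := (n %/ L)%N in lo up *.
  have l1 : l%:R * L%:R <= n%:R :> R by rewrite -natrM ler_nat leq_trunc_div.
  have l2 : n%:R <= (l%:R + 1) * L%:R :> R.
    by rewrite natr1 -natrM ler_nat ltnW// ltn_ceil.
  move: k1 k2; rewrite ler_pdivlMr// ltr_pdivrMr// => k1 k2.
  apply: (@le_trans _ _ ((l%:R - k%:R) ^+ 2 / k%:R)).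
    have : 1 - (l%:R - k%:R) ^+ 2 / k%:R <= be n by rewrite /be ler_pdivlMr.
    by rewrite /be; lra.
  have sq : (l%:R - k%:R) ^+ 2 <= 2 * ((n%:R - T) / L%:R) ^+ 2 + 2 :> R.
    set s := (n%:R - T) / L%:R.
    have sE : n%:R - T = s * L%:R by rewrite /s divfK// gt_eqF.
    have h : `|l%:R - k%:R| <= `|s| + 1 :> R.
      have := ler_norm s; have := ler_norm (- s); rewrite normrN => s1 s2.
      rewrite ler_norml; apply/andP; split; rewrite -(ler_pM2r Lp).
        have : - `|s| * L%:R <= s * L%:R by rewrite ler_pM2r//; lra.
        rewrite -sE; nra.
      have : s * L%:R <= `|s| * L%:R by rewrite ler_pM2r.
      rewrite -sE; nra.
    rewrite -[leLHS]real_normK ?num_real// -[s ^+ 2]real_normK ?num_real//.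
    apply: (@le_trans _ _ ((`|s| + 1) ^+ 2)); first by rewrite lerXn2r ?nnegrE ?addr_ge0.
    by have := sqr_ge0 (`|s| - 1); rewrite !expr2; nra.
  have k1' : 1 <= k%:R :> R by rewrite ler1n.
  have kT : k%:R^-1 <= 2 * L%:R / T :> R.
    rewrite -[leLHS]mul1r ler_pdivrMr// mulrAC ler_pdivlMr// mul1r.
    move: k2; rewrite -natr1; nra.
  apply: (@le_trans _ _ ((2 * ((n%:R - T) / L%:R) ^+ 2 + 2) * (2 * L%:R / T))).
    by apply: ler_pM; rewrite ?sqr_ge0 ?invr_ge0// ltW.
  have z0 : 0 <= (n%:R - T) ^+ 2 / T by rewrite divr_ge0 ?sqr_ge0// ltW.
  rewrite (_ : _ * (2 * L%:R / T) = 4 * (L%:R^-1 * ((n%:R - T) ^+ 2 / T) + L%:R / T)); last first.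
    by field; rewrite !gt_eqF.
  rewrite -mulrA ler_pM2l//.
  have i0 : 0 <= L%:R^-1 :> R by rewrite invr_ge0 ltW.
  have i1 : 0 <= L%:R / T by rewrite divr_ge0// ltW.
  by have := mulr_ge0 i1 z0; nra.
apply/andP; split.
  apply: sumr_ge0 => n _; rewrite -{1}[F n]mul1r -mulrBl mulr_ge0//.
  by have /andP[] := be1 n.
have Td : 0 <= C / Num.sqrt T ^+ d by rewrite divr_ge0// exprn_ge0// sqrtr_ge0.
have LL : 0 <= 4 * (L%:R^-1 + L%:R / T).
  by rewrite mulr_ge0// addr_ge0 ?invr_ge0 ?divr_ge0// ltW.
apply: (@le_trans _ _ (4 * (L%:R^-1 + L%:R / T) * (C / Num.sqrt T ^+ d) * (Cs * Num.sqrt T))).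
  apply: le_trans (ler_wpM2l _ (HCs T N T1)); last by rewrite mulr_ge0.
  rewrite mulr_sumr; apply: ler_sum => n _.
  rewrite -{1}[F n]mul1r -mulrBl.
  have /andP[b1 b2] := be1 n; apply: (le_trans (ler_pM b1 (F0 n) b2 (HC _ _ _ n su xu T1))).
  by rewrite le_eqVlt; apply/orP; left; apply/eqP; ring.
by rewrite le_eqVlt; apply/orP; left; apply/eqP; ring.
Qed.

End Walk.

(** * Continuity on the sphere *)

Section Within.
Variables (R : realType) (d : nat).
Implicit Types (u v : 'rV[R]_d) (A : set 'rV[R]_d).

Lemma within_lip A (f : 'rV[R]_d -> R) (rho K : R) : 0 < rho -> 0 <= K ->
  (forall u v (r : R), A u -> A v -> 0 <= r <= rho -> (forall k, `|(u - v) 0 k| <= r) ->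
    `|f u - f v| <= K * r) -> {within A, continuous f}.
Proof.
move=> rho0 K0 H; apply/subspace_continuousP => u Au.
apply/cvgrPdist_le => e e0.
pose r := Num.min rho (e / (K + 1)).
have K1 : 0 < K + 1 by lra.
have r0 : 0 < r by rewrite lt_min rho0 divr_gt0.
apply: filterS (nbhsx_ballx u r r0) => t bt At.
have clo k : `|(u - t) 0 k| <= r.
  by have [_ /(_ 0 k)/ltW] := bt; rewrite !mxE.
have rr : 0 <= r <= rho by rewrite (ltW r0) ge_min lexx.
apply: (le_trans (H u t r Au At rr clo)).
have : r * (K + 1) <= e by rewrite -ler_pdivlMr// ge_min lexx orbT.
have := ltW r0; lra.
Qed.

Lemma within_lip_rV A (f : 'rV[R]_d -> 'rV[R]_d) (K : R) : 0 <= K ->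
  (forall u v (r : R), A u -> A v -> (forall k, `|(u - v) 0 k| <= r) ->
    forall k, `|(f u - f v) 0 k| <= K * r) -> {within A, continuous f}.
Proof.
move=> K0 H; apply/subspace_continuousP => u Au.
apply/cvg_ballP => e e0.
have K1 : 0 < K + 1 by lra.
pose r := e / (2 * (K + 1)).
have r0 : 0 < r by rewrite divr_gt0// mulr_gt0.
apply: filterS (nbhsx_ballx u r r0) => t bt At.
have clo k : `|(u - t) 0 k| <= r.
  by have [_ /(_ 0 k)/ltW] := bt; rewrite !mxE.
split => // i k; rewrite ord1; have := H u t r Au At clo k; rewrite !mxE => h.
apply: (le_lt_trans h).
have : r * (2 * (K + 1)) = e by rewrite divfK// gt_eqF// mulr_gt0.
by lra.
Qed.

Lemma sphere_compact : compact (@sphere R d).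
Proof.
have cl : closed (@sphere R d).
  have -> : @sphere R d = (fun v => dotp v v) @^-1` [set 1].
    apply/seteqP; split => u /=; first exact: sphere_dotp.
    by move=> h; rewrite /sphere /= /enorm -[RHS]sqrtr1 -h /dotp; congr Num.sqrt.
  apply: (continuous_closedP _).1; last exact: closed_eq.
  apply: continuous_sum => k v.
  have h : continuous (fun v : 'rV[R]_d => v 0 k) by exact: coord_continuous.
  exact: (cvgM (h v) (h v)).
apply: (subclosed_compact cl (B := [set v : 'rV[R]_d | forall i, `[(-1 : R), 1]%classic (v ord0 i)])).
  by apply: (@rV_compact _ _ (fun=> `[(-1 : R), 1]%classic)) => i; exact: segment_compact.
move=> u su i /=; rewrite in_itv /=.
by have := sphere_coord i su; rewrite ler_norml.
Qed.

Lemma sphere_neq0 : (0 < d)%N -> @sphere R d !=set0.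
Proof.
move=> d0; exists (delta_mx 0 (Ordinal d0)).
rewrite /sphere /= /enorm (bigD1 (Ordinal d0))//= mxE !eqxx expr1n big1 ?addr0 ?sqrtr1//.
by move=> k kn; rewrite mxE (negPf kn) andbF expr0n.
Qed.

Lemma within_bounds (f : 'rV[R]_d -> R) : (0 < d)%N -> {within @sphere R d, continuous f} ->
  (forall u, sphere u -> 0 < f u) ->
  exists C1 C2 : R, [/\ 0 < C1, 0 < C2 & forall u, sphere u -> C1 <= f u <= C2].
Proof.
move=> d0 cf f0.
have [a aS amin] := @compact_EVT_min _ R f _ (sphere_neq0 d0) sphere_compact cf.
have [b bS bmax] := @compact_EVT_max _ R f _ (sphere_neq0 d0) sphere_compact cf.
rewrite !inE in aS bS.
exists (f a), (f b); split; [exact: f0|exact: f0|] => u su.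
by rewrite amin ?bmax ?inE.
Qed.

End Within.

(** * The asymptotics of the Green kernel of a walk *)

Lemma cvgX_filter (R : realType) (T : Type) (F : set_system T) (FF : Filter F)
    (f : T -> R) (l : R) (m : nat) :
  f k @[k --> F] --> l -> f k ^+ m @[k --> F] --> l ^+ m.
Proof.
move=> fl; elim: m => [|m IH]; first by rewrite expr0; exact: cvg_cst.
by rewrite exprS; under eq_fun do rewrite exprS; exact: cvgM.
Qed.

(** * Normalization by the central binomial weight *)

Section Ratio.
Variables (R : realType) (w : R).
Hypothesis w0 : 0 < w.
Hypothesis w_lim : forall eps, 0 < eps -> exists n0 : nat,
  forall k, (n0 <= k)%N -> `|w - Num.sqrt (k.*2)%:R * binw R k.*2 k| <= eps.

(** As [T] lies between [L k] and [L (k + 1)], the quotient [T / (2 k)] is squeezed between [L / 2]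
    and a sequence tending to it. Only [k] has to be large, uniformly in [T]. *)
Lemma ratio_cvg (n L : nat) (e : R) : (0 < L)%N -> 0 < e -> exists k0 : nat, forall k (T : R),
  (k0 <= k)%N -> k%:R <= T / L%:R < k.+1%:R ->
  `|Num.sqrt T ^+ n / Num.sqrt (k.*2)%:R ^+ n / (Num.sqrt (k.*2)%:R * binw R k.*2 k) -
    Num.sqrt (L%:R / 2) ^+ n / w| <= e.
Proof.
move=> L0 e0; have Lp : 0 < L%:R :> R by rewrite ltr0n.
pose b (k : nat) : R := Num.sqrt (k.*2)%:R * binw R k.*2 k.
have b0 k : 0 <= b k by rewrite mulr_ge0 ?sqrtr_ge0 ?binw_ge0.
have bw : b k @[k --> \oo] --> w.
  apply/cvgrPdist_le => eps eps0; have [n0 H] := w_lim eps0.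
  by exists n0 => // k; exact: H.
have bV : (b k)^-1 @[k --> \oo] --> w^-1 by apply: cvgV => //; rewrite gt_eqF.
pose lo (k : nat) := Num.sqrt (L%:R / 2) ^+ n / b k.
pose up (k : nat) := Num.sqrt (L%:R / 2 * (1 + 2 * harmonic k)) ^+ n / b k.
have lo_lim : lo k @[k --> \oo] --> Num.sqrt (L%:R / 2) ^+ n / w.
  by apply: cvgM bV; exact: cvg_cst.
have up_lim : up k @[k --> \oo] --> Num.sqrt (L%:R / 2) ^+ n / w.
  apply: cvgM bV.
  have h : Num.sqrt (L%:R / 2 * (1 + 2 * harmonic k)) @[k --> \oo] --> Num.sqrt (L%:R / 2 : R).
    apply: continuous_cvg; first exact: sqrt_continuous.
    rewrite -[X in _ --> X]mulr1; apply: cvgM; first exact: cvg_cst.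
    rewrite -[X in _ --> X]addr0; apply: cvgD; first exact: cvg_cst.
    by rewrite -[X in _ --> X](mulr0 2); apply: cvgM; [exact: cvg_cst|exact: cvg_harmonic].
  exact: cvgX_filter.
have [k1 _ H1] := (@cvgrPdist_le _ _ _ _ _ _ _).1 lo_lim e e0.
have [k2 _ H2] := (@cvgrPdist_le _ _ _ _ _ _ _).1 up_lim e e0.
exists (maxn 1 (maxn k1 k2)) => k T; rewrite !geq_max => /and3P[kp l1 l2] /andP[h1 h2].
have kr : 1 <= k%:R :> R by rewrite ler1n.
have k20 : 0 < (k.*2)%:R :> R by rewrite ltr0n double_gt0.
have T0 : 0 <= T.
  by rewrite -(pmulr_lge0 _ (x := L%:R^-1)) ?invr_gt0//; apply: le_trans h1.
have kE : (k.*2)%:R = 2 * k%:R :> R by rewrite -mul2n natrM.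
have mE : Num.sqrt T ^+ n / Num.sqrt (k.*2)%:R ^+ n = Num.sqrt (T / (k.*2)%:R) ^+ n.
  by rewrite sqrtrM// exprMn sqrtrV ?(ltW k20)// exprVn.
have TL1 : L%:R / 2 <= T / (k.*2)%:R.
  move: h1; rewrite ler_pdivlMr// kE ler_pdivlMr; last by lra.
  by nra.
have TL2 : T / (k.*2)%:R <= L%:R / 2 * (1 + 2 * harmonic k).
  move: h2; rewrite ltr_pdivrMr// => h2.
  rewrite ler_pdivrMr// kE /harmonic /= -natr1 in h2 *.
  have -> : L%:R / 2 * (1 + 2 * (k%:R + 1)^-1) * (2 * k%:R) =
      L%:R * (k%:R + 2 * (k%:R / (k%:R + 1))) :> R by field; lra.
  have : 1 <= 2 * (k%:R / (k%:R + 1)) :> R by rewrite mulrA ler_pdivlMr; lra.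
  by nra.
have lm : lo k <= Num.sqrt T ^+ n / Num.sqrt (k.*2)%:R ^+ n / b k.
  rewrite /lo mE ler_wpM2r ?invr_ge0// lerXn2r ?nnegrE ?sqrtr_ge0//.
  by rewrite ler_wsqrtr.
have mu : Num.sqrt T ^+ n / Num.sqrt (k.*2)%:R ^+ n / b k <= up k.
  rewrite /up mE ler_wpM2r ?invr_ge0// lerXn2r ?nnegrE ?sqrtr_ge0//.
  by rewrite ler_wsqrtr.
have := H1 k l1; have := H2 k l2; rewrite /= !ler_norml -/(b k); lra.
Qed.

End Ratio.

(** * Asymptotics along rays, uniformly in the direction *)

Section WalkAsymp.
Variables (R : realType) (d : nat).
Local Notation X := 'rV[int]_d.
Variables nu kap : X -> R.
Variables (c : 'rV[R]_d -> 'rV[R]_d) (del M eps lam0 lam1 Lc : R).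
Hypothesis d0 : (0 < d)%N.
Hypothesis nu_pos : forall x, 0 < nu x.
Hypothesis kap_pos : forall x, 0 < kap x.
Hypothesis spec : support_spec nu c del M eps lam0 lam1 Lc.
Hypothesis kap_mom : forall u, sphere u -> expmom del M (tilt (c u) kap).

(** Two Lipschitz estimates are composed: [c] is Lipschitz on the sphere, and tilted sums are
    Lipschitz for tilts at distance at most [del / 4], whence the radius. *)
Lemma within_sumR (f q : X -> R) (cq : R) : (forall u, sphere u -> expmom del M (tilt (c u) f)) ->
  0 <= cq -> (forall x, `|q x| <= cq * expR (del / 2 * n1 R x)) ->
  {within @sphere R d, continuous (fun u => sumR (fun x => q x * tilt (c u) f x))}.
Proof.
move=> Hf cq0 Hq; have [/andP[del0 del1] M0 _ _ [_ Lc0]] := sp_pos spec.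
have Lc1 : 0 < Lc + 1 by lra.
apply: (@within_lip _ _ _ _ (del / 4 / (Lc + 1)) ((Lc + 1) * (cq * (4 / del) * M))).
- by rewrite !divr_gt0.
- by rewrite !mulr_ge0 ?invr_ge0 ?(ltW del0) ?(ltW M0) ?(ltW Lc1).
move=> u v r su sv /andP[r0 rr] clo.
have clo' k : `|(c u - c v) 0 k| <= (Lc + 1) * r.
  by apply: (le_trans (sp_lip spec su sv clo k)); rewrite ler_wpM2r// lerDl.
have r' : (Lc + 1) * r <= del / 4 by rewrite mulrC -ler_pdivlMr.
have := perturb_lip del0 (Hf _ sv) (mulr_ge0 (ltW Lc1) r0) r' clo' cq0 Hq.
by rewrite [X in _ <= X -> _]mulrAC.
Qed.

Let phik u := sumR (tilt (c u) kap).
Let mm u := mean (tilt (c u) nu).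
Let Sg u := cov (tilt (c u) nu).
Let Ed u := \det (bordered (Sg u) (mm u)).
Let Dd u := \det (Sg u).

Lemma within_phik : {within @sphere R d, continuous phik}.
Proof.
have [/andP[del0 _] _ _ _ _] := sp_pos spec.
have -> : phik = (fun u => sumR (fun x => 1 * tilt (c u) kap x)).
  by apply/funext => u; rewrite sumRZ mul1r.
apply: (within_sumR kap_mom ler01) => x; rewrite normr1 mul1r.
by rewrite -[leLHS](expR0 R) ler_expR mulr_ge0 ?n1_ge0// divr_ge0// ltW.
Qed.

Lemma within_mean k : {within @sphere R d, continuous (fun u => mm u 0 k)}.
Proof.
have [/andP[del0 _] _ _ _ _] := sp_pos spec.
have d2 : 0 < del / 2 by rewrite divr_gt0.
have -> : (fun u => mm u 0 k) = (fun u => sumR (fun x : X => (x 0 k)%:~R * tilt (c u) nu x)).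
  by apply/funext => u; rewrite /mm mxE.
apply: (within_sumR (cq := 1 / (del / 2)) (sp_mom spec)); first by rewrite divr_ge0// ltW.
move=> x; apply: (le_trans (coord_le_n1 _ _ _)).
by have := pow_le_expR 1 d2 (n1_ge0 R x); rewrite !expr1.
Qed.

Lemma within_cov i j : {within @sphere R d, continuous (fun u => Sg u i j)}.
Proof.
have [/andP[del0 _] _ _ _ _] := sp_pos spec.
have d2 : 0 < del / 2 by rewrite divr_gt0.
have h : {within @sphere R d, continuous (fun u => sumR (fun x : X => (x 0 i)%:~R * (x 0 j)%:~R * tilt (c u) nu x))}.
  apply: (within_sumR (cq := (2 / (del / 2)) ^+ 2) (sp_mom spec)); first exact: sqr_ge0.
  move=> x; have := pow_le_expR 2 d2 (n1_ge0 R x); apply: le_trans.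
  by rewrite normrM expr2; apply: ler_pM => //; exact: coord_le_n1.
have -> : (fun u => Sg u i j) = (fun u =>
    sumR (fun x : X => (x 0 i)%:~R * (x 0 j)%:~R * tilt (c u) nu x) - mm u 0 i * mm u 0 j).
  apply/funext => u; rewrite /Sg /cov mxE [X in X + _]mxE [X in _ + X]mxE [X in - X]mxE.
  by rewrite big_ord1 [X in X * _]mxE.
move=> u; apply: cvgB; first exact: h.
by apply: cvgM; exact: within_mean.
Qed.

Lemma within_Dd : {within @sphere R d, continuous Dd}.
Proof. by apply: continuous_det => i j; exact: within_cov. Qed.

Lemma within_Ed : {within @sphere R d, continuous Ed}.
Proof.
apply: continuous_det => i j.
case: (split_ordP i) => i' ->; case: (split_ordP j) => j' ->.
- have -> : (fun u => bordered (Sg u) (mm u) (lshift d i') (lshift d j')) = cst 0.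
    by apply/funext => u; rewrite /bordered block_mxEul mxE.
  exact: cst_continuous.
- have -> : (fun u => bordered (Sg u) (mm u) (lshift d i') (rshift 1 j')) = (fun u => - mm u 0 j').
    by apply/funext => u; rewrite /bordered block_mxEur mxE ord1.
  by move=> u; apply: cvgN; exact: within_mean.
- have -> : (fun u => bordered (Sg u) (mm u) (rshift 1 i') (lshift d j')) = (fun u => mm u 0 i').
    by apply/funext => u; rewrite /bordered block_mxEdl mxE ord1.
  exact: within_mean.
- have -> : (fun u => bordered (Sg u) (mm u) (rshift 1 i') (rshift 1 j')) = (fun u => Sg u i' j').
    by apply/funext => u; rewrite /bordered block_mxEdr.
  exact: within_cov.
Qed.

Lemma within_lam : {within @sphere R d, continuous (lam_of nu c)}.
Proof.
apply: continuous_sum => k u; apply: cvgM; last exact: within_mean.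
apply: (continuous_subspaceT (f := fun v : 'rV[R]_d => v 0 k)).
exact: coord_continuous.
Qed.

Lemma Sg_bounded u : sphere u -> exists kk B, 0 < kk /\ form_bounded kk B (Sg u).
Proof.
move=> su; have [/andP[del0 _] M0 eps0 _ _] := sp_pos spec.
have dp : 0 < d%:R :> R by rewrite ltr0n.
have sp : spread eps (tilt (c u) nu).
  by apply: (sp_spread spec su) => k; rewrite subrr mxE normr0.
exists (eps / (2 * d%:R)), ((2 / del) ^+ 2 * M); split; first by rewrite divr_gt0 ?mulr_gt0.
split; first exact: cov_sym.
move=> v; rewrite (cov_lower d0 del0 eps0 (sp_mom spec su) sp (sp_one spec su)) /=.
rewrite qf_cov; have /andP[_] := mom2_bound del0 (sp_mom spec su) v.
rewrite enorm_sqr -mulrA mulrC; apply: le_trans; rewrite gerBl; exact: sqr_ge0.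
Qed.

Lemma Ed_gt0 u : sphere u -> 0 < Ed u.
Proof.
move=> su; have [kk [B [kk0 fb]]] := Sg_bounded su.
apply: (det_bordered_gt0 kk0 fb); rewrite /mm (sp_mean spec su).
have [_ _ _ lam00 _] := sp_pos spec; have /andP[lo _] := sp_lam spec su.
rewrite scaler_eq0 negb_or gt_eqF//=; last exact: lt_le_trans lo.
by apply/eqP => u0; move: (sphere_dotp su); rewrite u0 dotp0r => /esym/eqP; rewrite oner_eq0.
Qed.

Lemma Dd_gt0 u : sphere u -> 0 < Dd u.
Proof.
move=> su; have [kk [B [kk0 fb]]] := Sg_bounded su.
by have [C _ HC] := @gauss_lattice_sum R d kk B kk0; have [] := HC _ fb.
Qed.

Lemma sqrt_exp (x : R) (n : nat) : 0 <= x -> Num.sqrt (x ^+ n) = Num.sqrt x ^+ n.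
Proof.
move=> x0; rewrite -{1}[x]sqr_sqrtr// -exprM mulnC exprM sqrtr_sqr.
by rewrite ger0_norm// exprn_ge0// sqrtr_ge0.
Qed.

Let gg : R := Num.sqrt (2 * pi) ^+ d / (2 * pi) ^+ d.

Lemma gg_gt0 : 0 < gg.
Proof. by rewrite divr_gt0 ?exprn_gt0 ?sqrtr_gt0 ?mulr_gt0 ?pi_gt0. Qed.

(** Scaling by [L / 2] contributes the power [d], and the rank one part grows by one more factor
    [L / 2]. As [L] grows only the bordered determinant survives. *)
Lemma det_covQ (L : nat) u : (0 < L)%N ->
  \det (covQ L (tilt (c u) nu)) = (L%:R / 2) ^+ d.+1 * (Ed u + 2 * Dd u / L%:R).
Proof.
move=> L0; have Lp : 0 < L%:R :> R by rewrite ltr0n.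
have -> : covQ L (tilt (c u) nu) = (L%:R / 2) *: (Sg u + (L%:R / 2) *: ((mm u)^T *m mm u)).
  rewrite /covQ [RHS]scalerDr scalerA; congr (_ + _ *: _).
  by field.
rewrite detZ det_rank1 -/(Ed u) -/(Dd u) exprS.
by field; rewrite gt_eqF.
Qed.

(** All powers of [L] cancel: [(L/2)^((d-1)/2)] from the normalization and [L] from the block
    length, against [(L/2)^((d+1)/2)] from the determinant, leaving a factor 2. *)
Lemma llt_const (L : nat) (w : R) u : (0 < L)%N -> 0 < w -> sphere u ->
  Num.sqrt (L%:R / 2) ^+ d.-1 / w *
    (phik u * L%:R * (gauss_const (covQ L (tilt (c u) nu)) / (2 * pi) ^+ d)) =
  phik u * (2 * gg / w) / Num.sqrt (Ed u + 2 * Dd u / L%:R).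
Proof.
move=> L0 w0 su; have Lp : 0 < L%:R :> R by rewrite ltr0n.
have Z0 : 0 < Ed u + 2 * Dd u / L%:R.
  by rewrite addr_gt0 ?Ed_gt0// divr_gt0// mulr_gt0// Dd_gt0.
have sd : Num.sqrt (\det (covQ L (tilt (c u) nu))) =
    Num.sqrt (L%:R / 2) ^+ d.+1 * Num.sqrt (Ed u + 2 * Dd u / L%:R).
  by rewrite det_covQ// sqrtrM ?sqrt_exp ?exprn_ge0// divr_ge0.
rewrite /gauss_const sd /gg.
have s0 : 0 < Num.sqrt (Ed u + 2 * Dd u / L%:R) by rewrite sqrtr_gt0.
have h0 : 0 < Num.sqrt (L%:R / 2 : R) by rewrite sqrtr_gt0 divr_gt0.
have hE : L%:R = 2 * (Num.sqrt (L%:R / 2) * Num.sqrt (L%:R / 2)) :> R.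
  by rewrite -expr2 sqr_sqrtr ?divr_ge0//; field.
have p0 : 0 < (2 * pi) ^+ d :> R by rewrite exprn_gt0// mulr_gt0// pi_gt0.
have hd : Num.sqrt (L%:R / 2) ^+ d.+1 =
    Num.sqrt (L%:R / 2) * Num.sqrt (L%:R / 2) * Num.sqrt (L%:R / 2) ^+ d.-1 :> R.
  by rewrite exprS -{1}(prednK d0) exprS mulrA.
rewrite hd -[X in _ = X](mulr1); move: s0 h0 p0 hE.
move: (Num.sqrt (Ed u + _)) (Num.sqrt (L%:R / 2)) ((2 * pi) ^+ d) (Num.sqrt (2 * pi) ^+ d) => s h P Q s0 h0 p0 hE.
have hn : 0 < h ^+ d.-1 by rewrite exprn_gt0.
move: (h ^+ d.-1) hn => H hn; rewrite hE.
by field; rewrite !gt_eqF.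
Qed.

Lemma inv_sqrt_close (E0 E z : R) : 0 < E0 -> E0 <= E -> 0 <= z ->
  `|(Num.sqrt (E + z))^-1 - (Num.sqrt E)^-1| <= z / (E0 * Num.sqrt E0).
Proof.
move=> E00 EE z0; have Ep : 0 < E by exact: lt_le_trans EE.
have s0 : 0 < Num.sqrt E by rewrite sqrtr_gt0.
have s00 : 0 < Num.sqrt E0 by rewrite sqrtr_gt0.
have t0 : 0 < Num.sqrt (E + z) by rewrite sqrtr_gt0; lra.
have st : Num.sqrt E <= Num.sqrt (E + z) by rewrite ler_wsqrtr//; lra.
have s0s : Num.sqrt E0 <= Num.sqrt E by rewrite ler_wsqrtr.
have sE : Num.sqrt E ^+ 2 = E by rewrite sqr_sqrtr// ltW.
have s0E : Num.sqrt E0 ^+ 2 = E0 by rewrite sqr_sqrtr// ltW.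
have tE : Num.sqrt (E + z) ^+ 2 = E + z by rewrite sqr_sqrtr//; lra.
move: s0 s00 t0 st s0s sE s0E tE.
move: (Num.sqrt E) (Num.sqrt E0) (Num.sqrt (E + z)) => s q t s0 q0 t0 st qs sE qE tE.
have -> : t^-1 - s^-1 = - ((t - s) / (t * s)) by field; rewrite !gt_eqF.
rewrite normrN ger0_norm; last by rewrite divr_ge0 ?subr_ge0 ?mulr_ge0// ltW.
have ze : z = (t - s) * (t + s) by rewrite -subr_sqr tE sE; ring.
have a1 : 0 <= t - s by rewrite subr_ge0.
have tsq : q * q <= t * s by apply: ler_pM; rewrite ?(ltW q0)//; exact: le_trans st.
have qts : q <= t + s by lra.
rewrite ze -[leRHS]mulrA ler_wpM2l// -qE.
rewrite ler_pdivlMr ?mulr_gt0 ?exprn_gt0// mulrC ler_pdivrMr ?mulr_gt0//.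
by rewrite [leLHS]mulrC expr2; apply: ler_pM; rewrite ?mulr_ge0 ?(ltW q0).
Qed.

Lemma large_T (L k0 : nat) (Q : R) : (0 < L)%N -> 0 <= Q -> exists2 T0 : R, 0 < T0 &
  forall T, T0 <= T -> exists k : nat, [/\ 1 <= T, L%:R <= T, L%:R / T <= L%:R^-1,
    k%:R <= T / L%:R < k.+1%:R & [/\ (k0 <= k)%N, (0 < k)%N & Q < k%:R]].
Proof.
move=> L0 Q0; have L1 : 1 <= L%:R :> R by rewrite ler1n.
have Lp : 0 < L%:R :> R by lra.
have k00 : 0 <= k0%:R :> R by [].
have kp : 0 < L%:R * (k0%:R + 1) :> R by rewrite mulr_gt0//; lra.
have Qp : 0 < L%:R * (Q + 1) by rewrite mulr_gt0//; lra.
have L2 : 0 < L%:R ^+ 2 :> R by rewrite exprn_gt0.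
exists (L%:R ^+ 2 + L%:R * (k0%:R + 1) + L%:R * (Q + 1)); first by lra.
move=> T T0T; have hL : L%:R ^+ 2 <= T by lra.
have hk : L%:R * (k0%:R + 1) <= T by lra.
have hQ : L%:R * (Q + 1) <= T by lra.
have LT : L%:R <= T by apply: le_trans hL; rewrite expr2 ler_peMr// ltW.
have Tp : 0 < T by lra.
exists (Num.truncn (T / L%:R)).
have kT : (Num.truncn (T / L%:R))%:R <= T / L%:R < (Num.truncn (T / L%:R)).+1%:R.
  by apply: Num.Theory.truncn_itv; rewrite divr_ge0// ltW.
move: (Num.truncn _) kT => k kT; have /andP[k1 k2] := kT.
have kQ : Q < k%:R.
  move: k2; rewrite -natr1 => k2.
  have : Q + 1 <= T / L%:R by rewrite ler_pdivlMr// mulrC.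
  by lra.
split => //; first by lra.
  by rewrite ler_pdivrMr// -ler_pdivrMl ?invr_gt0// invrK -expr2.
split=> //.
  rewrite -ltnS -(ltr_nat R); apply: le_lt_trans k2.
  by rewrite ler_pdivlMr// mulrC; apply: le_trans hk; rewrite ler_pM2l//; lra.
by rewrite -(ltr_nat R); exact: le_lt_trans kQ.
Qed.

(** The number of lazy blocks is [2 k], of which half are run on average; the mean is then
    [k L lam u], at distance at most [L lam1] from [x]. *)
Lemma llt_ray (L : nat) : (0 < L)%N -> exists2 C : R, 0 <= C &
  forall u x (T : R) (k : nat), sphere u -> toR R x = (lam_of nu c u * T) *: u -> (0 < k)%N ->
  k%:R <= T / L%:R < k.+1%:R ->
  `|Num.sqrt (k.*2)%:R ^+ d * Wsum (tilt (c u) kap) (tilt (c u) nu) L k.*2 x -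
     phik u * L%:R * (gauss_const (covQ L (tilt (c u) nu)) / (2 * pi) ^+ d)| <=
  C / Num.sqrt (k.*2)%:R.
Proof.
move=> L0; have Lp : 0 < L%:R :> R by rewrite ltr0n.
have [/andP[del0 del1] M0 eps0 lam00 [lam10 Lc0]] := sp_pos spec.
have [C C0 HC] := llt_Wsum d0 L0 del0 eps0 (mulr_ge0 (ltW lam10) (ltW Lp)) (ltW M0).
exists C => // u x T k su xu k0 /andP[k1 k2].
have sp : spread eps (tilt (c u) nu).
  by apply: (sp_spread spec su) => j; rewrite subrr mxE normr0.
apply: (HC (tilt (c u) nu) (tilt (c u) kap) k.*2 x (sp_mom spec su) sp (sp_one spec su) (kap_mom su)).
  by rewrite double_gt0.
move=> j; rewrite (sp_mean spec su) xu !mxE -mul2n natrM.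
have -> : lam_of nu c u * T * u 0 j - 2%:R * k%:R * L%:R / 2 * (lam_of nu c u * u 0 j) =
  lam_of nu c u * (T - k%:R * L%:R) * u 0 j by field.
have /andP[llo lup] := sp_lam spec su.
have lp : 0 <= lam_of nu c u by apply: le_trans llo; exact: ltW.
have tk0 : 0 <= T - k%:R * L%:R by rewrite subr_ge0 -ler_pdivlMr.
have tk1 : T - k%:R * L%:R <= L%:R.
  move: k2; rewrite -natr1 ltr_pdivrMr// mulrDl mul1r => k2.
  by rewrite lerBlDl ltW.
rewrite normrM; apply: (@le_trans _ _ (`|lam_of nu c u * (T - k%:R * L%:R)| * 1)).
  by rewrite ler_wpM2l// sphere_coord.
by rewrite mulr1 ger0_norm ?mulr_ge0//; apply: ler_pM.
Qed.

Lemma quarters (x : R) : x / 4 + x / 4 = x / 2.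
Proof. lra. Qed.

Lemma last_split (x y z : R) : x + y <= z / 2 -> x + (z / 2 + y) <= z.
Proof. lra. Qed.

(** Each power near the optimum contributes [r^(-d/2)] and the window of such powers has width of
    order [sqrt r], hence the exponent [d - 1]. *)
Theorem walk_asymp : exists chi : 'rV[R]_d -> R,
  [/\ {within @sphere R d, continuous chi}, forall u, sphere u -> 0 < chi u &
  forall e : R, 0 < e -> exists2 r0 : R, 0 < r0 &
  forall u x (r : R), sphere u -> toR R x = r *: u -> r0 <= r ->
  exists N0 : nat, forall N, (N0 <= N)%N ->
  `|Num.sqrt r ^+ d.-1 * (\sum_(n < N) tilt (c u) (wpow kap nu n) x) - chi u| <= e].
Proof.
have [/andP[del0 del1] M0 eps0 lam00 [lam10 Lc0]] := sp_pos spec.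
have [w w0 w_lim] := wallis R.
have kap_ge0 x : 0 <= kap x by exact: ltW.
have [Cs Cs0 HCs] := smooth_compare d0 nu_pos kap_ge0 spec kap_mom.
have ksum u : sphere u -> summ (tilt (c u) kap) /\ phik u <= M.
  by move=> su; exact: expmom_summ del0 (kap_mom su).
have phik0 u : sphere u -> 0 < phik u.
  move=> su; have [s _] := ksum u su.
  apply: lt_le_trans (@sumR_term_le _ _ _ 0 _ s); first by rewrite mulr_gt0 ?expR_gt0.
  exact: tilt_ge0.
have [E0 [E1 [E00 E10 HE]]] := within_bounds d0 within_Ed Ed_gt0.
have [D0 [D1 [D00 D10 HD]]] := within_bounds d0 within_Dd Dd_gt0.
pose G : R := 2 * gg / w.
have G0 : 0 < G by rewrite divr_gt0// mulr_gt0// gg_gt0.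
pose Y u : R := phik u * G / Num.sqrt (Ed u).
(* The estimates are in the time variable [T = r / lam]; passing to [r] multiplies the limit by this
   power of [sqrt lam]. *)
pose chi u : R := Num.sqrt (lam_of nu c u) ^+ d.-1 * Y u.
have lamp u : sphere u -> 0 < lam_of nu c u.
  by move=> su; have /andP[lo _] := sp_lam spec su; exact: lt_le_trans lo.
exists chi; split.
- apply/subspace_continuousP => u su.
  have cl : Num.sqrt (lam_of nu c v) @[v --> within (@sphere R d) (nbhs u)] --> Num.sqrt (lam_of nu c u).
    apply: continuous_cvg; first exact: sqrt_continuous.
    exact: (subspace_continuousP _ _).1 within_lam u su.
  have cE : Num.sqrt (Ed v) @[v --> within (@sphere R d) (nbhs u)] --> Num.sqrt (Ed u).
    apply: continuous_cvg; first exact: sqrt_continuous.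
    exact: (subspace_continuousP _ _).1 within_Ed u su.
  apply: cvgM; last first.
    apply: cvgM; last by apply: cvgV => //; rewrite gt_eqF// sqrtr_gt0 Ed_gt0.
    apply: cvgM; last exact: cvg_cst.
    exact: (subspace_continuousP _ _).1 within_phik u su.
  exact: cvgX_filter.
- move=> u su; rewrite mulr_gt0 ?exprn_gt0 ?sqrtr_gt0 ?lamp//.
  by rewrite divr_gt0 ?sqrtr_gt0 ?Ed_gt0// mulr_gt0// phik0.
move=> e e0.
pose Lam := Num.sqrt lam1 ^+ d.-1.
have Lam0 : 0 < Lam by rewrite exprn_gt0// sqrtr_gt0.
pose e' := e / Lam; have e'0 : 0 < e' by rewrite divr_gt0.
suff [T0 T00 HT] : exists2 T0 : R, 0 < T0 &
    forall u x (T : R), sphere u -> toR R x = (lam_of nu c u * T) *: u -> T0 <= T ->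
    exists N0 : nat, forall N, (N0 <= N)%N ->
    `|Num.sqrt T ^+ d.-1 * (\sum_(n < N) tilt (c u) (wpow kap nu n) x) - Y u| <= e'.
  exists (lam1 * T0); first by rewrite mulr_gt0.
  move=> u x r su xr r0.
  have lp := lamp u su; have /andP[_ lup] := sp_lam spec su.
  pose T := r / lam_of nu c u.
  have rE : r = lam_of nu c u * T by rewrite /T mulrC divfK// gt_eqF.
  have T0T : T0 <= T.
    rewrite /T ler_pdivlMr// mulrC; apply: le_trans r0.
    by rewrite ler_wpM2r// ltW.
  have [N0 HN] := HT u x T su ltac:(by rewrite -rE) T0T.
  exists N0 => N /HN h; rewrite rE sqrtrM ?(ltW lp)// exprMn -mulrA -mulrBr normrM.
  rewrite ger0_norm ?exprn_ge0 ?sqrtr_ge0//.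
  have -> : e = Lam * e' by rewrite /e' mulrC divfK// gt_eqF.
  apply: ler_pM => //; rewrite ?exprn_ge0 ?sqrtr_ge0//.
  by rewrite lerXn2r ?nnegrE ?sqrtr_ge0// ler_wsqrtr.
pose CX := M * G * (2 * D1) / (E0 * Num.sqrt E0).
have MG : 0 <= M * G by exact: mulr_ge0 (ltW M0) (ltW G0).
have CX0 : 0 <= CX.
  apply: divr_ge0; first by apply: mulr_ge0 => //; apply: mulr_ge0 => //; exact: ltW.
  by rewrite mulr_ge0 ?sqrtr_ge0// ltW.
(* [L] is fixed from the two errors that decay only in [L]: [2 Cs / L] from the block comparison and
   [CX / L] from dropping [2 D / L] in the determinant. Only then may [T] grow, since the local
   limit constant depends on [L]. *)
pose L := (Num.truncn (2 * (2 * Cs + CX) / e')).+1.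
have L0 : (0 < L)%N by [].
have L1 : 1 <= L%:R :> R by rewrite ler1n.
have Lp : 0 < L%:R :> R by lra.
have LZ : (2 * Cs + CX) / L%:R <= e' / 2.
  rewrite ler_pdivrMr// mulrAC ler_pdivlMr// mulrC -ler_pdivrMl// mulrC.
  have tr : 0 <= 2 * (2 * Cs + CX) / e' by rewrite divr_ge0 ?(ltW e'0)// mulr_ge0// addr_ge0// mulr_ge0.
  have /andP[_ /ltW] := Num.Theory.truncn_itv tr; apply: le_trans.
  by rewrite [leLHS]mulrC -!mulrA [leLHS]mulrCA.
have [C C0 HC] := llt_ray L0.
pose a' := Num.sqrt (L%:R / 2) ^+ d.-1 / w.
have a'0 : 0 < a' by rewrite divr_gt0// exprn_gt0// sqrtr_gt0 divr_gt0.
pose Ym := M * G / Num.sqrt E0.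
have Ym0 : 0 <= Ym by apply: divr_ge0; rewrite ?sqrtr_ge0.
pose B := Ym / a' + C.
have B0 : 0 <= B by rewrite addr_ge0// divr_ge0// ltW.
have B1' : 0 < B + 1 by rewrite ltr_wpDl.
have B1 : 0 < 4 * (B + 1) by rewrite mulr_gt0.
have [k0 Hk0] := ratio_cvg w0 w_lim d.-1 L0 (divr_gt0 e'0 B1).
(* From [Q < k] it follows that the local limit error [a' * C / sqrt (2 k)] is at most [e' / 4]. *)
pose Q := (4 * (a' * C) / e') ^+ 2.
have Q0 : 0 <= Q by exact: sqr_ge0.
have [T0 T00 HT0] := large_T k0 L0 Q0.
exists T0 => // u x T su xu /HT0[k [T1 LT LT2 kT [kk0 kp kQ]]].
have Tp : 0 < T by exact: lt_le_trans T1.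
exists (L * k.*2.+1)%N => N LN.
have /andP[c1 c2] := HCs L k N u x T L0 su xu T1 LT kT LN.
set S := \sum_(n < N) _ in c1 c2 *.
set W := Wsum _ _ _ _ _ in c1 c2.
set b := binw R k.*2 k in c1 c2.
have b0 : 0 < b by exact: binw_central_gt0.
have K0 : (0 < k.*2)%N by rewrite double_gt0.
have Kp : 0 < (k.*2)%:R :> R by rewrite ltr0n.
set sK := Num.sqrt ((k.*2)%:R : R).
have sK0 : 0 < sK by rewrite sqrtr_gt0.
have := HC u x T k su xu kp kT.
rewrite -/W -/sK -/(phik u); set V := sK ^+ d * W; set V8 := phik u * L%:R * _ => hV.
have YL := llt_const L0 w0 su; rewrite -/a' -/V8 -/G in YL.
have [_ pM] := ksum u su; have p0 := phik0 u su.
have /andP[Elo _] := HE u su; have /andP[Dlo Dup] := HD u su.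
have z0 : 0 <= 2 * Dd u / L%:R by rewrite divr_ge0 ?(ltW Lp)// mulr_ge0// ltW// Dd_gt0.
have e1 : `|a' * V8 - Y u| <= CX / L%:R.
  rewrite YL /Y -mulrBr normrM ger0_norm; last by rewrite mulr_ge0// ltW.
  apply: (@le_trans _ _ (M * G * (2 * D1 / L%:R / (E0 * Num.sqrt E0)))).
    apply: ler_pM => //; first by rewrite mulr_ge0// ltW.
      by rewrite ler_wpM2r// ltW.
    apply: (le_trans (inv_sqrt_close E00 Elo z0)).
    rewrite ler_wpM2r ?invr_ge0 ?mulr_ge0 ?sqrtr_ge0 ?(ltW E00)//.
    by rewrite ler_wpM2r ?invr_ge0 ?(ltW Lp)// ler_pM2l.
  by rewrite le_eqVlt; apply/orP; left; apply/eqP; rewrite /CX; ring.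
have V80 : 0 <= V8.
  rewrite -(pmulr_rge0 _ a'0) YL; apply: divr_ge0; last exact: sqrtr_ge0.
  exact: mulr_ge0 (ltW p0) (ltW G0).
have V8m : V8 <= Ym / a'.
  rewrite ler_pdivlMr// mulrC YL /Ym; apply: ler_pM => //.
  - by rewrite mulr_ge0// ltW.
  - by rewrite ler_wpM2r// ltW.
  - have EZ : E0 <= Ed u + 2 * Dd u / L%:R by apply: (le_trans Elo); rewrite lerDl.
    by rewrite lef_pV2 ?posrE ?sqrtr_gt0 ?ler_wsqrtr//; exact: lt_le_trans EZ.
have sK1 : 1 <= sK by rewrite -[leLHS]sqrtr1 ler_wsqrtr// ler1n.
have VB : `|V| <= B.
  have : `|V - V8| <= C.
    by apply: (le_trans hV); rewrite ler_pdivrMr// ler_peMr.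
  have := ler_normD (V - V8) V8; rewrite subrK (ger0_norm V80) /B => h1 h2.
  by apply: (le_trans h1); rewrite addrC lerD.
pose a := Num.sqrt T ^+ d.-1 / sK ^+ d.-1 / (sK * b).
have e2 : `|a - a'| <= e' / (4 * (B + 1)) by exact: Hk0.
have e3 : `|a * V - a' * V8| <= e' / 2.
  have -> : a * V - a' * V8 = (a - a') * V + a' * (V - V8) by ring.
  apply: (le_trans (ler_normD _ _)); rewrite (normrM (a - a')) (normrM a') (gtr0_norm a'0).
  have h1 : `|a - a'| * `|V| <= e' / 4.
    apply: (@le_trans _ _ (e' / (4 * (B + 1)) * (B + 1))).
      by apply: ler_pM => //; apply: (le_trans VB); rewrite lerDl.
    rewrite le_eqVlt; apply/orP; left; apply/eqP; move: (B + 1) B1' => q q0.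
    by field; rewrite gt_eqF.
  have h2 : a' * `|V - V8| <= e' / 4.
    apply: (@le_trans _ _ (a' * (C / sK))); first by rewrite ler_pM2l.
    rewrite mulrA ler_pdivrMr// -ler_pdivrMl ?divr_gt0//.
    have -> : (e' / 4)^-1 * (a' * C) = 4 * (a' * C) / e' by field; rewrite gt_eqF.
    have qs : Num.sqrt Q <= sK.
      rewrite ler_wsqrtr//; apply: (le_trans (ltW kQ)).
      by rewrite ler_nat -addnn leq_addr.
    apply: le_trans qs; rewrite /Q sqrtr_sqr; exact: ler_norm.
  apply: (le_trans (lerD h1 h2)).
  by rewrite quarters.
have aV : a * V = Num.sqrt T ^+ d.-1 * (W / b).
  have hd : sK ^+ d = sK * sK ^+ d.-1 by rewrite -{1}(prednK d0) exprS.
  rewrite /a /V hd.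
  have : 0 < sK ^+ d.-1 by rewrite exprn_gt0.
  move: (sK ^+ d.-1) => H H0; by field; rewrite !gt_eqF.
have e4 : `|Num.sqrt T ^+ d.-1 * S - a * V| <= 2 * Cs / L%:R.
  rewrite aV -mulrBr normrM !ger0_norm ?exprn_ge0 ?sqrtr_ge0//.
  have sT : 0 < Num.sqrt T by rewrite sqrtr_gt0.
  apply: (@le_trans _ _ (Num.sqrt T ^+ d.-1 * (Cs * (Num.sqrt T / Num.sqrt T ^+ d) * (L%:R^-1 + L%:R / T)))).
    by rewrite ler_wpM2l// exprn_ge0// sqrtr_ge0.
  have -> : Num.sqrt T ^+ d.-1 * (Cs * (Num.sqrt T / Num.sqrt T ^+ d) * (L%:R^-1 + L%:R / T)) =
      Cs * (L%:R^-1 + L%:R / T).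
    have hd : Num.sqrt T ^+ d = Num.sqrt T * Num.sqrt T ^+ d.-1.
      by rewrite -{1}(prednK d0) exprS.
    rewrite hd.
    have : 0 < Num.sqrt T ^+ d.-1 by rewrite exprn_gt0.
    by move: (Num.sqrt T ^+ d.-1) => H H0; field; rewrite !gt_eqF.
  rewrite -[leRHS]mulrA [leRHS]mulrCA ler_wpM2l//.
  by rewrite (_ : 2 / L%:R = L%:R^-1 + L%:R^-1) ?lerD2l// mulr_natl mulr2n.
apply: (le_trans (ler_distD (a * V) _ _)).
have h := lerD e4 (le_trans (ler_distD (a' * V8) _ _) (lerD e3 e1)).
by apply: (le_trans h); apply: last_split; rewrite -mulrDl.
Qed.

End WalkAsymp.

(** * Nonnegative kernels *)

Section Kernel.
Variable R : realType.
Local Open Scope ereal_scope.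
Implicit Types S T U V : choiceType.

Definition kc S T U (A : S -> T -> \bar R) (B : T -> U -> \bar R) s u : \bar R :=
  \esum_(t in [set: T]) (A s t * B t u).

Definition kge0 S T (A : S -> T -> \bar R) := forall s t, 0 <= A s t.

Lemma kc_ge0 S T U (A : S -> T -> \bar R) (B : T -> U -> \bar R) :
  kge0 A -> kge0 B -> kge0 (kc A B).
Proof. by move=> A0 B0 s u; apply: esum_ge0 => t _; rewrite mule_ge0. Qed.

Lemma kc_assoc S T U V (A : S -> T -> \bar R) (B : T -> U -> \bar R) (C : U -> V -> \bar R) :
  kge0 A -> kge0 B -> kge0 C -> forall s v, kc (kc A B) C s v = kc A (kc B C) s v.
Proof.
move=> A0 B0 C0 s v; rewrite /kc.
transitivity (\esum_(t in [set: U]) \esum_(u in [set: T]) (A s u * B u t * C t v)).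
  apply: eq_esum => u _; rewrite -esumZr// => t.
  by rewrite mule_ge0.
rewrite esum_exchange; last by move=> x y; rewrite !mule_ge0.
apply: eq_esum => t _; rewrite -esumZl//.
  by apply: eq_esum => u _; rewrite muleA.
by move=> u; rewrite mule_ge0.
Qed.

Lemma eq_kc S T U (A A' : S -> T -> \bar R) (B B' : T -> U -> \bar R) s u :
  (forall t, A s t = A' s t) -> (forall t, B t u = B' t u) -> kc A B s u = kc A' B' s u.
Proof. by move=> eA eB; apply: eq_esum => t _; rewrite eA eB. Qed.

Lemma kc_le S T U (A A' : S -> T -> \bar R) (B B' : T -> U -> \bar R) s u :
  kge0 A -> kge0 B -> (forall t, A s t <= A' s t) -> (forall t, B t u <= B' t u) ->
  kc A B s u <= kc A' B' s u.
Proof.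
by move=> A0 B0 eA eB; apply: le_esum => t _; apply: lee_pmul.
Qed.

Lemma kcDl S T U (A A' : S -> T -> \bar R) (B : T -> U -> \bar R) s u :
  kge0 A -> kge0 A' -> kge0 B ->
  kc (fun s t => A s t + A' s t) B s u = kc A B s u + kc A' B s u.
Proof.
move=> A0 A'0 B0; rewrite /kc -esumD; try by move=> t _; rewrite mule_ge0.
by apply: eq_esum => t _; rewrite ge0_muleDl.
Qed.

Lemma kcDr S T U (A : S -> T -> \bar R) (B B' : T -> U -> \bar R) s u :
  kge0 A -> kge0 B -> kge0 B' ->
  kc A (fun s t => B s t + B' s t) s u = kc A B s u + kc A B' s u.
Proof.
move=> A0 A'0 B0; rewrite /kc -esumD; try by move=> t _; rewrite mule_ge0.
by apply: eq_esum => t _; rewrite ge0_muleDr.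
Qed.

Lemma kcZr S T U (A : S -> T -> \bar R) (B : T -> U -> \bar R) (c : \bar R) s u :
  kge0 A -> kge0 B -> 0 <= c -> kc A (fun s t => c * B s t) s u = c * kc A B s u.
Proof.
move=> A0 B0 c0; rewrite /kc -esumZl//; last by move=> t; rewrite mule_ge0.
by apply: eq_esum => t _; rewrite muleCA.
Qed.

Lemma kc_term S T U (A : S -> T -> \bar R) (B : T -> U -> \bar R) s t u :
  kge0 A -> kge0 B -> A s t * B t u <= kc A B s u.
Proof.
move=> A0 B0; apply: (@esum_term_le _ _ (fun t => A s t * B t u)) => y.
by rewrite mule_ge0.
Qed.

Lemma kc_gt0 S T U (A : S -> T -> \bar R) (B : T -> U -> \bar R) s u :
  0 < kc A B s u -> kge0 A -> kge0 B -> exists t, 0 < A s t /\ 0 < B t u.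
Proof.
move=> h A0 B0; apply: contrapT => H; move: h; rewrite /kc esum1 ?ltxx// => t _.
have [z|z] := eqVneq (A s t) 0; first by rewrite z mul0e.
have [z'|z'] := eqVneq (B t u) 0; first by rewrite z' mule0.
by exfalso; apply: H; exists t; rewrite !lt_neqAle !(eq_sym 0) z z' A0 B0.
Qed.

Definition kid S (s t : S) : \bar R := (if s == t then 1%R else 0%R)%:E.

Lemma kid_ge0 S : kge0 (@kid S).
Proof. by move=> s t; rewrite /kid lee_fin; case: ifP. Qed.

Lemma kc_idl S T (A : S -> T -> \bar R) s t : kge0 A -> kc (@kid S) A s t = A s t.
Proof.
move=> A0; rewrite /kc (@esum_point _ _ (fun x => kid s x * A x t) s).
- by rewrite /kid eqxx mul1e.
- by move=> x xs; rewrite /kid eq_sym (negPf xs) mul0e.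
- by rewrite mule_ge0// kid_ge0.
Qed.

Lemma kc_idr S T (A : S -> T -> \bar R) s t : kge0 A -> kc A (@kid T) s t = A s t.
Proof.
move=> A0; rewrite /kc (@esum_point _ _ (fun x => A s x * kid x t) t).
- by rewrite /kid eqxx mule1.
- by move=> x xs; rewrite /kid (negPf xs) mule0.
- by rewrite mule_ge0// kid_ge0.
Qed.

Fixpoint kpow S (Q : S -> S -> \bar R) n : S -> S -> \bar R :=
  if n is n'.+1 then kc (kpow Q n') Q else @kid S.

Definition star S (Q : S -> S -> \bar R) s t : \bar R := \esum_(n in [set: nat]) kpow Q n s t.

Lemma esum_natS (a : nat -> \bar R) : (forall n, 0 <= a n) ->
  \esum_(n in [set: nat]) a n = a 0%N + \esum_(n in [set: nat]) a n.+1.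
Proof.
move=> a0; rewrite (esumID [set 0%N])// setTI esum_set1//; congr (_ + _).
rewrite setTI (reindex_esum setT _ succn)//; split => //.
- by move=> m n _ _ [].
- by case=> //= m _; exists m.
Qed.

Lemma esum_nat_shift (a : nat -> \bar R) k : (forall n, 0 <= a n) ->
  \esum_(n in [set: nat]) a (n + k)%N <= \esum_(n in [set: nat]) a n.
Proof.
move=> a0; elim: k => [|k IH]; first by under eq_esum do rewrite addn0.
apply: le_trans IH; rewrite [leRHS]esum_natS//.
apply: (@le_trans _ _ (\esum_(n in [set: nat]) a (n.+1 + k)%N)); last by rewrite leeDr.
by apply: le_esum => n _; rewrite addnS addSn.
Qed.

Lemma esum_nat_leE (a : nat -> \bar R) (M : \bar R) : (forall n, 0 <= a n) ->
  (forall n, \sum_(k < n) a k <= M) -> \esum_(k in [set: nat]) a k <= M.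
Proof.
move=> a0 aM; rewrite -nneseries_esumT//.
apply: lime_le; first by apply: is_cvg_nneseries.
by apply: nearW => n; rewrite big_mkord.
Qed.

Section Star.
Variables (S : choiceType) (Q : S -> S -> \bar R).
Hypothesis Q0 : kge0 Q.

Lemma kpow_ge0 n : kge0 (kpow Q n).
Proof. by elim: n => [|n IH]; [exact: kid_ge0 | exact: kc_ge0]. Qed.

Lemma kpowD m n s t : kpow Q (m + n) s t = kc (kpow Q m) (kpow Q n) s t.
Proof.
elim: n t => [|n IH] t; first by rewrite addn0 kc_idr//; exact: kpow_ge0.
rewrite addnS /= -kc_assoc//; try exact: kpow_ge0.
by apply: eq_kc => // u; rewrite IH.
Qed.

Lemma kpow1 s t : kpow Q 1 s t = Q s t.
Proof. exact: kc_idl. Qed.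

Lemma kpowSl n s t : kpow Q n.+1 s t = kc Q (kpow Q n) s t.
Proof. by rewrite -(add1n n) kpowD; apply: eq_kc => // u; exact: kpow1. Qed.

Lemma star_ge0 : kge0 (star Q).
Proof. by move=> s t; apply: esum_ge0 => n _; exact: kpow_ge0. Qed.

Lemma star_term n s t : kpow Q n s t <= star Q s t.
Proof. by apply: (@esum_term_le _ _ (fun n => kpow Q n s t)) => k; exact: kpow_ge0. Qed.

Lemma kc_starl T (B : S -> T -> \bar R) s t : kge0 B ->
  kc (star Q) B s t = \esum_(n in [set: nat]) kc (kpow Q n) B s t.
Proof.
move=> B0; rewrite /kc -esum_exchange.
  apply: eq_esum => u _; rewrite -esumZr// => n; exact: kpow_ge0.
by move=> u n; rewrite mule_ge0//; exact: kpow_ge0.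
Qed.

Lemma kc_starr T (B : T -> S -> \bar R) s t : kge0 B ->
  kc B (star Q) s t = \esum_(n in [set: nat]) kc B (kpow Q n) s t.
Proof.
move=> B0; rewrite /kc -esum_exchange.
  apply: eq_esum => u _; rewrite -esumZl// => n; exact: kpow_ge0.
by move=> u n; rewrite mule_ge0//; exact: kpow_ge0.
Qed.

Lemma starE s t : star Q s t = kid s t + kc Q (star Q) s t.
Proof.
rewrite kc_starr// /star esum_natS; last by move=> n; exact: kpow_ge0.
by congr (_ + _); apply: eq_esum => n _; rewrite kpowSl.
Qed.

Lemma star_fix T (B : S -> T -> \bar R) s t : kge0 B ->
  kc (star Q) B s t = B s t + kc Q (kc (star Q) B) s t.
Proof.
move=> B0; rewrite -kc_assoc//; last exact: star_ge0.
rewrite -[X in _ = X + _]kc_idl// -kcDl//; [|exact: kid_ge0|exact: kc_ge0 Q0 star_ge0].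
by apply: eq_kc => // u; rewrite starE.
Qed.

(** Minimality of the potential among nonnegative supersolutions, by induction on partial sums. Path
    decompositions and moment bounds are all derived from it, without manipulating paths. *)
Lemma star_least T (B X : S -> T -> \bar R) : kge0 B -> kge0 X ->
  (forall s t, B s t + kc Q X s t <= X s t) -> forall s t, kc (star Q) B s t <= X s t.
Proof.
move=> B0 X0 H s t; rewrite kc_starl//.
apply: esum_nat_leE => [n|n]; first exact: (kc_ge0 (kpow_ge0 n) B0).
elim: n s t => [|n IH] s t; first by rewrite big_ord0.
rewrite big_ord_recl kc_idl//; apply: le_trans (H s t); apply: leeD => //.
have -> : \sum_(i < n) kc (kpow Q (lift ord0 i)) B s t =
    kc Q (fun s t => \sum_(i < n) kc (kpow Q i) B s t) s t.
  have sum0 m : kge0 (fun s t => \sum_(i < m) kc (kpow Q i) B s t).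
    by move=> x y; apply: sume_ge0 => i _; exact: (kc_ge0 (kpow_ge0 i) B0).
  elim: n {IH} => [|n IHn].
    rewrite big_ord0 /kc esum1// => u _; by rewrite big_ord0 mule0.
  rewrite big_ord_recr IHn /= -[X in _ + X](@eq_kc _ _ _ (kc Q (kpow Q n)) _ B)//; last first.
    by move=> u; rewrite -kpowSl.
  rewrite kc_assoc//; last exact: kpow_ge0.
  rewrite -kcDr//; [|exact: sum0|exact: (kc_ge0 (kpow_ge0 n) B0)].
  by apply: eq_kc => // u; rewrite big_ord_recr.
apply: kc_le => //.
by move=> x y; apply: sume_ge0 => i _; exact: (kc_ge0 (kpow_ge0 i) B0).
Qed.

Lemma star_le X s t : kge0 X ->
  (forall s t, kid s t + kc Q X s t <= X s t) -> star Q s t <= X s t.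
Proof.
move=> X0 H; rewrite -[star Q s t]kc_idr; last exact: star_ge0.
by apply: star_least => //; exact: kid_ge0.
Qed.

(** Adding [a] steps before and [b] steps after only shifts the index of the series by [a + b]. *)
Lemma star_absorb a b s t : kc (kc (kpow Q a) (star Q)) (kpow Q b) s t <= star Q s t.
Proof.
rewrite kc_assoc; [|exact: kpow_ge0|exact: star_ge0|exact: kpow_ge0].
have -> : kc (kpow Q a) (kc (star Q) (kpow Q b)) s t = \esum_(n in [set: nat]) kpow Q (a + (n + b)) s t.
  transitivity (kc (kpow Q a) (fun s t => \esum_(n in [set: nat]) kpow Q (n + b) s t) s t).
    apply: eq_kc => // u; rewrite kc_starl; last exact: kpow_ge0.
    by apply: eq_esum => n _; rewrite kpowD.
  rewrite /kc; under eq_esum => u _.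
    rewrite -esumZl; [|by move=> n; exact: kpow_ge0|exact: kpow_ge0].
    over.
  rewrite esum_exchange; last by move=> u n; rewrite mule_ge0//; exact: kpow_ge0.
  by apply: eq_esum => n _; rewrite kpowD.
have -> : \esum_(n in [set: nat]) kpow Q (a + (n + b)) s t =
    \esum_(n in [set: nat]) kpow Q (n + (a + b))%N s t.
  by apply: eq_esum => n _; congr (kpow Q _ s t); rewrite addnCA.
by apply: (esum_nat_shift (a := fun n => kpow Q n s t)) => n; exact: kpow_ge0.
Qed.

End Star.

(* A [Q]-path is decomposed at its [Qb]-steps. *)
Lemma star_split S (Q Qa Qb : S -> S -> \bar R) : kge0 Qa -> kge0 Qb ->
  (forall s t, Q s t = Qa s t + Qb s t) ->
  let H := star Qa in let A := kc H Qb in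
  forall s t, star Q s t = kc (star A) H s t.
Proof.
move=> a0 b0 QE H A s t.
have Q0 : kge0 Q by move=> x y; rewrite QE adde_ge0.
have H0 : kge0 H by exact: star_ge0.
have A0 : kge0 A by exact: kc_ge0.
have G0 : kge0 (star Q) by exact: star_ge0.
have Y0 : kge0 (kc (star A) H) by apply: kc_ge0 => //; exact: star_ge0.
(* Each side is a supersolution of the equation whose least solution is the other side. *)
apply/eqP; rewrite eq_le; apply/andP; split.
  apply: star_le => // {}s {}t.
  set Y := kc (star A) H in Y0 *.
  have YE x y : Y x y = kc H (fun x y => kid x y + kc Qb Y x y) x y.
    rewrite kcDr//; [|exact: kid_ge0|exact: kc_ge0].
    by rewrite [LHS]star_fix// kc_idr// /A kc_assoc.
  have B0 : kge0 (fun x y => kid x y + kc Qb Y x y).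
    by move=> x y; rewrite adde_ge0 ?kid_ge0//; exact: kc_ge0.
  have e : kc Qa Y s t + (kid s t + kc Qb Y s t) = Y s t.
    rewrite [RHS]YE star_fix// addeC; congr (_ + _).
    by apply: eq_kc => // u; exact: YE.
  rewrite -[leRHS]e.
  have -> : kc Q Y s t = kc Qa Y s t + kc Qb Y s t.
    by rewrite -kcDl//; apply: eq_kc => // u; exact: QE.
  by rewrite addeCA.
apply: star_least => // {}s {}t.
have B0 : kge0 (fun x y => kid x y + kc Qb (star Q) x y).
  by move=> x y; rewrite adde_ge0 ?kid_ge0//; exact: kc_ge0.
have : kc H (fun x y => kid x y + kc Qb (star Q) x y) s t <= star Q s t.
  apply: star_least => // x y.
  rewrite [leRHS]starE//.
  have -> : kc Q (star Q) x y = kc Qa (star Q) x y + kc Qb (star Q) x y.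
    by rewrite -kcDl//; apply: eq_kc => // u; exact: QE.
  by rewrite addeAC -addeA.
rewrite kcDr//; [|exact: kid_ge0|exact: kc_ge0].
by rewrite kc_idr// /A kc_assoc.
Qed.

End Kernel.

(** * Regeneration at a fixed type *)

Section Regen.
Variables (R : realType) (d p : nat) (mu : jump R d p) (i0 : 'I_p).
Local Notation X := 'rV[int]_d.
Local Notation S := (state d p).
Local Notation ang th x := (dotp th (toR R x)).
Local Open Scope ereal_scope.
Hypothesis mu_ge0 : forall i j x, (0 <= mu i j x)%R.

Definition Qk (s t : S) : \bar R := (P1 mu s t)%:E.

Lemma Qk_ge0 : kge0 Qk.
Proof. by move=> s t; rewrite lee_fin; exact: mu_ge0. Qed.

Lemma Pn_kpow n s t : Pn mu n s t = kpow Qk n s t.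
Proof.
elim: n t => [//|n IH] t /=.
by apply: eq_esum => u _; rewrite IH.
Qed.

Lemma green_star s t : green mu s t = star Qk s t.
Proof. by apply: eq_esum => n _; exact: Pn_kpow. Qed.

(* Steps landing in type [i0] are marked with probability 1/2, so that both the
   marked and the unmarked walk still see every path. *)
Definition Qb (s t : S) : \bar R := if t.2 == i0 then (P1 mu s t / 2)%:E else 0.
Definition Qa (s t : S) : \bar R := if t.2 == i0 then (P1 mu s t / 2)%:E else (P1 mu s t)%:E.
(** The potential of the unmarked walk, that is, of the segment between two marks; [Ak] closes the
    segment with a marked step. *)
Definition Hk := star Qa.
Definition Ak := kc Hk Qb.

Lemma Qa_ge0 : kge0 Qa.
Proof. by move=> s t; rewrite /Qa; case: ifP => _; rewrite lee_fin ?divr_ge0 ?mu_ge0. Qed.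

Lemma Qb_ge0 : kge0 Qb.
Proof. by move=> s t; rewrite /Qb; case: ifP => _; rewrite lee_fin ?divr_ge0 ?mu_ge0. Qed.

Lemma Hk_ge0 : kge0 Hk.
Proof. exact: star_ge0 Qa_ge0. Qed.

Lemma Ak_ge0 : kge0 Ak.
Proof. exact: kc_ge0 Hk_ge0 Qb_ge0. Qed.

Hint Resolve Qk_ge0 Qa_ge0 Qb_ge0 Hk_ge0 Ak_ge0 : core.

Lemma QkE s t : Qk s t = Qa s t + Qb s t.
Proof.
rewrite /Qk /Qa /Qb; case: ifP => _; last by rewrite adde0.
by rewrite -EFinD; congr _%:E; lra.
Qed.

Lemma Qa_le s t : Qa s t <= Qk s t.
Proof. by rewrite QkE leeDl. Qed.

Lemma Qb_le s t : Qb s t <= Qk s t.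
Proof. by rewrite QkE leeDr. Qed.

Lemma green_split s t : green mu s t = kc (star Ak) Hk s t.
Proof. by rewrite green_star; exact: (star_split Qa_ge0 Qb_ge0 QkE). Qed.

Definition inv_kernel (K : S -> S -> \bar R) :=
  forall z (s t : S), K (s.1 + z, s.2)%R (t.1 + z, t.2)%R = K s t.

Lemma shift_bij (z : X) : bijective (fun u : S => (u.1 + z, u.2)%R : S).
Proof.
exists (fun u : S => (u.1 - z, u.2)%R : S) => [[x i]|[x i]] /=; first by rewrite addrK.
by rewrite subrK.
Qed.

Lemma inv_kc K J : inv_kernel K -> inv_kernel J -> inv_kernel (kc K J).
Proof.
move=> hK hJ z s t; rewrite /kc (esum_bij _ (shift_bij z)).
by apply: eq_esum => u _; rewrite hK hJ.
Qed.

Lemma inv_kid : inv_kernel (@kid R S).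
Proof.
move=> z [x i] [y j]; rewrite /kid /=; congr (if _ then _ else _)%:E.
by rewrite !xpair_eqE (inj_eq (addIr z)).
Qed.

Lemma inv_kpow K n : inv_kernel K -> inv_kernel (kpow K n).
Proof. by move=> hK; elim: n => [|n IH]; [exact: inv_kid|exact: inv_kc]. Qed.

Lemma inv_star K : inv_kernel K -> inv_kernel (star K).
Proof. by move=> hK z s t; apply: eq_esum => n _; exact: inv_kpow. Qed.

Lemma inv_P1 z (s t : S) : P1 mu (s.1 + z, s.2)%R (t.1 + z, t.2)%R = P1 mu s t.
Proof. by rewrite /P1 /= opprD addrACA subrr addr0. Qed.

Lemma inv_Qk : inv_kernel Qk.
Proof. by move=> z s t; rewrite /Qk inv_P1. Qed.

Lemma inv_Qa : inv_kernel Qa.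
Proof. by move=> z s t; rewrite /Qa inv_P1. Qed.

Lemma inv_Qb : inv_kernel Qb.
Proof. by move=> z s t; rewrite /Qb inv_P1. Qed.

Lemma inv_Hk : inv_kernel Hk.
Proof. exact: inv_star inv_Qa. Qed.

Lemma inv_Ak : inv_kernel Ak.
Proof. exact: inv_kc inv_Hk inv_Qb. Qed.

Lemma inv_at0 K x i t : inv_kernel K -> K (x, i) t = K (0%R, i) (t.1 - x, t.2)%R.
Proof. by move=> hK; rewrite -[RHS](hK x) /= add0r subrK; case: t. Qed.

Section Irr.
Hypothesis d0 : (0 < d)%N.
Hypothesis irr : irreducible mu.

(** Irreducibility admits paths of length 0; passing through a translate of [s], which differs from
    [s], makes the length positive even when [s = t]. *)
Lemma irr_kpow (s t : S) : exists n, 0 < kpow Qk n.+1 s t.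
Proof.
pose u : S := (s.1 + ebase (Ordinal d0), s.2)%R.
have [a ha] := irr s u; have [b hb] := irr u t; rewrite !Pn_kpow in ha hb.
case: a ha => [|a] ha.
  move: ha; rewrite /= /kid; case: eqP => [e|_]; last by rewrite ltxx.
  have := congr1 fst e; rewrite /u /= -{1}[s.1]addr0 => /addrI/rowP/(_ (Ordinal d0)).
  by rewrite !mxE !eqxx.
exists (a + b)%N; rewrite -addSn kpowD//.
apply: (@lt_le_trans _ _ (kpow Qk a.+1 s u * kpow Qk b u t)); first exact: mule_gt0.
by apply: kc_term; exact: kpow_ge0.
Qed.

Lemma Qa_gt0 s t : 0 < Qk s t -> 0 < Qa s t.
Proof.
rewrite /Qk /Qa; case: ifP => _; rewrite !lte_fin//.
by move=> h; rewrite divr_gt0.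
Qed.

Lemma kpow_Qa_gt0 n s t : 0 < kpow Qk n s t -> 0 < kpow Qa n s t.
Proof.
elim: n t => [//|n IH] t h.
have [|u [h1 h2]] := kc_gt0 h _ Qk_ge0; first exact: kpow_ge0.
apply: (@lt_le_trans _ _ (kpow Qa n s u * Qa u t)).
  by rewrite mule_gt0 ?IH ?Qa_gt0.
by apply: kc_term => //; exact: kpow_ge0.
Qed.

Lemma path_Qb s (x : X) : exists n, 0 < kc (kpow Qa n) Qb s (x, i0).
Proof.
have [n h] := irr_kpow s (x, i0); exists n.
have [|u [h1 h2]] := kc_gt0 h _ Qk_ge0; first exact: kpow_ge0.
apply: (@lt_le_trans _ _ (kpow Qa n s u * Qb u (x, i0))).
  have h3 : 0 < Qb u (x, i0).
    by move: h2; rewrite /Qk /Qb /= eqxx !lte_fin => h2; rewrite divr_gt0.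
  by rewrite mule_gt0 ?kpow_Qa_gt0.
by apply: kc_term => //; exact: kpow_ge0.
Qed.

Lemma Hk_gt0 s t : 0 < Hk s t.
Proof.
have [n h] := irr_kpow s t.
by apply: lt_le_trans (star_term Qa_ge0 n.+1 s t); exact: kpow_Qa_gt0.
Qed.

Lemma Ak_gt0 s (x : X) : 0 < Ak s (x, i0).
Proof.
have [n h] := path_Qb s x; apply: (lt_le_trans h).
apply: kc_le => //; first exact: kpow_ge0.
by move=> t; exact: star_term.
Qed.

Lemma real_below (x : \bar R) : 0 < x -> exists2 c : R, (0 < c)%R & c%:E <= x.
Proof.
case: x => [r| |]//; first by rewrite lte_fin => r0; exists r.
by move=> _; exists 1%R => //; rewrite leey.
Qed.

(** A fixed path from [i0] to [i] before the segment, and a fixed path from [j] to a mark after it,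
    give a marked return with the same displacement at a constant cost. Finiteness of the Laplace
    transform of nu thus passes to all entries of [Hk]. *)
Lemma Hk_le_Ak i j : exists2 c : R, (0 < c)%R &
  forall x : X, c%:E * Hk (0%R, i) (x, j) <= Ak (0%R, i0) (x, i0).
Proof.
have [a ha] := irr_kpow (0%R, i0) (0%R, i).
have [b hb] := path_Qb (0%R, j) 0.
have [c1 c10 h1] := real_below (kpow_Qa_gt0 ha).
have [c2 c20 h2] := real_below hb.
exists (c1 * c2)%R => [|x]; first by rewrite mulr_gt0.
have P0 n : kge0 (kpow Qa n) by exact: kpow_ge0.
have st : kc (kc (kpow Qa a.+1) Hk) (kc (kpow Qa b) Qb) (0%R, i0) (x, i0) <= Ak (0%R, i0) (x, i0).
  rewrite -kc_assoc//; last exact: kc_ge0.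
  apply: kc_le => //; first by apply: kc_ge0 => //; exact: kc_ge0.
  by move=> t; exact: star_absorb.
apply: le_trans st.
apply: le_trans (kc_term _ (x, j) _ _ _); [|exact: kc_ge0|exact: kc_ge0].
rewrite EFinM muleAC; apply: lee_pmul; rewrite ?mule_ge0 ?lee_fin ?(ltW c10) ?(ltW c20)//.
  apply: le_trans (kc_term _ (0%R, i) _ _ _) => //.
  by apply: lee_pmul => //; rewrite lee_fin ltW.
rewrite (inv_at0 x j (x, i0)) /= ?subrr//.
by apply: inv_kc; [exact: inv_kpow inv_Qa|exact: inv_Qb].
Qed.

End Irr.

Section Weights.
Variables (al : 'rV[R]_d) (del : R).
Hypothesis del0 : (0 <= del)%R.
Implicit Types (g : 'I_p -> R).

(** A function on states encoded as a kernel into [unit], so that integrating it is a composition of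
    kernels. The term [del * n1] is the margin gained on top of the tilt. *)
Definition wg g (s : S) (_ : unit) : \bar R :=
  (expR (ang al s.1 + del * n1 R s.1) * g s.2)%:E.

Lemma wg_ge0 g : (forall i, 0 <= g i)%R -> kge0 (wg g).
Proof. by move=> g0 s t; rewrite lee_fin mulr_ge0 ?expR_ge0. Qed.

Lemma kc_wg_shift K g x i : inv_kernel K -> kge0 K -> (forall i, 0 <= g i)%R ->
  kc K (wg g) (x, i) tt <= (expR (ang al x + del * n1 R x))%:E * kc K (wg g) ((0%R, i) : S) tt.
Proof.
move=> hK K0 g0; rewrite /kc -esumZl; last 2 first.
- by move=> u; rewrite mule_ge0// wg_ge0.
- by rewrite lee_fin expR_ge0.
rewrite (esum_bij _ (shift_bij x)); apply: le_esum => u _.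
rewrite -{1}(add0r x) (hK x (0%R, i) u) muleCA; apply: lee_wpmul2l => //.
rewrite /wg -EFinM lee_fin mulrA ler_wpM2r// -expRD ler_expR /= toRD dotpDr.
have := n1D R u.1 x => h.
have : (del * n1 R (u.1 + x) <= del * (n1 R u.1 + n1 R x))%R by rewrite ler_wpM2l.
lra.
Qed.

Lemma kc_wg_shift0 K g x i : inv_kernel K -> kge0 K -> (forall i, 0 <= g i)%R -> del = 0%R ->
  kc K (wg g) (x, i) tt = (expR (ang al x))%:E * kc K (wg g) ((0%R, i) : S) tt.
Proof.
move=> hK K0 g0 dz; rewrite /kc -esumZl; last 2 first.
- by move=> u; rewrite mule_ge0// wg_ge0.
- by rewrite lee_fin expR_ge0.
rewrite (esum_bij _ (shift_bij x)); apply: eq_esum => u _.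
rewrite -{1}(add0r x) (hK x (0%R, i) u) muleCA; congr (_ * _).
rewrite /wg -EFinM dz !mul0r !addr0 mulrA -expRD /= toRD dotpDr.
by rewrite addrC.
Qed.

Definition bddk (K : S -> S -> \bar R) := exists2 M : R, (0 <= M)%R & forall i, kc K (wg (fun=> 1%R)) ((0%R, i) : S) tt <= M%:E.

Lemma bddk_comp K J : inv_kernel K -> inv_kernel J -> kge0 K -> kge0 J ->
  bddk K -> bddk J -> bddk (kc K J).
Proof.
move=> iK iJ K0 J0 [M M0 HM] [N N0 HN]; exists (N * M)%R => [|i]; first by rewrite mulr_ge0.
have w0 : kge0 (wg (fun=> 1%R)) by exact: wg_ge0.
rewrite kc_assoc//; apply: (@le_trans _ _ (kc K (fun s t => N%:E * wg (fun=> 1%R) s t) (0%R, i) tt)).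
  apply: kc_le => //; first exact: kc_ge0.
  move=> [x k]; apply: (le_trans (kc_wg_shift _ _ iJ J0 _)) => //.
  rewrite muleC; apply: lee_pmul => //; first exact: kc_ge0.
  by rewrite /wg /= mulr1.
by rewrite kcZr// EFinM; apply: lee_wpmul2l.
Qed.

Lemma kc_rows (K : S -> S -> \bar R) (W : S -> unit -> \bar R) s :
  kge0 K -> kge0 W ->
  kc K W s tt = (\sum_(k < p) \esum_(x in [set: X]) (K s (x, k) * W (x, k) tt))%E.
Proof.
move=> K0 W0; rewrite /kc (@esum_pair R _ _ (fun t : S => K s t * W t tt)); last first.
  by move=> z; rewrite mule_ge0.
by rewrite esum_exchange ?esum_finType// => *; rewrite ?esum_ge0// => *; rewrite mule_ge0.
Qed.

End Weights.

Lemma n1_le_enorm (x : X) : (n1 R x <= d%:R * enorm (toR R x))%R.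
Proof.
rewrite /n1; apply: (@le_trans _ _ (\sum_(k < d) enorm (toR R x))%R).
  by apply: ler_sum => k _; have := coord_le_enorm (toR R x) k; rewrite mxE.
by rewrite sumr_const card_ord mulr_natl.
Qed.

Lemma fine_sum_le (f : 'I_p -> \bar R) i : (forall i, 0 <= f i) -> (forall i, f i < +oo) ->
  f i <= (\sum_(k < p) fine (f k))%R%:E.
Proof.
move=> f0 fy; have fin k : f k \is a fin_num by rewrite ge0_fin_numE.
rewrite -(fineK (fin i)) lee_fin (bigD1 i)//= lerDl.
by apply: sumr_ge0 => k _; exact: fine_ge0.
Qed.

Lemma bddk_fin al del (K : S -> S -> \bar R) : kge0 K ->
  (forall i, kc K (wg al del (fun=> 1%R)) ((0%R, i) : S) tt < +oo) -> bddk al del K.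
Proof.
move=> K0 fy; have w0 : kge0 (wg al del (fun=> 1%R)) by exact: wg_ge0.
exists (\sum_(k < p) fine (kc K (wg al del (fun=> 1%R)) ((0%R, k) : S) tt))%R.
  by apply: sumr_ge0 => k _; apply: fine_ge0; exact: kc_ge0.
move=> i; apply: (@fine_sum_le (fun k => kc K (wg al del (fun=> 1%R)) ((0%R, k) : S) tt)) => // k.
exact: kc_ge0.
Qed.

Section Moments.
Hypothesis mom : finite_exp_moments mu.

Lemma mu_mom al (a : R) i k : (0 <= a)%R ->
  \esum_(x in [set: X]) (expR (ang al x + a * n1 R x) * mu i k x)%:E < +oo.
Proof.
move=> a0; pose b := ((enorm al + a) * d%:R + 1)%R.
have b0 : (0 < b)%R by rewrite ltr_wpDl// mulr_ge0// addr_ge0// enorm_ge0.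
apply: le_lt_trans (mom i k b0); apply: le_esum => x _.
rewrite lee_fin ler_wpM2r// ler_expR /b.
have e0 := enorm_ge0 (toR R x).
apply: (@le_trans _ _ ((enorm al + a) * n1 R x)%R).
  by rewrite mulrDl lerD2r; apply: (le_trans (ler_norm _)); exact: dotp_le_enorm.
apply: (@le_trans _ _ ((enorm al + a) * (d%:R * enorm (toR R x)))%R).
  by rewrite ler_wpM2l ?n1_le_enorm// addr_ge0// enorm_ge0.
by rewrite [leRHS]mulrDl mul1r -mulrA lerDl.
Qed.

Lemma kc_Q_fin al (a : R) (K : S -> S -> \bar R) (g : 'I_p -> R) i : (0 <= a)%R ->
  kge0 K -> (forall s t, K s t <= Qk s t) -> (forall k, 0 <= g k)%R ->
  kc K (wg al a g) ((0%R, i) : S) tt < +oo.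
Proof.
move=> a0 K0 KQ g0; rewrite kc_rows//; last exact: wg_ge0.
apply: lte_sum_pinfty => k _.
apply: (@le_lt_trans _ _ ((g k)%:E * \esum_(x in [set: X]) (expR (ang al x + a * n1 R x) * mu i k x)%:E)).
  rewrite -esumZl; last 2 first.
  - by move=> x; rewrite lee_fin mulr_ge0 ?expR_ge0.
  - by rewrite lee_fin.
  apply: le_esum => x _; apply: (@le_trans _ _ (Qk (0%R, i) (x, k) * wg al a g (x, k) tt)).
    by apply: lee_wpmul2r => //; exact: wg_ge0.
  by rewrite /Qk /wg /P1 /= subr0 -!EFinM lee_fin le_eqVlt; apply/orP; left; apply/eqP; ring.
apply: lte_mul_pinfty; rewrite ?lee_fin//.
exact: mu_mom.
Qed.

Lemma bddk_Qb al (a : R) : (0 <= a)%R -> bddk al a Qb.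
Proof.
by move=> a0; apply: bddk_fin => // i; apply: kc_Q_fin => //; exact: Qb_le.
Qed.

Section AtD.
Hypothesis d0 : (0 < d)%N.
Hypothesis irr : irreducible mu.
Variable al : 'rV[R]_d.
Hypothesis phifin :
  \esum_(x in [set: X]) (Ak (0%R, i0) (x, i0) * (expR (ang al x))%:E) < +oo.

Lemma Hk_lap_fin i : kc Hk (wg al 0 (fun=> 1%R)) ((0%R, i) : S) tt < +oo.
Proof.
rewrite kc_rows//; last exact: wg_ge0.
apply: lte_sum_pinfty => j _.
have [c c0 hc] := Hk_le_Ak d0 irr i j.
apply: (@le_lt_trans _ _ ((c^-1)%:E * \esum_(x in [set: X]) (Ak (0%R, i0) (x, i0) * (expR (ang al x))%:E))).
  rewrite -esumZl; last 2 first.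
  - by move=> x; rewrite mule_ge0// lee_fin expR_ge0.
  - by rewrite lee_fin invr_ge0 ltW.
  apply: le_esum => x _; rewrite /wg /= mul0r addr0 mulr1 muleA.
  apply: lee_wpmul2r; first by rewrite lee_fin expR_ge0.
  have -> : Hk (0%R, i) (x, j) = (c^-1)%:E * (c%:E * Hk (0%R, i) (x, j)).
    by rewrite muleA -EFinM mulVf ?gt_eqF// mul1e.
  by apply: lee_wpmul2l; rewrite ?lee_fin ?invr_ge0 ?(ltW c0).
by apply: lte_mul_pinfty => //; rewrite ?lee_fin ?invr_ge0 ?(ltW c0).
Qed.

(** The vector [G] of Laplace transforms of [Hk] solves [G = 1 + Qa G]. As [Qa] has all exponential
    moments, a small extra weight [del] raises [Qa G] by at most 1/2, so [G] remains a supersolution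
    with source 1/2, and minimality bounds [Hk] with the extra weight. *)
Lemma bddk_Hk : exists2 del : R, (0 < del)%R & bddk al del Hk.
Proof.
pose one : 'I_p -> R := fun=> 1%R.
have one0 i : (0 <= one i)%R by [].
pose G i := fine (kc Hk (wg al 0 one) ((0%R, i) : S) tt).
have w0 a g : (forall i, 0 <= g i)%R -> kge0 (wg al a g) by exact: wg_ge0.
have HE0 i : 0 <= kc Hk (wg al 0 one) ((0%R, i) : S) tt by apply: kc_ge0 => //; exact: w0.
have GE i : kc Hk (wg al 0 one) ((0%R, i) : S) tt = (G i)%:E.
  by rewrite fineK// ge0_fin_numE//; exact: Hk_lap_fin.
have G0 i : (0 <= G i)%R by rewrite -lee_fin -GE.
have gE (s : S) t : kc Hk (wg al 0 one) s t = wg al 0 G s t.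
  case: s t => x i []; rewrite kc_wg_shift0 ?GE//; last exact: inv_Hk.
  by rewrite /wg /= mul0r addr0.
have fix_ i : 1 + kc Qa (wg al 0 G) ((0%R, i) : S) tt = (G i)%:E.
  rewrite -GE /Hk star_fix//; last exact: w0.
  congr (_ + _); first by rewrite /wg /= toR0 dotp0r mul0r addr0 expR0 mulr1.
  by apply: eq_kc => // u; rewrite -gE.
(* The weight 2 comes from [expR (del n) - 1 <= del * n * expR (del n) <= del * expR (2 n)] for
   [del <= 1]. *)
pose r i := kc Qa (wg al 2 G) ((0%R, i) : S) tt.
have r0 i : 0 <= r i by apply: kc_ge0 => //; exact: w0.
have rfin i : r i < +oo by apply: kc_Q_fin => //; exact: Qa_le.
pose rs := (\sum_(k < p) fine (r k))%R.
have rs0 : (0 <= rs)%R by apply: sumr_ge0 => k _; exact: fine_ge0.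
pose del := Num.min 1%R (1 / (2 * (rs + 1)))%R.
have rs1 : (0 < 2 * (rs + 1))%R by lra.
have del0 : (0 < del)%R by rewrite lt_min ltr01 divr_gt0.
have del1 : (del <= 1)%R by rewrite ge_min lexx.
have delr : (del * rs <= 1 / 2)%R.
  apply: (@le_trans _ _ (1 / (2 * (rs + 1)) * (rs + 1))%R).
    apply: ler_pM; rewrite ?(ltW del0)//; last by lra.
    by rewrite ge_min lexx orbT.
  have z0 : (rs + 1 != 0)%R by rewrite gt_eqF//; lra.
  by rewrite invfM mulrA divfK.
exists del => //.
have step i : (2^-1)%:E + kc Qa (wg al del G) ((0%R, i) : S) tt <= (G i)%:E.
  have le1 : kc Qa (wg al del G) ((0%R, i) : S) tt <=
      kc Qa (wg al 0 G) ((0%R, i) : S) tt + del%:E * r i.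
    rewrite -kcZr//; [|exact: w0|by rewrite lee_fin ltW].
    rewrite -kcDr//; [|exact: w0|by move=> s t; rewrite mule_ge0 ?w0// lee_fin ltW].
    apply: kc_le => //; first exact: w0.
    move=> [x k]; rewrite /wg -EFinM -EFinD lee_fin /= mul0r addr0 mulrA -mulrDl.
    rewrite ler_wpM2r// !expRD mulrCA -{2}[expR (ang al x)]mulr1 -mulrDr ler_wpM2l ?expR_ge0//.
    have n0 := n1_ge0 R x.
    have := expR_sub1_le (del * n1 R x).
    have dn : (0 <= del * n1 R x)%R by rewrite mulr_ge0// ltW.
    rewrite (ger0_norm dn) => h.
    have h2 : (del * n1 R x * expR (del * n1 R x) <= del * expR (2 * n1 R x))%R.
      rewrite -mulrA ler_pM2l//.
      have -> : expR (2 * n1 R x) = (expR (n1 R x) * expR (n1 R x))%R by rewrite -expRD; congr expR; ring.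
      apply: ler_pM; rewrite ?expR_ge0// ?ler_expR ?ler_piMl//.
      by have := expR_ge1Dx (n1 R x); lra.
    by have := le_trans (ler_norm _) h; lra.
  have ri : r i <= rs%:E by exact: (fine_sum_le i r0 rfin).
  rewrite -fix_; apply: (@le_trans _ _ ((2^-1)%:E + (kc Qa (wg al 0 G) ((0%R, i) : S) tt + (2^-1)%:E))).
    apply: leeD2l; apply: (le_trans le1); apply: leeD2l.
    apply: (@le_trans _ _ (del%:E * rs%:E)); first by apply: lee_wpmul2l; rewrite ?lee_fin ?(ltW del0).
    by rewrite -EFinM lee_fin; move: delr; rewrite mul1r.
  rewrite addeCA addeC -EFinD; apply: leeD2r; rewrite lee_fin; lra.
have super : forall (s : S) t, kc Hk (fun s t => (2^-1)%:E * wg al del one s t) s t <= wg al del G s t.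
  apply: star_least => //.
  - by move=> s t; rewrite mule_ge0 ?w0// lee_fin invr_ge0.
  - exact: w0.
  move=> [x i] [].
  apply: (@le_trans _ _ ((expR (ang al x + del * n1 R x))%:E * ((2^-1)%:E + kc Qa (wg al del G) ((0%R, i) : S) tt))).
    rewrite ge0_muleDr ?lee_fin ?invr_ge0//; last by apply: kc_ge0 => //; exact: w0.
    apply: leeD; first by rewrite muleC /wg mulr1.
    by apply: kc_wg_shift => //; [exact: ltW|exact: inv_Qa].
  rewrite /wg EFinM; apply: lee_wpmul2l; last exact: step.
  by rewrite lee_fin expR_ge0.
apply: bddk_fin => // i.
have := super (0%R, i) tt; rewrite kcZr//; last exact: w0.
move=> h; have : 2%:E * ((2^-1)%:E * kc Hk (wg al del one) ((0%R, i) : S) tt) < +oo.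
  by apply: lte_mul_pinfty => //; apply: (le_lt_trans h); rewrite ltry.
by rewrite muleA -EFinM divff// mul1e.
Qed.

Lemma bddk_Ak : exists2 del : R, (0 < del)%R &
  [/\ bddk al del Hk, bddk al del Ak & bddk al del (kc Ak Hk)].
Proof.
have [del del0 bH] := bddk_Hk; exists del => //; have dl := ltW del0.
have bA : bddk al del Ak.
  by apply: bddk_comp => //; [exact: inv_Hk|exact: inv_Qb|exact: bddk_Qb].
by split => //; apply: bddk_comp => //; [exact: inv_Ak|exact: inv_Hk].
Qed.

End AtD.
End Moments.

Lemma bddk_summ al (del : R) (K : S -> S -> \bar R) i j : kge0 K ->
  (forall x : X, K (0%R, i) (x, j) < +oo) -> bddk al del K ->
  summ (fun x => (expR (del * n1 R x) * tilt al (fun x => fine (K (0%R, i) (x, j))) x)%R).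
Proof.
move=> K0 Kfin [M M0 HM]; rewrite summ_esum; last first.
  by move=> x; rewrite mulr_ge0 ?expR_ge0// tilt_ge0// => y; exact: fine_ge0.
apply: le_lt_trans (le_lt_trans (HM i) (ltry M)).
rewrite kc_rows//; last exact: wg_ge0.
rewrite (bigD1 j)//=; apply: le_trans (leeDl _ _); last first.
  apply: sume_ge0 => k _; apply: esum_ge0 => x _; rewrite mule_ge0//; exact: wg_ge0.
apply: le_esum => x _.
rewrite -[K _ _]fineK ?ge0_fin_numE// /wg /tilt -EFinM lee_fin /= expRD.
by rewrite le_eqVlt; apply/orP; left; apply/eqP; ring.
Qed.

End Regen.

(** * The Green function as a sum of convolution powers *)

Section Represent.
Variables (R : realType) (d p : nat) (mu : jump R d p) (i0 : 'I_p).
Local Notation X := 'rV[int]_d.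
Local Notation S := (state d p).
Local Notation ang th x := (dotp th (toR R x)).
Local Open Scope ereal_scope.
Hypothesis mu_ge0 : forall i j x, (0 <= mu i j x)%R.
Local Notation Hk := (Hk mu i0).
Local Notation Ak := (Ak mu i0).
Local Notation Qa := (Qa mu i0).
Local Notation Qb := (Qb mu i0).
Local Notation Qk := (Qk mu).

Let Qk0 : kge0 Qk := Qk_ge0 mu_ge0.
Let Qa0 : kge0 Qa := Qa_ge0 i0 mu_ge0.
Let Qb0 : kge0 Qb := Qb_ge0 i0 mu_ge0.
Let Hk0 : kge0 Hk := Hk_ge0 i0 mu_ge0.
Let Ak0 : kge0 Ak := Ak_ge0 i0 mu_ge0.
Let An0 n : kge0 (kpow Ak n) := kpow_ge0 Ak0 n.

Lemma Ak_land s (t : S) : t.2 != i0 -> Ak s t = 0.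
Proof.
move=> ti; rewrite /Ak /kc esum1// => u _.
by rewrite /Qb (negPf ti) mule0.
Qed.

Lemma kpowA_land n s (t : S) : t.2 != i0 -> kpow Ak n.+1 s t = 0.
Proof. by move=> ti; rewrite /= /kc esum1// => u _; rewrite Ak_land ?mule0. Qed.

Lemma esum_col (F : S -> \bar R) : (forall u, 0 <= F u) ->
  (forall u : S, u.2 != i0 -> F u = 0) -> \esum_(u in [set: S]) F u = \esum_(y in [set: X]) F (y, i0).
Proof.
move=> F0 Fz; rewrite (@esum_pair R _ _ F)//.
apply: eq_esum => y _; rewrite (@esum_point R _ (fun k => F (y, k)) i0)// => k ki.
by apply: Fz.
Qed.

Section Drift.
Variables (al : 'rV[R]_d) (h : 'I_p -> R) (eta : R).
Hypothesis h_gt0 : forall i, (0 < h i)%R.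
Hypothesis eta0 : (0 < eta)%R.
Hypothesis drift : forall i, eta%:E + kc Qk (wg al 0 h) ((0%R, i) : S) tt <= (h i)%:E.

Let one : 'I_p -> R := fun=> 1%R.
Let h0 i : (0 <= h i)%R := ltW (h_gt0 i).
Let W0 : kge0 (wg al 0 h) := wg_ge0 al 0 h0.
Let E0 : kge0 (wg al 0 one).
Proof. by apply: wg_ge0. Qed.

(** The weight is a strict supersolution for the full kernel; splitting off the unmarked part and
    applying minimality sums the slack [eta] over the whole unmarked segment. Finiteness of all
    kernels follows from it. *)
Lemma drift_ineq (s : S) : kc Ak (wg al 0 h) s tt + eta%:E * kc Hk (wg al 0 one) s tt <= wg al 0 h s tt.
Proof.
have e0 : 0 <= eta%:E by rewrite lee_fin ltW.
have B1 : kge0 (fun (s : S) t => eta%:E * wg al 0 one s t) by move=> u t; rewrite mule_ge0.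
have B2 : kge0 (kc Qb (wg al 0 h)) by exact: kc_ge0.
have -> : kc Ak (wg al 0 h) s tt + eta%:E * kc Hk (wg al 0 one) s tt =
    kc Hk (fun (s : S) t => kc Qb (wg al 0 h) s t + eta%:E * wg al 0 one s t) s tt.
  by rewrite kcDr// kcZr// /Ak kc_assoc.
apply: star_least => //; first by move=> u t; rewrite adde_ge0.
move=> [x i] [].
have -> : kc Qb (wg al 0 h) (x, i) tt + eta%:E * wg al 0 one (x, i) tt + kc Qa (wg al 0 h) (x, i) tt =
    eta%:E * wg al 0 one (x, i) tt + kc Qk (wg al 0 h) (x, i) tt.
  rewrite addeAC addeC; congr (_ + _); rewrite -kcDl//.
  by apply: eq_kc => // u; rewrite (QkE _ i0) addeC.
rewrite kc_wg_shift0//; last exact: inv_Qk.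
rewrite /wg /= mul0r addr0 mulr1 muleC -ge0_muleDr//; last exact: kc_ge0.
by rewrite EFinM; apply: lee_wpmul2l.
Qed.

Lemma Ak_super s : kc Ak (wg al 0 h) s tt <= wg al 0 h s tt.
Proof.
apply: le_trans (drift_ineq s); rewrite leeDl// mule_ge0 ?lee_fin ?(ltW eta0)//.
exact: kc_ge0.
Qed.

Lemma kpowA_super n s : kc (kpow Ak n) (wg al 0 h) s tt <= wg al 0 h s tt.
Proof.
elim: n => [|n IH]; first by rewrite kc_idl.
apply: le_trans IH; rewrite /= kc_assoc//.
by apply: kc_le => //; [exact: kc_ge0|move=> t; exact: Ak_super].
Qed.

Lemma kpowA_fin n s t : kpow Ak n s t < +oo.
Proof.
have le : kpow Ak n s t * wg al 0 h t tt <= wg al 0 h s tt.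
  by apply: le_trans (kpowA_super n s); exact: kc_term.
rewrite ltey; apply/eqP => e; move: le; rewrite e gt0_mulye.
  by rewrite leye_eq.
by rewrite lte_fin mulr_gt0 ?expR_gt0.
Qed.

Lemma AH_fin n s t : kc (kpow Ak n) Hk s t < +oo.
Proof.
have E1 : 0 < wg al 0 one t tt by rewrite lte_fin mulr_gt0 ?expR_gt0.
have et : 0 < eta%:E by rewrite lte_fin.
have le : eta%:E * (kc (kpow Ak n) Hk s t * wg al 0 one t tt) <= wg al 0 h s tt.
  apply: (@le_trans _ _ (eta%:E * kc (kc (kpow Ak n) Hk) (wg al 0 one) s tt)).
    by apply: lee_wpmul2l; [exact: ltW|apply: kc_term => //; exact: kc_ge0].
  rewrite kc_assoc// -kcZr//; [|exact: kc_ge0|exact: ltW].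
  apply: le_trans (kpowA_super n s); apply: kc_le => //.
    by move=> u v; rewrite mule_ge0 ?(ltW et)//; exact: kc_ge0.
  move=> u; apply: le_trans (drift_ineq u); rewrite leeDr//.
  exact: kc_ge0.
by rewrite ltey; apply/eqP => e; move: le; rewrite e gt0_mulye// gt0_muley.
Qed.

(** Marked steps land in type [i0] only, so the first term of [drift_ineq] is a multiple of [h i0];
    the term of length 0 in [Hk] keeps the slack at least [eta]. *)
Lemma lap_lt1 : ((h i0)%:E * (\esum_(x in [set: X]) (Ak (0%R, i0) (x, i0) * (expR (ang al x))%:E)) +
  eta%:E <= (h i0)%:E)%E.
Proof.
have := drift_ineq (0%R, i0).
have -> : wg al 0 h ((0%R, i0) : S) tt = (h i0)%:E.
  by rewrite /wg /= toR0 dotp0r mul0r addr0 expR0 mul1r.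
apply: le_trans; apply: leeD.
  rewrite /kc (@esum_col (fun t => Ak (0%R, i0) t * wg al 0 h t tt)); last 2 first.
  - by move=> u; rewrite mule_ge0.
  - by move=> u ui; rewrite Ak_land ?mul0e.
  rewrite -esumZl; last 2 first.
  - by move=> x; rewrite mule_ge0 ?lee_fin ?expR_ge0.
  - by rewrite lee_fin.
  apply: le_esum => x _; rewrite muleCA; apply: lee_wpmul2l => //.
  by rewrite /wg /= mul0r addr0 -EFinM mulrC.
rewrite -[leLHS]mule1; apply: lee_wpmul2l; first by rewrite lee_fin ltW.
rewrite /Hk star_fix//.
have -> : wg al 0 one ((0%R, i0) : S) tt = 1.
  by rewrite /wg /= toR0 dotp0r mul0r addr0 expR0 mul1r.
by rewrite leeDl//; apply: kc_ge0 => //; exact: kc_ge0.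
Qed.

End Drift.

Section Real.
Hypothesis Afin : forall n s t, kpow Ak n s t < +oo.
Hypothesis AHfin : forall n s t, kc (kpow Ak n) Hk s t < +oo.

Definition nu_r (x : X) : R := fine (Ak (0%R, i0) (x, i0)).
Definition hh (i j : 'I_p) (x : X) : R := fine (Hk (0%R, i) (x, j)).
Definition kap_r (i j : 'I_p) (x : X) : R := fine (kc Ak Hk (0%R, i) (x, j)).

Lemma Ak_fin s t : Ak s t < +oo.
Proof. by have := Afin 1 s t; rewrite kpow1. Qed.

Lemma Hk_fin s t : Hk s t < +oo.
Proof. by have := AHfin 0 s t; rewrite /= kc_idl. Qed.

Lemma nu_rE x : (nu_r x)%:E = Ak (0%R, i0) (x, i0).
Proof. by rewrite fineK// ge0_fin_numE// Ak_fin. Qed.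

Lemma hhE i j x : (hh i j x)%:E = Hk (0%R, i) (x, j).
Proof. by rewrite fineK// ge0_fin_numE// Hk_fin. Qed.

Lemma kap_rE i j x : (kap_r i j x)%:E = kc Ak Hk (0%R, i) (x, j).
Proof.
rewrite fineK// ge0_fin_numE; last exact: kc_ge0.
have := AHfin 1 (0%R, i) (x, j); congr (_ < _).
by apply: eq_kc => // u; rewrite kpow1.
Qed.

(** Commutativity of convolution. The unmarked segment comes last on a path, while [wpow] convolves
    with nu on the right, so the two must be exchanged. *)
Lemma econv_swap (a b c : X -> \bar R) x : (forall y, 0 <= a y) -> (forall y, 0 <= b y) ->
  (forall y, 0 <= c y) ->
  \esum_(y in [set: X]) ((\esum_(z in [set: X]) (a z * b (y - z)%R)) * c (x - y)%R) =
  \esum_(y in [set: X]) ((\esum_(z in [set: X]) (a z * c (y - z)%R)) * b (x - y)%R).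
Proof.
move=> a0 b0 c0.
transitivity (\esum_(z in [set: X]) \esum_(y in [set: X]) (a z * b (y - z)%R * c (x - y)%R)).
  rewrite esum_exchange; last by move=> z y; rewrite !mule_ge0.
  by apply: eq_esum => y _; rewrite -esumZr// => z; rewrite mule_ge0.
transitivity (\esum_(z in [set: X]) \esum_(y in [set: X]) (a z * c (y - z)%R * b (x - y)%R)).
  apply: eq_esum => z _; rewrite (esum_opp_shift (x + z)%R).
  apply: eq_esum => y _.
  have -> : (x + z - y - z = x - y)%R by rewrite addrAC addrK.
  have -> : (x - (x + z - y) = y - z)%R by apply/rowP => k; rewrite !mxE; ring.
  by rewrite -!muleA; congr (_ * _); rewrite muleC.
rewrite esum_exchange; last by move=> z y; rewrite !mule_ge0.
by apply: eq_esum => y _; rewrite -esumZr// => z; rewrite mule_ge0.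
Qed.

Lemma kc_kpowA_col n (K : S -> S -> \bar R) i x j : kge0 K -> inv_kernel K ->
  kc (kpow Ak n.+1) K (0%R, i) (x, j) =
  \esum_(y in [set: X]) (kpow Ak n.+1 (0%R, i) (y, i0) * K (0%R, i0) ((x - y)%R, j)).
Proof.
move=> K0 iK; rewrite /kc (@esum_col (fun u => kpow Ak n.+1 (0%R, i) u * K u (x, j))); last 2 first.
- by move=> u; rewrite mule_ge0// An0.
- by move=> u ui; rewrite kpowA_land ?mul0e.
by apply: eq_esum => y _; rewrite (inv_at0 _ _ _ iK).
Qed.

Lemma rconv_fin (f g : X -> R) x : (forall y, 0 <= f y)%R -> (forall y, 0 <= g y)%R ->
  \esum_(y in [set: X]) (f y * g (x - y))%R%:E < +oo ->
  (rconv f g x)%:E = \esum_(y in [set: X]) (f y * g (x - y))%R%:E.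
Proof.
move=> f0 g0 fin; rewrite /rconv ge0_sumRE//; first by move=> y; rewrite mulr_ge0.
by rewrite summ_esum// => y; rewrite mulr_ge0.
Qed.

Lemma nu_r_ge0 x : (0 <= nu_r x)%R.
Proof. exact: fine_ge0. Qed.

(** The first marked segment, which starts in type [i], and the last unmarked one, which ends in
    type [j], are grouped in [kap]; the [n] segments between go from [i0] to [i0]. *)
Lemma wpow_kpow i j n x : (wpow (kap_r i j) nu_r n x)%:E = kc (kpow Ak n.+1) Hk (0%R, i) (x, j).
Proof.
elim: n x => [|n IH] x.
  by rewrite kap_rE; apply: eq_kc => // u; rewrite kpow1.
have wp y : (0 <= wpow (kap_r i j) nu_r n y)%R.
  by rewrite -lee_fin IH; apply: kc_ge0.
have key : \esum_(y in [set: X]) (wpow (kap_r i j) nu_r n y * nu_r (x - y))%R%:E =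
    kc (kpow Ak n.+2) Hk (0%R, i) (x, j).
  transitivity (\esum_(y in [set: X]) ((\esum_(z in [set: X])
      (kpow Ak n.+1 (0%R, i) (z, i0) * Hk (0%R, i0) ((y - z)%R, j))) * Ak (0%R, i0) ((x - y)%R, i0))).
    apply: eq_esum => y _; rewrite EFinM IH nu_rE kc_kpowA_col//.
    exact: inv_Hk.
  rewrite (econv_swap (a := fun z => kpow Ak n.+1 (0%R, i) (z, i0))
    (b := fun z => Hk (0%R, i0) (z, j)) (c := fun z => Ak (0%R, i0) (z, i0)))//; last first.
    by move=> y; exact: An0.
  rewrite kc_kpowA_col//; last exact: inv_Hk.
  apply: eq_esum => y _; congr (_ * _).
  rewrite -kc_kpowA_col//; exact: inv_Ak.
by rewrite wpowS rconv_fin ?key//; exact: nu_r_ge0.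
Qed.

Lemma green_walk i j x : green mu (0%R, i) (x, j) =
  ((hh i j x)%:E + \esum_(n in [set: nat]) (wpow (kap_r i j) nu_r n x)%:E)%E.
Proof.
rewrite (green_split i0 mu_ge0) kc_starl// esum_natS; last by move=> n; exact: kc_ge0.
rewrite [kc (kpow _ 0) _ _ _]kc_idl// hhE; congr (_ + _).
by apply: eq_esum => n _; rewrite wpow_kpow.
Qed.

End Real.

End Represent.

(** * The Poisson equation and a strictly contracting tilt *)

Section Poisson.
Variables (R : realType) (d p : nat) (mu : jump R d p).
Local Notation X := 'rV[int]_d.
Local Notation S := (state d p).
Hypothesis p0 : (0 < p)%N.
Hypothesis jm : is_jump_matrix mu.
Hypothesis irr : irreducible mu.

Let mu_ge0 i j x : 0 <= mu i j x := jm.1 i j x.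

Definition Pm : 'M[R]_p := \matrix_(i, j) Mtrans mu i j.

Lemma mu_esum_le1 i j : (\esum_(x in [set: X]) (mu i j x)%:E <= 1)%E.
Proof.
rewrite -(jm.2 i) (bigD1 j)//= leeDl//; apply: sume_ge0 => k _.
by apply: esum_ge0 => x _; rewrite lee_fin.
Qed.

Lemma mu_summ i j : summ (mu i j).
Proof. by rewrite summ_esum//; apply: le_lt_trans (mu_esum_le1 i j) _; rewrite ltry. Qed.

Lemma MtransE i j : Mtrans mu i j = sumR (mu i j).
Proof. by rewrite ge0_sumR. Qed.

Lemma Mtrans_ge0 i j : 0 <= Mtrans mu i j.
Proof. by rewrite MtransE; exact: sumR_ge0. Qed.

Lemma Mtrans_sum i : \sum_(j < p) Mtrans mu i j = 1.
Proof.
apply/EFin_inj; rewrite -sumEFin -(jm.2 i); apply: eq_bigr => j _.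
by rewrite MtransE ge0_sumRE//; exact: mu_summ.
Qed.

Definition invariant (y : 'rV[R]_p) := y *m Pm = y.

Lemma invariantE y : invariant y -> forall j, y 0 j = \sum_i y 0 i * Mtrans mu i j.
Proof.
move=> h j; rewrite -{1}h mxE; apply: eq_bigr => i _; by rewrite mxE.
Qed.

(** The triangle inequality bounds each entry of [|y|] by that of [|y| P]; the totals agree because
    rows sum to 1, so all inequalities are equalities. *)
Lemma invariant_abs y : invariant y -> invariant (map_mx Num.norm y).
Proof.
move=> h; have yE := invariantE h.
have le j : `|y 0 j| <= \sum_i `|y 0 i| * Mtrans mu i j.
  rewrite yE; apply: (le_trans (ler_norm_sum _ _ _)); apply: ler_sum => i _.
  by rewrite normrM (ger0_norm (Mtrans_ge0 _ _)).
have tot : \sum_j (\sum_i `|y 0 i| * Mtrans mu i j - `|y 0 j|) = 0.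
  rewrite sumrB exchange_big /= -sumrB big1// => i _.
  by rewrite -mulr_sumr Mtrans_sum mulr1 subrr.
apply/rowP => j; rewrite !mxE.
have nn k : true -> 0 <= \sum_i `|y 0 i| * Mtrans mu i k - `|y 0 k| by rewrite subr_ge0.
apply/eqP; rewrite -subr_eq0 -[X in _ == X](psumr_eq0P nn tot (i := j) isT); apply/eqP.
by congr (_ - _); apply: eq_bigr => i _; rewrite !mxE.
Qed.

Lemma invariant_reach (y : 'rV[R]_p) : (forall i, 0 <= y 0 i) -> invariant y ->
  forall n (s t : S), (0 < Pn mu n s t)%E -> 0 < y 0 s.2 -> 0 < y 0 t.2.
Proof.
move=> y0 h; elim=> [|n IH] s t hp ys.
  by move: hp => /=; case: eqP => [<-//|_]; rewrite ltxx.
rewrite Pn_kpow in hp.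
have [|u [h1 h2]] := kc_gt0 hp _ (Qk_ge0 mu_ge0); first exact: kpow_ge0 (Qk_ge0 mu_ge0) n.
have yu : 0 < y 0 u.2 by apply: (IH s u) => //; rewrite Pn_kpow.
rewrite (invariantE h) (bigD1 u.2)//=; apply: ltr_wpDr.
  by apply: sumr_ge0 => i _; rewrite mulr_ge0// Mtrans_ge0.
rewrite mulr_gt0// MtransE; apply: lt_le_trans (sumR_term_le (t.1 - u.1) _ (mu_summ _ _)) => //.
Qed.

(** The vector [|y| + y] is invariant and nonnegative; positivity at [i] spreads to all types by
    irreducibility, and it vanishes exactly where [y <= 0]. *)
Lemma invariant_pos y i : invariant y -> 0 < y 0 i -> forall j, 0 < y 0 j.
Proof.
move=> h yi j.
pose z := map_mx Num.norm y + y.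
have zE k : z 0 k = `|y 0 k| + y 0 k by rewrite !mxE.
have hz : invariant z by rewrite /invariant mulmxDl (invariant_abs h) h.
have z0 k : 0 <= z 0 k by rewrite zE -lerBlDr sub0r -normrN ler_norm.
have [n hn] := irr (0, i) (0, j).
have : 0 < z 0 j by apply: (invariant_reach z0 hz hn); rewrite zE /= ltr_wpDl.
by rewrite zE; case: (leP (y 0 j) 0) => // yj; rewrite ler0_norm// addNr ltxx.
Qed.

Lemma invariant_zero y : invariant y -> \sum_i y 0 i = 0 -> y = 0.
Proof.
move=> h s; apply/rowP => i; rewrite mxE; apply/eqP; apply: contraT => yi.
have [yp|yn|y00] := ltgtP 0 (y 0 i); last by rewrite y00 eqxx in yi.
- have : 0 < \sum_j y 0 j; last by rewrite s ltxx.
  rewrite (bigD1 i)//= ltr_wpDr//; apply: sumr_ge0 => j _.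
  exact: ltW (invariant_pos h yp j).
- have hN : invariant (- y) by rewrite /invariant mulNmx h.
  have yN : 0 < (- y) 0 i by rewrite mxE oppr_gt0.
  have : 0 < \sum_j (- y) 0 j.
    rewrite (bigD1 i)//= ltr_wpDr//; apply: sumr_ge0 => j _.
    exact: ltW (invariant_pos hN yN j).
  by under eq_bigr do rewrite mxE; rewrite sumrN s oppr0 ltxx.
Qed.

Lemma stationary_exists : exists y : 'rV[R]_p, [/\ invariant y, forall i, 0 <= y 0 i & \sum_i y 0 i = 1].
Proof.
(* The constant column is in the kernel because rows sum to 1. Singularity then provides a left null
   vector, whose absolute value is normalized. *)
have : \det (1%:M - Pm) == 0.
  rewrite -det_tr; apply/det0P; exists (const_mx 1).
    by apply/eqP => /rowP/(_ (Ordinal p0)); rewrite !mxE => /eqP; rewrite oner_eq0.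
  apply/rowP => i; rewrite !mxE.
  under eq_bigr => j _ do rewrite !mxE mul1r.
  rewrite sumrB Mtrans_sum (bigD1 i)//= eqxx big1 ?addr0 ?subrr//.
  by move=> j ji; rewrite eq_sym (negPf ji).
move=> /det0P[y yn0 /eqP]; rewrite mulmxBr mulmx1 subr_eq0 => /eqP hy.
have ha := invariant_abs (esym hy).
have s0 : 0 < \sum_i `|y 0 i|.
  have [i yi] : exists i, y 0 i != 0.
    apply/existsP; apply: contraNT yn0 => /existsPn H; apply/eqP/rowP => i.
    by rewrite mxE; apply/eqP; have := H i; rewrite negbK.
  rewrite (bigD1 i)//= ltr_wpDr ?normr_gt0//; exact: sumr_ge0.
exists ((\sum_i `|y 0 i|)^-1 *: map_mx Num.norm y); split.
- by rewrite /invariant -scalemxAl ha.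
- by move=> i; rewrite !mxE mulr_ge0// invr_ge0 ltW.
under eq_bigr do rewrite !mxE.
by rewrite -mulr_sumr mulVf// gt_eqF.
Qed.

(** Fredholm alternative: [b] is in the range as soon as it is orthogonal to the left kernel, and
    that kernel is the line of [y] by [invariant_zero]. *)
Lemma poisson (y : 'rV[R]_p) (b : 'cV[R]_p) : invariant y -> \sum_i y 0 i = 1 -> y *m b = 0 ->
  exists w : 'cV[R]_p, (1%:M - Pm) *m w = b.
Proof.
move=> hy y1 yb; set A := 1%:M - Pm.
have key (z : 'rV[R]_p) : z *m A = 0 -> z *m b = 0.
  rewrite mulmxBr mulmx1 => /eqP; rewrite subr_eq0 => /eqP hz.
  pose u := z - (\sum_i z 0 i) *: y.
  have hu : invariant u by rewrite /invariant mulmxBl -scalemxAl hy -hz.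
  have : u = 0.
    apply: invariant_zero => //; under eq_bigr do rewrite !mxE.
    by rewrite sumrB -mulr_sumr y1 mulr1 subrr.
  by move=> /eqP; rewrite subr_eq0 => /eqP ->; rewrite -scalemxAl yb scaler0.
have : (b^T <= A^T)%MS.
  rewrite submxE; apply/eqP; apply: trmx_inj; rewrite trmx_mul trmxK trmx0.
  apply/row_matrixP => i; rewrite row_mul row0; apply: key.
  have e : (cokermx A^T)^T *m A = 0 by rewrite -{2}[A]trmxK -trmx_mul mulmx_coker trmx0.
  by rewrite -row_mul e row0.
move=> /submxP[D hD]; exists D^T; apply: trmx_inj.
by rewrite trmx_mul trmxK hD.
Qed.

Hypothesis mom : finite_exp_moments mu.
Hypothesis nc : non_centered mu.

Lemma tilt0 (f : X -> R) : tilt 0 f = f.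
Proof.
apply/funext => x; rewrite /tilt (_ : dotp 0 _ = 0) ?expR0 ?mul1r//.
by rewrite /dotp big1// => k _; rewrite mxE mul0r.
Qed.

Lemma mu_expmom : exists2 M : R, 0 < M & forall i k, expmom 1 M (mu i k).
Proof.
have s i k : summ (fun x => expR (1 * n1 R x) * mu i k x).
  rewrite summ_esum; last by move=> x; rewrite mulr_ge0 ?expR_ge0.
  apply: le_lt_trans (mu_mom mu_ge0 mom 0 i k ler01); apply: le_esum => x _.
  by rewrite (_ : dotp 0 _ = 0) ?add0r// /dotp big1// => l _; rewrite mxE mul0r.
pose N := \sum_i \sum_k sumR (fun x => expR (1 * n1 R x) * mu i k x).
have pos i k : 0 <= sumR (fun x => expR (1 * n1 R x) * mu i k x).
  by apply: sumR_ge0 => x; rewrite mulr_ge0 ?expR_ge0.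
have N0 : 0 <= N by apply: sumr_ge0 => i _; apply: sumr_ge0.
exists (N + 1); first by rewrite ltr_wpDl.
move=> i k; split => //; apply: (@le_trans _ _ N); last by rewrite lerDl.
rewrite /N (bigD1 i)//= (bigD1 k)//= -addrA lerDl addr_ge0//; first exact: sumr_ge0.
by apply: sumr_ge0 => j _; apply: sumr_ge0.
Qed.

Lemma dotp_sum (u : 'rV[R]_d) (I : finType) (F : I -> 'rV[R]_d) :
  dotp u (\sum_i F i) = \sum_i dotp u (F i).
Proof.
elim/big_rec2: _ => [|i a b _ <-]; last by rewrite dotpDr.
by rewrite dotp0r.
Qed.

Lemma kc_lap (al : 'rV[R]_d) (h : 'I_p -> R) i : (forall k, 0 <= h k) ->
  (forall k, summ (tilt al (mu i k))) ->
  kc (Qk mu) (wg al 0 h) ((0, i) : S) tt = (\sum_k h k * sumR (tilt al (mu i k)))%:E.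
Proof.
move=> h0 s; rewrite kc_rows; [|exact: Qk_ge0 mu_ge0|exact: wg_ge0].
rewrite -sumEFin; apply: eq_bigr => k _.
have t0 := tilt_ge0 al (mu_ge0 i k).
rewrite EFinM ge0_sumRE// -esumZl; last 2 first.
- by move=> x; rewrite lee_fin.
- by rewrite lee_fin.
apply: eq_esum => x _; rewrite /Qk /wg /P1 /tilt /= subr0 mul0r addr0 -!EFinM.
by congr _%:E; ring.
Qed.

Lemma expand_step (t w P q z C : R) : 0 <= t <= 1 -> 0 <= C -> 0 <= 1 + t * w ->
  z <= P + t * q + t ^+ 2 * C ->
  (1 + t * w) * z <= P + t * (q + P * w) + t ^+ 2 * (C + `|w| * `|q| + C * `|w|).
Proof.
move=> /andP[t0 t1] C0 h0 hz; apply: (le_trans (ler_wpM2l h0 hz)).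
have wq : w * q <= `|w| * `|q| by rewrite -normrM ler_norm.
have t2 : 0 <= t ^+ 2 by exact: sqr_ge0.
have h1 : t ^+ 2 * (w * q) <= t ^+ 2 * (`|w| * `|q|) by rewrite ler_wpM2l.
have h2 : t ^+ 2 * (C * (t * w)) <= t ^+ 2 * (C * `|w|).
  rewrite ler_wpM2l// ler_wpM2l//; apply: (le_trans (ler_norm _)).
  by rewrite normrM (ger0_norm t0) ler_piMl.
have -> : (1 + t * w) * (P + t * q + t ^+ 2 * C) =
    P + t * (q + P * w) + t ^+ 2 * C + t ^+ 2 * (w * q) + t ^+ 2 * (C * (t * w)) by ring.
have -> : t ^+ 2 * (C + `|w| * `|q| + C * `|w|) =
    t ^+ 2 * C + t ^+ 2 * (`|w| * `|q|) + t ^+ 2 * (C * `|w|) by ring.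
by rewrite !addrA lerD// lerD.
Qed.

(** A small tilt against the global drift lowers the Laplace transform only on average over the
    types. The corrector [w] in [h = 1 + t w] spreads the gain evenly, so that every type gains
    [t * rho] to first order. *)
Lemma drift_exists : exists (al : 'rV[R]_d) (h : 'I_p -> R) (eta : R),
  [/\ forall i, 0 < h i, 0 < eta &
    forall i, (eta%:E + kc (Qk mu) (wg al 0 h) ((0%R, i) : S) tt <= (h i)%:E)%E].
Proof.
have [y [hy y0 y1]] := stationary_exists.
have st : stationary mu (fun i => y 0 i).
  by split => //; split => // j; rewrite -(invariantE hy).
pose m := global_drift mu (fun i => y 0 i).
have mn0 : m != 0 := nc st.
pose rho := enorm m.
have rho0 : 0 < rho.
  rewrite lt_neqAle enorm_ge0 andbT eq_sym; apply: contraNneq mn0 => e.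
  by apply/eqP; apply: enorm_eq0; rewrite -enorm_sqr -/rho e expr0n.
pose v : 'rV[R]_d := - rho^-1 *: m.
have v1 k : `|v 0 k| <= 1.
  rewrite mxE normrM normrN normfV (gtr0_norm rho0) mulrC ler_pdivrMr// mul1r.
  exact: coord_le_enorm.
have vm : dotp v m = - rho.
  by rewrite dotpZl -enorm_sqr -/rho; field; rewrite gt_eqF.
pose mi i := \sum_(k < p) dotp v (local_drift mu i k).
have mE : dotp v m = \sum_i y 0 i * mi i.
  rewrite /m /global_drift dotp_sum; apply: eq_bigr => i _.
  by rewrite dotp_sum mulr_sumr; apply: eq_bigr => k _; rewrite dotpZr.
(* The deviation of the drift of type [i] along [v] from its stationary mean [- rho], hence
   orthogonal to the stationary law. *)
pose b : 'cV[R]_p := \col_i (mi i + rho).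
have yb : y *m b = 0.
  apply/rowP => k; rewrite ord1 !mxE.
  under eq_bigr do rewrite !mxE mulrDr.
  by rewrite big_split /= -mE vm -mulr_suml y1 mul1r addNr.
have [w hw] := poisson hy y1 yb.
have Pw i : \sum_k Mtrans mu i k * w k 0 = w i 0 - mi i - rho.
  have /colP/(_ i) := hw; rewrite mulmxBl mul1mx !mxE => e.
  have -> : \sum_k Mtrans mu i k * w k 0 = \sum_j Pm i j * w j 0.
    by apply: eq_bigr => k _; rewrite mxE.
  move: e; move: (\sum_j _) => z; lra.
have [M M0 HM] := mu_expmom.
pose C := (8 / 1) ^+ 2 * M.
have C0 : 0 <= C by rewrite mulr_ge0 ?sqr_ge0// ltW.
pose D := \sum_i \sum_k (C + `|w k 0| * `|dotp v (local_drift mu i k)| + C * `|w k 0|).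
have Dk i k : 0 <= C + `|w k 0| * `|dotp v (local_drift mu i k)| + C * `|w k 0|.
  by apply: addr_ge0; [apply: addr_ge0 => //; exact: mulr_ge0|exact: mulr_ge0].
have D0 : 0 <= D by apply: sumr_ge0 => i _; apply: sumr_ge0 => k _; exact: Dk.
pose B := \sum_k `|w k 0|.
have B0 : 0 <= B by apply: sumr_ge0.
(* The three bounds keep the tilt within the moment margin, keep [h] positive, and make the second
   order term [t^2 D] at most half of the gain [t * rho]. *)
pose t := Num.min (1 / 4) (Num.min (1 / (2 * (B + 1))) (rho / (2 * (D + 1)))).
have B1 : 0 < 2 * (B + 1) by lra.
have D1 : 0 < 2 * (D + 1) by lra.
have t0 : 0 < t by rewrite !lt_min !divr_gt0.
have t4 : t <= 1 / 4 by rewrite ge_min lexx.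
have tB : t * (2 * (B + 1)) <= 1 by rewrite -ler_pdivlMr// !ge_min lexx orbT.
have tD : t * (2 * (D + 1)) <= rho by rewrite -ler_pdivlMr// !ge_min lexx !orbT.
pose h i := 1 + t * w i 0.
have wB i : `|w i 0| <= B.
  by rewrite /B (bigD1 i)//= lerDl; apply: sumr_ge0.
have hp i : 0 < h i.
  have : t * `|w i 0| <= t * B by rewrite ler_pM2l.
  have : - (t * `|w i 0|) <= t * w i 0.
    by rewrite -mulrN ler_pM2l//; have := ler_norm (- w i 0); rewrite normrN; lra.
  rewrite /h; move: tB t0; move: (t * `|w i 0|) (t * w i 0) => a1 a2.
  by rewrite mulrCA mulrDr mulr1; lra.
have h0 i : 0 <= h i := ltW (hp i).
exists (t *: v), h, (t * rho / 2); split => //; first by rewrite !divr_gt0 ?mulr_gt0.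
move=> i.
have HM0 k : expmom 1 M (tilt 0 (mu i k)) by rewrite tilt0.
have t4' : `|t| <= 1 / 4 by rewrite gtr0_norm.
have clo k : `|(t *: v - 0) 0 k| <= 1 / 4.
  by rewrite subr0 mxE normrM -[leRHS]mulr1; apply: ler_pM.
have sm k : summ (tilt (t *: v) (mu i k)).
  have := expmom_perturb ltr01 (HM0 k) (lexx (1 / 4)) clo.
  have half : 0 < 1 / 2 :> R by rewrite divr_gt0.
  by move=> /(expmom_summ half)[].
rewrite kc_lap// -EFinD lee_fin.
pose q k := dotp v (local_drift mu i k).
have mg k : sumR (tilt (t *: v) (mu i k)) <= Mtrans mu i k + t * q k + t ^+ 2 * C.
  have := mgf_upper ltr01 (HM0 k) v1 t4'.
  by rewrite add0r tilt0 -MtransE.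
have st1 k := @expand_step t (w k 0) (Mtrans mu i k) (q k) _ C _ C0 (h0 k) (mg k).
have t01 : 0 <= t <= 1 by rewrite ltW//=; lra.
have sum_le : \sum_k h k * sumR (tilt (t *: v) (mu i k)) <=
    1 + t * (mi i + (w i 0 - mi i - rho)) + t ^+ 2 * D.
  apply: (le_trans (ler_sum _ (fun k _ => st1 t01 k))).
  rewrite !big_split /= Mtrans_sum -!mulr_sumr big_split /= Pw -/(mi i).
  rewrite lerD2l ler_wpM2l ?sqr_ge0//.
  rewrite /D [leRHS](bigD1 i)//= lerDl; apply: sumr_ge0 => j _; apply: sumr_ge0 => k _.
  exact: Dk.
apply: (le_trans (lerD (lexx _) sum_le)).
have : t ^+ 2 * D <= t * rho / 2.
  rewrite expr2 -mulrA -[leRHS]mulrA ler_pM2l//.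
  by move: tD t0; rewrite mulrCA mulrDr mulr1; lra.
rewrite /h mulrDr mulrBr mulrBr; lra.
Qed.

End Poisson.

(** * Auxiliary limits and bounds for the assembly *)

Section Final.
Variables (R : realType) (d : nat).
Local Notation X := 'rV[int]_d.

Lemma support_weaken (nu : X -> R) c del M eps lam0 lam1 Lc del' M' :
  0 < del' <= del -> M <= M' ->
  support_spec nu c del M eps lam0 lam1 Lc -> support_spec nu c del' M' eps lam0 lam1 Lc.
Proof.
move=> /andP[d'0 dd] MM [[/andP[d0 d1] M0 e0 l0 l1] HD H1 Hm Hl Hmom Hs HL]; split => //.
  split => //; last exact: lt_le_trans MM.
  by rewrite d'0 (le_trans dd).
by move=> u su; apply: (expmom_weaken _ MM (Hmom u su)); rewrite ltW.
Qed.

Lemma enorm_le_n1 (x : X) : enorm (toR R x) <= n1 R x.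
Proof.
rewrite /enorm -[leRHS]ger0_norm ?n1_ge0// -sqrtr_sqr ler_wsqrtr//.
rewrite expr2 {1}/n1 mulr_suml; apply: ler_sum => k _.
rewrite mxE -real_normK ?num_real// expr2 ler_wpM2l//.
exact: coord_le_n1.
Qed.

Lemma powR_sqrt (r : R) (n : nat) : 0 < r -> r `^ (- (n%:R / 2)) = (Num.sqrt r ^+ n)^-1.
Proof.
move=> r0; rewrite powRN; congr (_^-1).
by rewrite mulrC powRrM powR12_sqrt ?ltW// powR_mulrn// sqrtr_ge0.
Qed.

Lemma esum_nat_close (a : nat -> R) (K b e : R) (N0 : nat) : 0 < K -> (forall n, 0 <= a n) ->
  (forall N, (N0 <= N)%N -> `|K * (\sum_(n < N) a n) - b| <= e) ->
  exists2 Z : R, (\esum_(n in [set: nat]) (a n)%:E = Z%:E)%E & `|K * Z - b| <= e.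
Proof.
move=> K0 a0 H.
have up : (\esum_(n in [set: nat]) (a n)%:E <= ((b + e) / K)%:E)%E.
  apply: esum_nat_le => // n; rewrite ler_pdivlMr// mulrC.
  have := H (maxn n N0) (leq_maxr _ _); rewrite ler_norml => /andP[_ h].
  apply: (@le_trans _ _ (K * \sum_(k < maxn n N0) a k)); last by lra.
  rewrite ler_pM2l// -(big_mkord xpredT a) -(big_mkord xpredT a).
  rewrite (@big_cat_nat _ _ _ n 0 (maxn n N0))//= ?leq_maxl// lerDl.
  by apply: sumr_ge0.
have ge0 : (0 <= \esum_(n in [set: nat]) (a n)%:E)%E by apply: esum_ge0 => n _; rewrite lee_fin.
have fin : (\esum_(n in [set: nat]) (a n)%:E)%E \is a fin_num.
  by rewrite ge0_fin_numE//; apply: le_lt_trans up (ltry _).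
exists (fine (\esum_(n in [set: nat]) (a n)%:E)%E); first by rewrite fineK.
have lo := esum_nat_ge N0 a0.
rewrite -(fineK fin) !lee_fin in up lo.
move: (fine _) up lo => Z up lo.
have := H N0 (leqnn _); rewrite !ler_norml => /andP[h1 _]; apply/andP; split.
  by apply: (le_trans h1); rewrite lerD2r ler_pM2l.
by rewrite lerBlDr addrC mulrC -ler_pdivlMr// .
Qed.

Lemma decay_bound (n : nat) (del M e : R) : 0 < del -> 0 <= M -> 0 < e -> exists2 r0 : R, 1 <= r0 &
  forall r, r0 <= r -> Num.sqrt r ^+ n * (M * expR (- (del * r))) <= e.
Proof.
(* One extra power of [r] is absorbed; it supplies the factor [1 / r] that makes the bound small. *)
move=> del0 M0 e0; have [C C0 HC] := @pow_absorb R n.+1 del del0.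
exists (1 + M * C / e); first by rewrite lerDl divr_ge0 ?mulr_ge0// ltW.
move=> r hr; have MC : 0 <= M * C / e by rewrite divr_ge0 ?mulr_ge0// ltW.
have r1 : 1 <= r by apply: le_trans hr; rewrite lerDl.
have r0 : 0 < r by exact: lt_le_trans r1.
have sr : Num.sqrt r <= r.
  rewrite -[leRHS]sqr_sqrtr ?(ltW r0)// expr2 ler_peMr ?sqrtr_ge0//.
  by rewrite -[leLHS]sqrtr1 ler_wsqrtr.
apply: (@le_trans _ _ (r ^+ n * (M * expR (- (del * r))))).
  rewrite ler_wpM2r ?mulr_ge0 ?expR_ge0// lerXn2r ?nnegrE ?sqrtr_ge0//; exact: ltW.
rewrite -(ler_pM2l r0) mulrA -exprS mulrCA.
apply: (@le_trans _ _ (M * C)); first by rewrite ler_wpM2l// HC// ltW.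
rewrite -ler_pdivrMr//; apply: le_trans hr; by rewrite lerDr.
Qed.

Lemma wpow_ge0 (f g : X -> R) n x : (forall y, 0 <= f y) -> (forall y, 0 <= g y) ->
  0 <= wpow f g n x.
Proof.
move=> f0 g0; elim: n x => [//|n IH] x; rewrite wpowS.
by apply: sumR_ge0 => y; rewrite mulr_ge0.
Qed.

End Final.

(** * Reduction of the Markov-additive process to a walk, and conclusion *)

Section Assembly.
Variables (R : realType) (d p : nat) (mu : jump R d p).
Local Notation X := 'rV[int]_d.
Local Notation S := (state d p).
Hypothesis d0 : (0 < d)%N.
Hypothesis p0 : (0 < p)%N.
Hypothesis jm : is_jump_matrix mu.
Hypothesis irr : irreducible mu.
Hypothesis mom : finite_exp_moments mu.
Hypothesis nc : non_centered mu.

Lemma map_reduction : exists (nu : X -> R) (kap hh : 'I_p -> 'I_p -> X -> R) (al0 : 'rV[R]_d),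
  [/\ forall x, 0 < nu x, forall i j x, 0 < kap i j x, forall i j x, 0 <= hh i j x,
      [/\ local_mom nu nu, forall i j, local_mom nu (kap i j) & forall i j, local_mom nu (hh i j)] &
      [/\ Dset nu al0, sumR (tilt al0 nu) < 1 &
        forall i j x, green mu ((0 : X), i) (x, j) =
          ((hh i j x)%:E + \esum_(n in [set: nat]) (wpow (kap i j) nu n x)%:E)%E]].
Proof.
have mu_ge0 := jm.1.
pose i0 := Ordinal p0.
have [al0 [h [eta [h0 eta0 drift]]]] := drift_exists p0 jm irr mom nc.
have Afin := kpowA_fin i0 mu_ge0 h0 eta0 drift.
have AHfin := AH_fin i0 mu_ge0 h0 eta0 drift.
have lap := lap_lt1 i0 mu_ge0 h0 eta0 drift.
have Hk0 := Hk_ge0 i0 mu_ge0; have Ak0 := Ak_ge0 i0 mu_ge0.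
have nuE := nu_rE mu_ge0 Afin.
have hhE := hhE mu_ge0 AHfin.
have kapE := kap_rE mu_ge0 AHfin.
pose nu := nu_r mu i0.
have nu_pos x : 0 < nu x by rewrite -lte_fin nuE; exact: Ak_gt0.
have tE al : (\esum_(x in [set: X]) (tilt al nu x)%:E =
    \esum_(x in [set: X]) (Ak mu i0 (0%R, i0) (x, i0) * (expR (dotp al (toR R x)))%:E))%E.
  by apply: eq_esum => x _; rewrite -nuE -EFinM mulrC.
have t0 al x : 0 <= tilt al nu x by apply: tilt_ge0 => y; exact: ltW.
have phifin al : Dset nu al -> (\esum_(x in [set: X])
    (Ak mu i0 (0%R, i0) (x, i0) * (expR (dotp al (toR R x)))%:E) < +oo)%E.
  by move=> [s _]; rewrite -tE -summ_esum.
have lm (K : S -> S -> \bar R) i j : kge0 K -> (forall x : X, K (0%R, i) (x, j) < +oo)%E ->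
    (forall al del, bddk al del (Hk mu i0) -> bddk al del (Ak mu i0) ->
      bddk al del (kc (Ak mu i0) (Hk mu i0)) -> bddk al del K) ->
    local_mom nu (fun x => fine (K ((0 : X), i) (x, j))).
  move=> K0 Kf Kb al Da.
  have [del del0 [b1 b2 b3]] := bddk_Ak mu_ge0 mom d0 irr (phifin al Da).
  by exists del => //; apply: bddk_summ => //; exact: Kb.
exists nu, (kap_r mu i0), (hh mu i0), al0; split => //.
- move=> i j x; rewrite -lte_fin kapE.
  apply: (@lt_le_trans _ _ (Ak mu i0 (0%R, i) (0%R, i0) * Hk mu i0 (0%R, i0) (x, j))%E).
    by rewrite mule_gt0 ?Ak_gt0 ?Hk_gt0.
  exact: kc_term.
- by move=> i j x; exact: fine_ge0.
- split.
  + by apply: lm => // x; exact: Ak_fin.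
  + move=> i j; apply: lm => //; first exact: kc_ge0.
    by move=> x; rewrite -kapE ltry.
  + by move=> i j; apply: lm => // x; rewrite -hhE ltry.
have Philt : (\esum_(x in [set: X]) (tilt al0 nu x)%:E <= ((h i0 - eta) / h i0)%:E)%E.
  rewrite tE; move: lap; set Phi := (\esum_(x in _) _)%E.
  have Phi0 : (0 <= Phi)%E.
    by apply: esum_ge0 => x _; rewrite mule_ge0// lee_fin expR_ge0.
  case: Phi Phi0 => [r _| _|//]; last by rewrite gt0_muley ?lte_fin// addye.
  rewrite -EFinM -EFinD !lee_fin => l; rewrite ler_pdivlMr//; lra.
have s0 : summ (tilt al0 nu) by rewrite summ_esum//; apply: le_lt_trans Philt (ltry _).
have lt1 : sumR (tilt al0 nu) < 1.
  rewrite -(ge0_sumRE (t0 al0) s0) lee_fin in Philt.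
  by apply: (le_lt_trans Philt); rewrite ltr_pdivrMr// mul1r; lra.
split => //; first by split => //; exact: ltW.
move=> i j x; exact: green_walk.
Qed.

End Assembly.

Theorem theorem1p5 (R : realType) (d p : nat) (mu : jump R d p) :
  (0 < d)%N -> (0 < p)%N ->
  is_jump_matrix mu -> irreducible mu -> aperiodic mu ->
  finite_exp_moments mu -> non_centered mu ->
  exists (c : 'rV[R]_d -> 'rV[R]_d) (chi : 'I_p -> 'I_p -> 'rV[R]_d -> R) (C1 C2 : R),
    [/\ 0 < C1 /\ 0 < C2,
        {within @sphere R d, continuous c},
        (forall i j, {within @sphere R d, continuous (chi i j)}),
        (forall i j u, sphere u -> C1 <= chi i j u <= C2) &
        (forall (i j : 'I_p) (eps : R), 0 < eps ->
           exists M : R, forall x : 'rV[int]_d,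
             M < enorm (toR R x) ->
             let y : 'rV[R]_d := toR R x in
             let u := (enorm y)^-1 *: y in
             let f := chi i j u * (enorm y `^ (- ((d%:R - 1) / 2))) *
                        expR (- dotp (c u) y) in
             (`| green mu ((0%R : 'rV[int]_d), i) (x, j) - f%:E | <= (eps * f)%:E)%E)].
Proof.
move=> d0 p0 jm irr _ mom nc.
have [nu [kap [hh [al0 [nu_pos kap_pos hh0 [nu_mom kap_mom hh_mom] [al0D al01 greenE]]]]]] :=
  map_reduction d0 p0 jm irr mom nc.
have [c [del [M [eps0 [lam0 [lam1 [Lc spec]]]]]]] := support_package d0 nu_pos nu_mom al0D al01.
have [/andP[del0 del1] M0 _ _ [_ Lc0]] := sp_pos spec.
have walk i j : exists chi : 'rV[R]_d -> R,
    [/\ {within @sphere R d, continuous chi}, forall u, sphere u -> 0 < chi u &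
    forall e : R, 0 < e -> exists2 r0 : R, 0 < r0 &
    forall u x (r : R), sphere u -> toR R x = r *: u -> r0 <= r ->
    exists N0 : nat, forall N, (N0 <= N)%N ->
    `|Num.sqrt r ^+ d.-1 * (\sum_(n < N) tilt (c u) (wpow (kap i j) nu n) x) - chi u| <= e].
  have kge x : 0 <= kap i j x by exact: ltW.
  have [del' [M' [d'0 M'0 H']]] := unif_expmom nu_pos kge (kap_mom i j).
  (* [walk_asymp] takes one rate and one bound for both measures, so the support data are weakened
     to common constants; [c] is unchanged and shared by all pairs of types. *)
  pose dl := Num.min del del'.
  have dl0 : 0 < dl by rewrite lt_min del0.
  have sp' : support_spec nu c dl (M + M') eps0 lam0 lam1 Lc.
    by apply: support_weaken spec; rewrite ?dl0 ?ge_min ?lexx// lerDl ltW.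
  apply: (walk_asymp d0 nu_pos (kap_pos i j) sp') => u su.
  apply: expmom_weaken (H' _ (sp_D spec su)); last by rewrite lerDr ltW.
  by rewrite (ltW dl0) ge_min lexx orbT.
have [chi Hchi] : exists chi : 'I_p -> 'I_p -> 'rV[R]_d -> R, forall i j,
    [/\ {within @sphere R d, continuous (chi i j)}, forall u, sphere u -> 0 < chi i j u &
    forall e : R, 0 < e -> exists2 r0 : R, 0 < r0 &
    forall u x (r : R), sphere u -> toR R x = r *: u -> r0 <= r ->
    exists N0 : nat, forall N, (N0 <= N)%N ->
    `|Num.sqrt r ^+ d.-1 * (\sum_(n < N) tilt (c u) (wpow (kap i j) nu n) x) - chi i j u| <= e].
  have [f Hf] := boolp.choice (fun z : 'I_p * 'I_p => walk z.1 z.2).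
  by exists (fun i j => f (i, j)) => i j; exact: (Hf (i, j)).
have bnd (z : 'I_p * 'I_p) : exists b : R * R, [/\ 0 < b.1, 0 < b.2 &
    forall u, sphere u -> b.1 <= chi z.1 z.2 u <= b.2].
  have [cc cp _] := Hchi z.1 z.2.
  by have [a [b [a0 b0 H]]] := within_bounds d0 cc cp; exists (a, b).
have [b Hb] := boolp.choice bnd.
(* Sums over the finitely many pairs serve as maxima: [I1^-1] is below every lower bound and [C2]
   above every upper bound. *)
pose I1 := \sum_z (b z).1^-1; pose C2 := \sum_z (b z).2.
pose z0 := (Ordinal p0, Ordinal p0).
have b1p z : 0 < (b z).1^-1 by have [h _ _] := Hb z; rewrite invr_gt0.
have b2p z : 0 < (b z).2 by have [_ h _] := Hb z.
have I1p : 0 < I1.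
  by rewrite /I1 (bigD1 z0)//= ltr_wpDr//; apply: sumr_ge0 => z _; exact: ltW.
have C2p : 0 < C2.
  by rewrite /C2 (bigD1 z0)//= ltr_wpDr//; apply: sumr_ge0 => z _; exact: ltW.
have chiB i j u : sphere u -> I1^-1 <= chi i j u <= C2.
  move=> su; have [h1 _ /(_ u su)/andP[lo up]] := Hb (i, j).
  apply/andP; split.
    apply: le_trans lo; rewrite -[leRHS]invrK lef_pV2 ?posrE//.
    by rewrite /I1 (bigD1 (i, j))//= lerDl; apply: sumr_ge0 => z _; exact: ltW.
  apply: (le_trans up); rewrite /C2 (bigD1 (i, j))//= lerDl.
  by apply: sumr_ge0 => z _; exact: ltW.
exists c, chi, I1^-1, C2; split => //.
- by rewrite invr_gt0.
- by apply: (within_lip_rV Lc0) => u v r su sv uv; exact: (sp_lip spec su sv uv).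
- by move=> i j; have [] := Hchi i j.
move=> i j eps eps_gt0.
(* The error must be relative to [chi], which is at least [I1^-1]; one half is for the unmarked term
   [hh], the other for the walk. *)
pose e1 := eps * I1^-1 / 2.
have e10 : 0 < e1 by rewrite divr_gt0// mulr_gt0// invr_gt0.
have [_ chip /(_ e1 e10)[r1 r10 Hr1]] := Hchi i j.
have [dh [Mh [dh0 Mh0 Hh]]] := unif_expmom nu_pos (hh0 i j) (hh_mom i j).
have [r2 r21 Hr2] := decay_bound d.-1 dh0 (ltW Mh0) e10.
exists (r1 + r2) => x hx; cbv zeta.
set y := toR R x; set u := (enorm y)^-1 *: y.
set f := chi i j u * _ * _.
pose r := enorm y.
have r1r : r1 <= r by apply: ltW; apply: le_lt_trans hx; rewrite lerDl; lra.
have r2r : r2 <= r by apply: ltW; apply: le_lt_trans hx; rewrite lerDr; lra.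
have r0 : 0 < r by lra.
have yu : y = r *: u by rewrite /u scalerA mulfV ?scale1r// gt_eqF.
have su : sphere u.
  rewrite /sphere /= -[LHS]ger0_norm ?enorm_ge0// -sqrtr_sqr enorm_sqr dotpZl dotpZr.
  by rewrite -enorm_sqr -/r mulrA -expr2 -exprMn mulVf ?gt_eqF// expr1n sqrtr1.
have [N0 HN] := Hr1 u x r su yu r1r.
pose K := Num.sqrt r ^+ d.-1 * expR (dotp (c u) y).
have K0 : 0 < K by rewrite mulr_gt0 ?expR_gt0// exprn_gt0// sqrtr_gt0.
have w0 n : 0 <= wpow (kap i j) nu n x by apply: wpow_ge0 => z; exact: ltW.
have cl N : (N0 <= N)%N -> `|K * (\sum_(n < N) wpow (kap i j) nu n x) - chi i j u| <= e1.
  move=> /HN; congr (`|_ - _| <= _); rewrite /K -mulrA; congr (_ * _).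
  by rewrite mulr_sumr.
have [Z ZE ZC] := esum_nat_close K0 w0 cl.
(* At [c u] the function [hh] has a moment margin [dh], so its tilt at [x] is at most
   [Mh * expR (- (dh * n1 x))], which beats the power of [r]. *)
have hb : K * hh i j x <= e1.
  apply: le_trans (Hr2 r r2r); rewrite /K -mulrA ler_wpM2l ?exprn_ge0 ?sqrtr_ge0//.
  have [t0 ts tM] := Hh _ (sp_D spec su).
  have := le_trans (sumR_term_le x (fun z => mulr_ge0 (expR_ge0 _) (t0 z)) ts) tM.
  move=> h.
  apply: (@le_trans _ _ (Mh * expR (- (dh * n1 R x)))).
    by rewrite expRN ler_pdivlMr ?expR_gt0// mulrC.
  by rewrite ler_pM2l// ler_expR lerN2 ler_pM2l//; exact: enorm_le_n1.
have fE : f = chi i j u / K.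
  have dE : d%:R - 1 = d.-1%:R :> R by rewrite -{1}(prednK d0) -natr1 addrK.
  by rewrite /f dE powR_sqrt// /K invfM expRN mulrA.
rewrite greenE ZE fE.
rewrite -[X in (`|X| <= _)%E]/((hh i j x + Z - chi i j u / K)%:E) abse_EFin lee_fin.
have -> : hh i j x + Z - chi i j u / K = (K * hh i j x + (K * Z - chi i j u)) / K.
  by field; rewrite gt_eqF.
rewrite normrM normfV (gtr0_norm K0) mulrA ler_wpM2r ?invr_ge0 ?(ltW K0)//.
apply: (le_trans (ler_normD _ _)); rewrite ger0_norm ?mulr_ge0 ?(ltW K0)//.
apply: (le_trans (lerD hb ZC)); rewrite /e1.
have /andP[lo _] := chiB i j u su.
have : eps * I1^-1 <= eps * chi i j u by rewrite ler_pM2l.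
lra.
Qed.
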